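(* There exists a function $f:\mathbb{N}\to\mathbb{R}$ with $f(k)=\mathcal{O}(k^2\log k)$ such that for every $C_4$-free graph $G$ and every $k\in\mathbb{N}$, $G$ either contains $k$ vertex-disjoint holes of length at least $6$, or a set $X$ of at most $f(k)$ vertices such that $G-X$ has no hole of length at least $6$. Moreover, there is a polynomial-time algorithm that, given a $C_4$-free graph $G$ and a positive integer $k$, either finds $k$ vertex-disjoint holes of length at least $6$ in $G$, or a set $X$ of at most $\mathcal{O}(k^2\log k)$ vertices such that $G-X$ has no hole of length at least $6$.
   Context: All graphs are finite, undirected, without loops or parallel edges. $\mathbb{N}$ is the set of positive integers. $C_\ell$ denotes the cycle of length $\ell$. A graph is $C_4$-free if it has no induced subgraph isomorphic to $C_4$. A hole in a graph is an induced subgraph that is a cycle of length at least $4$. $G-X$ is the graph obtained from $G$ by deleting the vertices of $X$. *)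

(* Defs.v *)
From mathcomp Require Import all_boot all_algebra.

Set Implicit Arguments.
Unset Strict Implicit.
Unset Printing Implicit Defensive.

Record sgraph := SGraph {
  vertex :> finType;
  edge : rel vertex;
  edge_sym : symmetric edge;
  edge_irrefl : irreflexive edge }.

Section Graphs.
Variable G : sgraph.

Section Induced.
Variable S : {set G}.

Definition induced_edge : rel {x : G | x \in S} :=
  fun x y => edge (val x) (val y).

Lemma induced_edge_sym : symmetric induced_edge.
Proof. by move=> x y; apply: edge_sym. Qed.

Lemma induced_edge_irrefl : irreflexive induced_edge.
Proof. by move=> x; apply: edge_irrefl. Qed.

Definition induced : sgraph := SGraph induced_edge_sym induced_edge_irrefl.
End Induced.

Definition delete (X : {set G}) : sgraph := induced (~: X).

Definition isomorphic (H : sgraph) : Prop :=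
  exists2 h : G -> H, bijective h & forall x y, edge (h x) (h y) = edge x y.
End Graphs.

(* [ordS] is the successor modulo l, so this is the cycle of length l as soon
   as 3 <= l; only such l are used below. *)
Definition cycle_edge (l : nat) : rel 'I_l :=
  fun i j => (i != j) && ((j == ordS i) || (i == ordS j)).

Lemma cycle_edge_sym l : symmetric (@cycle_edge l).
Proof. by move=> i j; rewrite /cycle_edge eq_sym orbC. Qed.

Lemma cycle_edge_irrefl l : irreflexive (@cycle_edge l).
Proof. by move=> i; rewrite /cycle_edge eqxx. Qed.

Definition cycle_graph (l : nat) : sgraph :=
  SGraph (@cycle_edge_sym l) (@cycle_edge_irrefl l).

Section Holes.
Variable G : sgraph.

Definition C4_free : Prop :=
  ~ exists S : {set G}, isomorphic (induced S) (cycle_graph 4).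

(* Induced subgraphs are identified with their vertex sets. *)
Definition hole (l : nat) (S : {set G}) : Prop :=
  4 <= l /\ isomorphic (induced S) (cycle_graph l).

Definition long_hole (S : {set G}) : Prop := exists2 l, 6 <= l & hole l S.

Definition disjoint_long_holes (k : nat) (H : 'I_k -> {set G}) : Prop :=
  (forall i, long_hole (H i)) /\
  (forall i j, i != j -> [disjoint H i & H j]).
End Holes.

Definition hits_long_holes (G : sgraph) (X : {set G}) : Prop :=
  ~ exists S : {set delete X}, long_hole S.

(* Random access machines with unit-cost addition and truncated subtraction
   (and no multiplication), in the style of Cook and Reckhow, with structured
   control flow instead of jumps.  Such machines are polynomially equivalent to
   Turing machines.  A program mentions finitely many registers; the memory is
   accessed by indirect addressing through registers. *)
Inductive cmd :=
  | Const (x c : nat)     (* r_x := c *)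
  | Add (x y z : nat)     (* r_x := r_y + r_z *)
  | Sub (x y z : nat)     (* r_x := r_y - r_z *)
  | Fetch (x y : nat)      (* r_x := mem[r_y] *)
  | Store (x y : nat)     (* mem[r_x] := r_y *)
  | Seq (c1 c2 : cmd)
  | If (x : nat) (c1 c2 : cmd)  (* c1 if r_x is nonzero, c2 otherwise *)
  | While (x : nat) (c : cmd).  (* as long as r_x is nonzero *)

Record state := State { reg : nat -> nat; mem : nat -> nat }.

Definition set_reg (s : state) (x v : nat) : state :=
  State [eta reg s with x |-> v] (mem s).

Definition set_mem (s : state) (a v : nat) : state :=
  State (reg s) [eta mem s with a |-> v].

(* [exec c s s' t]: started in s, the program c halts in s' after t steps. *)
Inductive exec : cmd -> state -> state -> nat -> Prop :=
  | exec_Const x c s : exec (Const x c) s (set_reg s x c) 1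
  | exec_Add x y z s :
      exec (Add x y z) s (set_reg s x (reg s y + reg s z)) 1
  | exec_Sub x y z s :
      exec (Sub x y z) s (set_reg s x (reg s y - reg s z)) 1
  | exec_Fetch x y s : exec (Fetch x y) s (set_reg s x (mem s (reg s y))) 1
  | exec_Store x y s : exec (Store x y) s (set_mem s (reg s x) (reg s y)) 1
  | exec_Seq c1 c2 s1 s2 s3 t1 t2 :
      exec c1 s1 s2 t1 -> exec c2 s2 s3 t2 ->
      exec (Seq c1 c2) s1 s3 (t1 + t2)
  | exec_IfT x c1 c2 s s' t :
      reg s x != 0 -> exec c1 s s' t -> exec (If x c1 c2) s s' t.+1
  | exec_IfF x c1 c2 s s' t :
      reg s x == 0 -> exec c2 s s' t -> exec (If x c1 c2) s s' t.+1
  | exec_WhileT x c s1 s2 s3 t1 t2 :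
      reg s1 x != 0 -> exec c s1 s2 t1 -> exec (While x c) s2 s3 t2 ->
      exec (While x c) s1 s3 (t1 + t2).+1
  | exec_WhileF x c s :
      reg s x == 0 -> exec (While x c) s s 1.

(* Vertices are numbered 0, ..., #|G|-1 by [enum_rank].  On input (G, k),
   register 0 contains #|G|, register 1 contains k, the memory contains the
   adjacency matrix of G row by row, and all the other cells contain 0. *)
Definition input_mem (G : sgraph) (a : nat) : nat :=
  [exists x : G, exists y : G,
    edge x y && (a == enum_rank x * #|G| + enum_rank y)].

Definition input (G : sgraph) (k : nat) : state :=
  State (fun x => nth 0 [:: #|G|; k] x) (input_mem G).

(* Number of bits of the input: the adjacency matrix, and k in binary. *)
Definition input_size (G : sgraph) (k : nat) : nat :=
  #|G| ^ 2 + (trunc_log 2 k).+1.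

(* The first #|G| memory cells encode the output, with one cell per vertex: a
   vertex set is given by the nonzero cells, and a family of disjoint vertex
   sets by putting i.+1 in the cells of the vertices of the i-th set. *)
Definition output_set (G : sgraph) (s : state) : {set G} :=
  [set x | mem s (enum_rank x) != 0].

Definition output_family (G : sgraph) (k : nat) (s : state) (i : 'I_k) :
  {set G} := [set x | mem s (enum_rank x) == i.+1].

(* Register 0 tells which of the two outcomes is returned. *)
Definition correct_output (G : sgraph) (k : nat) (small : {set G} -> Prop)
    (s : state) : Prop :=
  if reg s 0 == 0 then disjoint_long_holes (@output_family G k s)
  else small (output_set G s) /\ hits_long_holes (output_set G s).

Definition polynomial_time (c : cmd) (dom : sgraph -> nat -> Prop)
    (post : forall (G : sgraph) (k : nat), state -> Prop) : Prop :=
  exists p : {poly nat}, forall G k, dom G k ->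
    exists s t, [/\ exec c (input G k) s t,
                    t <= horner p (input_size G k) & post G k s].

(* Main.v *)
(* Disjoint long holes C_1, C_2, ... are chosen greedily, each shortest in what
   remains.  If fewer than k are found, they are treated from the last to the
   first, so that C = C_i is a shortest long hole of the current vertex set V
   and V \ C contains none.  The vertices outside C whose neighbours on C are
   not contained in three consecutive vertices form a clique D ([spread]);
   outside D, distances are bounded by distances along C.

   Long holes are detected by parity.  Label edges by bits, so that triangles
   and induced 5-cycles have sum zero ([coc]); then in a C_4-free graph an odd
   closed walk contains a long hole among its vertices.  Balls that contain a
   long hole are packed, and their surroundings on C deleted.  After this every
   long hole that avoids D is odd for a label [lam I R], where I is the part of
   a small ball on C and R a component of a larger ball minus I.  A subgraph H
   is grown such that its even edge sets are coordinatised by the labels used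
   so far ([frame]); a long hole that avoids the branch vertices of H and the
   sets I is even for these labels, and its own label extends H, so in the end
   these vertices meet all long holes outside D.  If H has more than order
   k log k branch vertices, the Moore bound yields k disjoint subgraphs of H
   that are odd for some label, hence k disjoint long holes.  The long holes
   that meet D are destroyed in the same spirit: each gives a component of
   M \ I with a neighbour in D, and such components nest like the branches of a
   tree.

   All steps are loops over vertices, pairs and triples, and are compiled to
   machine code: [compu a b phi] says that phi can be computed within
   (n + 2)^d steps on values stored in slots of n^2 memory cells. *)
Require Import Defs.
From HB Require Import structures.
From Stdlib Require Classical_Prop.
From mathcomp Require Import all_boot zify.

Set Implicit Arguments.
Unset Strict Implicit.
Unset Printing Implicit Defensive.

(** * Holes and odd closed walks *)

(** Long holes are not the odd cycles of one fixed labelling, so packing theorems for odd cycles do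
    not apply: every hole brings its own label, and dimensions are counted over all labels at once.
    The labels of [coc] are cocycles modulo 2 of the complex with discs glued to triangles and
    induced 5-cycles. Hence a C4-free set without long hole has only coboundaries, and this is how
    absence of long holes is used: take a potential and compare its values. Minimality of C enters
    through one fact, that fewer than |C| vertices of V contain no long hole; so most contradictions
    exhibit a small set with an odd closed walk, usually by [p5crit].

    Outside D, distance r implies distance at most 5(r + 2) on C. This yields 25 for the radius 3 of
    the sets I, and 80 for two balls of radius 7 that meet.

    Each of the fewer than k chosen holes costs O(k log k) vertices, the logarithm coming from the
    Moore bound; this gives k^2 log k. The existence statement is read off from the output of the
    algorithm. *)

Section HoleParam.
Variable G : sgraph.
Implicit Types (S Z : {set G}) (f : nat -> G) (l : nat).

(** A hole as an l-periodic walk on the natural numbers, so that rotations are shifts of the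
    argument and runs are intervals. *)
Definition hol l f :=
  [/\ 4 <= l, forall i j, (f i == f j) = (i == j %[mod l]) &
      forall i j, edge (f i) (f j)
        = (j == i.+1 %[mod l]) || (i == j.+1 %[mod l])].

Definition img l f : {set G} := [set f (i : 'I_l) | i in 'I_l].

Definition holed S := exists l f, [/\ 6 <= l, hol l f & img l f \subset S].

Lemma edgeC (x y : G) : edge x y = edge y x.
Proof. exact: edge_sym. Qed.

Lemma edgexx (x : G) : edge x x = false.
Proof. exact: edge_irrefl. Qed.

Lemma edge_neq (x y : G) : edge x y -> x != y.
Proof. by apply: contraTneq => ->; rewrite edgexx. Qed.

Lemma imgP l f x : 0 < l -> (forall i, f (i %% l) = f i) ->
  reflect (exists i, x = f i) (x \in img l f).
Proof.
move=> l0 per; apply: (iffP imsetP) => [[i _ ->]|[i ->]]; first by exists i.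
by exists (Ordinal (ltn_pmod i l0)) => //=; rewrite per.
Qed.

Lemma hol_mod l f i : hol l f -> f (i %% l) = f i.
Proof. by case=> _ e _; apply/eqP; rewrite e modn_mod. Qed.

Lemma in_img l f i : hol l f -> f i \in img l f.
Proof.
move=> h; apply/imgP; [by case: h; lia | by move=> j; exact: hol_mod | by exists i].
Qed.

Lemma in_imgP l f x : hol l f -> x \in img l f -> exists2 i, i < l & x = f i.
Proof. by move=> h /imsetP[i _ ->]; exists i. Qed.

Lemma card_img l f : hol l f -> #|img l f| = l.
Proof.
case=> l4 e _; rewrite card_in_imset ?card_ord // => i j _ _ /eqP.
by rewrite e !modn_small // => /eqP /val_inj.
Qed.

Lemma img_ordS l (i j : 'I_l) : (j == ordS i) = (j == i.+1 %[mod l]).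
Proof. by rewrite -val_eqE /= (modn_small (ltn_ord j)). Qed.

Lemma modS_neq l a b : 2 <= l -> a = b %[mod l] -> (a == b.+1 %[mod l]) = false.
Proof.
move=> l2 ab; apply/negbTE; rewrite -[b.+1]addn1 -modnDml -ab modnDml.
by rewrite -{1}[a]addn0 eqn_modDl mod0n modn_small.
Qed.

Lemma hol_iso l f : hol l f -> isomorphic (induced (img l f)) (cycle_graph l).
Proof.
move=> h; have [l4 e ed] := h; have l0 : 0 < l by lia.
have ex (x : induced (img l f)) : exists i : 'I_l, f i == val x.
  by case/imsetP: (valP x) => i _ ->; exists i.
pose h' (x : induced (img l f)) : cycle_graph l := xchoose (ex x).
have fh x : f (h' x) = val x by exact/eqP/(xchooseP (ex x)).
pose g (i : cycle_graph l) : induced (img l f) := Sub (f i) (in_img i h).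
exists h'.
  exists g => [x|i]; first by apply: val_inj; rewrite /= fh.
  have /eqP := fh (g i); rewrite /= e !modn_small ?ltn_ord // => /eqP.
  exact: val_inj.
move=> x y; rewrite /= /cycle_edge /induced_edge -!fh ed !img_ordS.
by case: eqP => [->|] //=; rewrite orbb modS_neq //; lia.
Qed.

Lemma iso_hol l S : 4 <= l -> isomorphic (induced S) (cycle_graph l) ->
  exists2 f, hol l f & img l f = S.
Proof.
move=> l4 [h [g hK gK] hE]; have l0 : 0 < l by lia.
pose o i : 'I_l := Ordinal (ltn_pmod i l0).
pose f i : G := val (g (o i)).
have oE i j : (o i == o j) = (i == j %[mod l]) by rewrite -val_eqE.
have gI : injective g := can_inj gK.
have fh : hol l f.
  split=> // i j.
    by rewrite /f (inj_eq val_inj) (inj_eq gI) oE.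
  have -> : edge (f i) (f j) = edge (g (o i)) (g (o j)) by [].
  rewrite -hE !gK /= /cycle_edge !img_ordS /= !modn_mod.
  rewrite -[(i %% l).+1]addn1 -[(j %% l).+1]addn1 !modnDml !addn1.
  case: (eqVneq (o i) (o j)) => [E|] //=.
  symmetry; apply/negbTE; move/eqP: E; rewrite oE => /eqP E.
  by rewrite !modS_neq //; lia.
exists f => //; apply/setP => x; apply/imsetP/idP => [[i _ ->]|xS].
  exact: valP.
exists (h (Sub x xS)) => //; rewrite /f.
have -> : o (h (Sub x xS)) = h (Sub x xS) by apply: val_inj; rewrite /= modn_small.
by rewrite hK.
Qed.

Lemma long_hole_hol S : long_hole S -> exists l f, [/\ 6 <= l, hol l f & img l f = S].
Proof. by case=> l l6 [l4 /(iso_hol l4)[f fh fS]]; exists l, f. Qed.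

Lemma hol_long_hole l f : 6 <= l -> hol l f -> long_hole (img l f).
Proof. by move=> l6 h; exists l => //; split; [lia | exact: hol_iso]. Qed.

Lemma holedS S S' : S \subset S' -> holed S -> holed S'.
Proof. by move=> s [l [f [a b c]]]; exists l, f; split=> //; exact: subset_trans s. Qed.

End HoleParam.

Lemma hits_unholed (G : sgraph) (X : {set G}) : ~ holed (~: X) -> hits_long_holes X.
Proof.
move=> nh [S /long_hole_hol[l [f [l6 [l4 e ed] _]]]]; apply: nh.
exists l, (fun i => val (f i)); split=> //.
by apply/subsetP => x /imsetP[i _ ->]; exact: (valP (f i)).
Qed.

Section Walks.
Variable G : sgraph.
Hypothesis c4 : C4_free G.
Implicit Types (S T R U I : {set G}) (x y z : G) (p q : seq G).
Implicit Type (m : G -> G -> bool).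

Definition cyc5 (a b c d e : G) :=
  [&& edge a b, edge b c, edge c d, edge d e & edge e a] &&
  [&& ~~ edge a c, ~~ edge a d, ~~ edge b d, ~~ edge b e & ~~ edge c e].

(** The cocycle condition on S modulo 2, where triangles and induced 5-cycles bound discs. *)
Definition coc S m :=
  [/\ forall x y, m x y = m y x,
      forall x y z, x \in S -> y \in S -> z \in S ->
        edge x y -> edge y z -> edge z x -> m x y (+) m y z (+) m z x = false &
      forall a b c d e, a \in S -> b \in S -> c \in S -> d \in S -> e \in S ->
        cyc5 a b c d e ->
        m a b (+) m b c (+) m c d (+) m d e (+) m e a = false].

Fixpoint psum m x p := if p is y :: q then m x y (+) psum m y q else false.

Definition csum m p := if p is y :: q then psum m y (rcons q y) else false.

Lemma psum_cat m x p q : psum m x (p ++ q) = psum m x p (+) psum m (last x p) q.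
Proof. by elim: p x => //= y p IH x; rewrite IH addbA. Qed.

Lemma psum_rcons m x p y : psum m x (rcons p y) = psum m x p (+) m (last x p) y.
Proof. by rewrite -cats1 psum_cat /= addbF. Qed.

Lemma csum_rot1 m p : csum m (rot 1 p) = csum m p.
Proof.
case: p => // x p; rewrite rot1_cons; case: p => [|y p] //=.
by rewrite !psum_rcons last_rcons addbC.
Qed.

Lemma csum_rot m n p : csum m (rot n p) = csum m p.
Proof.
case: (leqP (size p) n) => [|/ltnW]; first by move/rot_oversize->.
elim: n => [|n IH] h; first by rewrite rot0.
by rewrite -add1n rotD // csum_rot1 IH // ltnW.
Qed.

Lemma csum_cat m x p y q : csum m (x :: p ++ y :: q) =
  psum m x (rcons p y) (+) psum m y (rcons q x).
Proof. by rewrite /= rcons_cat /= -cat_rcons psum_cat last_rcons. Qed.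

Lemma C4P (a b c d : G) : edge a b -> edge b c -> edge c d -> edge d a ->
  a != c -> b != d -> edge a c || edge b d.
Proof.
move=> ab bc cd da ac bd; apply: contraT; rewrite negb_or => /andP[nac nbd].
case: c4; pose s := [:: a; b; c; d].
pose f i := nth a s (i %% 4).
have h : hol 4 f.
  have per i : f i = f (i %% 4) by rewrite /f modn_mod.
  have us : uniq s.
    rewrite /= !inE !negb_or ac bd (edge_neq ab) (edge_neq bc) (edge_neq cd).
    by rewrite eq_sym (edge_neq da).
  split=> // i j.
    by rewrite /f nth_uniq //= ltn_mod.
  rewrite per [f j]per -[j.+1]addn1 -[i.+1]addn1 -(modnDml i) -(modnDml j 1).
  rewrite -{2}(modn_mod i) -{2}(modn_mod j).
  have := ltn_pmod i (isT : 0 < 4); have := ltn_pmod j (isT : 0 < 4).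
  move: (i %% 4) (j %% 4) => {}i {}j.
  by case: j => [|[|[|[|]]]] //; case: i => [|[|[|[|]]]] // _ _;
    rewrite /f /= ?edgexx ?[edge b a]edgeC ?[edge c b]edgeC ?[edge d c]edgeC
      ?[edge a d]edgeC ?[edge c a]edgeC ?[edge d b]edgeC
      ?ab ?bc ?cd ?da ?(negbTE nac) ?(negbTE nbd).
by exists (img 4 f); exact: hol_iso.
Qed.

Lemma cycle_cat_split x p y q : cycle (@edge G) (x :: p ++ y :: q) ->
  path (@edge G) x (rcons p y) && path (@edge G) y (rcons q x).
Proof. by rewrite /= rcons_cat /= -cat_rcons cat_path last_rcons. Qed.

Lemma cycle_nthS x0 p i : cycle (@edge G) p -> i < size p ->
  edge (nth x0 p i) (nth x0 p (i.+1 %% size p)).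
Proof.
case: p => // x p /=; rewrite ltnS => /pathP h lei.
have := h x0 i; rewrite size_rcons ltnS => /(_ lei).
rewrite -rcons_cons !nth_rcons /= ltnS lei.
case: ltngtP lei => // [lt|->] _; first by rewrite modn_small.
by rewrite modnn.
Qed.

Lemma chord_split p i j x0 : i < j < size p ->
  exists q1 q2, [/\ rot i p = nth x0 p i :: q1 ++ nth x0 p j :: q2,
    size q1 = j - i.+1 & size q2 = size p - (j - i).+1].
Proof.
move=> /andP[ij js]; have ip := ltn_trans ij js.
exists (take (j - i.+1) (drop i.+1 p)), (drop j.+1 p ++ take i p); split.
- rewrite /rot (drop_nth x0) //= -{1}(cat_take_drop (j - i.+1) (drop i.+1 p)).
  by rewrite drop_drop subnK // (drop_nth x0 js) -catA.
- by rewrite size_takel // size_drop leq_sub2r // ltnW.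
- by rewrite size_cat size_drop size_takel ?(ltnW ip) //; lia.
Qed.

(* Splitting at repeated vertices and at chords, an odd closed walk shrinks to an
   odd induced cycle, which is neither a triangle nor a 5-cycle. *)
Lemma odd_walk_hole S m p : coc S m -> cycle (@edge G) p -> {subset p <= S} ->
  csum m p -> holed [set x in p].
Proof.
move=> cm; have [ms mt m5] := cm.
have [n] := ubnP (size p); elim: n p => // n IH p szp cyc pS odd.
case Ep: p => [|x0 p']; first by rewrite Ep in odd.
rewrite -Ep; set L := size p; set v := nth x0 p.
have L0 : 0 < L by rewrite /L Ep.
(* A repetition, or an edge between positions that are not cyclically consecutive. *)
pose bad (i j : 'I_L) := (i < j) && ((v i == v j) ||
   [&& edge (v i) (v j), j != i.+1 :> nat & (i != 0 :> nat) || (j != L.-1 :> nat)]).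
have sub q : {subset q <= p} -> holed [set x in q] -> holed [set x in p].
  by move=> h; apply: holedS; apply/subsetP => x; rewrite !inE; exact: h.
case: (boolP [exists i, exists j, bad i j]) => [/existsP[i /existsP[j /andP[ij b]]]|nb].
  have ijs : i < j < size p by rewrite ij ltn_ord.
  have [q1 [q2 [E s1 s2]]] := chord_split x0 ijs; rewrite -/v -/L in E s2.
  have odd' : csum m (rot i p) by rewrite csum_rot.
  have cyc' : cycle (@edge G) (rot i p) by rewrite rot_cycle.
  have mem : rot i p =i p by move=> x; rewrite mem_rot.
  rewrite E in odd' cyc' mem.
  have step q : size q < L -> {subset q <= p} -> cycle (@edge G) q -> csum m q ->
      holed [set x in p].
    move=> sq qp cq oq; apply: (sub q) => //; apply: IH => //.
      by apply: leq_trans sq _; rewrite -ltnS.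
    by move=> x /qp /pS.
  move: odd'; rewrite csum_cat => odd'.
  have /andP[c1 c2] := cycle_cat_split cyc'.
  have jL := ltn_ord j.
  case/orP: b => [/eqP vij|/and3P[vij b1 b2]].
    case: (boolP (psum m (v i) (rcons q1 (v j)))) odd' => o1 /= o2.
      apply: (step (v i :: q1)); rewrite /= ?[X in rcons _ X]vij //.
      - by rewrite s1; move: ijs; clear; lia.
      - by move=> x; rewrite -mem !(inE, mem_cat); case/orP => ->; rewrite ?orbT.
    apply: (step (v j :: q2)); rewrite /= -?[X in rcons _ X]vij //.
    - by rewrite s2; move: ijs; clear; lia.
    - by move=> x; rewrite -mem !(inE, mem_cat); case/orP => ->; rewrite ?orbT.
  have q1n : 0 < size q1 by rewrite s1; move: ijs b1; clear; lia.
  have q2n : 0 < size q2 by rewrite s2; move: ijs b2; clear; lia.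
  have szE : L = (size q1 + size q2).+2.
    by rewrite s1 s2; move: ijs; clear; lia.
  (* The chord is traversed by both pieces and cancels, so one of the two shorter pieces is odd. *)
  have : csum m (v i :: rcons q1 (v j)) (+) csum m (v i :: v j :: q2).
    by rewrite /= psum_rcons last_rcons ms -addbA addKb.
  case: (boolP (csum m (v i :: rcons q1 (v j)))) => [o _|_ o].
    apply: (step _ _ _ _ o).
    - by rewrite /= size_rcons szE !ltnS -addn1 leq_add2l.
    - move=> x; rewrite -mem !(inE, mem_rcons, mem_cat).
      by do ![case/orP] => ->; rewrite ?orbT.
    - by rewrite /= rcons_path last_rcons c1 edgeC.
  apply: (step (v i :: v j :: q2)) => //.
  - by rewrite /= szE !ltnS -add1n leq_add2r.
  - move=> x; rewrite -mem !(inE, mem_cat).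
    by do ![case/orP] => ->; rewrite ?orbT.
  - by rewrite /= vij.
have inj i j : i < L -> j < L -> v i = v j -> i = j.
  wlog ij : i j / i < j => [hw|] iL jL vij.
    by case: (ltngtP i j) => // h; [|symmetry]; apply: hw.
  case/existsP: nb; exists (Ordinal iL); apply/existsP; exists (Ordinal jL).
  by rewrite /bad /= ij vij eqxx.
have edg i j : i < j -> j < L -> edge (v i) (v j) -> j = i.+1 \/ i = 0 /\ j = L.-1.
  move=> ij jL e; case: (eqVneq j i.+1) => [->|n1]; first by left.
  case: (eqVneq i 0) => [i0|n2]; last first.
    case/existsP: nb; exists (Ordinal (ltn_trans ij jL)); apply/existsP; exists (Ordinal jL).
    by rewrite /bad /= ij e n1 n2 orbT.
  case: (eqVneq j L.-1) => [j0|n3]; first by right.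
  case/existsP: nb; exists (Ordinal (ltn_trans ij jL)); apply/existsP; exists (Ordinal jL).
  by rewrite /bad /= ij e n1 n3 !orbT.
have cycE i : i < L -> edge (v i) (v (i.+1 %% L)) by move=> h; exact: cycle_nthS.
clear IH; case: (leqP 6 L) => L6.
  exists L, (fun i => v (i %% L)); split=> //.
    split; first exact: ltn_trans L6.
      move=> i j; apply/eqP/eqP => [/inj|->] //; by apply; rewrite ltn_mod.
    move=> i j; rewrite -[j.+1]addn1 -[i.+1]addn1 -(modnDml i) -(modnDml j 1).
    rewrite -{2}(modn_mod i) -{2}(modn_mod j).
    have := ltn_pmod i L0; have := ltn_pmod j L0.
    move: (i %% L) (j %% L) => {}i {}j jL iL; rewrite !addn1 !(@modn_small i L) ?(@modn_small j L) //.
    apply/idP/idP => [e|]; last first.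
      by case/orP => /eqP ->; rewrite ?cycE // edgeC cycE.
    case: (ltngtP i j) => [ij|ji|E]; last by move: e; rewrite E edgexx.
    - case: (edg _ _ ij jL e) => [E|[-> ->]]; first by rewrite -E modn_small ?eqxx.
      by rewrite prednK // modnn eqxx orbT.
    - rewrite edgeC in e.
      case: (edg _ _ ji iL e) => [E|[-> ->]]; first by rewrite -E [i %% L]modn_small ?eqxx ?orbT.
      by rewrite prednK // modnn eqxx.
  apply/subsetP => x /imsetP[i _ ->]; rewrite inE; apply: mem_nth.
  by rewrite ltn_mod.
have vS i : i < L -> v i \in S by move=> h; apply/pS/mem_nth.
have {}cycE i : i < L -> edge (v i) (v (if i.+1 == L then 0 else i.+1)).
  move=> iL; have := cycE i iL; case: eqP => [->|n1]; first by rewrite modnn.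
  by rewrite modn_small //; lia.
have pE : p = mkseq v L by rewrite -[LHS](mkseq_nth x0).
move: (odd); rewrite pE.
move: inj edg cycE vS; clear -m5 mt ms c4 L6 L0; move: L v L6 L0 => L v.
(* Length 1 would be a loop, length 2 has sum zero, length 4 has a chord because G is C4-free;
   lengths 3 and 5 are even by [coc]. *)
case: L => [|[|[|[|[|[|]]]]]] // _ _ inj edg cycE vS.
- by have := cycE 0 isT; rewrite edgexx.
- by rewrite /= /mkseq /= addbF ms addbb.
- rewrite /mkseq /= addbF addbA mt ?vS //; [exact: (cycE 0)|exact: (cycE 1)|exact: (cycE 2)].
- have n02 : v 0 != v 2 by apply/eqP => /(inj 0 2 isT isT).
  have n13 : v 1 != v 3 by apply/eqP => /(inj 1 3 isT isT).
  case/orP: (C4P (cycE 0 isT) (cycE 1 isT) (cycE 2 isT) (cycE 3 isT) n02 n13).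
    by case/(edg 0 2 isT isT) => // [] [].
  by case/(edg 1 3 isT isT) => // [] [].
rewrite /mkseq /= addbF !addbA m5 ?vS // /cyc5.
rewrite (cycE 0) // (cycE 1) // (cycE 2) // (cycE 3) // (cycE 4) //=.
apply/and5P; split; apply/negP => /edg h; by case: (h isT isT) => // -[].
Qed.
End Walks.

(** * Balls and crossing labels *)

Definition expand (G : sgraph) (S T : {set G}) : {set G} :=
  T :|: [set v in S | [exists u in T, edge u v]].
(** Locked, so that simplification does not unfold the iteration at concrete radii such as 80 or
    120. *)
HB.lock Definition ball (G : sgraph) (S : {set G}) (r : nat) (x : G) : {set G} :=
  iter r (expand S) ([set x] :&: S).

Section Labels.
Variable G : sgraph.
Hypothesis c4 : C4_free G.
Implicit Types (S T R U I Y W : {set G}) (x y z : G) (p q : seq G).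
Implicit Type (m : G -> G -> bool).

Lemma closed_walk (e : rel G) m x p : path e x p -> last x p = x ->
  cycle e p /\ csum m p = psum m x p.
Proof.
case/lastP: p => // p y; rewrite last_rcons => + E; rewrite E => pp.
by rewrite -{1 2}rot1_cons rot_cycle csum_rot.
Qed.

Lemma psum_rev m x p : (forall u v, m u v = m v u) ->
  psum m (last x p) (rev (belast x p)) = psum m x p.
Proof.
move=> ms; elim: p x => //= y p IH x.
rewrite rev_cons psum_rcons IH addbC; congr addb.
by case: p {IH} => [|z p] /=; rewrite ?rev_cons ?last_rcons ms.
Qed.

(** The potential at x is the sum along a chosen path from the root of its component; two such paths
    closed up by an edge form an even closed walk. *)
Lemma potential (e : rel G) m : symmetric e -> (forall u v, m u v = m v u) ->
  (forall p, cycle e p -> csum m p = false) ->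
  exists g : G -> bool, forall x y, e x y -> m x y = g x (+) g y.
Proof.
move=> es ms even.
have sc : connect_sym e by exact: sym_connect_sym.
have ex x : exists p, path e (root e x) p && (last (root e x) p == x).
  have : connect e (root e x) x by rewrite sc connect_root.
  by case/connectP => p pp lp; exists p; rewrite pp -lp eqxx.
pose P x := xchoose (ex x); pose g x := psum m (root e x) (P x).
have PP x : path e (root e x) (P x) /\ last (root e x) (P x) = x.
  by case/andP: (xchooseP (ex x)) => ? /eqP.
exists g => x y exy.
have rxy : root e x = root e y by apply/eqP; rewrite root_connect // connect1.
have [px lx] := PP x; have [py ly] := PP y; rewrite /g rxy in px lx *.
set r := root e y in px lx py ly *.
pose w := P x ++ y :: rev (belast r (P y)).
have pw : path e r w.
  rewrite cat_path px /= lx exy /=; have := rev_path e r (P y); rewrite ly => ->.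
  by rewrite (eq_path (e' := e)) // => u v; rewrite es.
have lw : last r w = r.
  by rewrite last_cat /=; case: (P y) ly => [|z s] //= ly; rewrite rev_cons last_rcons.
have [cw] := closed_walk m pw lw; rewrite even // => /esym.
rewrite psum_cat /= lx; have := psum_rev r (P y) ms; rewrite ly => ->.
by do 2!case: psum; case: (m x y).
Qed.

Lemma coc_add S m1 m2 : coc S m1 -> coc S m2 -> coc S (fun u v => m1 u v (+) m2 u v).
Proof.
move=> [s1 t1 f1] [s2 t2 f2]; split.
- by move=> x y; rewrite s1 s2.
- move=> x y z xS yS zS xy yz zx.
  rewrite -[RHS](addbb false) -{1}(t1 x y z) // -(t2 x y z) //.
  by do 3!case: (m1 _ _); do 3!case: (m2 _ _).
move=> a b c d e aS bS cS dS eS h.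
rewrite -[RHS](addbb false) -{1}(f1 a b c d e) // -(f2 a b c d e) //.
by case: (m1 a b); case: (m1 b c); case: (m1 c d); case: (m1 d e); case: (m1 e a);
  case: (m2 a b); case: (m2 b c); case: (m2 c d); case: (m2 d e); case: (m2 e a).
Qed.

Lemma coc_cob S (g : G -> bool) : coc S (fun u v => g u (+) g v).
Proof.
split=> [x y|x y z _ _ _ _ _ _|a b c d e _ _ _ _ _ _]; first by rewrite addbC.
  by case: (g x); case: (g y); case: (g z).
by case: (g a); case: (g b); case: (g c); case: (g d); case: (g e).
Qed.

Lemma cocS S T m : S \subset T -> coc T m -> coc S m.
Proof.
move=> /subsetP s [h1 h2 h3]; split=> // [x y z|a b c d e] *; [apply: h2|apply: h3]; auto.
Qed.

Lemma unholed_even S m p : ~ holed S -> coc S m -> cycle (@edge G) p ->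
  {subset p <= S} -> csum m p = false.
Proof.
move=> nh cm cp sp; apply/negP => o; apply: nh.
apply: holedS (odd_walk_hole c4 cm cp sp o).
by apply/subsetP => x; rewrite inE => /sp.
Qed.

Lemma cyc5_rot (a b c d e : G) : cyc5 a b c d e -> cyc5 b c d e a.
Proof.
case/andP=> /and5P[ab bc cd de ea] /and5P[ac ad bd be ce].
apply/andP; split; apply/and5P; split=> //; by rewrite edgeC.
Qed.

Lemma cyc5_rev (a b c d e : G) : cyc5 a b c d e -> cyc5 b a e d c.
Proof.
case/andP=> /and5P[ab bc cd de ea] /and5P[ac ad bd be ce].
apply/andP; split; apply/and5P; split=> //; by rewrite edgeC.
Qed.

Definition er S := [rel u v | [&& u \in S, v \in S & edge u v]].
Definition conn S := connect (er S).

Lemma er_sym S : symmetric (er S).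
Proof. by move=> x y /=; rewrite edgeC; case: (x \in S); case: (y \in S). Qed.

Lemma conn_sym S x y : conn S x y = conn S y x.
Proof. exact: (sym_connect_sym (@er_sym S)). Qed.

Lemma conn_in S x y : x \in S -> conn S x y -> y \in S.
Proof.
move=> xS /connectP[p pp ->]; elim: p x xS pp => //= z p IH x xS /andP[/and3P[_ zS _]].
exact: IH.
Qed.

Lemma connSub S T x y : S \subset T -> conn S x y -> conn T x y.
Proof.
move=> /subsetP s; apply: connect_sub => u v /and3P[uS vS e].
by apply: connect1; rewrite /= !s.
Qed.

Lemma conn1 S x y : x \in S -> y \in S -> edge x y -> conn S x y.
Proof. by move=> xS yS e; apply: connect1; rewrite /= xS yS. Qed.

Lemma er_path S x p : x \in S -> path (er S) x p -> path (@edge G) x p /\ {subset p <= S}.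
Proof.
elim: p x => [|y p IH] x xS //= /andP[/and3P[_ yS ->] pp]; have [-> s] := IH y yS pp.
by split=> // z; rewrite inE => /predU1P[->|/s].
Qed.

Lemma path_er S x p : x \in S -> path (@edge G) x p -> {subset p <= S} -> path (er S) x p.
Proof.
elim: p x => [|y p IH] x xS //= /andP[-> pp] s.
have yS : y \in S by apply: s; rewrite inE eqxx.
by rewrite xS yS IH // => z zp; apply: s; rewrite inE zp orbT.
Qed.

(** Label only the edge [a1 a2]. No triangle of Y contains it, and a 5-cycle through it would have
    to be a0, ..., a4 closed up by the missing edge [a0 a4]; so the label is a cocycle. The path
    closed up outside its inner vertices uses this edge once and is odd. *)
Lemma p5crit Y a0 a1 a2 a3 a4 : uniq [:: a0; a1; a2; a3; a4] ->
  [&& a0 \in Y, a1 \in Y, a2 \in Y, a3 \in Y & a4 \in Y] ->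
  edge a0 a1 -> edge a1 a2 -> edge a2 a3 -> edge a3 a4 -> ~~ edge a0 a4 ->
  (forall y, y \in Y -> edge a1 y -> y \in [:: a0; a2]) ->
  (forall y, y \in Y -> edge a2 y -> y \in [:: a1; a3]) ->
  (forall y, y \in Y -> edge a3 y -> y \in [:: a2; a4]) ->
  conn (Y :\: [set a1; a2; a3]) a4 a0 -> holed Y.
Proof.
move=> un /and5P[Y0 Y1 Y2 Y3 Y4] e01 e12 e23 e34 n04 N1 N2 N3 /connectP[q pq lq].
pose m u v := ((u == a1) && (v == a2)) || ((u == a2) && (v == a1)).
have ms u v : m u v = m v u by rewrite /m orbC; congr orb; exact: andbC.
move: un; rewrite /= !inE !negb_or -!andbA => /and5P[n01 n02 n03 n04' /and5P[n12 n13 n14 n23 /and3P[n24 n34 _]]].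
have tri z : z \in Y -> edge a1 z -> edge a2 z -> False.
  move=> zY /(N1 _ zY) + /(N2 _ zY); rewrite !inE.
  case/orP => /eqP->; first by rewrite (negbTE n01) (negbTE n03).
  by rewrite eq_sym (negbTE n12) (negbTE n23).
have pent c d e : c \in Y -> d \in Y -> e \in Y -> cyc5 a1 a2 c d e -> False.
  move=> cY dY eY /andP[/and5P[_ bc cd de ea] /and5P[ac ad bd be ce]].
  rewrite edgeC in ea; move: (N1 _ eY ea) (N2 _ cY bc); rewrite !inE.
  case/orP => /eqP eE; last by move: de; rewrite eE edgeC (negbTE bd).
  case/orP => /eqP cE; first by move: cd; rewrite cE (negbTE ad).
  rewrite cE in cd; move: (N3 _ dY cd); rewrite !inE => /orP[]/eqP dE.
    by move: de; rewrite dE (negbTE be).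
  by move: de; rewrite dE eE edgeC (negbTE n04).
have tri0 x y z : x \in Y -> y \in Y -> z \in Y -> edge x y -> edge y z -> edge z x -> m x y = false.
  move=> xY yY zY xy yz zx; apply/negP => /orP[]/andP[/eqP xE /eqP yE];
   by apply: (tri z) => //; rewrite -?xE -?yE // edgeC.
have pent0 a b c d e : a \in Y -> b \in Y -> c \in Y -> d \in Y -> e \in Y ->
    cyc5 a b c d e -> m a b = false.
  move=> aY bY cY dY eY h; apply/negP => /orP[]/andP[/eqP xE /eqP yE].
    by apply: (pent c d e) => //; rewrite -xE -yE.
  by apply: (pent e d c) => //; rewrite -xE -yE; exact: cyc5_rev.
have cm : coc Y m.
  split=> // [x y z xY yY zY xy yz zx|a b c d e aY bY cY dY eY h].
    by rewrite (tri0 x y z) // (tri0 y z x) // (tri0 z x y).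
  have h2 := cyc5_rot h; have h3 := cyc5_rot h2; have h4 := cyc5_rot h3.
  have h5 := cyc5_rot h4.
  by rewrite (pent0 _ _ _ _ _ _ _ _ _ _ h) // (pent0 _ _ _ _ _ _ _ _ _ _ h2) //
    (pent0 _ _ _ _ _ _ _ _ _ _ h3) // (pent0 _ _ _ _ _ _ _ _ _ _ h4) //
    (pent0 _ _ _ _ _ _ _ _ _ _ h5).
have a4D : a4 \in Y :\: [set a1; a2; a3].
  by rewrite !inE Y4 ![a4 == _]eq_sym (negbTE n14) (negbTE n24) (negbTE n34).
have [pq' sq] := er_path a4D pq.
pose w := [:: a2, a3, a4 & q ++ [:: a1]].
have pw : path (@edge G) a1 w.
  by rewrite /= e12 e23 e34 cat_path pq' -lq /= e01.
have lw : last a1 w = a1 by rewrite /= last_cat.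
have [cw sw] := closed_walk m pw lw.
suff o : csum m w.
  apply: holedS (odd_walk_hole c4 cm cw _ o) => [|x]; last first.
    rewrite !inE mem_cat inE => /or4P[/eqP->|/eqP->|/eqP->|/orP[/sq|/eqP->]] //.
    by rewrite !inE => /andP[].
  apply/subsetP => x; rewrite !inE mem_cat inE => /or4P[/eqP->|/eqP->|/eqP->|/orP[/sq|/eqP->]] //.
  by rewrite !inE => /andP[].
rewrite sw /= psum_cat -lq /= addbF.
have -> : m a1 a2 by rewrite /m !eqxx.
have -> : m a2 a3 = false by rewrite /m eq_sym (negbTE n12) eqxx /= eq_sym (negbTE n13).
have -> : m a3 a4 = false.
  by rewrite /m ![a3 == _]eq_sym (negbTE n13) (negbTE n23).
have -> : m a0 a1 = false by rewrite /m (negbTE n01) (negbTE n02).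
rewrite /= addbF; have -> : psum m a4 q = false => //.
have : a4 \notin [:: a1; a2] by move: a4D; rewrite !inE !negb_or => /andP[/andP[/andP[-> ->]]].
elim: q a4 sq {a4D pq lq w pw lw cw sw pq' n04' n14 n24 n34 Y4 e34 n04 N3 pent} => //= y q IH z sq nz.
have yD : y \in Y :\: [set a1; a2; a3] by apply: sq; rewrite inE eqxx.
have ny : y \notin [:: a1; a2] by move: yD; rewrite !inE !negb_or => /andP[/andP[/andP[-> ->]]].
rewrite IH // => [|u uq]; last by apply: sq; rewrite inE uq orbT.
by move: nz ny; rewrite !inE !negb_or /m => /andP[/negbTE-> /negbTE->].
Qed.

Definition lam I R : rel G := fun u v => (u \in I) && (v \in R) || (v \in I) && (u \in R).

Definition closed_in W R := forall x y, x \in R -> y \in W -> edge x y -> y \in R.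

Definition short_in S I U :=
  (forall x y z, x \in I -> y \in S -> z \in S -> edge x y -> edge y z -> edge z x ->
     (y \in U) && (z \in U)) /\
  (forall a b c d e, a \in I -> b \in S -> c \in S -> d \in S -> e \in S ->
     cyc5 a b c d e -> [&& b \in U, c \in U, d \in U & e \in U]).

Lemma lam_sym I R x y : lam I R x y = lam I R y x.
Proof. by rewrite /lam orbC. Qed.

(** All edges of U that leave R end in I, so inside U the crossing label is the coboundary of R. *)
Lemma lam_cut U I R u v : I \subset U -> R \subset U :\: I -> closed_in (U :\: I) R ->
  u \in U -> v \in U -> edge u v -> lam I R u v = (u \in R) (+) (v \in R).
Proof.
move=> /subsetP IU /subsetP RU cl uU vU uv; rewrite /lam.
have nI x : x \in R -> x \notin I by move/RU; rewrite inE => /andP[].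
case: (boolP (u \in R)) => uR; case: (boolP (v \in R)) => vR /=.
- by rewrite (negbTE (nI _ uR)) (negbTE (nI _ vR)).
- rewrite andbF andbT; apply: contraT => vI.
  by case/negP: vR; apply: cl uv => //; rewrite inE vI.
- rewrite andbF andbT orbF; apply: contraT => uI.
  by case/negP: uR; apply: cl vR _ _; rewrite 1?edgeC // inE uI.
- by rewrite !andbF.
Qed.

(** A short cycle that misses I carries no label; one that meets I lies in U, where the label is a
    coboundary. Outside U the label need not be one, which is why it can detect long holes. *)
Lemma coc_lam S U I R : I \subset U -> R \subset U :\: I -> closed_in (U :\: I) R ->
  short_in S I U -> coc S (lam I R).
Proof.
move=> IU RU cl [h3 h5].
have cut u v := lam_cut IU RU cl (u := u) (v := v).
have sI x : x \in I -> x \in U by move/(subsetP IU).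
have z0 u v : u \notin I -> v \notin I -> lam I R u v = false.
  by move=> uI vI; rewrite /lam (negbTE uI) (negbTE vI).
split; first exact: lam_sym.
  move=> x y z xS yS zS xy yz zx.
  case: (boolP [|| x \in I, y \in I | z \in I]) => [hI|]; last first.
    by rewrite !negb_or => /and3P[xI yI zI]; rewrite !z0.
  suff /and3P[xU yU zU] : [&& x \in U, y \in U & z \in U].
    by rewrite !cut //; do 3!case: (_ \in R).
  case/or3P: hI => hI; rewrite (sI _ hI).
  - by rewrite (h3 x).
  - by case/andP: (h3 y z x hI zS xS yz zx xy) => -> ->.
  - by case/andP: (h3 z x y hI xS yS zx xy yz) => -> ->.
move=> a b c d e aS bS cS dS eS h.
case: (boolP [|| a \in I, b \in I, c \in I, d \in I | e \in I]) => [hI|]; last first.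
  by rewrite !negb_or => /and5P[aI bI cI dI eI]; rewrite !z0.
suff /and5P[aU bU cU dU eU] : [&& a \in U, b \in U, c \in U, d \in U & e \in U].
  case/andP: h => /and5P[ab bc cd de ea] _.
  by rewrite !cut //; do 5!case: (_ \in R).
have h2 := cyc5_rot h; have hc := cyc5_rot h2; have hd := cyc5_rot hc.
have he := cyc5_rot hd.
case/orP: hI => [hI|/or4P[] hI]; rewrite (sI _ hI).
- exact: h5 h.
- by case/and4P: (h5 _ _ _ _ _ hI cS dS eS aS h2) => -> -> -> ->.
- by case/and4P: (h5 _ _ _ _ _ hI dS eS aS bS hc) => -> -> -> ->.
- by case/and4P: (h5 _ _ _ _ _ hI eS aS bS cS hd) => -> -> -> ->.
- by case/and4P: (h5 _ _ _ _ _ hI aS bS cS dS he) => -> -> -> ->.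
Qed.

Lemma ballE0 S x : ball S 0 x = [set x] :&: S.
Proof. by rewrite ball.unlock. Qed.

Lemma ballE S r x : ball S r.+1 x = expand S (ball S r x).
Proof. by rewrite ball.unlock. Qed.

Lemma ball0 S x : x \in S -> x \in ball S 0 x.
Proof. by move=> xS; rewrite ballE0 !inE eqxx. Qed.

Lemma ballS S r x y z : y \in ball S r x -> z \in S -> edge y z -> z \in ball S r.+1 x.
Proof.
move=> yb zS yz; rewrite ballE inE; apply/orP; right.
by rewrite inE zS; apply/existsP; exists y; rewrite yb.
Qed.

Lemma ball_leq S r s x : r <= s -> ball S r x \subset ball S s x.
Proof.
move=> /subnK<-; elim: (s - r) => //= n IH.
by by apply: subset_trans IH _; rewrite addSn ballE; exact: subsetUl.
Qed.

Lemma ballP S r x y : reflect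
  (exists p, [/\ x \in S, path (er S) x p, last x p = y & size p <= r]) (y \in ball S r x).
Proof.
apply: (iffP idP) => [|[p [xS pp <- sp]]].
  elim: r y => [|r IH] y.
    by rewrite ballE0 !inE => /andP[/eqP-> xS]; exists [::].
  rewrite ballE inE => /orP[/IH[p [xS pp lp sp]]|]; first by exists p; split=> //; exact: leqW.
  rewrite inE => /andP[yS /existsP[z /andP[/IH[p [xS pp lp sp]] zy]]].
  exists (rcons p y); rewrite rcons_path last_rcons size_rcons pp lp /= yS zy.
  by split=> //; rewrite andbT; rewrite -lp (conn_in xS) //; apply/connectP; exists p.
apply: (subsetP (ball_leq _ _ sp)).
elim/last_ind: p pp {sp} => [|p z IH]; first by rewrite ball0.
rewrite rcons_path last_rcons size_rcons => /andP[pp /and3P[_ zS e]].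
exact: ballS (IH pp) zS e.
Qed.

Lemma ball_sub S r x : ball S r x \subset S.
Proof.
apply/subsetP => y /ballP[p [xS pp <- _]]; apply: (conn_in xS).
by apply/connectP; exists p.
Qed.

Lemma ballSS S T r x : S \subset T -> ball S r x \subset ball T r x.
Proof.
move=> sT; apply/subsetP => y /ballP[p [xS pp lp sp]]; apply/ballP; exists p.
split=> //; first exact: (subsetP sT).
apply: sub_path pp => u v /and3P[uS vS e].
by rewrite /= !(subsetP sT).
Qed.

Lemma ball_cat S r s x y z : y \in ball S r x -> z \in ball S s y -> z \in ball S (r + s) x.
Proof.
move=> /ballP[p [xS pp lp sp]] /ballP[q [yS pq lq sq]]; apply/ballP; exists (p ++ q).
by rewrite cat_path last_cat lp pp pq size_cat leq_add.
Qed.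

Lemma ballC S r x y : (y \in ball S r x) = (x \in ball S r y).
Proof.
suff h u v : u \in ball S r v -> v \in ball S r u by apply/idP/idP; exact: h.
elim: r u => [|r IH] u; first by rewrite !ballE0 !inE => /andP[/eqP->]; rewrite eqxx.
have uS' := subsetP (ball_sub S r.+1 v) u.
move=> uv; have uS := uS' uv; move: uv; rewrite ballE inE => /orP[/IH|].
  exact: (subsetP (ball_leq _ _ (leqnSn r))).
rewrite inE => /andP[_ /existsP[z /andP[zv zu]]].
have zS := subsetP (ball_sub _ _ _) _ zv.
rewrite -add1n; apply: ball_cat (IH _ zv).
by apply: (ballS (ball0 uS)); rewrite // edgeC.
Qed.

Definition reach S x := ball S #|G| x.

Lemma reachP S x y : (y \in reach S x) = (x \in S) && conn S x y.
Proof.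
apply/ballP/andP => [[p [xS pp <- _]]|[xS /connectP[p pp ->]]].
  by split=> //; apply/connectP; exists p.
case/shortenP: pp => q pq uq _; exists q; split=> //.
rewrite -ltnS -[(size q).+1]/(size (x :: q)) -(card_uniqP uq).
exact: leq_trans (max_card _) (leqnSn _).
Qed.

Lemma ball_conn S r x y : y \in ball S r x -> conn (ball S r x) x y.
Proof.
elim: r y => [|r IH] y; first by rewrite ballE0 !inE => /andP[/eqP-> _]; exact: connect0.
rewrite ballE; have s := subsetUl (ball S r x) [set v in S | [exists u in ball S r x, edge u v]].
rewrite inE => /orP[/IH|]; first exact: connSub.
rewrite inE => /andP[yS /existsP[z /andP[zb zy]]].
apply: connect_trans (connSub s (IH _ zb)) _; apply: conn1 => //.
  exact: (subsetP s).
rewrite -[_ :|: _]/(expand S _) -ballE; exact: ballS zb yS zy.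
Qed.

Lemma reach_closed S x : closed_in S (reach S x).
Proof.
move=> y z; rewrite !reachP => /andP[xS xy] zS yz; rewrite xS /=.
by apply: (connect_trans xy); apply: conn1 => //; exact: conn_in xS xy.
Qed.

Lemma reach_sub S x : reach S x \subset S.
Proof. exact: ball_sub. Qed.
End Labels.

(** * Detecting long holes by labels *)

Section HoleSums.
Variable G : sgraph.
Implicit Types (f : nat -> G) (m : G -> G -> bool) (l : nat).

Definition zs l f m := \big[addb/false]_(i < l) m (f i) (f i.+1).

Lemma zs_add l f m1 m2 : zs l f (fun u v => m1 u v (+) m2 u v) = zs l f m1 (+) zs l f m2.
Proof. exact: big_split. Qed.

Lemma hol_per l f i : hol l f -> f (i + l) = f i.
Proof. by case=> _ e _; apply/eqP; rewrite e modnDr. Qed.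

Lemma telescope_addb (g : nat -> bool) n :
  \big[addb/false]_(i < n) (g i (+) g i.+1) = g 0 (+) g n.
Proof.
elim: n => [|n IH]; first by rewrite big_ord0 addbb.
by rewrite big_ord_recr /= IH -addbA addKb.
Qed.

Lemma zs_cob l f (g : G -> bool) : hol l f -> zs l f (fun u v => g u (+) g v) = false.
Proof.
move=> h; rewrite /zs (telescope_addb (g \o f)) /= -[l]add0n hol_per //.
by rewrite addbb.
Qed.

Lemma zs_eq l f m1 m2 : (forall i, m1 (f i) (f i.+1) = m2 (f i) (f i.+1)) ->
  zs l f m1 = zs l f m2.
Proof. by move=> h; rewrite /zs; under eq_bigr => i _ do rewrite h. Qed.

Lemma hol_edgeS l f i : hol l f -> edge (f i) (f i.+1).
Proof. by case=> _ _ ->; rewrite eqxx. Qed.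

Lemma hol_shift l f k : hol l f -> hol l (fun i => f (i + k)).
Proof.
case=> l4 e ed; split=> // i j; first by rewrite e eqn_modDr.
by rewrite ed -!addSn !eqn_modDr.
Qed.

Lemma zs_shift l f k m : hol l f -> zs l (fun i => f (i + k)) m = zs l f m.
Proof.
move=> h; elim: k => [|k IH]; first by rewrite /zs; under eq_bigr do rewrite !addn0.
rewrite -IH /zs; pose H i := m (f (i + k)) (f (i.+1 + k)).
have -> : \big[addb/false]_(i < l) m (f (i + k.+1)) (f (i.+1 + k.+1))
    = \big[addb/false]_(i < l) H i.+1.
  by apply: eq_bigr => i _; rewrite /H !addSnnS.
have Hl : H l = H 0 by rewrite /H addSn ![l + k]addnC -addSn !(hol_per _ h).
have : \big[addb/false]_(i < l.+1) H i = \big[addb/false]_(i < l.+1) H i by [].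
by rewrite {1}big_ord_recl big_ord_recr /= Hl addbC => /addIb.
Qed.

Lemma img_shift l f k : hol l f -> img l (fun i => f (i + k)) = img l f.
Proof.
move=> h; have h' := hol_shift k h.
apply/eqP; rewrite eqEcard !(card_img h) (card_img h') leqnn andbT.
by apply/subsetP => x /(in_imgP h')[i _ ->]; exact: in_img.
Qed.
End HoleSums.

Section Detect.
Variable G : sgraph.
Hypothesis c4 : C4_free G.
Variables (M D C : {set G}).
Implicit Types (S T R I Y : {set G}) (x y z : G) (m : G -> G -> bool).

Definition clique (S : {set G}) := forall x y, x \in S -> y \in S -> x != y -> edge x y.

Definition Uball c := ball M 7 c :|: D.
(** The restriction on ranks serves the elimination in [detect]: C is cleared by decreasing rank,
    and the label attached to c then puts nothing on edges between vertices that are already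
    cleared. *)
Definition Iset c := [set x in C | (enum_rank x <= enum_rank c) && (x \in ball M 3 c)].

Hypothesis CM : C \subset M.
Hypothesis Dcl : clique D.

Lemma near3 r c x y : x \in ball M r c -> y \in M :|: D -> edge x y ->
  y \in ball M r.+1 c :|: D.
Proof.
move=> xb; rewrite !in_setU => /orP[yM|->] e; rewrite ?orbT //.
by rewrite (ballS xb).
Qed.

(** The clique D could be a shortcut. But if b is in D then d and e, being nonadjacent to b, are
    not, and c is reached from a the other way round in three steps. *)
Lemma near5 r x (a b c d e : G) : a \in ball M r x -> cyc5 a b c d e ->
  [&& b \in M :|: D, c \in M :|: D, d \in M :|: D & e \in M :|: D] ->
  (b \in ball M r.+3 x :|: D) && (c \in ball M r.+3 x :|: D).
Proof.
move=> ab h /and4P[bM cM dM eM].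
case/andP: (h) => /and5P[eab ebc ecd ede eea] /and5P[nac nad nbd nbe nce].
have up s t y : s <= t -> y \in ball M s x :|: D -> y \in ball M t x :|: D.
  by move=> st; rewrite !in_setU => /orP[/(subsetP (ball_leq _ _ st))->|->]; rewrite ?orbT.
have b1 := near3 ab bM eab.
apply/andP; split; first by apply: (up r.+1) => //; exact: leqW.
case: (boolP (b \in D)) => bD; last first.
  move: b1; rewrite in_setU (negbTE bD) orbF => b1.
  by apply: (up r.+2) => //; exact: near3 b1 cM ebc.
have eD : e \notin D.
  apply/negP => eD; case: (eqVneq b e) => [E|/(Dcl bD eD)]; last by rewrite (negbTE nbe).
  by move: ede; rewrite -E edgeC (negbTE nbd).
have dD : d \notin D.
  apply/negP => dD; case: (eqVneq b d) => [E|/(Dcl bD dD)]; last by rewrite (negbTE nbd).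
  by move: ede; rewrite -E (negbTE nbe).
have := near3 ab eM; rewrite edgeC eea => /(_ isT); rewrite in_setU (negbTE eD) orbF => e1.
have := near3 e1 dM; rewrite edgeC ede => /(_ isT); rewrite in_setU (negbTE dD) orbF => d1.
by have := near3 d1 cM; rewrite edgeC ecd => /(_ isT).
Qed.

Lemma near5' r x (a b c d e : G) : a \in ball M r x -> cyc5 a b c d e ->
  [&& b \in M :|: D, c \in M :|: D, d \in M :|: D & e \in M :|: D] ->
  [&& b \in ball M r.+3 x :|: D, c \in ball M r.+3 x :|: D,
      d \in ball M r.+3 x :|: D & e \in ball M r.+3 x :|: D].
Proof.
move=> ab h mm; case/andP: (near5 ab h mm) => -> ->.
have h' : cyc5 a e d c b by exact/cyc5_rot/cyc5_rev.
have mm' : [&& e \in M :|: D, d \in M :|: D, c \in M :|: D & b \in M :|: D].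
  by case/and4P: mm => -> -> -> ->.
by case/andP: (near5 ab h' mm') => -> ->.
Qed.

(** Short cycles through the ball leave it by at most three steps, and 4 + 3 is the radius 7 of
    [Uball]. *)
Lemma short_ball r c I : I \subset ball M r c -> r <= 4 -> short_in (M :|: D) I (Uball c).
Proof.
move=> /subsetP Ib r4.
have up s y : s <= 7 -> y \in ball M s c :|: D -> y \in Uball c.
  by move=> st; rewrite !in_setU => /orP[/(subsetP (ball_leq _ _ st))->|->]; rewrite ?orbT.
split=> [x y z /Ib xI yS zS xy yz zx|a b c' d e /Ib aI bS cS dS eS h].
  by rewrite !(up r.+1) //; [move: r4; clear; lia|rewrite (near3 xI) // edgeC|move: r4; clear; lia|rewrite (near3 xI)].
have : r.+3 <= 7 by move: r4; clear; lia.
have := near5' aI h; rewrite bS cS dS eS => /(_ isT) /and4P[h1 h2 h3 h4] r7.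
by rewrite (up _ _ r7 h1) (up _ _ r7 h2) (up _ _ r7 h3) (up _ _ r7 h4).
Qed.

Lemma lam_ball_coc r c I R : I \subset ball M r c -> r <= 4 ->
  R \subset Uball c :\: I -> closed_in (Uball c :\: I) R -> coc (M :|: D) (lam I R).
Proof.
move=> Ib r4 RU cl; apply: (@coc_lam _ _ (Uball c)) => //; last exact: short_ball Ib r4.
apply: subset_trans Ib _; apply: subset_trans (subsetUl _ _).
by apply: ball_leq; move: r4; clear; lia.
Qed.

Variables (l : nat) (f : nat -> G).
Hypotheses (l6 : 6 <= l) (fh : hol l f).
Hypothesis fMD : img l f \subset M :|: D.
Hypothesis Df : D \subset img l f.
Hypothesis NL : forall c, c \in C -> ~ holed (Uball c).
Hypothesis dMD : [disjoint M & D].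

Lemma hol_run (g : nat -> G) (Y : {set G}) i n : hol l g ->
  (forall j, i <= j <= i + n -> g j \in Y) -> conn Y (g i) (g (i + n)).
Proof.
move=> h; elim: n => [|n IH] s; first by rewrite addn0; exact: connect0.
apply: (@connect_trans _ _ (g (i + n))).
  by apply: IH => j /andP[ij jn]; apply: s; rewrite ij addnS leqW.
apply: conn1; last by rewrite addnS; exact: hol_edgeS h.
  by apply: s; rewrite leq_addr leq_add2l leqnSn.
by apply: s; rewrite leq_addr leqnn.
Qed.

(* Rotate the hole so that a maximal run inside the ball [B] comes first. *)
Lemma rotate_run c (B : {set G}) : c \in img l f -> c \in B -> ~~ (img l f \subset B) ->
  exists g t a, [/\ hol l g, img l g = img l f, (forall m, zs l g m = zs l f m),
    t < a < l & [/\ g t = c, (forall i, i < a -> g i \in B), g a \notin B & g l.-1 \notin B]].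
Proof.
move=> cZ cB /subsetPn[x xZ xB].
have l0 : 0 < l by apply: leq_trans l6.
have [p pl cE] := in_imgP fh cZ; have [q ql xE] := in_imgP fh xZ.
have exj : exists j, (0 < j < l) && (f (p + l - j) \notin B).
  case: (ltngtP p q) => pq; last by move: xB; rewrite xE -pq -cE cB.
    exists (p + l - q); rewrite subKn; last by apply: ltnW; rewrite ltn_addl.
    by rewrite -xE xB andbT; move: pq ql; clear; lia.
  exists (p - q); have -> : p + l - (p - q) = q + l by move: pq; clear; lia.
  by rewrite hol_per // -xE xB andbT; move: pq pl; clear; lia.
case: (ex_minnP exj) => j /andP[/andP[j0 jl] jB] jmin.
pose k := p + l - j.-1; pose g i := f (i + k).
have gh : hol l g by exact: hol_shift.
have gl : g l.-1 \notin B.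
  rewrite /g; have -> : l.-1 + k = p + l - j + l by rewrite /k; move: j0 jl; clear; lia.
  by rewrite hol_per.
have gt : g j.-1 = c.
  rewrite /g; have -> : j.-1 + k = p + l by rewrite /k; move: j0 jl; clear; lia.
  by rewrite hol_per.
have exa : exists a, g a \notin B by exists l.-1.
case: (ex_minnP exa) => a aB amin.
exists g, j.-1, a; split=> //; first exact: img_shift.
- by move=> m; exact: zs_shift.
- apply/andP; split; last by have := amin _ gl; move: l0; clear; lia.
  rewrite ltnNge; apply/negP => aj; case/negP: aB.
  case: (eqVneq a j.-1) => [->|na]; first by rewrite gt.
  have -> : g a = f (p + l - (j.-1 - a)) by rewrite /g /k; congr f; move: aj j0 jl; clear; lia.
  apply: contraT => nb; have := jmin (j.-1 - a); rewrite nb andbT.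
  by move: aj j0 jl na; clear; lia.
- split=> // i ia; apply: contraT => nb; have := amin _ nb; rewrite leqNgt ia.
  by [].
Qed.

(** The hole enters and leaves the ball B around c. If the two ends of its run through c were joined
    in [Uball c] outside B, the run would close up to a long hole inside [Uball c]; hence a
    component at one end is crossed an odd number of times. *)
Lemma seed c : c \in img l f -> c \in C ->
  exists R, [/\ R \subset Uball c :\: ball M 3 c, closed_in (Uball c :\: ball M 3 c) R &
    zs l f (lam (ball M 3 c) R)].
Proof.
move=> cZ cC; set B := ball M 3 c; set U := Uball c.
have cM : c \in M by exact: (subsetP CM).
have cB : c \in B by apply: (subsetP (ball_leq _ _ (leq0n 3))); exact: ball0.
have BM : B \subset M by exact: ball_sub.
have BU : B \subset U by apply: subset_trans (subsetUl _ _); exact: ball_leq.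
have nZU : ~~ (img l f \subset U).
  by apply/negP => h; case: (NL cC); exists l, f.
have nZB : ~~ (img l f \subset B) by apply: contra nZU => h; exact: subset_trans h BU.
have [g [t [a [gh gi gz /andP[ta al] [gt gB ga gl]]]]] := rotate_run cZ cB nZB.
have l0 : 0 < l by apply: leq_trans l6.
have eS i : edge (g i) (g i.+1) := hol_edgeS i gh.
have gZ i : g i \in M :|: D by apply: (subsetP fMD); rewrite -gi; exact: in_img.
have gg i j : (g i == g j) = (i == j %[mod l]) by case: gh.
have ge i j : edge (g i) (g j) = (j == i.+1 %[mod l]) || (i == j.+1 %[mod l]) by case: gh.
have gU i : g i \in B -> g i.+1 \in U.
  move=> h; have := near3 h (gZ i.+1) (hol_edgeS i gh); rewrite !in_setU.
  by case/orP=> [/(subsetP (ball_leq _ _ (isT : 4 <= 7)))->|->]; rewrite ?orbT.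
have gU' i : g i.+1 \in B -> g i \in U.
  move=> h; have := near3 h (gZ i); rewrite edgeC => /(_ (hol_edgeS i gh)); rewrite !in_setU.
  by case/orP=> [/(subsetP (ball_leq _ _ (isT : 4 <= 7)))->|->]; rewrite ?orbT.
(* The component T is grown from the last vertex before the run, outside B but through the later
   visits of the hole to B; in this way the later visits contribute evenly. *)
pose A := [set g (i : 'I_l) | i in 'I_l & (a <= i) && (g i \in B)].
pose W := (U :\: B) :|: A; pose T := reach W (g l.-1); pose R := T :\: B.
have AB x : x \in A -> x \in B by case/imsetP => i; rewrite !inE /= => /andP[_ h] ->.
have inA i : a <= i < l -> g i \in B -> g i \in A.
  by move=> /andP[ai il] h; apply/imsetP; exists (Ordinal il); rewrite // inE /= ai.
have TW : T \subset W by exact: reach_sub.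
have lE : l.-1.+1 = l by rewrite prednK.
have glU : g l.-1 \in U.
  by apply: gU'; rewrite lE -[l]add0n hol_per // gB //; apply: leq_trans ta.
have glT : g l.-1 \in T.
  by rewrite /T reachP in_setU in_setD glU gl /=; exact: connect0.
have RU : R \subset U :\: B.
  apply/subsetP => x /setDP[/(subsetP TW) /setUP[//|/AB xB'] xB].
  by rewrite xB' in xB.
have clT : closed_in W T by exact: reach_closed.
have clR : closed_in (U :\: B) R.
  move=> x y /setDP[xT _] yUB e; have /setDP[_ yB] := yUB.
  by apply/setDP; split=> //; apply: clT xT _ e; rewrite in_setU yUB.
have Wout i : a <= i < l -> g i \in U -> g i \in W.
  move=> ai h; rewrite in_setU in_setD h andbT.
  by case: (boolP (g i \in B)) => // hB; rewrite inA.
have RE x : (x \in R) = (x \notin B) && (x \in T) by rewrite in_setD.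
clearbody R.
have a0 : 0 < a by apply: leq_trans ta.
have aE : a.-1.+1 = a by rewrite prednK.
have gl0 : g l = g 0 by rewrite -[l]add0n hol_per.
have sumE : zs l f (lam B R) = (g a \in T) (+) true.
  (* The label of an edge is the difference of F at its ends, except at the two ends of the run:
     there it is the membership of [g a] in T, and 1. *)
  pose F i := [&& a <= i < l, g i \in B & g i \in T].
  have F0 : F 0 = false by rewrite /F leqn0 eqn0Ngt a0.
  have Fl : F l = false by rewrite /F ltnn andbF.
  have ind (k : nat) (b : bool) : k < l -> \big[addb/false]_(i < l) ((i == k :> nat) && b) = b.
    move=> kl; rewrite (bigD1 (Ordinal kl)) //= eqxx big1 ?addbF // => i /negbTE.
    by rewrite -val_eqE /= => ->.
  have E : forall i : 'I_l, true -> lam B R (g i) (g i.+1)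
      = (F i (+) F i.+1) (+) (((i == a.-1 :> nat) && (g a \in T)) (+) ((i == l.-1 :> nat) && true)).
    move=> i _; have il := ltn_ord i; move: (val i) il => {}i il.
    case: (ltngtP i a.-1) => ia.
    - have h1 : i < a by rewrite -aE ltnS ltnW.
      have h2 : i.+1 < a by rewrite -aE ltnS.
      have -> : (i == l.-1) = false by apply/eqP => E; move: al; rewrite -lE -E ltnS leqNgt h1.
      by rewrite /F !(leqNgt a) h1 h2 /= /lam !RE (gB _ h1) (gB _ h2).
    - have h1 : a <= i by rewrite -aE.
      case: (eqVneq i l.-1) => iE.
        by rewrite iE lE gl0 Fl /F (negbTE gl) andbF /= /lam !RE (negbTE gl) gB //= glT.
      have il' : i.+1 < l by move: il iE; clear; lia.
      rewrite /= addbF /F h1 il (leqW h1) il' /= /lam !RE.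
      have inW j : a <= j < l -> (g j \in B) -> g j \in W.
        by move=> hj hB; apply: Wout => //; exact: (subsetP BU).
      case: (boolP (g i \in B)) => b1; case: (boolP (g i.+1 \in B)) => b2 //=.
      + have w1 : g i \in W by apply: inW; rewrite ?h1.
        have w2 : g i.+1 \in W by apply: inW; rewrite ?il' ?(leqW h1).
        have -> : (g i \in T) = (g i.+1 \in T); last by rewrite addbb.
        by apply/idP/idP => h; apply: (clT _ _ h) => //; rewrite 1?edgeC; exact: eS.
      + have w1 : g i \in W by apply: inW; rewrite ?h1.
        have w2 : g i.+1 \in W by apply: Wout; rewrite ?il' ?(leqW h1) ?gU.
        rewrite orbF addbF.
        by apply/idP/idP => h; apply: (clT _ _ h) => //; rewrite 1?edgeC; exact: eS.
      + have w1 : g i \in W by apply: Wout; rewrite ?h1 ?gU'.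
        have w2 : g i.+1 \in W by apply: inW; rewrite ?il' ?(leqW h1).
        by apply/idP/idP => h; apply: (clT _ _ h) => //; rewrite 1?edgeC; exact: eS.
    - have h1 : i < a by rewrite -aE ia.
      have -> : (i == l.-1) = false by apply/eqP => E; move: al; rewrite -lE -E ltnS leqNgt h1.
      have Fi : F a.-1 = false by rewrite /F leqNgt prednK // leqnn.
      by rewrite ia aE Fi /F (negbTE ga) andbF /= /lam !RE (negbTE ga) gB -?ia //= orbF addbF.
  rewrite -gz /zs (eq_bigr _ E) big_split /= (telescope_addb F) F0 Fl big_split /=.
  by rewrite !ind //; move: a0 al; clear; lia.
exists R; split=> //; rewrite sumE; case: (boolP (g a \in T)) => // gaT; exfalso.
have b2in i : i < a -> i <= t.+2 -> t <= i.+2 -> g i \in ball M 2 c.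
  move=> ia it ti; have b0 : g t \in ball M 0 c by rewrite gt; exact: ball0.
  have gM j : j < a -> g j \in M by move=> ja; apply: (subsetP BM); exact: gB.
  have up r s x : r <= s -> x \in ball M r c -> x \in ball M s c.
    by move=> rs; exact: (subsetP (ball_leq _ _ rs)).
  have e j := hol_edgeS j gh.
  case: (ltngtP i t) => h; last by rewrite h; exact: up b0.
    have tE : t.-1.+1 = t by move: h; clear; lia.
    have b1 : g t.-1 \in ball M 1 c.
      apply: (ballS b0); first by apply: gM; move: ta; clear; lia.
      by rewrite edgeC -{2}tE.
    case: (eqVneq i t.-1) => [->|n1]; first exact: up b1.
    have -> : i = t.-2 by move: h ti n1; clear; lia.
    apply: (ballS b1); first by apply: gM; move: ta; clear; lia.
    rewrite edgeC; have -> : t.-1 = t.-2.+1 by move: h n1; clear; lia.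
    exact: e.
  have b1 : g t.+1 \in ball M 1 c by apply: (ballS b0); rewrite ?gM // (leq_ltn_trans h).
  case: (eqVneq i t.+1) => [->|n1]; first exact: up b1.
  have E : i = t.+2 by move: h it n1; clear; lia.
  by rewrite E; apply: (ballS b1); rewrite // gM // -E.
have b34 x : x \in ball M 2 c -> forall y, y \in M -> edge x y -> y \in B.
  by move=> xb y yM; exact: ballS xb yM.
case: (leqP a 2) => a2.
  (* both ends of the run leave through D, which is a clique *)
  have inD j k : k < a -> edge (g k) (g j) -> g j \notin B -> g j \in D.
    move=> ka e jB; have := gZ j; rewrite in_setU => /orP[jM|//].
    case/negP: jB; apply: b34 jM e; apply: b2in => //; move: ka ta a2; clear; lia.
  have d1 : g l.-1 \in D.
    apply: (inD _ 0) => //; rewrite edgeC; have := hol_edgeS l.-1 gh.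
    by rewrite lE gl0.
  have d2 : g a \in D.
    by apply: (inD _ a.-1) => //; rewrite ?aE // -{2}aE; exact: eS.
  have nE : g l.-1 != g a.
    by rewrite gg !modn_small //; [move: a2 l6; clear; lia | rewrite -{2}lE].
  have := Dcl d1 d2 nE; rewrite ge lE modnn; case/orP.
    by rewrite modn_small // eqn0Ngt a0.
  rewrite !modn_small; [|by move: a2 l6; clear; lia|by rewrite -{2}lE].
  by move: a2 l6; clear; lia.
(* Three consecutive vertices of the run within distance 2 of c: their neighbours in M lie in B, and
   those of T lie on the hole, as [p5crit] requires. *)
have [i0 [i0a i0l i0r]] : exists i0, [/\ i0.+2 < a, i0.+2 <= t.+2 & t <= i0.+2].
  case: (ltnP t.+2 a) => h; first by exists t; rewrite h leqnn leqW.
  by exists (a - 3); split; move: h ta a2; clear; lia.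
have sB i : i0 <= i <= i0.+2 -> g i \in ball M 2 c.
  by move=> hi; apply: b2in; move: hi i0a i0l i0r; clear; lia.
pose Y := [set g (i : 'I_l) | i in 'I_l & i < a] :|: T.
have inY i : i < a -> g i \in Y.
  move=> ia; rewrite in_setU; apply/orP; left; apply/imsetP.
  by exists (Ordinal (ltn_trans ia al)) => //; rewrite inE.
have YU : Y \subset U.
  apply/subsetP => x /setUP[/imsetP[i ia ->]|/(subsetP TW)].
    by apply: (subsetP BU); apply: gB; rewrite inE in ia.
  by case/setUP=> [/setDP[]|/AB /(subsetP BU)].
have YMD x : x \in Y -> (x \in img l g) || (x \in M) && (x \notin B).
  case/setUP => [/imsetP[i _ ->]|/(subsetP TW)]; first by rewrite in_img.
  case/setUP => [|/imsetP[i _ ->]]; last by rewrite in_img.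
  case/setDP => /setUP[h|xD] xB.
    by rewrite xB (subsetP (ball_sub _ _ _) _ h) orbT.
  by rewrite gi (subsetP Df).
have nbY i y : i0 <= i <= i0.+2 -> y \in Y -> edge (g i) y -> y \in [:: g (i + l.-1); g i.+1].
  move=> hi yY e; case/orP: (YMD _ yY) => [|/andP[yM yB]]; last first.
    by case/negP: yB; apply: b34 yM e; exact: sB.
  case/(in_imgP gh) => j jl yE; move: e; rewrite yE ge !inE !gg => /orP[->|/eqP E].
    by rewrite orbT.
  apply/orP; left; rewrite -(eqn_modDr 1) !addn1 -addnS lE modnDr.
  by apply/eqP; rewrite E.
have mods i j : i < l -> j < l -> (i == j %[mod l]) = (i == j).
  by move=> il jl; rewrite !modn_small.
(* One period later, so that the predecessor has an index even if [i0] is 0. *)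
pose i1 := i0 + l.
have gper i : g (i + l) = g i by rewrite hol_per.
have a0E : (i0 + l.-1).+1 = i1 by rewrite -addnS lE.
have neq i j : i < j < i + l -> g i != g j.
  move=> hij; rewrite gg; have -> : j = i + (j - i) by move: hij; clear; lia.
  rewrite -{1}[i]addn0 eqn_modDl mod0n modn_small; move: hij; clear; lia.
pose x0 := g (i0 + l.-1); pose x1 := g i1; pose x2 := g i1.+1; pose x3 := g i1.+2; pose x4 := g i1.+3.
have x1E : x1 = g i0 by rewrite /x1 gper.
have x2E : x2 = g i0.+1 by rewrite /x2 -addSn gper.
have x3E : x3 = g i0.+2 by rewrite /x3 -!addSn gper.
have x4E : x4 = g i0.+3 by rewrite /x4 -!addSn gper.
have i0l' : i0.+3 < l by apply: leq_ltn_trans al.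
have x0Y : x0 \in Y.
  rewrite /x0; case: (posnP i0) => [->|i00]; first by rewrite in_setU glT orbT.
  have -> : i0 + l.-1 = i0.-1 + l by move: i00 l0; clear; lia.
  by rewrite gper; apply: inY; move: i0a; clear; lia.
have x4Y : x4 \in Y.
  rewrite x4E; case: (ltngtP i0.+3 a) => h; first exact: inY.
    by move: h i0a; clear; lia.
  by rewrite h in_setU gaT orbT.
apply: (NL cC); apply: (holedS YU).
apply: (@p5crit _ c4 _ x0 x1 x2 x3 x4).
- rewrite /= !inE !negb_or !neq //; move: l6 l0; rewrite /i1; clear; lia.
- by rewrite x0Y x4Y x1E x2E x3E !inY //; move: i0a; clear; lia.
- by rewrite /x0 /x1 -a0E; exact: eS.
- exact: eS.
- exact: eS.
- exact: eS.
- rewrite ge a0E negb_or.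
  have := @neq i1 i1.+3; have := @neq (i0 + l.-1) i1.+4; rewrite !gg => h1 h2.
  by rewrite eq_sym h2 ?h1 //; move: l6; rewrite /i1; clear; lia.
- move=> y yY; rewrite x1E => e; have := nbY i0 y; rewrite x2E; apply => //.
  by rewrite leqnn -addn2 leq_addr.
- move=> y yY; rewrite x2E => e; have := nbY i0.+1 y; rewrite x3E.
  rewrite addSn a0E; apply => //; by rewrite !leqnSn.
- move=> y yY; rewrite x3E => e; have := nbY i0.+2 y; rewrite x4E.
  rewrite !addSn a0E; apply => //; by rewrite -addn2 leq_addr leqnn.
set Y' := Y :\: _.
have inY' i : i0.+3 <= i <= i0 + l.-1 -> g i \in Y -> g i \in Y'.
  move=> hi h; rewrite in_setD h andbT !inE !negb_or x1E x2E x3E.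
  by rewrite ![g i == _]eq_sym !neq //; move: hi l0; clear; lia.
have TY' : T \subset Y'.
  apply/subsetP => x xT; apply/setDP; split; first by apply/setUP; right.
  rewrite !inE !negb_or x1E x2E x3E.
  suff h j : j < a -> x != g j by rewrite !h //; move: i0a; clear; lia.
  move=> ja; apply/eqP => E; have := subsetP TW _ xT; rewrite E in_setU in_setD gB //=.
  case/imsetP => k /[!inE] /= /andP[ak _] /eqP.
  by rewrite gg mods ?ltn_ord //; [move: ja ak; clear; lia | apply: ltn_trans ja al].
have c1 : conn Y' x4 (g a).
  rewrite x4E -(subnKC i0a); apply: hol_run => // j /andP[j1 j2]; rewrite subnKC // in j2.
  apply: inY'; first by rewrite j1; move: j2 al; clear; lia.
  case: (ltngtP j a) => ja; [exact: inY | by move: ja j2; clear; lia | by rewrite ja in_setU gaT orbT].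
have c2 : conn Y' (g l.-1) (g a) by apply: (connSub TY'); exact: ball_conn gaT.
apply: (connect_trans c1); rewrite -/(conn Y' _ _) in c2 *.
apply: (@connect_trans _ _ (g l.-1)); first by rewrite -/(conn Y' _ _) conn_sym.
have -> : x0 = g (l.-1 + i0) by rewrite addnC.
apply: hol_run => // j /andP[j1 j2]; case: (eqVneq j l.-1) => [->|n1].
  by apply: (subsetP TY').
apply: inY'; first by move: j1 j2 n1 i0l'; clear; lia.
have -> : j = (j - l) + l by move: j1 n1 l0; clear; lia.
by rewrite gper; apply: inY; move: j1 j2 i0a; clear; lia.
Qed.

Hypothesis nMC : ~ holed ((M :\: C) :|: D).

(** Suppose that all these crossing labels are even on the hole. The label of [seed] is odd; adding
    coboundaries and crossing labels keeps it odd, yet they suffice to clear all edges, one vertex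
    of C after the other. *)
Lemma detect : exists c R, [/\ c \in C, R \subset Uball c :\: Iset c,
  closed_in (Uball c :\: Iset c) R & zs l f (lam (Iset c) R)].
Proof.
have fZ i : f i \in M :|: D by apply: (subsetP fMD); exact: in_img.
have [c0 c0Z c0C] : exists2 c, c \in img l f & c \in C.
  case: (boolP [exists c, (c \in img l f) && (c \in C)]) => [/existsP[c /andP[]]|]; first by exists c.
  move=> nC; case: nMC; exists l, f; split=> //; apply/subsetP => x xZ.
  case/setUP: (subsetP fMD _ xZ) => h; apply/setUP; [left|by right].
  apply/setDP; split=> //; apply: contra nC => xC; apply/existsP; exists x.
  by rewrite xZ.
apply: Classical_Prop.NNPP => nd.
have {nd}ev c R : c \in C -> R \subset Uball c :\: Iset c ->
    closed_in (Uball c :\: Iset c) R -> zs l f (lam (Iset c) R) = false.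
  by move=> cC RU cl; apply/negP => o; apply: nd; exists c, R.
have [R0 [R0U R0cl R0o]] := seed c0Z c0C.
have coc0 : coc (M :|: D) (lam (ball M 3 c0) R0) by apply: (@lam_ball_coc 3 c0).
set m0 := lam _ _ in coc0 R0o.
pose S j := [set x in C | enum_rank x < j].
(* No long hole avoids C, so off C the label is a coboundary and is normalised to zero. *)
have [g gE] : exists g : G -> bool, forall x y, er ((M :\: C) :|: D) x y -> m0 x y = g x (+) g y.
  apply: potential => [||p cp]; first exact: er_sym; first exact: lam_sym.
  have sub : (M :\: C) :|: D \subset M :|: D by apply: setSU; exact: subsetDl.
  case: p cp => [|x p] // cp.
  have xS : x \in (M :\: C) :|: D.
    by move: cp; rewrite /= rcons_path => /andP[_ /and3P[]].
  have [cp' sp] := er_path xS cp.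
  apply: (unholed_even c4 nMC (cocS sub coc0)) => // y yp; apply: sp.
  by rewrite mem_rcons.
pose m1 u v := m0 u v (+) (g u (+) g v).
have coc1 : coc (M :|: D) m1 by apply: coc_add coc0 (coc_cob _ _).
have o1 : zs l f m1 by rewrite zs_add zs_cob // addbF.
(* [S j] is the part of C still to be cleared; for j = 0 the label vanishes on every edge. *)
suff claim j m : coc (M :|: D) m ->
   (forall x y, x \in (M :|: D) :\: S j -> y \in (M :|: D) :\: S j -> edge x y -> m x y = false) ->
   zs l f m = false.
  move: o1; rewrite (claim #|G|) // => x y.
  have SE x' : x' \in (M :|: D) :\: S #|G| -> x' \in (M :\: C) :|: D.
    case/setDP => /setUP[xM|xD] xC; apply/setUP; [left|by right].
    by apply/setDP; split=> //; apply: contra xC => xC; rewrite inE xC ltn_ord.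
  by move=> /SE xS /SE yS e; rewrite /m1 gE ?addbb //= xS yS.
elim: j m => [|j IH] m cm mv.
  rewrite (@zs_eq _ _ _ _ (fun _ _ => false)); first by rewrite /zs big1.
  move=> i; apply: mv; last exact: (hol_edgeS i fh).
    by apply/setDP; split=> //; rewrite inE ltn0 andbF.
  by apply/setDP; split=> //; rewrite inE ltn0 andbF.
case: (boolP [exists c in C, enum_rank c == j :> nat]) => [/existsP[c /andP[cC /eqP cj]]|ncj]; last first.
  apply: (IH _ cm) => x y xS yS; apply: mv.
    case/setDP: xS => h h'; apply/setDP; split=> //; apply: contra h'.
    rewrite !inE ltnS leq_eqVlt => /andP[xC /orP[xj|->]]; last by rewrite xC.
    by case/negP: ncj; apply/existsP; exists x; rewrite xC.
  case/setDP: yS => h h'; apply/setDP; split=> //; apply: contra h'.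
  rewrite !inE ltnS leq_eqVlt => /andP[xC /orP[xj|->]]; last by rewrite xC.
  by case/negP: ncj; apply/existsP; exists y; rewrite xC.
set I := Iset c; set U := Uball c.
have cM : c \in M by exact: (subsetP CM).
have cb0 : c \in ball M 0 c by exact: ball0.
have IE x : (x \in I) = [&& x \in C, enum_rank x <= j & x \in ball M 3 c].
  by rewrite inE cj.
have cI : c \in I by rewrite IE cC cj leqnn (subsetP (ball_leq _ _ (leq0n 3))).
have UMD x : x \in U -> x \in M :|: D.
  case/setUP => [/(subsetP (ball_sub _ _ _)) h|h]; apply/setUP; [by left|by right].
pose Y := c |: (U :\: I).
have cU : c \in U by apply/setUP; left; apply: (subsetP (ball_leq _ _ (leq0n 7))).
have YU : Y \subset U by apply/subsetP => x /setU1P[->//|/setDP[]].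
have nS x : x \in Y -> x \in ball M 3 c :|: D -> x \in (M :|: D) :\: S j.
  move=> xY xb; apply/setDP; split; first exact/UMD/(subsetP YU).
  apply/negP; rewrite inE => /andP[xC xj].
  case/setU1P: xY => [E|/setDP[_ /negP]]; first by move: xj; rewrite E cj ltnn.
  apply; rewrite IE xC (ltnW xj); case/setUP: xb => // xD.
  by move/pred0P: dMD => /(_ x); rewrite /= xD (subsetP CM).
have mv' x y : x != c -> y != c -> x \in (M :|: D) :\: S j -> y \in (M :|: D) :\: S j ->
    edge x y -> m x y = false.
  have aux z : z != c -> z \in (M :|: D) :\: S j -> z \in (M :|: D) :\: S j.+1.
    move=> zc /setDP[h1 h2]; apply/setDP; split=> //; apply: contra h2.
    rewrite !inE ltnS leq_eqVlt => /andP[->] /orP[/eqP E|//].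
    by case/eqP: zc; apply/enum_rank_inj/ord_inj; rewrite E cj.
  by move=> xc yc xS yS; apply: mv; exact: aux.
(* On Y, which contains no long hole, only edges at c matter: short cycles of Y through c avoid
   [S j], so there k agrees with m. *)
pose k x y := ((x == c) || (y == c)) && m x y.
have kE x y : x \in (M :|: D) :\: S j -> y \in (M :|: D) :\: S j -> edge x y -> k x y = m x y.
  move=> xS yS e; rewrite /k; case: eqVneq => //= xc; case: eqVneq => //= yc.
  by rewrite mv'.
have n1 x : x \in Y -> edge c x -> x \in (M :|: D) :\: S j.
  move=> xY e; apply: nS => //.
  have := near3 cb0 (UMD _ (subsetP YU _ xY)) e; case/setUP => h; apply/setUP; last by right.
  by left; apply: (subsetP (ball_leq _ _ (isT : 1 <= 3))).
have cS : c \in (M :|: D) :\: S j.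
  by apply: nS; rewrite ?setU11 //; apply/setUP; left; apply: (subsetP (ball_leq _ _ (leq0n 3))).
have k0 x y : x != c -> y != c -> k x y = false by move=> /negbTE h1 /negbTE h2; rewrite /k h1 h2.
have [sm tm fm] := cm.
have ck : coc Y k.
  split.
  - by move=> x y; rewrite /k orbC sm.
  - move=> x y z xY yY zY xy yz zx.
    case: (boolP [|| x == c, y == c | z == c]) => [h|]; last first.
      by rewrite !negb_or => /and3P[xc yc zc]; rewrite !k0.
    suff /and3P[xS yS zS] : [&& x \in (M :|: D) :\: S j, y \in (M :|: D) :\: S j & z \in (M :|: D) :\: S j].
      by rewrite !kE // tm // ?UMD // (subsetP YU).
    case/or3P: h => /eqP E; rewrite E ?cS /=.
    + by rewrite !n1 // -E // edgeC.
    + by rewrite !n1 // -E // edgeC.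
    + by rewrite !n1 // -E // edgeC.
  move=> x y z u v xY yY zY uY vY h.
  case: (boolP [|| x == c, y == c, z == c, u == c | v == c]) => [h'|]; last first.
    by rewrite !negb_or => /and5P[xc yc zc uc vc]; rewrite !k0.
  have aux a1 a2 a3 a4 a5 : a1 == c -> cyc5 a1 a2 a3 a4 a5 -> a2 \in Y -> a3 \in Y -> a4 \in Y -> a5 \in Y ->
     [/\ a1 \in (M :|: D) :\: S j, a2 \in (M :|: D) :\: S j, a3 \in (M :|: D) :\: S j, a4 \in (M :|: D) :\: S j & a5 \in (M :|: D) :\: S j].
    move=> /eqP-> h5 y2 y3 y4 y5; have := near5' cb0 h5; rewrite !UMD ?(subsetP YU) //.
    by case/(_ isT)/and4P => b2 b3 b4 b5; split=> //; exact: nS.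
  have [xS yS zS uS vS] : [/\ x \in (M :|: D) :\: S j, y \in (M :|: D) :\: S j, z \in (M :|: D) :\: S j, u \in (M :|: D) :\: S j & v \in (M :|: D) :\: S j].
    have h2 := cyc5_rot h; have h3 := cyc5_rot h2; have h4 := cyc5_rot h3.
    have h5 := cyc5_rot h4.
    case/orP: h' => [E|/or4P[]E].
    - exact: aux E h _ _ _ _.
    - by have [] := aux _ _ _ _ _ E h2.
    - by have [] := aux _ _ _ _ _ E h3.
    - by have [] := aux _ _ _ _ _ E h4.
    - by have [] := aux _ _ _ _ _ E h5.
  case/andP: (h) => /and5P[xy yz zu uv vx] _.
  by rewrite !kE // fm // ?UMD // (subsetP YU).
(* The components that c sees by edges of label 1. Two edges from c to one component close up to a
   walk in Y, so they carry the same label, and the crossing label cancels m at c. *)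
pose R := [set v in U :\: I | [exists u in U :\: I, [&& edge c u, m c u & conn (U :\: I) u v]]].
have RU : R \subset U :\: I by apply/subsetP => x; rewrite inE => /andP[].
have Rcl : closed_in (U :\: I) R.
  move=> x y; rewrite [x \in R]inE => /andP[xUI /existsP[u /and4P[uUI cu mu ux]]] yUI xy.
  rewrite inE yUI; apply/existsP; exists u; rewrite uUI cu mu /=.
  by apply: connect_trans ux _; exact: conn1.
have Rc u : u \in U :\: I -> edge c u -> (u \in R) = m c u.
  move=> uUI cu; apply/idP/idP => [|mu]; last first.
    by rewrite inE uUI; apply/existsP; exists u; rewrite uUI cu mu; exact: connect0.
  rewrite inE => /andP[_ /existsP[u' /and4P[u'UI cu' mu' /connectP[p pp lp]]]].
  apply: contraT => nmu; have [pp' sp] := er_path u'UI pp.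
  have cUI z : z \in U :\: I -> z != c by apply: contraTneq => ->; rewrite in_setD cI.
  have cp : cycle (@edge G) (c :: u' :: p) by rewrite /= cu' rcons_path pp' -lp edgeC cu.
  have : csum k (c :: u' :: p) = false.
    apply: (unholed_even c4 _ ck) cp _ => [h|x].
      by apply: (NL cC); exact: holedS YU h.
    rewrite 2!in_cons => /or3P[/eqP->|/eqP->|/sp xUI].
    - exact: setU11.
    - exact/setU1r.
    - exact/setU1r.
  rewrite /= psum_rcons -lp {1 3}/k !eqxx orbT /= mu' [m u c]sm (negbTE nmu) addbF.
  suff -> : psum k u' p = false by [].
  elim: p u' u'UI sp {pp pp' lp mu' cu' cp} => //= x p IHp y yUI sp.
  have xUI : x \in U :\: I by apply: sp; rewrite inE eqxx.
  rewrite (k0 _ _ (cUI _ yUI) (cUI _ xUI)) IHp // => z zp; apply: sp.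
  by rewrite inE zp orbT.
have lc : coc (M :|: D) (lam I R).
  apply: (@lam_ball_coc 3 c) => //.
  by apply/subsetP => x; rewrite IE => /and3P[].
have := ev _ _ cC RU Rcl.
suff : zs l f (fun u v => m u v (+) lam I R u v) = false by rewrite zs_add => h1 h2; move: h1; rewrite h2 addbF.
apply: IH; first exact: coc_add.
have lamc u : u \in (M :|: D) :\: S j -> edge c u -> lam I R c u = m c u.
  move=> /setDP[uMD uS] e; rewrite /lam cI /=.
  have uI : u \notin I.
    rewrite IE; apply/negP => /and3P[uC uj _]; case/negP: uS; rewrite inE uC ltn_neqAle uj andbT.
    apply: contraTneq e => E; rewrite (_ : u = c) ?edgexx //.
    by apply/enum_rank_inj/ord_inj; rewrite cj.
  rewrite (negbTE uI) orbF -Rc //; apply/setDP; split=> //.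
  case/setUP: (near3 cb0 uMD e) => h; apply/setUP; [left|by right].
  exact: (subsetP (ball_leq _ _ (isT : 1 <= 7))).
move=> x y xS yS e; case: (eqVneq x c) => xc; first by rewrite xc lamc -?xc // addbb.
case: (eqVneq y c) => yc.
  by rewrite yc sm lam_sym lamc ?addbb // -yc edgeC.
rewrite mv' // /lam.
have nI z : z != c -> z \in (M :|: D) :\: S j -> z \notin I.
  move=> zc /setDP[_]; apply: contra; rewrite IE inE => /and3P[-> zj _].
  rewrite ltn_neqAle zj andbT; apply: contra zc => /eqP E.
  by apply/eqP/enum_rank_inj/ord_inj; rewrite cj.
by rewrite (negbTE (nI _ xc xS)) (negbTE (nI _ yc yS)).
Qed.

(** If R contains the clique D, pass to its complement in [Uball c] minus I: the two crossing labels
    differ by the coboundary of I, which is even on the hole. Then split R into components; one of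
    them is odd. *)
Lemma detect_comp : exists c x, let R := reach (ball M 7 c :\: Iset c) x in
  [/\ c \in C, zs l f (lam (Iset c) R) & forall d y, d \in D -> y \in R -> ~~ edge d y].
Proof.
have [c [R0 [cC RU cl o]]] := detect; exists c.
have fZ i : f i \in M :|: D by apply: (subsetP fMD); exact: in_img.
set I := Iset c in RU cl o *; set U := Uball c in RU cl *.
have Ib x : x \in I -> x \in ball M 3 c by rewrite inE => /and3P[].
have DI d : d \in D -> d \in U :\: I.
  move=> dD; apply/setDP; split; first by apply/setUP; right.
  apply/negP => /Ib /(subsetP (ball_sub _ _ _)) dM.
  by move/pred0P: dMD => /(_ d); rewrite /= dM dD.
pose ok R := [&& R \subset U :\: I, [forall x in R, forall y in U :\: I, edge x y ==> (y \in R)],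
  zs l f (lam I R) & [disjoint R & D]].
have okP R : R \subset U :\: I -> closed_in (U :\: I) R -> zs l f (lam I R) ->
    (forall d, d \in D -> d \notin R) -> ok R.
  move=> h1 h2 h3 h4; apply/and4P; split=> //.
    apply/forallP => x; apply/implyP => xR; apply/forallP => y; apply/implyP => yU.
    by apply/implyP; exact: h2.
  by rewrite disjoint_sym; apply/pred0P => d /=; apply/negP => /andP[/h4/negP].
have {o RU cl} [R okR] : exists R, ok R.
  case: (boolP [exists d in D, d \in R0]) => [/existsP[d /andP[dD dR]]|]; last first.
    move=> h; exists R0; apply: okP => // d dD; apply: contra h => dR.
    by apply/existsP; exists d; rewrite dD.
  exists ((U :\: I) :\: R0); apply: okP.
  - exact: subsetDl.
  - move=> x y /setDP[xU xR] yU xy; apply/setDP; split=> //; apply: contra xR => yR.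
    by apply: cl yR xU _; rewrite edgeC.
  (* Every hole edge from I ends in U, so the sum of the two labels is the coboundary of I along the
     hole. *)
  - have : zs l f (fun u v => lam I R0 u v (+) lam I ((U :\: I) :\: R0) u v) = false.
      rewrite -(zs_cob (fun x => x \in I) fh); apply: zs_eq => i.
      have e := hol_edgeS i fh; move: (fZ i) (fZ i.+1); move: (f i) (f i.+1) e => x y e xM yM.
      have inU x' y' : x' \in I -> y' \in M :|: D -> edge x' y' -> y' \in U.
        move=> /Ib xb yMD e'; case/setUP: (near3 xb yMD e') => h; apply/setUP; [left|by right].
        exact: (subsetP (ball_leq _ _ (isT : 4 <= 7))).
      have RI z : z \in R0 -> (z \in U) && (z \notin I) by move/(subsetP RU)/setDP => [-> ->].
      rewrite /lam !in_setD; move: (RI x) (RI y) (inU x y) (inU y x); rewrite [edge y x]edgeC e xM yM.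
      case: (x \in I); case: (y \in I); case: (x \in R0); case: (y \in R0) => //= h1 h2 h3 h4;
        rewrite ?h3 ?h4 //; by [have := h1 isT; rewrite andbF|have := h2 isT; rewrite andbF].
    by rewrite zs_add o => /negbFE.
  - move=> d' d'D; apply/negP => /setDP[_ /negP]; apply.
    case: (eqVneq d d') => [<-//|n].
    exact: cl dR (DI _ d'D) (Dcl dD d'D n).
have [n] := ubnP #|R|; elim: n R okR => // n IH R /and4P[RU /forallP clR oR dR] cR.
have cl : closed_in (U :\: I) R.
  move=> x y xR yU xy; have := clR x; rewrite xR => /forallP/(_ y).
  by rewrite yU xy.
have ntR : R != set0.
  apply: contraTneq oR => ->; rewrite (@zs_eq _ _ _ _ (fun _ _ => false)) => [|i].
    by rewrite /zs big1.
  by rewrite /lam !in_set0 !andbF.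
case/set0Pn: ntR => x xR.
have Rb y : y \in R -> y \in ball M 7 c :\: I.
  move=> yR; case/setDP: (subsetP RU _ yR) => /setUP[h|yD] yI; first exact/setDP.
  by move/pred0P: dR => /(_ y); rewrite /= yR yD.
have bU y : y \in ball M 7 c :\: I -> y \in U :\: I.
  by case/setDP => h1 h2; apply/setDP; split=> //; apply/setUP; left.
pose Rx := reach (ball M 7 c :\: I) x.
have RxR : Rx \subset R.
  apply/subsetP => y; rewrite reachP => /andP[_ /connectP[p pp ->]].
  elim: p x xR pp {Rx} => //= z p IHp w wR /andP[/and3P[_ zb e]].
  by apply: IHp; apply: cl wR _ e; exact: bU.
have Rxcl : closed_in (U :\: I) Rx.
  move=> y z yR zU yz; apply: (reach_closed yR _ yz); apply: Rb.
  by apply: cl (subsetP RxR _ yR) zU yz.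
case: (boolP (zs l f (lam I Rx))) => ox.
  exists x; split=> // d y dD yR; apply/negP => e.
  have dR' : d \in R by apply: cl (subsetP RxR _ yR) (DI _ dD) _; rewrite edgeC.
  by move/pred0P: dR => /(_ d); rewrite /= dR' dD.
apply: (IH (R :\: Rx)); last first.
  rewrite ltnS in cR; apply: leq_trans cR; apply: proper_card; apply/properP; split; first exact: subsetDl.
  exists x => //; suff xx : x \in Rx by rewrite in_setD xx.
  by rewrite reachP Rb //=; exact: connect0.
apply: okP.
- by apply: subset_trans RU; exact: subsetDl.
- move=> y z /setDP[yR yx] zU yz; apply/setDP; split; first exact: cl yR zU yz.
  apply: contra yx => zx; apply: (Rxcl _ _ zx); [exact: (subsetP RU)|by rewrite edgeC].
- have : zs l f (fun u v => lam I Rx u v (+) lam I (R :\: Rx) u v) = zs l f (lam I R).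
    apply: zs_eq => i; move: (f i) (f i.+1) => u v; rewrite /lam !in_setD.
    have := subsetP RxR u; have := subsetP RxR v.
    have RI z : z \in R -> z \notin I by move/(subsetP RU)/setDP => [].
    move: (RI u) (RI v).
    by case: (u \in Rx); case: (v \in Rx); case: (u \in R); case: (v \in R);
      case: (u \in I); case: (v \in I) => //= h1 h2 h3 h4;
      (have h := h1 isT) || (have h := h2 isT) || (have h := h3 isT) || (have h := h4 isT) || done.
  by rewrite zs_add (negbTE ox) oR.
- move=> d dD; apply/negP => /setDP[dR' _].
  by move/pred0P: dR => /(_ d); rewrite /= dR' dD.
Qed.
End Detect.

(** * Shortest long holes *)

Section Cycles.
Variables (G : sgraph).
Hypothesis c4 : C4_free G.
Implicit Types (S C : {set G}) (h : nat -> G) (x y c : G).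

(** A cocycle that is not a coboundary is odd on some closed walk, which contains a long hole among
    its vertices. *)
Lemma coc_potential S m : ~ holed S -> coc S m ->
  exists g : G -> bool, forall x y, x \in S -> y \in S -> edge x y -> m x y = g x (+) g y.
Proof.
move=> nS cm; have ms : forall x y, m x y = m y x by case: cm.
have [||p cp|g gE] := @potential G (er S) m; first exact: er_sym; first exact: ms.
  case: p cp => [|x p] // cp.
  have xS : x \in S by move: cp; rewrite /= rcons_path => /andP[_ /and3P[]].
  have [cp' sp] := er_path xS cp.
  by apply: (unholed_even c4 nS cm) => // y yp; apply: sp; rewrite mem_rcons.
by exists g => x y xS yS xy; apply: gE; rewrite /= xS yS.
Qed.

Lemma hol_nbr m h i y : hol m h -> y \in img m h -> edge (h i) y ->
  y = h i.+1 \/ y = h (i + m.-1).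
Proof.
move=> hh yC; have [m4 e ed] := hh; have [j jm ->] := in_imgP hh yC.
rewrite ed => /orP[/eqP E|/eqP E]; [left|right]; apply/eqP; rewrite e; first exact/eqP.
rewrite -(eqn_modDr 1) !addn1 -addnS prednK; last by apply: leq_trans m4.
by rewrite modnDr -E.
Qed.

(** Multiplication by m - 1 is negation modulo m. *)
Lemma hol_rev m h : hol m h -> hol m (fun i => h (i * m.-1)).
Proof.
move=> hh; have [m4 e ed] := hh.
have mE i : i * m.-1 + i = i * m by rewrite -mulnSr prednK //; apply: leq_trans m4.
have aux a b i j : (a + i * m.-1 == b + j * m.-1 %[mod m]) = (a + j == b + i %[mod m]).
  rewrite -(eqn_modDr (i + j)).
  have -> : a + i * m.-1 + (i + j) = (a + j) + i * m by rewrite -mE; clear; lia.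
  have -> : b + j * m.-1 + (i + j) = (b + i) + j * m by rewrite -mE; clear; lia.
  by rewrite [_ + i * m]addnC [_ + j * m]addnC !modnMDl.
split=> // i j.
  by rewrite e; have := aux 0 0 i j; rewrite !add0n => ->; rewrite eq_sym.
rewrite ed -[i * _]add0n -[j * _]add0n -!addSn !aux !add0n !add1n.
by rewrite orbC eq_sym [X in _ || X]eq_sym.
Qed.

Lemma img_rev m h : hol m h -> img m (fun i => h (i * m.-1)) = img m h.
Proof.
move=> hh; have h' := hol_rev hh; apply/eqP; rewrite eqEcard (card_img hh) (card_img h') leqnn andbT.
by apply/subsetP => x /(in_imgP h')[i _ ->]; exact: in_img.
Qed.

Lemma ball_run m h C i n : hol m h -> (forall j, i <= j <= i + n -> h j \in C) ->
  h (i + n) \in ball C n (h i).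
Proof.
move=> hh; elim: n => [|n IH] s; first by rewrite addn0 ball0 // s // leqnn leq_addr.
apply: (@ballS _ _ _ _ (h (i + n))); last by rewrite addnS; exact: (hol_edgeS _ hh).
  by apply: IH => j /andP[h1 h2]; apply: s; rewrite h1 addnS leqW.
by apply: s; rewrite leq_addr leqnn.
Qed.

(** The index [q + r * m.-1] is q - r modulo m. *)
Lemma ball_window m h r q x : hol m h -> x \in ball (img m h) r (h q) ->
  exists2 i, i < (r.*2).+1 & x = h (q + r * m.-1 + i).
Proof.
move=> hh; have m0 : 0 < m by case: hh => m4 _ _; apply: leq_trans m4.
have per := hol_per _ hh.
elim: r x => [|r IH] x.
  by rewrite ballE0 !inE => /andP[/eqP-> _]; exists 0; rewrite // !addn0.
rewrite ballE inE => /orP[/IH[i ir ->]|].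
  exists i.+1; first by move: ir; clear; lia.
  rewrite -per; congr h; rewrite mulSn; move: m0; clear; lia.
rewrite inE => /andP[xC /existsP[y /andP[/IH[i ir ->]]]] /(hol_nbr hh xC)[]->.
  exists i.+2; first by move: ir; clear; lia.
  rewrite -per; congr h; rewrite mulSn; move: m0; clear; lia.
exists i; first by move: ir; clear; lia.
by congr h; rewrite mulSn; clear; lia.
Qed.

Lemma card_ball m h r c : hol m h -> c \in img m h -> #|ball (img m h) r c| <= (r.*2).+1.
Proof.
move=> hh /(in_imgP hh)[q _ ->].
rewrite -[X in _ <= X]card_ord; pose w (i : 'I_(r.*2).+1) := h (q + r * m.-1 + i).
apply: leq_trans (leq_imset_card w _); apply/subset_leq_card/subsetP => x.
move=> /(ball_window hh)[i ir ->]; apply/imsetP; by exists (Ordinal ir).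
Qed.

Lemma arc_param m f (M : {set G}) c y : hol m f -> c \in img m f :&: M ->
  conn (img m f :&: M) c y ->
  exists h t, [/\ hol m h, img m h = img m f, h 0 = c, h t = y &
    t < m /\ forall i, i <= t -> h i \in M].
Proof.
move=> hf cCM; set CM := _ :&: M.
have m0 : 0 < m by case: hf => m4 _ _; apply: leq_trans m4.
have m2 : 1 < m by case: hf => m4 _ _; apply: leq_trans m4.
have shift0 : exists2 h, hol m h & img m h = img m f /\ h 0 = c.
  case/setIP: cCM => /(in_imgP hf)[q _ ->] _.
  exists (fun i => f (i + q)); first exact: hol_shift.
  by rewrite add0n (img_shift q hf).
case/connectP => p; elim/last_ind: p y => [|p z IH] y /=.
  move=> _ ->; have [h hh [hi h0]] := shift0; exists h, 0; split=> //; split=> // i.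
  by rewrite leqn0 => /eqP->; rewrite h0; case/setIP: cCM.
rewrite rcons_path last_rcons => /andP[pp /and3P[_ zCM e]] ->.
have [h [t [hh hi h0 ht [tm hM]]]] := IH _ pp erefl.
have /setIP[zC zM] := zCM; rewrite -hi in zC; rewrite -ht in e.
case: (hol_nbr hh zC e) => zE.
  case: (eqVneq t.+1 m) => tE.
    exists h, 0; split=> //; last by split=> // i; rewrite leqn0 => /eqP->; exact: hM.
    by rewrite zE tE -[m]add0n hol_per.
  exists h, t.+1; split=> //; split; first by move: tm tE; clear; lia.
  by move=> i; rewrite leq_eqVlt => /predU1P[->|/hM//]; rewrite -zE.
case: (posnP t) => t0; last first.
  exists h, t.-1; split=> //.
    by rewrite zE -(hol_per _ hh); congr h; move: t0 m0; clear; lia.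
  by split=> [|i it]; [move: tm; clear; lia|apply: hM; move: it; clear; lia].
rewrite t0 add0n in zE.
exists (fun i => h (i * m.-1)), 1; split; [exact: hol_rev|by rewrite img_rev|by []|by rewrite mul1n|].
split=> // -[|[|//]] _; last by rewrite mul1n -zE.
by rewrite mul0n h0; case/setIP: cCM.
Qed.
End Cycles.

Section Shortest.
Variable G : sgraph.
Hypothesis c4 : C4_free G.
Implicit Types (S Y : {set G}) (h k : nat -> G) (x y z c d u v w : G).
Variables (V : {set G}) (m : nat) (f : nat -> G).
Hypothesis fh : hol m f.
Let C := img m f.
Hypothesis CV : C \subset V.
Hypothesis Cmin : forall l h, 6 <= l -> hol l h -> img l h \subset V -> m <= l.

Definition spread (V C : {set G}) := [set v in V :\: C |
  [forall c in C, ~~ ([set x in C | edge v x] \subset ball C 1 c)]].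
Let D := spread V C.

Lemma min_unholed Y : Y \subset V -> #|Y| < m -> ~ holed Y.
Proof.
move=> YV cY [l [h [l6 hh hY]]].
have := Cmin l6 hh (subset_trans hY YV).
by have := subset_leq_card hY; rewrite (card_img hh); move: cY; clear; lia.
Qed.

Lemma hol_neq h i j : hol m h -> i < j < i + m -> h i != h j.
Proof.
case=> m4 e _ hij; rewrite e; have -> : j = i + (j - i) by move: hij; clear; lia.
rewrite -{1}[i]addn0 eqn_modDl mod0n modn_small; move: hij; clear; lia.
Qed.

Lemma hol_nedge h i j : hol m h -> i.+1 < j -> j.+1 < i + m -> ~~ edge (h i) (h j).
Proof.
move=> hh ij jm; have [_ e ed] := hh; rewrite ed negb_or -!e.
rewrite eq_sym (hol_neq hh) ?(hol_neq hh) //; move: ij jm; clear; lia.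
Qed.

(** Suppose that three consecutive vertices are missed. Walking away from them on both sides, d has
    a first and a last neighbour on C, at least three steps apart since d is in D. The shortcut
    through d bypasses at least two vertices of C, and [p5crit] around the missed vertices gives a
    long hole that is too short. *)
Lemma spread_hits h q d : 6 <= m -> hol m h -> img m h = C -> d \in D ->
  exists2 i, i < 3 & edge d (h (q + i)).
Proof.
move=> m6 hh hC; rewrite inE => /andP[/setDP[dV dC] /forallP dD].
pose k i := h (i + q.+1); have kh : hol m k by exact: hol_shift.
have m0 : 0 < m by apply: leq_trans m6.
have kC : img m k = C by rewrite img_shift.
have kin i : k i \in C by rewrite -kC in_img.
case: (boolP [exists i : 'I_3, edge d (h (q + i))]) => [/existsP[i e]|nh]; first by exists i.
have {}nh i : i < 3 -> edge d (h (q + i)) = false.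
  by move=> i3; apply: contraNF nh => e; apply/existsP; exists (Ordinal i3).
have n1 : edge d (k m.-1) = false.
  rewrite /k; have -> : m.-1 + q.+1 = q + 0 + m by move: m0; clear; lia.
  by rewrite hol_per // nh.
have n2 : edge d (k 0) = false by rewrite /k add0n -addn1 nh.
have n3 : edge d (k 1) = false by rewrite /k add1n -addn2 nh.
have exb : exists i, [&& 2 <= i, i < m & edge d (k i)].
  have := dD (k 0); rewrite kin /= => /subsetPn[x]; rewrite inE => /andP[xC dx] _.
  rewrite -kC in xC; have [i im xE] := in_imgP kh xC; rewrite xE in dx.
  exists i; rewrite im dx andbT; case: i dx {im xE} => [|[|//]]; by rewrite ?n2 ?n3.
case: (ex_minnP exb) => b /and3P[b2 bm db] bmin.
have exa : exists j, [&& j < m, 2 <= m - j & edge d (k (m - j))].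
  by exists (m - b); rewrite subKn ?(ltnW bm) // b2 db andbT; move: b2 bm; clear; lia.
case: (ex_minnP exa) => j /and3P[jm j2 da] jmin; pose a := m - j.
have rng i : i < m -> edge d (k i) -> b <= i <= a.
  move=> im di; have i2 : 2 <= i by case: i im di => [|[|//]] _; rewrite ?n2 ?n3.
  rewrite bmin ?i2 ?im //=; have := jmin (m - i); rewrite subKn ?(ltnW im) // i2 di andbT.
  by rewrite /a; move: im i2; clear; lia.
have am : a < m.-1.
  have : a != m.-1 by apply: contraTneq da; rewrite -/a => ->; rewrite n1.
  have j0 : 0 < j.
    by rewrite lt0n; apply: contraTneq da => ->; rewrite subn0 -[m]add0n hol_per // n2.
  by rewrite /a; move: j2 m0 jm j0; clear; lia.
have ab : b + 3 <= a.
  rewrite leqNgt; apply/negP => ab; have := dD (k b.+1); rewrite kin /= => /negP; apply.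
  apply/subsetP => x; rewrite inE => /andP[xC dx]; rewrite -kC in xC.
  have [i im xE] := in_imgP kh xC; rewrite xE in dx; have bi := rng _ im dx.
  rewrite xE; have b0 : k b.+1 \in ball C 0 (k b.+1) by exact: ball0.
  have : [|| i == b, i == b.+1 | i == b.+2] by move: bi ab; clear; lia.
  case/or3P => /eqP->.
  - by apply: ballS b0 (kin _) _; rewrite edgeC; exact: (hol_edgeS _ kh).
  - exact: (subsetP (ball_leq _ _ (leq0n 1))).
  - by apply: ballS b0 (kin _) _; exact: (hol_edgeS _ kh).
(* It has m - 1 vertices, one fewer than a shortest long hole. *)
pose Y := (d |: C) :\: [set k b.+1; k b.+2].
have YV : Y \subset V.
  by apply/subsetP => x /setDP[/setU1P[->//|/(subsetP CV)]].
exfalso; apply: (min_unholed YV).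
  have : #|(d |: C) :&: [set k b.+1; k b.+2]| = 2.
    rewrite (setIidPr _) ?cards2 ?(hol_neq kh) //; first by rewrite leqnn; move: bm b2; clear; lia.
    by apply/subsetP => x /set2P[]->; apply/setU1P; right.
  have := cardsD (d |: C) [set k b.+1; k b.+2]; rewrite cardsU1 dC card_img // -/Y => -> ->.
  by move: m6; clear; lia.
have neq i1 i2 : i1 < i2 < i1 + m -> k i1 != k i2 by exact: hol_neq.
have kY i : i <= b \/ b.+3 <= i <= m.-1 -> k i \in Y.
  move=> hi; apply/setDP; split; first by apply/setU1P; right.
  rewrite !inE negb_or; case: hi => hi.
    by rewrite !neq //; move: hi bm ab am; clear; lia.
  by rewrite ![k i == _]eq_sym !neq //; move: hi m0; clear; lia.
have dY : d \in Y.
  apply/setDP; split; first exact: setU11.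
  by rewrite !inE; apply/negP => /orP[]/eqP E; move: dC; rewrite E kin.
have nY i y : (i < 2) || (i == m.-1) -> y \in Y -> edge (k i) y -> y \in [:: k (i + m.-1); k i.+1].
  move=> hi /setDP[/setU1P[->|yC] _] e.
    rewrite edgeC in e; have := e; case/orP: hi => [|/eqP iE]; last by rewrite iE n1.
    by case: i e => [|[|//]]; rewrite ?n2 ?n3.
  by rewrite !inE -kC in yC *; case: (hol_nbr kh yC e) => ->; rewrite eqxx ?orbT.
have eS i : edge (k i) (k i.+1) := hol_edgeS i kh.
have km i : k (i + m) = k i by exact: hol_per.
have k0E : k 0 = k m.-1.+1 by rewrite prednK // -[m]add0n km.
have k1E : k m.-2 = k (m.-1 + m.-1).
  by rewrite -km; congr k; move: m6; clear; lia.
have m12 : m.-2.+1 = m.-1 by move: m6; clear; lia.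
apply: (@p5crit _ c4 Y (k m.-2) (k m.-1) (k 0) (k 1) (k 2)).
- rewrite /= !inE !negb_or ![k m.-2 == _]eq_sym ![k m.-1 == _]eq_sym.
  rewrite !neq //; move: m6 m12; clear; lia.
- by rewrite !kY //; move: ab am m12 b2; clear; lia.
- by rewrite -m12; exact: eS.
- by rewrite k0E; exact: eS.
- exact: eS.
- exact: eS.
- rewrite edgeC; apply: (hol_nedge kh); move: m6 m12; clear; lia.
- by move=> y yY e; rewrite k1E k0E; apply: nY; rewrite ?eqxx ?orbT.
- by move=> y yY e; have := nY 0 y isT yY e; rewrite add0n.
- by move=> y yY e; have := nY 1 y isT yY e; rewrite add1n prednK // -[m]add0n km.
set Y' := Y :\: _.
have kY' i : 2 <= i <= b \/ a <= i <= m.-2 -> k i \in Y'.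
  move=> hi; apply/setDP; split; first by apply: kY; move: hi ab am; clear; lia.
  rewrite !inE !negb_or [k i == k 0]eq_sym [k i == k 1]eq_sym !neq //; move: hi ab am b2; clear; lia.
have dY' : d \in Y'.
  apply/setDP; split=> //; rewrite !inE; apply/negP => /orP[/orP[]|]/eqP E;
   by move: dC; rewrite E kin.
have bE : 2 + (b - 2) = b by rewrite subnKC.
have aE : a + (m.-2 - a) = m.-2 by rewrite subnKC //; move: am; clear; lia.
apply: (@connect_trans _ _ (k b)).
  by rewrite -[in X in connect _ _ X]bE; apply: (hol_run kh) => i; rewrite bE => hi; apply: kY'; left.
apply: (@connect_trans _ _ d).
  by apply: conn1 => //; [apply: kY'; left; rewrite b2 leqnn|rewrite edgeC].
apply: (@connect_trans _ _ (k a)).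
  by apply: conn1 => //; apply: kY'; right; rewrite leqnn -aE leq_addr.
by rewrite -[in X in connect _ _ X]aE; apply: (hol_run kh) => i; rewrite aE => hi; apply: kY'; right.
Qed.

(** Two nonadjacent u, v in D each have a neighbour in two disjoint triples of a short window of C.
    The closed walk from u through the first triple, v and the second triple is odd for the label of
    the edges between u and the first triple, although the set Y has fewer than m vertices. *)
Lemma spread_clique : 11 <= m -> clique D.
Proof.
move=> m11 u v uD vD uv; apply: contraT => nuv; exfalso.
have /andP[/setDP[uV uC] _] : (u \in V :\: C) && true by move: uD; rewrite inE => /andP[->].
have /andP[/setDP[vV vC] _] : (v \in V :\: C) && true by move: vD; rewrite inE => /andP[->].
(* Two common neighbours of u and v are adjacent, as G is C4-free; so if there is one on C, a window
   that starts two steps after it contains none. Then no short cycle through u meets v. *)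
have [k kh [kC kn]] : exists2 k, hol m k & img m k = C /\
    forall i, i < 7 -> edge u (k i) -> edge v (k i) = false.
  case: (boolP [exists w in C, edge u w && edge v w]) => [/existsP[w /and3P[wC uw vw]]|nw].
    have [p _ wE] := in_imgP fh wC.
    exists (fun i => f (i + p.+2)); first exact: hol_shift.
    split; first exact: img_shift.
    move=> i i7 ui; apply/negP => vi; rewrite edgeC in vw; rewrite edgeC in ui.
    have n1 : w != f (i + p.+2).
      by rewrite wE (hol_neq fh) //; move: m11 i7; clear; lia.
    have := C4P c4 uw vw vi ui uv n1; rewrite (negbTE nuv) /= wE; apply/negP.
    apply: (hol_nedge fh); move: m11 i7; clear; lia.
  exists f => //; split=> // i _ ui; apply/negP => vi; case/negP: nw; apply/existsP.
  by exists (f i); rewrite in_img // ui vi.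
have m6 : 6 <= m by apply: leq_trans m11.
have kin i : k i \in C by rewrite -kC in_img.
pose Y := [set u; v] :|: [set k (i : 'I_7) | i in 'I_7 & i != 3 :> nat].
pose R := [set k (i : 'I_3) | i in 'I_3].
pose U := Y :\ v.
have kneC i : (k i != u) && (k i != v).
  by apply/andP; split; apply: contraTneq (kin i) => ->.
have kY i : i < 7 -> i != 3 -> k i \in Y.
  move=> i7 i3; apply/setUP; right; apply/imsetP; exists (Ordinal i7) => //; by rewrite inE.
have uY : u \in Y by rewrite !inE eqxx.
have vY : v \in Y by rewrite !inE eqxx orbT.
have Yc x : x \in Y -> x != u -> x != v -> exists2 i, (i < 7) && (i != 3) & x = k i.
  move=> /setUP[/set2P[]->|/imsetP[i hi ->]]; rewrite ?eqxx // => _ _.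
  by exists i => //; rewrite ltn_ord; move: hi; rewrite inE => /andP[_ ->].
have YV : Y \subset V.
  apply/subsetP => x xY; case: (eqVneq x u) => [->//|xu]; case: (eqVneq x v) => [->//|xv].
  by have [i _ ->] := Yc _ xY xu xv; exact: (subsetP CV).
have kR i : i < 3 -> k i \in R by move=> i3; apply/imsetP; exists (Ordinal i3).
have nR i : 3 <= i < 7 -> k i \notin R.
  move=> hi; apply/imsetP => -[[j j3] _ /= /eqP]; apply/negP; rewrite eq_sym (hol_neq kh) //.
  by move: hi j3 m11; clear; lia.
have nY : ~ holed Y.
  apply: min_unholed => //; apply: leq_trans (_ : 10 <= m); last by apply: leq_trans m11.
  rewrite ltnS -[9]/(2 + 7).
  apply: leq_trans (leq_card_setU _ _) _; rewrite leq_add //.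
    by rewrite cards2; case: (u != v).
  by apply: leq_trans (leq_imset_card _ _) _; rewrite -[7 in X in _ <= X]card_ord; exact: max_card.
have nE w i : w \in [set u; v] -> k i != w by case/set2P => ->; case/andP: (kneC i).
have cl : coc Y (lam [set u] R).
  apply: (@coc_lam _ Y U).
  - by apply/subsetP => x /set1P->; rewrite in_setD1 uv.
  - apply/subsetP => x /imsetP[[i i3] _ ->] /=; rewrite !inE.
    have /andP[-> ->] := kneC i; rewrite /=; apply/orP; right.
    apply/imsetP; have i7 : i < 7 by move: i3; clear; lia.
    by exists (Ordinal i7) => //; rewrite inE /=; move: i3; clear; lia.
  - move=> x y /imsetP[[i i3] _ ->] /= /setDP[/setD1P[yv yY]] /set1P/eqP yu e.
    have [j /andP[j7 j3] yE] := Yc _ yY yu yv; rewrite yE in e *.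
    apply: kR; case: (ltnP j 3) => // j3'.
    suff : ~~ edge (k i) (k j) by rewrite e.
    by apply: (hol_nedge kh); move: j3 j3' j7 i3 m11; clear; lia.
  split=> [x y z /set1P-> yY zY uy yz zu|a b c d e /set1P-> bY cY dY eY h5].
    rewrite !in_setD1 yY zY !andbT; apply/andP; split.
      by apply: contraNneq nuv => <-.
    by apply: contraNneq nuv => <-; rewrite edgeC.
  case/andP: (h5) => /and5P[ub bc cd de eu] /and5P[uc ud bd be ce].
  have bv : b != v by apply: contraNneq nuv => <-.
  have ev : e != v by apply: contraNneq nuv => <-; rewrite edgeC.
  have comm x : x \in Y -> x != u -> x != v -> edge u x -> edge x v -> False.
    move=> xY xu xv; have [i /andP[i7 _] ->] := Yc _ xY xu xv.
    by move=> /(kn _ i7); rewrite edgeC => ->.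
  rewrite !in_setD1 bY cY dY eY !andbT bv ev /= andbT; apply/andP; split.
    apply/eqP => E; rewrite E in bc; apply: (comm b) => //.
    by rewrite eq_sym edge_neq.
  apply/eqP => E; rewrite E in de; apply: (comm e) => //; first exact: edge_neq.
    by rewrite edgeC.
  by rewrite edgeC.
have [g gE] := coc_potential c4 nY cl.
have lk i j : lam [set u] R (k i) (k j) = false.
  by rewrite /lam !inE; have /andP[/negbTE-> _] := kneC i; have /andP[/negbTE-> _] := kneC j.
have run s i : (s == 0) || (s == 4) -> i < 3 -> g (k (s + i)) = g (k s).
  move=> hs; elim: i => [|i IH] i3; first by rewrite addn0.
  rewrite -IH ?(ltnW i3) //; have := gE (k (s + i)) (k (s + i.+1)).
  rewrite lk !kY; [|by move: hs i3; clear; lia..].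
  by rewrite addnS; move=> /(_ isT isT (hol_edgeS _ kh)); case: (g _); case: (g _).
have lu x : lam [set u] R u x = (x \in R).
  rewrite /lam set11 /=; case: (boolP (u \in R)) => [|_]; last by rewrite andbF orbF.
  by case/imsetP => i _ E; move: uC; rewrite E kin.
have lv x : lam [set u] R v x = false.
  rewrite /lam inE eq_sym (negbTE uv) /=; apply/negbTE/negP => /andP[_] /imsetP[i _ E].
  by move: vC; rewrite E kin.
have hit w (s : nat) : w \in D -> w \in Y -> (s == 0) || (s == 4) ->
    exists b, [/\ lam [set u] R w (k b) = g w (+) g (k s), s <= b & b < s + 3].
  move=> wD wY hs; have [i i3 e] := spread_hits s m6 kh kC wD.
  exists (s + i); split; [|exact: leq_addr|by rewrite ltn_add2l].
  rewrite -(run s i) //; apply: gE => //; apply: kY; move: hs i3; clear; lia.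
have [b1 [E1 b10 b13]] := hit u 0 uD uY isT.
have [b2 [E2 b20 b23]] := hit u 4 uD uY isT.
have [b3 [E3 _ _]] := hit v 0 vD vY isT.
have [b4 [E4 _ _]] := hit v 4 vD vY isT.
move: E1 E2 E3 E4; rewrite !lu !lv kR // (negbTE (nR _ _)) ?b23 ?(ltnW b20) //.
by case: (g u); case: (g v); case: (g (k 0)); case: (g (k 4)).
Qed.

Lemma touch_window (h : nat -> G) x : hol m h -> img m h = C -> x \in V :\: D ->
  exists q, forall r, (x == h r) || edge x (h r) -> exists2 i, i < 3 & h r = h (q + i).
Proof.
move=> hh hC /setDP[xV xD]; have m0 : 0 < m by case: hh => m4 _ _; apply: leq_trans m4.
have hin i : h i \in C by rewrite -hC in_img.
case: (boolP (x \in C)) => xC.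
  rewrite -hC in xC; have [s _ ->] := in_imgP hh xC; exists (s + m.-1) => r.
  case/orP => [/eqP<-|e].
    by exists 1; rewrite // -(hol_per _ hh); congr h; move: m0; clear; lia.
  have : h r \in img m h by rewrite hC.
  move=> hr; case: (hol_nbr hh hr e) => ->; last by exists 0; rewrite // addn0.
  by exists 2; rewrite // -(hol_per _ hh); congr h; move: m0; clear; lia.
have : x \in V :\: C by apply/setDP.
move=> xVC; move: xD; rewrite inE xVC /= negb_forall => /existsP[c].
rewrite negb_imply negbK => /andP[cC /subsetP sc].
rewrite -hC in cC; have [s _ cE] := in_imgP hh cC.
exists (s + 1 * m.-1) => r /orP[/eqP E|e]; first by move: xC; rewrite E hin.
have : h r \in ball C 1 c by apply: sc; rewrite inE hin.
by rewrite -hC cE => /(ball_window hh)[i i3 ->]; exists i.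
Qed.

(** Cut an arc into r + 2 blocks of five. A vertex outside D touches C within three consecutive
    vertices, hence touches the middle triple of at most one block, and the path has at most r + 1
    vertices. An untouched block feeds [p5crit] in the union of path and arc, which is too small if
    the other arc is long as well. *)
Lemma spread_near r c c' : 6 <= m -> c \in C -> c' \in C ->
  c' \in ball (V :\: D) r c -> c' \in ball C (5 * r.+2) c.
Proof.
move=> m6 cC c'C /ballP[p [cV pp lp sp]].
have m0 : 0 < m by apply: leq_trans m6.
have [q _ cE] := in_imgP fh cC.
pose k i := f (i + q); have kh : hol m k by exact: hol_shift.
have kC : img m k = C by rewrite img_shift.
have kin i : k i \in C by rewrite -kC in_img.
have k0 : k 0 = c by rewrite cE /k add0n.
have [t tm c'E] : exists2 t, t < m & c' = k t.
  by rewrite -kC in c'C; have [t tm ->] := in_imgP kh c'C; exists t.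
case: (leqP t (5 * r.+2)) => t5.
  apply: (subsetP (ball_leq _ _ t5)); rewrite c'E -k0 -[t]add0n.
  exact: (ball_run kh).
case: (leqP (m - t) (5 * r.+2)) => t6.
  apply: (subsetP (ball_leq _ _ t6)); rewrite ballC c'E -k0 -[k 0](hol_per _ kh).
  rewrite add0n -[X in k X](subnKC (ltnW tm)).
  exact: (ball_run kh).
exfalso; pose Y := [set x in p] :|: [set k (i : 'I_t.+1) | i in 'I_t.+1].
have Vp x : x \in c :: p -> x \in V :\: D.
  rewrite inE => /predU1P[->//|xp]; exact: (er_path cV pp).2.
have kY i : i <= t -> k i \in Y.
  by move=> it; apply/setUP; right; apply/imsetP; exists (Ordinal (it : i < t.+1)).
have YV : Y \subset V.
  apply/subsetP => x /setUP[|/imsetP[i _ ->]]; last exact: (subsetP CV).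
  rewrite inE => xp; have xp' : x \in c :: p by rewrite inE xp orbT.
  by have /setDP[] := Vp _ xp'.
have nY : ~ holed Y.
  apply: min_unholed => //; apply: leq_ltn_trans (leq_card_setU _ _) _.
  have h1 : #|[set x in p]| <= size p by rewrite cardsE card_size.
  have h2 : #|[set k (i : 'I_t.+1) | i in 'I_t.+1]| <= t.+1.
    by apply: leq_trans (leq_imset_card _ _) _; rewrite card_ord.
  by move: h1 h2 sp t5 t6; clear; lia.
pose touch x j := [exists i : 'I_3, (x == k (5 * j + i.+1)) || edge x (k (5 * j + i.+1))].
have [j jr nt] : exists2 j, j < r.+2 & forall x, x \in c :: p -> ~~ touch x j.
  case: (boolP [exists j : 'I_r.+2, all (fun x => ~~ touch x j) (c :: p)]) => [/existsP[j /allP h]|].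
    by exists j.
  rewrite negb_exists => /forallP h.
  have ex (j : 'I_r.+2) : exists x, (x \in c :: p) && touch x j.
    by have := h j; rewrite -has_predC => /hasP[x xp /= /negPn]; exists x; rewrite xp.
  pose F j := xchoose (ex j).
  have FP j : F j \in c :: p /\ touch (F j) j by case/andP: (xchooseP (ex j)).
  have Finj : injective F.
    move=> j1 j2 E; have [p1 t1] := FP j1; have [_ t2] := FP j2; rewrite -E in t2.
    have [s sP] := touch_window kh kC (Vp _ p1).
    case/existsP: t1 => i1 /sP[a1 a13 /eqP E1]; case/existsP: t2 => i2 /sP[a2 a23 /eqP E2].
    have [_ e _] := kh; rewrite e in E1; rewrite e in E2.
    have : 5 * j1 + i1.+1 + a2 == 5 * j2 + i2.+1 + a1 %[mod m].
      rewrite -modnDml (eqP E1) modnDml -[in X in _ == X]modnDml (eqP E2) modnDml.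
      by rewrite -!addnA [a1 + a2]addnC.
    have l1 := ltn_ord j1; have l2 := ltn_ord j2; have l3 := ltn_ord i1; have l4 := ltn_ord i2.
    rewrite !modn_small; [|move: l2 l4 a13 t5 tm|move: l1 l3 a23 t5 tm]; try by clear; lia.
    move=> /eqP h12; apply: ord_inj; move: h12 l3 l4 a13 a23.
    move: (nat_of_ord i1) (nat_of_ord i2) (nat_of_ord j1) (nat_of_ord j2) => v1 v2 w1 w2.
    by clear; lia.
  have : #|F @: 'I_r.+2| <= #|[set x in c :: p]|.
    by apply/subset_leq_card/subsetP => x /imsetP[i _ ->]; rewrite inE; case: (FP i).
  rewrite card_imset // card_ord cardsE => h1.
  by have := leq_trans h1 (card_size _); move: sp; clear => /=; lia.
have ntp i x : 0 < i < 4 -> x \in c :: p -> (k (5 * j + i) != x) && ~~ edge (k (5 * j + i)) x.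
  move=> hi xp; have := nt _ xp; rewrite negb_exists.
  have i3 : i.-1 < 3 by move: hi; clear; lia.
  move/forallP/(_ (Ordinal i3)); rewrite /= prednK; last by case/andP: hi.
  by rewrite negb_or eq_sym edgeC.
have jt : 5 * j + 4 < t by move: jr t5; clear; lia.
have nbr i y : 0 < i < 4 -> y \in Y -> edge (k (5 * j + i)) y -> y \in [:: k (5 * j + i).-1; k (5 * j + i).+1].
  move=> hi /setUP[yp|/imsetP[s _ ->]] e.
    have yp' : y \in c :: p by rewrite inE in yp; rewrite inE yp orbT.
    by case/andP: (ntp i y hi yp'); rewrite e.
  have ks := kin s; rewrite -kC in ks.
  case: (hol_nbr kh ks e) => ->; first by rewrite !inE eqxx orbT.
  have -> : k (5 * j + i + m.-1) = k (5 * j + i).-1; last by rewrite inE eqxx.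
  by rewrite -[RHS](hol_per _ kh); congr k; move: hi m0; clear; lia.
have neq i i' : i < i' <= t -> k i != k i'.
  by move=> hi; apply: (hol_neq kh); move: hi tm; clear; lia.
apply: nY; apply: (@p5crit _ c4 Y (k (5 * j)) (k (5 * j + 1)) (k (5 * j + 2)) (k (5 * j + 3)) (k (5 * j + 4))).
- by rewrite /= !inE !negb_or !neq //; move: jt; clear; lia.
- by rewrite !kY //; move: jt; clear; lia.
- by rewrite addn1; exact: (hol_edgeS _ kh).
- by rewrite addn1 addn2; exact: (hol_edgeS _ kh).
- by rewrite addn3 addn2; exact: (hol_edgeS _ kh).
- by rewrite addn3 addn4; exact: (hol_edgeS _ kh).
- by apply: (hol_nedge kh); move: jt tm t6; clear; lia.
- by move=> y yY e; have := nbr 1 y isT yY e; rewrite addn1 addn2.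
- by move=> y yY e; have := nbr 2 y isT yY e; rewrite addn1 addn2 addn3.
- by move=> y yY e; have := nbr 3 y isT yY e; rewrite addn4 addn2 addn3.
set Y' := Y :\: _.
have kY' i : i <= 5 * j \/ 5 * j + 4 <= i -> i <= t -> k i \in Y'.
  move=> hi it; apply/setDP; split; first exact: kY.
  rewrite !inE !negb_or; case: hi => hi.
    by rewrite !neq //; move: hi jt; clear; lia.
  by rewrite ![k i == _]eq_sym !neq //; move: hi it jt; clear; lia.
have pY' x : x \in c :: p -> x \in Y'.
  move=> xp; apply/setDP; split.
    move: xp; rewrite inE => /predU1P[->|xp]; first by rewrite -k0 kY.
    by apply/setUP; left; rewrite inE.
  rewrite !inE !negb_or ![x == _]eq_sym.
  by case/andP: (ntp 1 x isT xp) => ->; case/andP: (ntp 2 x isT xp) => ->; case/andP: (ntp 3 x isT xp) => ->.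
apply: (@connect_trans _ _ (k t)).
  rewrite -(subnKC (ltnW jt)); apply: (hol_run kh) => i; rewrite subnKC; last exact: ltnW.
  by case/andP => h1 h2; apply: kY' => //; right.
apply: (@connect_trans _ _ (k 0)).
  rewrite -/(conn _ _ _) conn_sym k0 -c'E; apply/connectP; exists p => //.
  have cc : c \in c :: p by rewrite mem_head.
  apply: path_er (pY' _ cc) _ _; first by case: (er_path cV pp).
  by move=> x xp; apply: pY'; rewrite inE xp orbT.
rewrite -[5 * j]add0n; apply: (hol_run kh) => i /andP[_ ij]; apply: kY'; first by left.
by move: ij jt; clear; lia.
Qed.
End Shortest.

(** * Spaces of edge sets *)

Section XorSums.
Variable E : finType.
Implicit Types (S T : {set E}) (w : E -> bool).

Definition xs T w := \big[addb/false]_e ((e \in T) && w e).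
Definition sdiff S T := (S :\: T) :|: (T :\: S).

Lemma in_sdiff S T e : (e \in sdiff S T) = (e \in S) (+) (e \in T).
Proof. by rewrite !inE; case: (e \in S); case: (e \in T). Qed.

Lemma xs_sdiff S T w : xs (sdiff S T) w = xs S w (+) xs T w.
Proof.
rewrite /xs -big_split; apply: eq_bigr => e _.
by rewrite in_sdiff; case: (e \in S); case: (e \in T); case: (w e).
Qed.

Lemma xs0 w : xs set0 w = false.
Proof. by rewrite /xs big1 // => e _; rewrite inE. Qed.

Lemma xs1 e w : xs [set e] w = w e.
Proof.
rewrite /xs (bigD1 e) //= set11 big1 ?addbF // => i ie; by rewrite inE (negbTE ie).
Qed.

Lemma xsU1 e T w : e \notin T -> xs (e |: T) w = w e (+) xs T w.
Proof.
move=> eT; rewrite -(xs1 e w) -xs_sdiff; congr xs; apply/setP => i; rewrite in_sdiff !inE.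
by case: eqVneq => // ->; rewrite (negbTE eT).
Qed.

Lemma xsD1 e T w : e \in T -> xs T w = w e (+) xs (T :\ e) w.
Proof. by move=> eT; rewrite -xsU1 ?setD11 // setD1K. Qed.

Lemma eq_xs T w1 w2 : {in T, w1 =1 w2} -> xs T w1 = xs T w2.
Proof.
move=> h; apply: eq_bigr => e _; case: (boolP (e \in T)) => // /h -> //.
Qed.

Lemma xs_odd T w : xs T w = odd #|[set e in T | w e]|.
Proof.
rewrite /xs cardsE -sum1_card (big_morph odd oddD (erefl _)) [RHS]big_mkcond /=.
by apply: eq_bigr => e _; rewrite -[X in if X then _ else _]topredE /=; case: (_ && _).
Qed.

Lemma sdiff_sub S T (W : {set E}) : S \subset W -> T \subset W -> sdiff S T \subset W.
Proof.
move=> /subsetP sS /subsetP sT; apply/subsetP => e; rewrite !inE.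
by case/orP=> /andP[_]; auto.
Qed.
End XorSums.

(** * Gaussian elimination over the two-element field *)

Section Elimination.
Variable K : finType.
Implicit Types (M : K -> K -> bool) (x y v : K -> bool).

Definition mulv M x k := \big[addb/false]_q (M k q && x q).

Lemma mulvD M x y k : mulv M (fun q => x q (+) y q) k = mulv M x k (+) mulv M y k.
Proof. by rewrite /mulv -big_split; apply: eq_bigr => q _; rewrite andb_addr. Qed.

Lemma mulv_upd M M' v p x k : (forall k q, M' k q = M k q (+) (v k && M p q)) ->
  mulv M' x k = mulv M x k (+) (v k && mulv M x p).
Proof.
move=> h; rewrite /mulv; transitivity (\big[addb/false]_q ((M k q && x q) (+) (v k && (M p q && x q)))).
  by apply: eq_bigr => q _; rewrite h; case: (M k q); case: (v k); case: (M p q); case: (x q).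
rewrite big_split /=; congr addb; elim/big_rec2: _ => [|q a b _ ->]; first by rewrite andbF.
by rewrite -andb_addr.
Qed.

(* Adding [M f] times row [p] to [M] enlarges the kernel by [f]. *)
Lemma ker_upd M M' f p x : mulv M f p ->
  (forall k q, M' k q = M k q (+) (mulv M f k && M p q)) ->
  (forall k, mulv M' x k = false) <->
  (forall k, mulv M x k = false) \/ (forall k, mulv M (fun q => x q (+) f q) k = false).
Proof.
move=> fp h; split=> [z|[z|z] k]; last 2 first.
- by rewrite (mulv_upd _ _ h) !z andbF.
- rewrite (mulv_upd _ _ h); have := z k; have := z p; rewrite !mulvD fp.
  by case: (mulv M x p) => // _; rewrite andbT.
case: (boolP (mulv M x p)) => xp; [right|left] => k; have := z k; rewrite (mulv_upd _ _ h).
  by rewrite xp andbT mulvD.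
by rewrite (negbTE xp) andbF addbF.
Qed.
End Elimination.

Section Basis.
Variable G : sgraph.
Implicit Types (I R H B T cand : {set G * G}) (e : G * G).

(** A square matrix indexed by [bool * G], stored as four blocks because a relation on vertices is
    what one memory slot can hold. *)
Definition mat := ((({set G * G} * {set G * G}) * ({set G * G} * {set G * G})) : Type).
Definition blk (M : mat) (a b : bool) : {set G * G} :=
  if a then (if b then M.2.2 else M.2.1) else (if b then M.1.2 else M.1.1).
Definition mfun (M : mat) (k q : bool * G) := (k.2, q.2) \in blk M k.1 q.1.

Definition lab I R (j x y : G) :=
  ((j, x) \in I) && ((j, y) \in R) || ((j, y) \in I) && ((j, x) \in R).
(** The coordinates of an edge: index [(false, v)] is its boundary at v, index [(true, j)] its label
    in slot j. *)
Definition phi I R e (k : bool * G) :=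
  if k.1 then lab I R k.2 e.1 e.2 else (k.2 == e.1) (+) (k.2 == e.2).

Definition col_image I R (M : mat) e (a : bool) : {set G} :=
  [set x | (odd #|[set y | ((x, y) \in blk M a false) && phi I R e (false, y)]|)
       (+) (odd #|[set y | ((x, y) \in blk M a true) && phi I R e (true, y)]|)].
(** A choice function: a singleton, or empty if S is; keeping it a set makes it computable without a
    default vertex. *)
Definition least (S : {set G}) : {set G} := [set x in S | [forall y in S, enum_rank x <= enum_rank y]].
(** The pivot row: the row of the least index at which the image [(v0, v1)] of the new column is
    nonzero. *)
Definition prow (M : mat) (v0 v1 : {set G}) b y :=
  [exists x in least v0, (x, y) \in blk M false b] ||
  (v0 == set0) && [exists x in least v1, (x, y) \in blk M true b].
Definition upd (M : mat) (v0 v1 : {set G}) (a b : bool) : {set G * G} :=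
  [set p | (p \in blk M a b) (+) ((p.1 \in if a then v1 else v0) && prow M v0 v1 b p.2)].
Definition bstep I R cand (st : {set G * G} * mat) e : {set G * G} * mat :=
  let v0 := col_image I R st.2 e false in let v1 := col_image I R st.2 e true in
  if (e \in cand) && ~~ ((v0 == set0) && (v1 == set0)) then
    (e |: st.1, ((upd st.2 v0 v1 false false, upd st.2 v0 v1 false true),
                 (upd st.2 v0 v1 true false, upd st.2 v0 v1 true true)))
  else st.
Definition diag : {set G * G} := [set p | p.1 == p.2].
Definition vpairs : seq (G * G) := [seq (u, v) | u <- enum G, v <- enum G].
Definition basis I R cand := (foldl (bstep I R cand) (set0, ((diag, set0), (set0, diag))) vpairs).1.

Lemma mem_vpairs e : e \in vpairs.
Proof. by case: e => u v; apply/allpairsP; exists (u, v); rewrite !mem_enum. Qed.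

Lemma big_boolG (F : bool * G -> bool) :
  \big[addb/false]_q F q = (\big[addb/false]_y F (false, y)) (+) (\big[addb/false]_y F (true, y)).
Proof.
transitivity (\big[addb/false]_(a : bool) \big[addb/false]_(y : G) F (a, y)).
  by rewrite pair_bigA; apply: eq_bigr => -[].
by rewrite big_bool addbC.
Qed.

Lemma image_mulv I R M e k : (k.2 \in col_image I R M e k.1) = mulv (mfun M) (phi I R e) k.
Proof.
rewrite inE /mulv big_boolG; congr addb.
  have := xs_odd [set y | (k.2, y) \in blk M k.1 false] (fun y => phi I R e (false, y)).
  rewrite (_ : [set _ in _ | _] = [set y | ((k.2, y) \in blk M k.1 false) && phi I R e (false, y)]).
    by move=> <-; apply: eq_bigr => y _; rewrite inE.
  by apply/setP => y; rewrite !inE.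
have := xs_odd [set y | (k.2, y) \in blk M k.1 true] (fun y => phi I R e (true, y)).
rewrite (_ : [set _ in _ | _] = [set y | ((k.2, y) \in blk M k.1 true) && phi I R e (true, y)]).
  by move=> <-; apply: eq_bigr => y _; rewrite inE.
by apply/setP => y; rewrite !inE.
Qed.

Lemma least_ex (S : {set G}) : S != set0 -> exists2 x, x \in S & least S = [set x].
Proof.
case/set0Pn => x0 x0S; case: (arg_minnP (fun x : G => enum_rank x : nat) x0S) => x xS xmin.
have {}xS : x \in S by [].
exists x => //; apply/setP => y; rewrite !inE; apply/andP/eqP => [[yS /forallP h]|->].
  have := h x; rewrite xS => /= yx; apply/enum_rank_inj/ord_inj/eqP.
  by rewrite eqn_leq yx xmin.
by split=> //; apply/forallP => z; apply/implyP; exact: xmin.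
Qed.

Lemma prow_ex M v0 v1 : ~~ ((v0 == set0) && (v1 == set0)) ->
  exists2 p : bool * G, p.2 \in (if p.1 then v1 else v0) &
    forall q, prow M v0 v1 q.1 q.2 = mfun M p q.
Proof.
have ex x (P : pred G) : [exists y in [set x], P y] = P x.
  by apply/existsP/idP => [[y /andP[/set1P-> //]]|Px]; exists x; rewrite set11.
have l0 : least set0 = set0 by apply/setP => x; rewrite !inE.
have e0 (P : pred G) : [exists y in least set0, P y] = false.
  by apply/negbTE/negP => /existsP[y]; rewrite l0 inE.
case: (eqVneq v0 set0) => [->|v0n] /= h.
  have [y yv lE] := least_ex h; exists (true, y) => // -[b q].
  by rewrite /prow e0 eqxx lE ex.
have [x xv lE] := least_ex v0n; exists (false, x) => // -[b q].
by rewrite /prow (negbTE v0n) lE ex orbF.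
Qed.

(** Starting from the identity, the kernel of the current matrix is always the span of the columns
    chosen so far. So an edge has a nonzero image exactly if it is independent of them, and by
    [ker_upd] the update adds it to the kernel. *)
Lemma basisP I R cand : let B := basis I R cand in
  [/\ B \subset cand,
      forall T, T \subset B -> (forall k, xs T (phi I R ^~ k) = false) -> T = set0 &
      forall T, T \subset cand -> exists2 T' : {set G * G}, T' \subset B &
        forall k, xs T' (phi I R ^~ k) = xs T (phi I R ^~ k)].
Proof.
pose spn B (x : bool * G -> bool) := exists2 T : {set G * G}, T \subset B & forall k, x k = xs T (phi I R ^~ k).
pose inv (s : seq (G * G)) (st : {set G * G} * mat) :=
  [/\ st.1 \subset cand,
      forall T, T \subset st.1 -> (forall k, xs T (phi I R ^~ k) = false) -> T = set0,
      forall x, (forall k, mulv (mfun st.2) x k = false) <-> spn st.1 x &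
      forall e, e \in cand -> e \in s -> spn st.1 (phi I R e)].
have step s st e : inv s st -> inv (rcons s e) (bstep I R cand st e).
  case: st => B M [/= Bc Bi ker sp]; rewrite /bstep /=.
  set v0 := col_image I R M e false; set v1 := col_image I R M e true.
  have vE k : (k.2 \in if k.1 then v1 else v0) = mulv (mfun M) (phi I R e) k.
    by rewrite -image_mulv; case: k => -[].
  have same : (e \in cand -> spn B (phi I R e)) -> inv (rcons s e) (B, M).
    by move=> h; split=> // i ic; rewrite mem_rcons inE => /predU1P[E|/sp]; [rewrite E in ic *; auto|auto].
  case: (boolP (e \in cand)) => ec /=; last by apply: same => ec1; rewrite ec1 in ec.
  case: ifP => nv; last first.
    apply: same => _; apply/ker => k; rewrite -vE.
    by case/negbFE/andP: nv => /eqP-> /eqP->; case: k => -[] x; rewrite inE.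
  have [p pv prE] := prow_ex M nv.
  pose M' : mat := ((upd M v0 v1 false false, upd M v0 v1 false true),
    (upd M v0 v1 true false, upd M v0 v1 true true)).
  rewrite -[(_, (_, _))]/(e |: B, M').
  have M'E k q : mfun M' k q = mfun M k q (+) (mulv (mfun M) (phi I R e) k && mfun M p q).
    rewrite -vE -prE; case: k q => -[] x [[] y]; by rewrite /mfun /= inE.
  rewrite vE in pv; have kerE x := ker_upd x pv M'E.
  have nspe : ~ spn B (phi I R e) by move/ker/(_ p); rewrite pv.
  have eB : e \notin B.
    by apply/negP => eB; apply: nspe; exists [set e]; [rewrite sub1set|move=> k; rewrite xs1].
  have inc x : spn B x -> spn (e |: B) x.
    by case=> T TB xE; exists T => //; apply: subset_trans TB _; exact: subsetUr.
  split=> //=.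
  - by rewrite subUset sub1set ec.
  - move=> T TB z; case: (boolP (e \in T)) => eT.
      case: nspe; exists (T :\ e); first by rewrite subDset.
      by move=> k; have := z k; rewrite (xsD1 _ eT); case: (phi _ _ _ _); case: (xs _ _).
    apply: Bi z; apply/subsetP => i iT; have := subsetP TB _ iT.
    by case/setU1P => // E; rewrite -E iT in eT.
  - move=> x; split=> [/kerE[/ker/inc //|/ker[T TB xE]]|[T TB xE]].
      exists (e |: T); first by rewrite setUS.
      have eT : e \notin T by apply: contra eB; exact: (subsetP TB).
      by move=> k; rewrite xsU1 // -xE; case: (x k); case: (phi _ _ _ _).
    apply/kerE; case: (boolP (e \in T)) => eT; [right|left]; apply/ker.
      exists (T :\ e); first by rewrite subDset.
      by move=> k; rewrite xE (xsD1 _ eT); case: (phi _ _ _ _); case: (xs _ _).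
    exists T => //; apply/subsetP => i iT; have := subsetP TB _ iT.
    by case/setU1P => // E; rewrite -E iT in eT.
  - move=> i ic; rewrite mem_rcons inE => /predU1P[->|/(sp _ ic)/inc //].
    by exists [set e]; [rewrite sub1set setU11|move=> k; rewrite xs1].
have fold s : inv s (foldl (bstep I R cand) (set0, ((diag, set0), (set0, diag))) s).
  elim/last_ind: s => [|s e IH]; last by rewrite foldl_rcons; exact: step.
  have m1 x k : mulv (mfun ((diag, set0), (set0, diag))) x k = x k.
    rewrite /mulv (bigD1 k) //= big1 => [|q qk].
      by rewrite addbF; case: k => -[] y; rewrite /mfun /= inE eqxx.
    case: k q qk => -[] y [[] z] qk; rewrite /mfun /= inE //=;
      by case: eqVneq => // E; rewrite E eqxx in qk.
  split=> //=; first exact: sub0set.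
    by move=> T; rewrite subset0 => /eqP.
  move=> x; split=> [z|[T]].
    by exists set0 => // k; rewrite xs0 -(z k) m1.
  by rewrite subset0 => /eqP-> z k; rewrite m1 z xs0.
have [Bc Bi _ sp] := fold vpairs; split=> // T.
have [n] := ubnP #|T|; elim: n T => // n IH T cT Tc.
case: (set_0Vmem T) => [->|[e eT]]; first by exists set0; rewrite ?sub0set.
have [||T1 T1B T1E] := IH (T :\ e).
- by move: cT; rewrite (cardsD1 e) eT.
- exact: subset_trans (subsetDl _ _) Tc.
have [T2 T2B T2E] := sp e (subsetP Tc _ eT) (mem_vpairs e).
exists (sdiff T1 T2); first exact: sdiff_sub.
by move=> k; rewrite xs_sdiff T1E -T2E (xsD1 _ eT) addbC.
Qed.
End Basis.

(** * Frames *)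

Lemma iter_saturated (T : finType) (f : {set T} -> {set T}) S n : (forall S : {set T}, S \subset f S) ->
  #|T| <= n -> f (iter n f S) = iter n f S.
Proof.
move=> inc; have fixed m i : f (iter m f S) = iter m f S -> m <= i -> f (iter i f S) = iter i f S.
  by move=> e /subnK <-; elim: (i - m) => //= j IHj; rewrite !IHj.
suff h m : (m <= #|iter m f S|) || [exists i : 'I_m, f (iter i f S) == iter i f S].
  case/orP: (h #|T|.+1) => [hc|/existsP[i /eqP e]] cn; first by move: hc; rewrite ltnNge max_card.
  by apply: (fixed i) => //; apply: leq_trans cn; rewrite -ltnS.
elim: m => [//|m /orP[IH|/existsP[i e]]].
- case: (eqVneq (f (iter m f S)) (iter m f S)) => [e|ne].
    by apply/orP; right; apply/existsP; exists ord_max; apply/eqP.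
  apply/orP; left; apply: leq_ltn_trans IH _; apply: proper_card.
  by rewrite properEneq eq_sym ne inc.
- by apply/orP; right; apply/existsP; exists (widen_ord (leqnSn m) i).
Qed.

(** * Inclusion-minimal sets by greedy deletion *)

Section Greedy.
Variables (T : finType) (P : {set T} -> bool).
Implicit Types U : {set T}.
Definition gmin U := foldl (fun U x => if P (U :\ x) then U :\ x else U) U (enum T).
Hypothesis mono : forall U U', U \subset U' -> P U -> P U'.

(** One pass is enough: an element that could not be deleted from a larger set cannot be deleted
    later, by monotonicity. *)
Lemma gminP U : P U ->
  [/\ P (gmin U), gmin U \subset U & forall U', U' \subset gmin U -> P U' -> U' = gmin U].
Proof.
move=> PU; rewrite /gmin.
suff h (s : seq T) U0 : P U0 -> let V := foldl (fun U x => if P (U :\ x) then U :\ x else U) U0 s in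
    [/\ P V, V \subset U0 & forall x, x \in s -> x \in V -> ~~ P (V :\ x)].
  have [h1 h2 h3] := h (enum T) U PU; split=> // U' U'V PU'.
  apply/eqP; rewrite eqEsubset U'V; apply/subsetP => x xV; apply: contraT => xU'.
  have xe : x \in enum T by rewrite mem_enum.
  case/negP: (h3 x xe xV).
  by apply: mono PU'; rewrite subsetD1 U'V.
elim: s U0 => [|x s IH] U0 PU0 /=; first by split.
case: ifP => Px; first by have [h1 h2 h3] := IH _ Px; split=> //;
  [apply: subset_trans h2 (subsetDl _ _)|move=> y; rewrite inE => /predU1P[->|/h3 //];
   move=> /(subsetP h2); rewrite in_setD1 eqxx].
have [h1 h2 h3] := IH _ PU0; split=> // y; rewrite inE => /predU1P[->|/h3 //] _.
by apply: contraFN Px => /mono; apply; rewrite setSD.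
Qed.
End Greedy.

Section Families.
Variable G : sgraph.
Implicit Types (fam : {ffun G -> nat}) (U : {set G}).

Definition cls fam i := [set x | fam x == i.+1].
Definition famok fam q := (forall i, i < q -> holed (cls fam i)) /\ (forall x, fam x <= q).
Definition addf fam q U : {ffun G -> nat} := [ffun x => if x \in U then q.+1 else fam x].

Lemma famok0 : famok [ffun=> 0] 0.
Proof. by split=> // x; rewrite ffunE. Qed.

Lemma famok_add fam q U : famok fam q -> holed U -> (forall x, x \in U -> fam x = 0) ->
  famok (addf fam q U) q.+1.
Proof.
move=> [h1 h2] hU U0; split=> [i|x]; last by rewrite ffunE; case: ifP => // _; exact: leqW.
rewrite ltnS leq_eqVlt => /predU1P[->|iq].
  apply: holedS hU; apply/subsetP => x xU; by rewrite inE ffunE xU.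
apply: holedS (h1 _ iq); apply/subsetP => x; rewrite !inE ffunE.
case: ifP => // /U0 ->; by rewrite eq_sym.
Qed.
End Families.

Section EdgeSets.
Variable G : sgraph.
Hypothesis c4 : C4_free G.
Implicit Types (I R H T F B : {set G * G}) (S U W A : {set G}) (e : G * G) (u v x y z : G).

Definition oedges : {set G * G} := [set p | edge p.1 p.2 && (enum_rank p.1 < enum_rank p.2)].
Definition inc v e := (v == e.1) || (v == e.2).
Definition bnd v e := (v == e.1) (+) (v == e.2).
Definition deg H v := #|[set e in H | inc v e]|.
Definition even T := forall v, xs T (bnd v) = false.
Definition restr H W := [set e in H | (e.1 \in W) && (e.2 \in W)].
Definition adj H u v := ((u, v) \in H) || ((v, u) \in H).
Definition prune H := [set e in H | (deg H e.1 != 1) && (deg H e.2 != 1)].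
(** The 2-core; each effective round removes a vertex from the support, so #|G| rounds suffice. *)
Definition core H := iter #|G| prune H.
Definition branch H := [set v | 3 <= deg H v].
Definition supp H := [set v | 0 < deg H v].

Lemma oedgeP e : e \in oedges -> edge e.1 e.2 /\ e.1 != e.2.
Proof. by rewrite inE => /andP[h _]; split=> //; exact: edge_neq. Qed.

Lemma bnd_inc v e : e \in oedges -> bnd v e = inc v e.
Proof.
case/oedgeP => _ ne; rewrite /bnd /inc; case: eqVneq => //= ->; by rewrite (negbTE ne).
Qed.

Lemma adjC H u v : adj H u v = adj H v u.
Proof. by rewrite /adj orbC. Qed.

Lemma adj_sub H F u v : H \subset F -> adj H u v -> adj F u v.
Proof. by move=> /subsetP s; rewrite /adj => /orP[/s->|/s->]; rewrite ?orbT. Qed.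

Lemma deg_sub H F v : H \subset F -> deg H v <= deg F v.
Proof.
move=> /subsetP s; apply/subset_leq_card/subsetP => e; rewrite !inE => /andP[/s -> ->].
by [].
Qed.

Lemma even_sdiff T F : even T -> even F -> even (sdiff T F).
Proof. by move=> h1 h2 v; rewrite xs_sdiff h1 h2. Qed.

Lemma even_deg T v : T \subset oedges -> even T -> odd (deg T v) = false.
Proof.
move=> /subsetP sT eT; rewrite /deg -xs_odd -(eT v); apply: eq_xs => e /sT h.
by rewrite bnd_inc.
Qed.

Lemma prune_sub H : prune H \subset H.
Proof. by apply/subsetP => e; rewrite inE => /andP[]. Qed.

Lemma core_sub H : core H \subset H.
Proof.
rewrite /core; elim: #|G| => //= n IH; exact: subset_trans (prune_sub _) IH.
Qed.

(** An even set has no vertex of degree 1, so none of its edges is ever pruned. *)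
Lemma even_core H T : H \subset oedges -> T \subset H -> even T -> T \subset core H.
Proof.
move=> sH sT eT; rewrite /core; have sTo := subset_trans sT sH.
elim: #|G| => //= n IH; apply/subsetP => e eT'; rewrite inE (subsetP IH) //=.
have h v : inc v e -> deg (iter n prune H) v != 1.
  move=> ve; have := deg_sub v IH; have := even_deg v sTo eT.
  have : 0 < deg T v by apply/card_gt0P; exists e; rewrite inE eT'.
  by case: (deg T v) => [|[|d]] // _ _; case: (deg _ v) => [|[|]].
by rewrite !h // /inc eqxx ?orbT.
Qed.

Lemma prune_fix H : prune H = H -> forall v, deg H v != 1.
Proof.
move=> pH v; apply/negP => d1; have : 0 < deg H v by rewrite (eqP d1).
case/card_gt0P => e; rewrite inE => /andP[eH /orP[]/eqP vE]; move: eH; rewrite -pH inE -vE d1 ?andbF //.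
Qed.

Lemma core_leaf H v : deg (core H) v != 1.
Proof.
apply: prune_fix; rewrite /core.
suff h n F : #|supp F| <= n -> prune (iter n prune F) = iter n prune F by apply: h; exact: max_card.
elim: n F => [|n IH] F sF; last first.
  case: (eqVneq (prune F) F) => [e|ne].
    by have h k : iter k prune F = F by [elim: k => //= k ->]; rewrite h.
  rewrite iterSr; apply: IH; rewrite -ltnS; apply: leq_trans sF; apply: proper_card.
  have [v0 d1] : exists v, deg F v == 1.
    have /properP[_ [e eF]] : prune F \proper F by rewrite properEneq ne prune_sub.
    rewrite inE eF /= negb_and !negbK => /orP[]; by [exists e.1|exists e.2].
  apply/properP; split.
    apply/subsetP => x; rewrite !inE => h; exact: leq_trans h (deg_sub _ (prune_sub _)).
  exists v0; rewrite !inE; first by rewrite (eqP d1).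
  rewrite -leqNgt leqn0 cards_eq0; apply/eqP/setP => e; rewrite !inE; apply/negbTE/negP.
  by move=> /andP[/andP[_ /andP[n1 n2]] /orP[]/eqP E]; rewrite E ?(negbTE n1) ?(negbTE n2) in d1.
apply/setP => e; rewrite !inE; case: (boolP (e \in F)) => //= eF.
move: sF; rewrite leqn0 cards_eq0 => /eqP/setP/(_ e.1); rewrite !inE => /negbT.
by rewrite -leqNgt leqn0 cards_eq0 => /eqP/setP/(_ e); rewrite !inE eF /inc eqxx.
Qed.

Lemma handshake H : H \subset oedges -> \sum_v deg H v = (#|H|).*2.
Proof.
move=> sH; under eq_bigr do rewrite /deg -sum1dep_card.
rewrite (exchange_big_dep (mem H)) /=; last by move=> v e _ /andP[].
transitivity (\sum_(e in H) 2); last by rewrite sum_nat_const muln2.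
apply: eq_bigr => e eH; have [_ ne] := oedgeP (subsetP sH _ eH).
have := cards2 e.1 e.2; rewrite ne sum1dep_card => <-; apply: eq_card => v.
by rewrite !inE eH.
Qed.

(* Boundaries and labels separate the edge sets, and deg v - 2 is summed over the
   branch vertices: compare dimensions. *)
Lemma card_branch I R H A : H \subset oedges -> (forall v, deg H v != 1) ->
  (forall j x, j \notin A -> (j, x) \notin I) ->
  (forall T, T \subset H -> (forall k, xs T (phi I R ^~ k) = false) -> T = set0) ->
  #|branch H| <= #|A|.*2.
Proof.
move=> sH nl oA ind.
pose F T : {set G} * {set G} := ([set v in supp H | xs T (bnd v)], [set j in A | xs T (phi I R ^~ (true, j))]).
have Finj : {in powerset H &, injective F}.
  move=> T1 T2; rewrite !inE => s1 s2 [/setP E1 /setP E2].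
  have z : sdiff T1 T2 = set0.
    apply: ind; first exact: sdiff_sub.
    case=> -[] j; rewrite xs_sdiff.
      case: (boolP (j \in A)) => jA; first by have := E2 j; rewrite !inE jA /= => ->; rewrite addbb.
      rewrite -[RHS](xs0 (phi I R ^~ (true, j))).
      have h e : phi I R e (true, j) = false by rewrite /phi /lab /= !(negbTE (oA _ _ jA)).
      by rewrite /xs !big1 // => e _; rewrite h andbF.
    case: (boolP (j \in supp H)) => jV; first by have := E1 j; rewrite inE [X in _ = X]inE jV /= => h; rewrite /phi /= -/(bnd j) h addbb.
    have h T : T \subset H -> xs T (bnd j) = false.
      move=> sT; rewrite /xs big1 // => e _; case: (boolP (e \in T)) => //= eT.
      rewrite bnd_inc ?(subsetP sH) ?(subsetP sT) //.
      apply: contraNF jV => je; rewrite inE; apply/card_gt0P; exists e.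
      by rewrite inE (subsetP sT).
    by rewrite /phi /= -/(bnd j) !h.
  apply/setP => e; have := in_sdiff T1 T2 e; rewrite z inE.
  by case: (e \in T1); case: (e \in T2).
(* The subsets of H have distinct images, whence |H| is at most |supp H| + |A|; the handshake lemma
   then bounds the excess degrees. *)
have : #|F @: powerset H| <= #|setX (powerset (supp H)) (powerset A)|.
  apply/subset_leq_card/subsetP => p /imsetP[T _ ->]; rewrite !inE /=.
  by apply/andP; split; apply/subsetP => x; rewrite inE => /andP[].
rewrite card_in_imset // cardsX !card_powerset -expnD leq_exp2l // => hc.
have hs := handshake sH.
have : (#|supp H|).*2 + #|branch H| <= \sum_v deg H v.
  rewrite -!sum1_card -mul2n big_distrr /= [X in X + _]big_mkcond [X in _ + X]big_mkcond -big_split /=.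
  apply: leq_sum => v _; rewrite !inE; have := nl v.
  by case: (deg H v) => [|[|[|d]]].
by rewrite hs; move: hc; clear; lia.
Qed.

Lemma even_cob T (g : G -> bool) : even T -> xs T (fun e => g e.1 (+) g e.2) = false.
Proof.
move=> eT; transitivity (\big[addb/false]_v (g v && xs T (bnd v))); last first.
  by rewrite big1 // => v _; rewrite eT andbF.
rewrite /xs; transitivity (\big[addb/false]_v \big[addb/false]_e ((e \in T) && (g v && bnd v e))).
  rewrite exchange_big; apply: eq_bigr => e _; case: (e \in T) => /=; last by rewrite big1.
  have h w : \big[addb/false]_v (g v && (v == w)) = g w.
    rewrite (bigD1 w) //= eqxx andbT big1 ?addbF // => v /negbTE->; by rewrite andbF.
  rewrite -(h e.1) -(h e.2) -big_split; apply: eq_bigr => v _ /=.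
  by rewrite -andb_addr.
apply: eq_bigr => v _; case: (g v) => /=; first by [].
by rewrite big1 // => e _; rewrite andbF.
Qed.

(** Without a long hole in S the label is a coboundary there, and coboundaries vanish on even
    sets. *)
Lemma even_holed T S m : T \subset oedges -> even T -> coc S m ->
  (forall e, e \in T -> (e.1 \in S) && (e.2 \in S)) -> xs T (fun e => m e.1 e.2) -> holed S.
Proof.
move=> sT eT cm TS o; apply: Classical_Prop.NNPP => nS.
have [g gE] := coc_potential c4 nS cm.
move: o; rewrite (@eq_xs _ T _ (fun e => g e.1 (+) g e.2)) ?even_cob // => e eT'.
by have /andP[e1 e2] := TS _ eT'; apply: gE => //; case: (oedgeP (subsetP sT _ eT')).
Qed.

Definition orient x y := if enum_rank x < enum_rank y then (x, y) else (y, x).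

Lemma orientE x y : edge x y -> orient x y \in oedges.
Proof.
move=> e; rewrite /orient; case: ltngtP => [h|h|/ord_inj/enum_rank_inj E].
- by rewrite inE e.
- by rewrite inE edgeC e.
- by rewrite E edgexx in e.
Qed.

Lemma orient_in e : e \in oedges -> orient e.1 e.2 = e.
Proof. by rewrite inE => /andP[_ h]; rewrite /orient h; case: e {h}. Qed.

Lemma orient_sym (w : G -> G -> bool) x y : (forall x y, w x y = w y x) ->
  w (orient x y).1 (orient x y).2 = w x y.
Proof. by move=> s; rewrite /orient; case: ifP. Qed.

Lemma orientC x y : orient x y = orient y x.
Proof.
rewrite /orient; case: ltngtP => //= /ord_inj/enum_rank_inj->; by [].
Qed.

Section HoleEdges.
Variables (l : nat) (f : nat -> G).
Hypothesis fh : hol l f.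
Let Z := img l f.

Lemma hole_edgesE : restr oedges Z = [set orient (f i) (f i.+1) | i : 'I_l in 'I_l].
Proof.
have [l4 fe fed] := fh.
apply/setP => e; apply/idP/imsetP => [|[i _ ->]]; last first.
  rewrite inE orientE ?(hol_edgeS _ fh) //=.
  by rewrite /orient; case: ifP => _; rewrite !in_img.
rewrite inE => /andP[eo /andP[/(in_imgP fh)[i il e1] /(in_imgP fh)[j jl e2]]].
have [ee _] := oedgeP eo; rewrite -(orient_in eo); rewrite e1 e2 fed in ee *.
have mE k : k < l -> f k = f (Ordinal (ltn_pmod k (ltnW (ltnW (ltnW l4))))).
  by move=> kl; rewrite /= modn_small.
case/orP: ee => /eqP E; [exists (Ordinal il)|exists (Ordinal jl)] => //=; last rewrite orientC.
  by congr orient; apply/eqP; rewrite fe E.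
by congr orient; apply/eqP; rewrite fe E.
Qed.

Lemma orient_inj : injective (fun i : 'I_l => orient (f i) (f i.+1)).
Proof.
have [l4 fe fed] := fh; move=> i j E.
have : (f i == f j) && (f i.+1 == f j.+1) || (f i == f j.+1) && (f i.+1 == f j).
  have := orient_sym (w := fun x y => (f i == x) && (f i.+1 == y) || (f i == y) && (f i.+1 == x)).
  move=> h; have hs x y : (f i == x) && (f i.+1 == y) || (f i == y) && (f i.+1 == x) =
    (f i == y) && (f i.+1 == x) || (f i == x) && (f i.+1 == y) by rewrite orbC.
  by rewrite -(h (f j) (f j.+1) hs) -E (h (f i) (f i.+1) hs) !eqxx.
case/orP => /andP[]; rewrite !fe => /eqP E1 /eqP E2.
  by apply: ord_inj; move: E1; rewrite !modn_small.
exfalso; have : j.+2 == j %[mod l] by rewrite -E2 -[i.+1]addn1 -modnDml E1 modnDml addn1.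
rewrite -addn2 -{2}[val j]addn0 eqn_modDl mod0n modn_small //.
by move: l4; clear; lia.
Qed.

Lemma hole_xs (w : G -> G -> bool) : (forall x y, w x y = w y x) ->
  xs (restr oedges Z) (fun e => w e.1 e.2) = zs l f w.
Proof.
move=> ws; rewrite /xs /zs; transitivity (\big[addb/false]_(e in restr oedges Z) w e.1 e.2).
  by rewrite [RHS]big_mkcond; apply: eq_bigr => e _; case: (e \in _).
rewrite hole_edgesE big_imset /=; last by move=> i j _ _; exact: orient_inj.
by apply: eq_big => // i _; rewrite orient_sym.
Qed.

Lemma hole_even : even (restr oedges Z).
Proof.
by move=> v; rewrite (hole_xs (w := fun x y => (v == x) (+) (v == y))) ?zs_cob // => x y; rewrite addbC.
Qed.

Lemma hole_deg v : deg (restr oedges Z) v <= (v \in Z).*2.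
Proof.
have [l4 fe fed] := fh.
case: (boolP (v \in Z)) => vZ /=; last first.
  rewrite leqn0 cards_eq0; apply/eqP/setP => e; rewrite !inE; apply/negbTE/negP.
  move=> /andP[/andP[_ /andP[e1 e2]] /orP[]/eqP E]; move: vZ; by rewrite E ?e1 ?e2.
have [p pl vE] := in_imgP fh vZ.
apply: (leq_trans _ (_ : #|[set orient (f p) (f p.+1); orient (f (p + l.-1)) (f (p + l.-1).+1)]| <= 2)); last first.
  by rewrite cards2; case: (_ != _).
apply/subset_leq_card/subsetP => e; rewrite inE hole_edgesE => /andP[/imsetP[i _ ->] ve].
have : (v == f i) || (v == f i.+1).
  by move: ve; rewrite /inc /orient; case: ifP => //=; rewrite orbC.
have aux a b : f a = f b -> orient (f a) (f a.+1) = orient (f b) (f b.+1).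
  move=> /eqP; rewrite fe => /eqP h; congr orient; apply/eqP; rewrite fe //.
    exact/eqP.
  by rewrite -[a.+1]addn1 -[b.+1]addn1 -modnDml h modnDml.
rewrite vE !inE => /orP[/eqP/aux->|/eqP E]; first by rewrite eqxx.
apply/orP; right; apply/eqP/aux/eqP; rewrite fe -(eqn_modDr 1) !addn1 -addnS prednK; last first.
  by apply: leq_trans l4.
by rewrite modnDr -fe E.
Qed.
End HoleEdges.

(* The state of the frame construction: [H] is a subgraph whose even edge sets are
   coordinatised by the labels attached to the slots in [A]. *)
Record frame (Gam A : {set G}) I R H : Prop := Frame {
  fr_sub : H \subset restr oedges Gam;
  fr_ind : forall T, T \subset H -> (forall k, xs T (phi I R ^~ k) = false) -> T = set0;
  fr_full : forall w : {set G}, w \subset A -> exists2 T : {set G * G}, T \subset H &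
    forall k, xs T (phi I R ^~ k) = k.1 && (k.2 \in w);
  fr_deg : forall v, deg H v <= 4;
  fr_leaf : forall v, deg H v != 1;
  fr_act : forall j x, j \notin A -> ((j, x) \notin I) && ((j, x) \notin R);
  fr_coc : forall j, coc Gam (lab I R j) }.

Definition addrow I (j : G) S : {set G * G} := I :|: [set p | (p.1 == j) && (p.2 \in S)].

Lemma restr_sub H W : restr H W \subset H.
Proof. by apply/subsetP => e; rewrite inE => /andP[]. Qed.

Lemma restrS H W W' : W \subset W' -> restr H W \subset restr H W'.
Proof. by move=> /subsetP s; apply/subsetP => e; rewrite !inE => /andP[-> /andP[/s-> /s->]]. Qed.

Lemma frame0 Gam : frame Gam set0 set0 set0 set0.
Proof.
split=> //.
- exact: sub0set.
- by move=> T; rewrite subset0 => /eqP.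
- move=> w; rewrite subset0 => /eqP->; exists set0 => // -[a x]; rewrite xs0 inE andbF.
  by [].
- by move=> v; rewrite /deg (_ : [set _ in _ | _] = set0) ?cards0 //; apply/setP => e; rewrite !inE.
- by move=> v; rewrite /deg (_ : [set _ in _ | _] = set0) ?cards0 //; apply/setP => e; rewrite !inE.
- by move=> j x _; rewrite !inE.
- move=> j; have z x y : lab set0 set0 j x y = false by rewrite /lab !inE.
  by split=> *; rewrite !z.
Qed.

Lemma lab_row I R (j : G) S S' i x y :
  (forall x, ((j, x) \notin I) && ((j, x) \notin R)) ->
  lab (addrow I j S) (addrow R j S') i x y = if i == j then lam S S' x y else lab I R i x y.
Proof.
move=> h; rewrite /lab /lam !inE /=; case: eqVneq => [->|] /=; last by rewrite !orbF.
by have /andP[/negbTE-> /negbTE->] := h x; have /andP[/negbTE-> /negbTE->] := h y.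
Qed.

(** The new hole avoids the old sets I, so its edge set has zero boundary and zero old labels, and
    it is odd in the new slot: adding it realises the missing unit vector. A basis of the enlarged
    edge set restores independence without changing the span, and passing to the core loses no even
    set. *)
Lemma frame_step Gam A I R H (j : G) S S' l f : frame Gam A I R H -> j \notin A ->
  hol l f -> img l f \subset Gam -> [disjoint img l f & branch H] ->
  (forall i x, x \in img l f -> (i, x) \notin I) ->
  coc Gam (lam S S') -> zs l f (lam S S') ->
  frame Gam (j |: A) (addrow I j S) (addrow R j S')
    (core (basis (addrow I j S) (addrow R j S') (H :|: restr oedges (img l f)))).
Proof.
move=> fr jA fh fG fB fI cS oS; have [sH ind full d4 d1 act cc] := fr.
set I' := addrow I j S; set R' := addrow R j S'; set EZ := restr oedges _; set cand := H :|: EZ.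
have [sB Bind Bsp] := basisP I' R' cand; set B := basis I' R' cand in sB Bind Bsp *.
have rowj := fun x => act j x jA.
have labE i x y := lab_row S S' i x y rowj.
have candS : cand \subset restr oedges Gam.
  by rewrite subUset sH; exact: restrS.
have cando : cand \subset oedges := subset_trans candS (restr_sub _ _).
have EZo : EZ \subset oedges := restr_sub _ _.
have Bo : B \subset oedges := subset_trans sB cando.
have phi0 T v : xs T (phi I' R' ^~ (false, v)) = xs T (bnd v) by [].
have phi0' T v : xs T (phi I R ^~ (false, v)) = xs T (bnd v) by [].
have phi1 T i : T \subset H -> i != j -> xs T (phi I' R' ^~ (true, i)) = xs T (phi I R ^~ (true, i)).
  by move=> _ ij; apply: eq_xs => e _; rewrite /phi /= labE (negbTE ij).
have EZ1 i : xs EZ (phi I' R' ^~ (true, i)) = (i == j).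
  rewrite (eq_xs (w2 := fun e => (if i == j then lam S S' else lab I R i) e.1 e.2)); last first.
    by move=> e _; rewrite /phi /= labE; case: ifP.
  case: eqVneq => ij; first by rewrite (hole_xs fh) ?oS //; exact: lam_sym.
  rewrite (hole_xs fh); last by move=> x y; rewrite /lab orbC.
  rewrite /zs big1 // => k _; rewrite /lab !(negbTE (fI _ _ (in_img _ fh))); by [].
have spanw (w : {set G}) : w \subset j |: A -> exists2 T : {set G * G}, T \subset cand & forall k, xs T (phi I' R' ^~ k) = k.1 && (k.2 \in w).
  move=> sw; have [T TH TE] := full (w :\ j) ltac:(by rewrite subDset).
  have T0 v : xs T (phi I' R' ^~ (false, v)) = false by rewrite phi0 -phi0' TE.
  have T1 i : i != j -> xs T (phi I' R' ^~ (true, i)) = (i \in w).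
    by move=> ij; rewrite phi1 // TE /= in_setD1 ij.
  case: (boolP (xs T (phi I' R' ^~ (true, j)) == (j \in w))) => [/eqP h|h].
    exists T; first by apply: subset_trans TH _; exact: subsetUl.
    by case=> -[] i //=; case: (eqVneq i j) => [->|/T1].
  exists (sdiff T EZ); first by apply: sdiff_sub; [apply: subset_trans TH _; exact: subsetUl|exact: subsetUr].
  case=> -[] i; rewrite xs_sdiff /=; last by rewrite T0 phi0 hole_even.
  rewrite EZ1; case: (eqVneq i j) => [->|/T1->]; last by rewrite addbF.
  by move: h; case: (xs _ _); case: (j \in w).
split.
- exact: subset_trans (core_sub _) (subset_trans sB candS).
- by move=> T sT; apply: Bind; exact: subset_trans (core_sub _).
- move=> w /spanw[T sT TE]; have [T' sT' T'E] := Bsp _ sT; exists T'; last by move=> k; rewrite T'E TE.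
  by apply: even_core => // v; rewrite -phi0 T'E TE.
(* The hole adds degree 2 only at vertices that are not branch vertices of H, that is, of degree at
   most 2 in H. *)
- move=> v; apply: leq_trans (deg_sub v (subset_trans (core_sub _) sB)) _.
  have : deg cand v <= deg H v + deg EZ v.
    rewrite /deg; apply: leq_trans (leq_card_setU _ _); apply/subset_leq_card/subsetP => e.
    by rewrite !inE => /andP[/orP[->|->] ->]; rewrite ?orbT.
  move=> h; apply: leq_trans h _; have := hole_deg fh v; case: (boolP (v \in img l f)) => vZ /= hz.
    have : v \notin branch H by move/pred0P: fB => /(_ v) /=; rewrite vZ /= => ->.
    by rewrite inE; move: hz; rewrite -/EZ; move: (deg H v) (deg EZ v) => a b; clear; lia.
  by have := d4 v; move: hz; rewrite -/EZ; move: (deg H v) (deg EZ v) => a b; clear; lia.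
- move=> v; exact: core_leaf.
- move=> i x; rewrite !inE negb_or => /andP[ij iA] /=; rewrite (negbTE ij) /= !orbF.
  exact: act.
- move=> i; case: (eqVneq i j) => ij.
    have h x y : lab I' R' i x y = lam S S' x y by rewrite labE ij eqxx.
    by case: cS => h1 h2 h3; split=> *; rewrite !h; auto.
  have h x y : lab I' R' i x y = lab I R i x y by rewrite labE (negbTE ij).
  by case: (cc i) => h1 h2 h3; split=> *; rewrite !h; auto.
Qed.

(** By independence a nonempty even set of H is odd for one of the labels. *)
Lemma frame_holed Gam A I R H U T : frame Gam A I R H -> U \subset Gam ->
  T \subset restr H U -> even T -> T != set0 -> holed U.
Proof.
move=> [sH ind full d4 d1 act cc] UG sT eT nT.
have [j oj] : exists j, xs T (fun e => lab I R j e.1 e.2).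
  apply: Classical_Prop.NNPP => nj; case/eqP: nT; apply: ind.
    exact: subset_trans sT (restr_sub _ _).
  case=> -[] j; last exact: eT.
  by apply/negbTE/negP => o; apply: nj; exists j.
apply: (even_holed _ eT (cocS UG (cc j)) _ oj).
  by apply: subset_trans sT (subset_trans (restr_sub _ _) (subset_trans sH (restr_sub _ _))).
by move=> e /(subsetP sT); rewrite inE => /andP[].
Qed.
End EdgeSets.

(** * Packing short cycles *)

Section FirstSuccess.
Variables (G : sgraph) (P : nat -> bool).
(** For a monotone P that succeeds below #|G| this is the least success, written as a cardinality so
    that it is computed by counting. *)
Definition first_true := #|[set v : G | ~~ P (enum_rank v)]|.
Hypothesis mono : forall i j, i <= j -> P i -> P j.

Lemma first_true_min i : P i -> first_true <= i.
Proof.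
move=> Pi; case: (leqP #|G| i) => iG; first by apply: leq_trans iG; exact: max_card.
apply: (@leq_trans #|[set enum_val (widen_ord (ltnW iG) j) | j in 'I_i]|); last first.
  by apply: leq_trans (leq_imset_card _ _) _; rewrite card_ord.
apply/subset_leq_card/subsetP => v; rewrite inE => nP.
have vi : enum_rank v < i by move: nP; apply: contraR; rewrite -leqNgt => h; exact: mono h Pi.
apply/imsetP; exists (Ordinal vi) => //.
by rewrite -[LHS]enum_rankK; congr enum_val; apply: ord_inj.
Qed.

Lemma first_trueP i : i < #|G| -> P i -> P first_true.
Proof.
move=> iG Pi; apply: contraT => nP; have ti := first_true_min Pi.
have tG : first_true < #|G| := leq_ltn_trans ti iG.
have : #|[set enum_val (widen_ord tG j) | j in 'I_first_true.+1]| <= first_true.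
  apply/subset_leq_card/subsetP => v /imsetP[j _ ->]; rewrite inE enum_valK /=.
  by apply: contra nP => /(mono _); apply; rewrite -ltnS.
rewrite card_imset ?card_ord ?ltnn // => j1 j2 /enum_val_inj/(congr1 val) /= h.
exact: ord_inj.
Qed.
End FirstSuccess.

Section Levels.
Variable G : sgraph.
Implicit Types (H T F : {set G * G}) (S U W A Br : {set G}) (e : G * G) (u v x y z : G) (p q : seq G).

Definition nbhd F S := [set y | [exists x in S, adj F x y]].
Definition spr F S := S :|: nbhd F S.
Definition smooth F Br S := iter #|G| (fun S => S :|: (nbhd F S :\: Br)) S.
(** Distance measured in branch vertices: vertices of degree 2 are passed for free, since subdivided
    edges may be arbitrarily long. *)
Fixpoint lev F Br t u := if t is t'.+1 then smooth F Br (spr F (lev F Br t' u)) else smooth F Br [set u].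

Lemma smoothP F Br S x y : x \in smooth F Br S -> y \notin Br -> adj F x y -> y \in smooth F Br S.
Proof.
move=> xS yB xy; rewrite /smooth -(iter_saturated (f := fun S => S :|: (nbhd F S :\: Br)) S (fun S => subsetUl _ _) (leqnn _)).
by rewrite in_setU in_setD yB inE; apply/orP; right; apply/existsP; exists x; rewrite xy andbT.
Qed.

Lemma smooth_sub F Br S : S \subset smooth F Br S.
Proof.
rewrite /smooth; elim: #|G| => //= n IH; exact: subset_trans IH (subsetUl _ _).
Qed.

Lemma levP F Br t u y : reflect
  (exists p, [/\ path (adj F) u p, last u p = y & count (mem Br) p <= t]) (y \in lev F Br t u).
Proof.
apply: (iffP idP) => [|[p [pp <- cp]]].
  have sm S i : (forall x, x \in S -> exists p, [/\ path (adj F) u p, last u p = x & count (mem Br) p <= i]) ->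
     forall x, x \in smooth F Br S -> exists p, [/\ path (adj F) u p, last u p = x & count (mem Br) p <= i].
    move=> hS; rewrite /smooth; elim: #|G| => //= n IH x /setUP[/IH //|/setDP[]].
    rewrite inE => /existsP[z /andP[/IH[p [pp lp cp]] zx]] xB.
    exists (rcons p x); rewrite rcons_path last_rcons lp pp zx -cats1 count_cat /= (negbTE xB) !addn0.
    by split.
  elim: t y => [|t IH] y /=; apply: sm => x.
    by move/set1P->; exists [::].
  case/setUP => [/IH[p [pp lp cp]]|]; first by exists p; split=> //; exact: leqW.
  rewrite inE => /existsP[z /andP[/IH[p [pp lp cp]] zx]].
  exists (rcons p x); rewrite rcons_path last_rcons lp pp zx -cats1 count_cat /= addn0.
  by split=> //; rewrite -[t.+1]addn1 leq_add // leq_b1.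
have mono i j x : i <= j -> x \in lev F Br i u -> x \in lev F Br j u.
  move=> /subnK <-; elim: (j - i) => //= n IH h.
  by apply: (subsetP (smooth_sub _ _ _)); apply/setUP; left; exact: IH.
elim/last_ind: p t pp cp => [|p z IH] t.
  by move=> _ _; apply: (mono 0) => //; apply: (subsetP (smooth_sub _ _ _)); rewrite inE.
rewrite rcons_path last_rcons -cats1 count_cat /= addn0 => /andP[pp e].
case: (boolP (z \in Br)) => zB /=; last first.
  rewrite addn0 => /(IH _ pp) h; case: t h => [|t] h; exact: smoothP h zB e.
rewrite addn1; case: t => // t /(IH _ pp) h /=; apply: (subsetP (smooth_sub _ _ _)).
by apply/setUP; right; rewrite inE; apply/existsP; exists (last u p); rewrite h.
Qed.

Lemma path_adj_sub F F' x p : F \subset F' -> path (adj F) x p -> path (adj F') x p.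
Proof. by move=> s; apply: sub_path => a b; exact: adj_sub. Qed.

(** A closed walk in U that uses e once, with at most t branch vertices besides its starting point
    [e.1]. *)
Definition cyc F Br t U := [exists e in restr F U, e.2 \in lev (restr F U :\ e) Br t e.1].

Lemma cycP F Br t U : reflect (exists e p, [/\ e \in restr F U, path (adj (restr F U :\ e)) e.1 p,
   last e.1 p = e.2 & count (mem Br) p <= t]) (cyc F Br t U).
Proof.
apply: (iffP existsP) => [[e /andP[eF /levP[p [h1 h2 h3]]]]|[e [p [h1 h2 h3 h4]]]].
  by exists e, p.
by exists e; rewrite h1; apply/levP; exists p.
Qed.

Lemma cyc_mono F Br t t' U U' : t <= t' -> U \subset U' -> cyc F Br t U -> cyc F Br t' U'.
Proof.
move=> tt' UU' /cycP[e [p [h1 h2 h3 h4]]]; apply/cycP; have s := restrS F UU'.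
exists e, p; split=> //; [exact: (subsetP s)|by apply: path_adj_sub h2; exact: setSD|exact: leq_trans tt'].
Qed.

Lemma path_restr F U x p : path (adj (restr F U)) x p -> {subset p <= U}.
Proof.
elim: p x => //= y p IH x /andP[xy /IH h] z; rewrite inE => /predU1P[->|/h //].
by move: xy; rewrite /adj !inE /= => /orP[]/and3P[].
Qed.

Lemma min_cyc F Br t U : cyc F Br t U -> (forall U', U' \subset U -> cyc F Br t U' -> U' = U) ->
  exists e p, [/\ e \in restr F U, path (adj (restr F U :\ e)) e.1 p, last e.1 p = e.2 &
    count (mem Br) p <= t /\ U = [set x in e.1 :: p]].
Proof.
move=> /cycP[e [p [h1 h2 h3 h4]]] mn.
exists e, p; split=> //; split=> //; symmetry; apply: mn.
  apply/subsetP => x; rewrite !inE => /predU1P[->|]; first by move: h1; rewrite inE => /and3P[].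
  by apply: (path_restr (path_adj_sub _ h2)); exact: subsetDl.
apply/cycP; exists e, p; split=> //.
  by move: h1; rewrite !inE eqxx -h3 => /and3P[-> _ _] /=; have := mem_last e.1 p; rewrite inE.
set U' := [set x in e.1 :: p].
have : all (mem U') (e.1 :: p) by apply/allP => x xp; change (x \in U'); rewrite in_set.
clearbody U'; elim: p (e.1) h2 {h3 h4} => //= y p IH x /andP[xy pp] /and3P[xU yU aU].
rewrite IH //= ?yU // andbT; move: xy; rewrite /adj !in_setD1 !inE /= => /orP[]/and4P[-> -> _ _] /=.
  by rewrite xU yU.
by rewrite xU yU orbT.
Qed.

Lemma path_bnd F x p : path (adj F) x p -> exists2 T : {set G * G}, T \subset F &
  forall v, xs T (bnd v) = (v == x) (+) (v == last x p).
Proof.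
elim: p x => [|y p IH] x /=.
  by move=> _; exists set0; rewrite ?sub0set // => v; rewrite xs0 addbb.
move=> /andP[xy /IH[T sT TE]].
have [f fF fE] : exists2 f, f \in F & forall v, bnd v f = (v == x) (+) (v == y).
  by case/orP: xy => h; [exists (x, y)|exists (y, x)] => // v; rewrite /bnd /= addbC.
exists (sdiff [set f] T); first by apply: sdiff_sub => //; rewrite sub1set.
by move=> v; rewrite xs_sdiff xs1 fE TE -addbA addKb.
Qed.

Lemma cyc_even F U e p : e \in restr F U -> path (adj (restr F U :\ e)) e.1 p -> last e.1 p = e.2 ->
  exists T, [/\ T \subset restr F U, even T & T != set0].
Proof.
move=> eF /path_bnd[T sT TE] lp; have eT : e \notin T by apply/negP => /(subsetP sT); rewrite !inE eqxx.
exists (e |: T); split.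
- by rewrite subUset sub1set eF; apply: subset_trans sT (subsetDl _ _).
- by move=> v; rewrite xsU1 // TE lp addbb.
- by apply/set0Pn; exists e; exact: setU11.
Qed.

Lemma adj_connect_sym F x y : connect (adj F) x y = connect (adj F) y x.
Proof. by apply: sym_connect_sym => a b; exact: adjC. Qed.

(** At a vertex of U where T has an edge, F has degree at most 2, so T contains all edges of F
    there. Hence T would spread along the whole cycle and contain e. *)
Lemma even_avoid F U e p T : F \subset @oedges G -> e \in restr F U -> path (adj (restr F U :\ e)) e.1 p ->
  U = [set x in e.1 :: p] -> T \subset F -> even T -> e \notin T ->
  (forall f b, f \in T -> b \in U -> b \in branch F -> ~~ inc b f) ->
  forall f x, f \in T -> x \in U -> ~~ inc x f.
Proof.
move=> Fo eF pp UE TF eT neT nb f x fT xU; apply/negP => xf.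
have full z g : z \in U -> (exists2 f, f \in T & inc z f) -> g \in F -> inc z g -> g \in T.
  move=> zU [f' fT' zf'] gF zg.
  have zB : z \notin branch F by apply: contraL zf'; exact: nb.
  rewrite inE -ltnNge ltnS in zB.
  have := even_deg z (subset_trans TF Fo) eT; have sd := deg_sub z TF.
  have d0 : 0 < deg T z by apply/card_gt0P; exists f'; rewrite inE fT'.
  move=> od; have dT : deg F z <= deg T z.
    by apply: leq_trans zB _; case: (deg T z) d0 od => [|[|]].
  have : [set e in T | inc z e] == [set e in F | inc z e].
    rewrite eqEcard dT andbT; apply/subsetP => i; rewrite !inE => /andP[/(subsetP TF)-> ->].
    by [].
  by move=> /eqP/setP/(_ g); rewrite !inE gF zg andbT => ->.
have clos z w : z \in U -> adj (restr F U) z w -> (exists2 f, f \in T & inc z f) -> w \in U /\ exists2 f, f \in T & inc w f.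
  move=> zU zw ex; have [g [gF zg wg]] : exists g, [/\ g \in restr F U, inc z g & inc w g].
    by case/orP: zw => h; [exists (z, w)|exists (w, z)]; split=> //; rewrite /inc /= eqxx ?orbT.
  move: (gF); rewrite inE => /and3P[gF' g1 g2]; split; last by exists g => //; exact: (full z).
  by case/orP: wg => /eqP->.
have : connect (adj (restr F U)) x e.1.
  rewrite adj_connect_sym; rewrite UE inE in xU; have pp' := path_adj_sub (subsetDl _ _) pp.
  by apply: path_connect pp' _ _.
case/connectP => q pq eq; suff : (exists2 f, f \in T & inc e.1 f).
  move=> ex; case/negP: neT; apply: (full e.1) => //; last by rewrite /inc eqxx.
    by move: eF; rewrite inE => /and3P[].
  by move: eF; rewrite inE => /and3P[].
have : exists2 f, f \in T & inc x f by exists f.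
elim: q x xU pq eq {xf} => [|y q IH] x xU /=; first by move=> _ ->.
by move=> /andP[xy pq] eq ex; have [yU ey] := clos _ _ xU xy ex; apply: (IH y).
Qed.

Definition evens F W := [set T : {set G * G} | (T \subset restr F W) && [forall v, ~~ xs T (bnd v)]].

Lemma evensP F W (T : {set G * G}) : reflect (T \subset restr F W /\ even T) (T \in evens F W).
Proof.
rewrite inE; apply: (iffP andP) => -[-> h]; split=> //.
  by move=> v; apply/negbTE; move/forallP: h.
by apply/forallP => v; rewrite h.
Qed.

(** Group the even sets by their trace on E. Adding a fixed member maps a group injectively into the
    even sets that avoid E, and there are at most 2^|E| traces. *)
Lemma card_evens_delete F W (E : {set G * G}) W' :
  (forall T, T \in evens F W -> T :&: E = set0 -> T \in evens F W') ->
  #|evens F W| <= 2 ^ #|E| * #|evens F W'|.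
Proof.
move=> h; rewrite -card_powerset -sum1_card (partition_big (fun T => T :&: E) (mem (powerset E))) /=; last first.
  by move=> T _; rewrite inE; exact: subsetIr.
rewrite -sum_nat_const; apply: leq_sum => Q _; rewrite sum1dep_card.
case: (set_0Vmem [set T in evens F W | T :&: E == Q]) => [->|[T0]]; first by rewrite cards0.
rewrite inE => /andP[/evensP[s0 e0] /eqP Q0].
have inj : injective (sdiff T0).
  by move=> T1 T2 /setP E12; apply/setP => i; have := E12 i; rewrite !in_sdiff => /addbI.
rewrite -(card_imset _ inj); apply/subset_leq_card/subsetP => T' /imsetP[T].
rewrite inE => /andP[/evensP[s1 e1] /eqP Q1] ->; apply: h.
  by apply/evensP; split; [exact: sdiff_sub|exact: even_sdiff].
apply/setP => i; rewrite in_setI in_sdiff inE.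
have := erefl (i \in Q); rewrite -{1}Q0 -Q1 !in_setI.
by case: (i \in E); rewrite ?andbF // !andbT => ->; rewrite addbb.
Qed.

Lemma card_inc_le H S d : (forall v, deg H v <= d) ->
  #|[set f in H | [exists b in S, inc b f]]| <= d * #|S|.
Proof.
move=> hd; have [n] := ubnP #|S|; elim: n S => // n IH S cS.
case: (set_0Vmem S) => [->|[b bS]].
  rewrite cards0 muln0 leqn0 cards_eq0; apply/eqP/setP => f; rewrite !inE; apply/negbTE/negP.
  by move=> /andP[_ /existsP[b]]; rewrite inE.
have : #|S| = #|S :\ b|.+1 by rewrite (cardsD1 b) bS.
move=> cE; rewrite cE mulnS; apply: leq_trans (leq_add (hd b) (IH (S :\ b) _)); last by rewrite -ltnS -cE.
apply: leq_trans (leq_card_setU _ _); apply/subset_leq_card/subsetP => f; rewrite !inE.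
move=> /andP[-> /existsP[c /andP[cS' cf]]] /=; case: (eqVneq c b) => [<-|cb]; first by rewrite cf.
by apply/orP; right; apply/existsP; exists c; rewrite in_setD1 cb cS'.
Qed.
End Levels.

(** * A Moore bound that counts branch vertices only *)

Section Moore.
Variable G : sgraph.
Implicit Types (H T F : {set G * G}) (S U W A : {set G}) (e f : G * G) (u v x y z : G) (p q w : seq G).
Variables (F : {set G * G}) (s : nat).
Hypothesis Fo : F \subset oedges G.
Hypothesis Fl : forall v, deg F v != 1.
Let Br := branch F.
Hypothesis noc : ~~ cyc F Br s.*2 setT.

Lemma rev_adj T u p : path (adj T) u p -> path (adj T) (last u p) (rev (belast u p)).
Proof. by rewrite rev_path => pp; rewrite (eq_path (e' := adj T)) // => a b; exact: adjC. Qed.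

Lemma count_rev_belast (a : pred G) u p : count a (last u p :: rev (belast u p)) = count a (u :: p).
Proof.
by rewrite -(count_rev a (u :: p)) [in RHS]lastI rev_rcons.
Qed.

Lemma no_short f x y w : f \in F -> f = (x, y) \/ f = (y, x) -> path (adj (F :\ f)) x w -> last x w = y ->
  s.*2 < count (mem Br) (x :: w).
Proof.
move=> fF fE pw lw; rewrite ltnNge; apply/negP => cw; case/negP: noc; apply/cycP.
have rT : restr F setT = F by apply/setP => e; rewrite !inE !andbT.
rewrite rT; exists f; case: fE => fE.
  have [f1 f2] : f.1 = x /\ f.2 = y by rewrite fE.
  exists w; rewrite fF f1 f2; split=> //.
  by apply: leq_trans cw; rewrite /= leq_addl.
have [f1 f2] : f.1 = y /\ f.2 = x by rewrite fE.
exists (rev (belast x w)); rewrite f1 f2; split=> //.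
- by rewrite -lw; exact: rev_adj.
- by rewrite -lw; case: (w) => //= z w'; rewrite rev_cons last_rcons.
- by apply: leq_trans cw; rewrite -count_rev_belast /= leq_addl.
Qed.

(** T connects A with fewer edges than vertices, so it acts as a spanning tree rooted at u of branch
    depth i. *)
Let near u i A T := [/\ u \in A, T \subset restr F A, #|T| < #|A| &
  forall x, x \in A -> exists p, [/\ path (adj T) u p, last u p = x & count (mem Br) p <= i]].

Lemma near_join u i A T x y T' : near u i A T -> T \subset T' -> x \in A -> y \in A ->
  exists w, [/\ path (adj T') x w, last x w = y & count (mem Br) (x :: w) <= i.*2.+1].
Proof.
move=> [uA TA cT pT] TT' /pT[p [pp lp cp]] /pT[q [pq lq cq]].
exists (rev (belast u p) ++ q).
have lr : last x (rev (belast u p)) = u.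
  rewrite -lp; case: (p) => //= z p'; by rewrite rev_cons last_rcons.
rewrite cat_path last_cat lr lq -{1}lp; split=> //.
  by apply/andP; split; [apply: path_adj_sub TT' (rev_adj pp)|exact: path_adj_sub TT' pq].
rewrite -cat_cons count_cat -{1}lp count_rev_belast /=.
by move: (leq_b1 (u \in Br)) cp cq; rewrite /in_mem /=; clear; lia.
Qed.

Lemma near_add u i A T x y p : near u i A T -> x \in A -> y \notin A -> adj F x y ->
  path (adj T) u p -> last u p = x -> count (mem Br) p + (y \in Br) <= i ->
  exists2 g, T \subset g |: T & near u i (y |: A) (g |: T).
Proof.
move=> [uA TA cT pT] xA yA xy pp lp cp.
have [g gF gE] : exists2 g, g \in F & g = (x, y) \/ g = (y, x).
  by case/orP: xy => h; [exists (x, y)|exists (y, x)] => //; [left|right].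
have gT : g \notin T.
  apply: contra yA => /(subsetP TA); rewrite inE => /and3P[_].
  by case: gE => ->.
have sub : T \subset g |: T by exact: subsetUr.
exists g => //; split.
- exact: setU1r.
- rewrite subUset sub1set; apply/andP; split; last by apply: subset_trans TA (restrS _ (subsetUr _ _)).
  by rewrite inE gF; case: gE => ->; rewrite /= !inE eqxx xA ?orbT.
- by rewrite !cardsU1 gT yA !add1n ltnS.
- move=> z /setU1P[->|/pT[q [pq lq cq]]]; last first.
    by exists q; split=> //; exact: path_adj_sub pq.
  exists (rcons p y).
  rewrite rcons_path last_rcons lp (path_adj_sub sub pp) -cats1 count_cat /= addn0; split=> //.
  by rewrite /adj; case: gE => <-; rewrite setU11 ?orbT.
Qed.

Lemma near_closed u i A T : near u i A T -> exists A' T', [/\ near u i A' T', A \subset A' &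
  forall x y, x \in A' -> y \notin Br -> adj F x y -> y \in A'].
Proof.
have [n] := ubnP #|~: A|; elim: n A T => // n IH A T cA nA.
case: (boolP [exists x in A, exists y in ~: A, (y \notin Br) && adj F x y]) => [|h]; last first.
  exists A, T; split=> // x y xA yB xy; apply: contraR h => yA.
  apply/existsP; exists x; rewrite xA; apply/existsP; exists y; by rewrite inE yA yB.
case/existsP => x /andP[xA /existsP[y /and3P[]]]; rewrite inE => yA yB xy.
have [p [pp lp cp]] : exists p, [/\ path (adj T) u p, last u p = x & count (mem Br) p <= i].
  by case: nA => _ _ _; apply.
have [|g _ nA'] := near_add nA xA yA xy pp lp; first by rewrite (negbTE yB) addn0.
have [|A' [T' [h1 h2 h3]]] := IH (y |: A) (g |: T) _ nA'.
  rewrite ltnS in cA; apply: leq_trans cA; apply: proper_card; apply/properP; split.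
    by rewrite setCS subsetUr.
  by exists y; rewrite !inE ?yA // eqxx.
exists A', T'; split=> //; exact: subset_trans (subsetUr _ _) h2.
Qed.

Lemma near_all u i A T S : near u i A T -> [disjoint A & S] ->
  (forall y, y \in S -> exists2 x, x \in A & adj F x y) ->
  exists2 T' : {set G * G}, T \subset T' & near u i.+1 (A :|: S) T'.
Proof.
move=> nA; have [n] := ubnP #|S|; elim: n S => // n IH S cS dS hS.
case: (set_0Vmem S) => [->|[y yS]].
  rewrite setU0; exists T => //; case: nA => h1 h2 h3 h4; split=> // x /h4[p [a b c]].
  by exists p; split=> //; exact: leqW.
have [||z zS|T' TT' nT'] := IH (S :\ y).
- by move: cS; rewrite (cardsD1 y) yS.
- by apply: disjointWr dS; exact: subsetDl.
- by apply: hS; move: zS; rewrite in_setD1 => /andP[].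
have [x xA xy] := hS _ yS.
have yA : y \notin A by apply/negP => yA; move/pred0P: dS => /(_ y); rewrite /= yA yS.
have [p [pp lp cp]] : exists p, [/\ path (adj T) u p, last u p = x & count (mem Br) p <= i].
  by case: nA => _ _ _; apply.
have yA' : y \notin A :|: S :\ y by rewrite !inE eqxx negb_or yA.
have xA' : x \in A :|: S :\ y by rewrite inE xA.
have [|g sg ng] := near_add nT' xA' yA' xy (path_adj_sub TT' pp) lp.
  by rewrite -[i.+1]addn1 leq_add // leq_b1.
exists (g |: T'); first exact: subset_trans sg.
have -> : A :|: S = y |: (A :|: S :\ y) by rewrite setUCA setD1K.
exact: ng.
Qed.

(** Let b be the number of branch vertices in A. All edges inside A belong to T, else there is a
    short cycle; so there are at most |A| - 1 of them, while the degrees sum to at least 2|A| + b.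
    Thus b + 2 edges leave A, and their outer ends are distinct branch vertices, again because short
    cycles are absent. *)
Lemma near_grow u i A T : i < s -> near u i A T ->
  (forall x y, x \in A -> y \notin Br -> adj F x y -> y \in A) -> 1 < deg F u ->
  exists A' T', [/\ near u i.+1 A' T', (#|Br :&: A|).*2 + 2 <= #|Br :&: A'| &
    forall x y, x \in A' -> y \notin Br -> adj F x y -> y \in A'].
Proof.
move=> lis nA clA du; have [uA TA cT pT] := nA.
pose S := [set y in ~: A | [exists x in A, adj F x y]].
have SP y : y \in S -> exists2 x, x \in A & adj F x y.
  by rewrite inE => /andP[_ /existsP[x /andP[xA xy]]]; exists x.
have dS : [disjoint A & S] by apply/pred0P => y /=; rewrite !inE; case: (y \in A).
have SB : S \subset Br.
  apply/subsetP => y yS; apply: contraT => yB; have [x xA xy] := SP _ yS.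
  by move: yS; rewrite !inE (clA x y xA yB xy).
have [T1 TT1 n1] := near_all nA dS SP.
have [A' [T' [n2 A1 cl2]]] := near_closed n1.
exists A', T'; split=> //.
pose inner := restr F A; pose bd := [set e in F | (e.1 \in A) (+) (e.2 \in A)].
have innT : inner \subset T.
  apply/subsetP => f; rewrite inE => /and3P[fF f1 f2]; apply: contraT => fT.
  have sT : T \subset F :\ f.
    by rewrite subsetD1 fT andbT; exact: subset_trans TA (restr_sub _ _).
  have [w [pw lw cw]] := near_join nA sT f1 f2.
  have := no_short fF (or_introl (surjective_pairing f)) pw lw.
  by move: cw lis; clear; lia.
have dA x : x \in A -> 2 + (x \in Br) <= deg F x.
  move=> xA; have : 0 < deg F x.
    case: (eqVneq x u) => [->|xu]; first exact: ltnW.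
    have [p [pp lp _]] := pT _ xA; case/lastP: p pp lp => [|p z] /=; first by move=> _ E; rewrite E eqxx in xu.
    rewrite rcons_path last_rcons => /andP[_ e] zx; rewrite zx in e.
    case/orP: e => /(subsetP TA); rewrite inE => /and3P[h _ _]; apply/card_gt0P.
      by exists (last u p, x); rewrite inE h /inc eqxx orbT.
    by exists (x, last u p); rewrite inE h /inc eqxx.
  have := Fl x; rewrite /Br inE; by case: (deg F x) => [|[|[|d]]].
have sumd : \sum_(x in A) deg F x = (#|inner|).*2 + #|bd|.
  under eq_bigr do rewrite /deg -sum1dep_card.
  rewrite (exchange_big_dep (mem F)) /=; last by move=> x f _ /andP[].
  have -> : (#|inner|).*2 + #|bd| = \sum_(f in F) ((f.1 \in A) + (f.2 \in A)).
    rewrite -!sum1_card -mul2n big_distrr /= [X in X + _]big_mkcond [X in _ + X]big_mkcond -big_split /=.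
    rewrite [RHS]big_mkcond; apply: eq_bigr => f _; rewrite !inE.
    by case: (f \in F) => //=; case: (f.1 \in A); case: (f.2 \in A).
  apply: eq_bigr => f fF; have [_ ne] := oedgeP (subsetP Fo _ fF).
  rewrite sum1dep_card; have -> : [set x in A | (f \in F) && inc x f] = A :&: [set f.1; f.2].
    by apply/setP => x; rewrite !inE fF.
  rewrite -sum1_card big_mkcond (bigD1 f.1) //= (bigD1 f.2) 1?eq_sym //= big1.
    by rewrite !inE !eqxx orbT !andbT addn0; case: (f.1 \in A); case: (f.2 \in A).
  by move=> x /andP[h1 h2]; rewrite !inE (negbTE h1) (negbTE h2) andbF.
have low : (#|A|).*2 + #|Br :&: A| <= \sum_(x in A) deg F x.
  apply: leq_trans (_ : \sum_(x in A) (2 + (x \in Br)) <= _); last exact: leq_sum.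
  rewrite big_split /= sum_nat_const muln2 leq_add2l -sum1_card [X in X <= _]big_mkcond [X in _ <= X]big_mkcond /=.
  apply: eq_leq; apply: eq_bigr => x _; rewrite inE; by case: (x \in A); case: (x \in Br).
have ci := subset_leq_card innT.
have cb : #|bd| <= #|S|.
  pose o f := if f.1 \in A then f.2 else f.1.
  pose h f := if f.1 \in A then f.1 else f.2.
  have bdP f : f \in bd -> [/\ f \in F, h f \in A, o f \notin A & f = (h f, o f) \/ f = (o f, h f)].
    rewrite inE /h /o => /andP[fF]; case: (boolP (f.1 \in A)) => /= f1 f2; split=> //; rewrite -?surjective_pairing; auto.
  have hin f : f \in bd -> adj F (h f) (o f).
    by move=> /bdP[fF _ _ fE]; rewrite /adj; case: fE => <-; rewrite fF ?orbT.
  rewrite -(card_in_imset (f := o) (D := mem bd)) => [|f f' fb f'b E].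
    apply/subset_leq_card/subsetP => y /imsetP[f fb ->]; rewrite !inE; have [_ h1 -> _] := bdP _ fb.
    by apply/existsP; exists (h f); rewrite h1 hin.
  apply/eqP; apply: contraT => ne.
  have [fF hA oA fE] := bdP _ fb; have [f'F h'A o'A f'E] := bdP _ f'b.
  have sT : T \subset F :\ f.
    rewrite subsetD1; apply/andP; split; first exact: subset_trans TA (restr_sub _ _).
    apply: contra oA => /(subsetP TA); rewrite inE => /and3P[_].
    by case: fE => {1 2}->.
  have [w [pw lw cw]] := near_join nA sT hA h'A.
  have : s.*2 < count (mem Br) (h f :: rcons w (o f)).
    apply: (no_short (y := o f) fF fE); last by rewrite last_rcons.
    have ff' : f' \in F :\ f by rewrite in_setD1 eq_sym ne.
    rewrite rcons_path pw lw /= E /adj.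
    by move: ff'; case: f'E => {1}-> ->; rewrite ?orbT.
  rewrite -rcons_cons -cats1 count_cat /= addn0.
  by move: (leq_b1 (o f \in Br)) cw lis; rewrite /in_mem /=; clear; lia.
have : #|Br :&: A| + #|S| <= #|Br :&: A'|.
  rewrite -cardsUI; have -> : Br :&: A :&: S = set0.
    by apply/setP => x; rewrite !inE; case: (x \in A); rewrite ?andbF.
  rewrite cards0 addn0; apply/subset_leq_card/subsetP => x; rewrite !in_setU !in_setI.
  case/orP => [/andP[-> xA]|xS]; first by rewrite (subsetP A1) // inE xA.
  by rewrite (subsetP SB) // (subsetP A1) // inE xS orbT.
by move: low sumd ci cT cb; clear; lia.
Qed.

(** Each growth step takes b to at least 2b + 2, that is, doubles b + 2. *)
Lemma moore : F != set0 -> 2 ^ s.+1 <= #|Br| + 2.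
Proof.
case/set0Pn => e eF; pose u := e.1.
have du : 1 < deg F u.
  have : 0 < deg F u by apply/card_gt0P; exists e; rewrite inE eF /inc eqxx.
  by have := Fl u; case: (deg F u) => [|[|]].
have n0 : near u 0 [set u] set0.
  split; [exact: set11|exact: sub0set|by rewrite cards0 cards1|].
  by move=> x /set1P->; exists [::].
have [A0 [T0 [h1 _ h3]]] := near_closed n0.
suff h i : i <= s -> exists A T, [/\ near u i A T, 2 ^ i.+1 <= #|Br :&: A| + 2 &
    forall x y, x \in A -> y \notin Br -> adj F x y -> y \in A].
  have [A [T [_ hs _]]] := h s (leqnn s); apply: leq_trans hs _; rewrite leq_add2r.
  by apply/subset_leq_card; exact: subsetIl.
elim: i => [_|i IH lis]; first by exists A0, T0; split=> //; rewrite expn1 leq_addl.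
have [A [T [nA cA clA]]] := IH (ltnW lis).
have [A' [T' [n' c' cl']]] := near_grow lis nA clA du.
exists A', T'; split=> //; rewrite expnS mul2n; move: cA c'.
by move: (2 ^ i.+1) #|Br :&: A| #|Br :&: A'| => a b c; clear; lia.
Qed.
End Moore.

Section Pack.
Variable G : sgraph.
Hypothesis c4 : C4_free G.
Implicit Types (I R H T F : {set G * G}) (S U W A : {set G}) (e f : G * G) (u v x y z : G) (p q w : seq G).

Definition shortest_cycle F W :=
  gmin (cyc F (branch F) (first_true G (fun t => cyc F (branch F) t W))) W.
Definition pack_step H k (st : {set G} * {ffun G -> nat} * nat) :=
  let F := core (restr H st.1.1) in
  if (st.2 < k) && (F != set0) then
    let U := shortest_cycle F st.1.1 in (st.1.1 :\: U, addf st.1.2 st.2 U, st.2.+1)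
  else st.
Definition pack H k := foldl (fun st (_ : G) => pack_step H k st) (setT, [ffun=> 0], 0) (enum G).

Lemma core_restr_sub H W : core (restr H W) \subset restr (core (restr H W)) W.
Proof.
apply/subsetP => e eF; have := subsetP (core_sub _) _ eF; rewrite !inE eF.
by case/and3P => _ -> ->.
Qed.

Lemma shortest_cycleP F W t : F \subset oedges G -> F \subset restr F W -> (forall v, deg F v != 1) ->
  F != set0 -> #|branch F| + 2 < 2 ^ t.+1 ->
  exists e p, let U := shortest_cycle F W in
    [/\ e \in restr F U, path (adj (restr F U :\ e)) e.1 p, last e.1 p = e.2 &
     [/\ count (mem (branch F)) p <= t.*2, U = [set x in e.1 :: p] & U \subset W]].
Proof.
move=> Fo FW Fl F0 ct; set Br := branch F.
pose P i := cyc F Br i W.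
have rW : restr F W = F by apply/eqP; rewrite eqEsubset restr_sub.
have rT : restr F setT = F by apply/setP => e; rewrite !inE !andbT.
have Pt : P t.*2.
  rewrite /P /cyc rW; have : cyc F Br t.*2 setT.
    by apply: contraLR ct => noc; rewrite -leqNgt; exact: moore.
  by rewrite /cyc rT.
have mono i j : i <= j -> P i -> P j by move=> ij; exact: cyc_mono.
have G0 : 0 < #|G| by case/set0Pn: F0 => e _; apply/card_gt0P; exists e.1.
(* [first_true] needs a success below #|G|; it is provided by a path without repetitions. *)
have Pn : P #|G|.-1.
  case/cycP: Pt => e [p [h1 h2 h3 _]].
  case/shortenP: h2 h3 => q pq uq _ lq.
  apply/cycP; exists e, q; split=> //; apply: leq_trans (count_size _ _) _.
  rewrite -ltnS prednK // -[(size q).+1]/(size (e.1 :: q)) -(card_uniqP uq); exact: max_card.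
have Pf : P (first_true G P) by apply: (first_trueP mono _ Pn); rewrite prednK.
have mU U U' : U \subset U' -> cyc F Br (first_true G P) U -> cyc F Br (first_true G P) U'.
  exact: cyc_mono.
have [g1 g2 g3] := gminP mU Pf.
have [e [p [h1 h2 h3 [h4 h5]]]] := min_cyc g1 g3.
exists e, p; split=> //; split=> //.
by apply: leq_trans h4 _; exact: (first_true_min G mono Pt).
Qed.

(** The cycle U has at most 2t + 1 branch vertices, each of degree at most 4. An even set that
    avoids their edges and e avoids U altogether, so forbidding 4(2t + 1) + 1 edges accounts for the
    deletion of U. *)
Lemma evens_step Gam A I R H W t : frame Gam A I R H -> core (restr H W) != set0 ->
  (#|A|).*2 + 2 < 2 ^ t.+1 -> let U := shortest_cycle (core (restr H W)) W in
  [/\ holed U, U \subset W & #|evens H W| <= 2 ^ (4 * (t.*2).+1).+1 * #|evens H (W :\: U)|].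
Proof.
move=> fr F0 ct U; have [sH ind full d4 d1 act cc] := fr; set F := core _ in F0 U *.
have FH : F \subset restr H W := core_sub _.
have FH' : F \subset H := subset_trans FH (restr_sub _ _).
have HG : H \subset oedges G := subset_trans sH (restr_sub _ _).
have Fo : F \subset oedges G := subset_trans FH' HG.
have bF : #|branch F| <= (#|A|).*2.
  apply: (card_branch (I := I) (R := R) Fo (core_leaf _)).
    by move=> j x jA; case/andP: (act j x jA).
  by move=> T sT; apply: ind; exact: subset_trans FH'.
have ct' : #|branch F| + 2 < 2 ^ t.+1.
  by apply: leq_ltn_trans ct; rewrite leq_add2r.
have [e [p [h1 h2 h3 [h4 h5 h6]]]] := shortest_cycleP Fo (core_restr_sub _ _) (core_leaf _) F0 ct'.
rewrite -/U in h1 h2 h5 h6; split=> //.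
  have [T [sT eT T0]] := cyc_even h1 h2 h3.
  have UG : U \subset Gam.
    have eG g : g \in F -> (g.1 \in Gam) && (g.2 \in Gam).
      by move=> /(subsetP FH')/(subsetP sH); rewrite inE => /andP[].
    rewrite h5; apply/subsetP => x; rewrite inE in_cons => /predU1P[->|xp].
      by move: h1; rewrite inE => /andP[/eG/andP[]].
    elim: (p) (e.1) h2 xp => //= y q IH z /andP[zy pq]; rewrite in_cons => /predU1P[->|]; last exact: IH pq.
    by case/orP: zy; rewrite !inE => /andP[_ /andP[/eG/andP[h7 h8]]].
  apply: (frame_holed c4 fr UG _ eT T0); apply: subset_trans sT _.
  by apply/subsetP => g; rewrite !inE => /andP[/(subsetP FH') -> ->].
pose E := e |: [set f in F | [exists b in U :&: branch F, inc b f]].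
have cE : #|E| <= (4 * (t.*2).+1).+1.
  rewrite cardsU1; apply: leq_trans (leq_add (leq_b1 _) (card_inc_le _ (d := 4) _)) _.
    by move=> v; exact: leq_trans (deg_sub v FH') (d4 v).
  rewrite add1n ltnS leq_mul2l /=.
  have : #|U :&: branch F| <= #|[set x in filter (mem (branch F)) (e.1 :: p)]|.
    apply/subset_leq_card/subsetP => x /setIP[xU xB]; rewrite inE mem_filter.
    by rewrite h5 inE in xU; apply/andP.
  move=> h; apply: leq_trans h _; rewrite cardsE; apply: leq_trans (card_size _) _.
  rewrite size_filter /=; move: h4 (leq_b1 (e.1 \in branch F)); rewrite /in_mem /=; clear; lia.
apply: leq_trans (card_evens_delete (E := E) (W' := W :\: U) _) _; last first.
  by rewrite leq_mul2r leq_exp2l // cE orbT.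
move=> T /evensP[sT eT] /setP TE; apply/evensP; split=> //.
have TF : T \subset F by apply: even_core => //; exact: subset_trans (restr_sub _ _) HG.
have nT f : f \in T -> f \notin E by move=> fT; have := TE f; rewrite in_setI fT in_set0 /= => ->.
have av := even_avoid Fo h1 h2 h5 TF eT.
apply/subsetP => f fT; have := subsetP sT _ fT; rewrite !inE => /and3P[-> -> ->].
have /av {}av : e \notin T by apply/negP => /nT; rewrite setU11.
have {}av : forall f x, f \in T -> x \in U -> ~~ inc x f.
  apply: av => f' b f'T bU bB; apply/negP => bf; have := nT _ f'T; rewrite in_setU1 negb_or => /andP[_].
  rewrite inE (subsetP TF _ f'T) /= => /negP; apply; apply/existsP; exists b.
  by rewrite in_setI bU bB.
rewrite !andbT /=; apply/andP; split; apply/negP => xU; have := av _ _ fT xU;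
  by rewrite /inc eqxx ?orbT.
Qed.

(* Short cycles meet few branch vertices, so a nonzero even set survives their
   deletion and contains the next one. *)
Lemma packP Gam A I R H k t : frame Gam A I R H -> (#|A|).*2 + 2 < 2 ^ t.+1 -> k <= #|G| ->
  k * (4 * (t.*2).+1).+1 <= #|A| -> (pack H k).2 = k /\ famok (pack H k).1.2 k.
Proof.
move=> fr ct kG kA; have [sH ind full d4 d1 act cc] := fr; set s := (4 * _).+1 in kA.
have HG : H \subset oedges G := subset_trans sH (restr_sub _ _).
(* By [fr_full] every subset of A is the label vector of an even set. *)
have e0 : 2 ^ #|A| <= #|evens H setT|.
  rewrite -card_powerset.
  have ex (w : {set G}) : exists T : {set G * G}, (w \subset A) ==> (T \subset H) && [forall q, xs T (phi I R ^~ q) == q.1 && (q.2 \in w)].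
    case: (boolP (w \subset A)) => [/full[T sT TE]|_]; last by exists set0.
    by exists T; rewrite sT /=; apply/forallP => q; apply/eqP.
  pose h (w : {set G}) := xchoose (ex w).
  have hP (w : {set G}) : w \subset A -> h w \subset H /\ forall b : bool * G, xs (h w) (phi I R ^~ b) = b.1 && (b.2 \in w).
    by move=> wA; have /implyP/(_ wA)/andP[-> /forallP h'] := xchooseP (ex w); split=> // b; apply/eqP.
  rewrite -(card_in_imset (f := h) (D := mem (powerset A))) => [|w1 w2].
    apply/subset_leq_card/subsetP => T /imsetP[w]; rewrite inE => wA ->; have [h1 h2] := hP _ wA.
    apply/evensP; split; last by move=> v; exact: (h2 (false, v)).
    by apply/subsetP => f /(subsetP h1) fH; rewrite !inE fH.
  rewrite !inE => /hP[_ h1] /hP[_ h2] E; apply/setP => j.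
  by have := h1 (true, j); rewrite E h2.
pose inv i (st : {set G} * {ffun G -> nat} * nat) := [/\ st.2 = minn i k, famok st.1.2 st.2,
  forall x, x \in st.1.1 -> st.1.2 x = 0 & 2 ^ #|A| <= 2 ^ (st.2 * s) * #|evens H st.1.1|].
have fold l st i : inv i st -> inv (i + size l) (foldl (fun st (_ : G) => pack_step H k st) st l).
  elim: l st i => [|x l IH] st i /= h; first by rewrite addn0.
  rewrite addnS -addSn; apply: IH; case: st h => -[W fam] q [/= qE fo f0 ev].
  rewrite /pack_step /=; case: (ltnP q k) => qk /=; last first.
    by split=> //=; rewrite qE; move: qE qk; clear; lia.
  have F0 : core (restr H W) != set0.
    apply: contraTneq ev => c0; rewrite -ltnNge.
    have : #|evens H W| <= 1.
      rewrite -[1](cards1 (set0 : {set G * G})); apply/subset_leq_card/subsetP => T /evensP[sT eT].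
      have := even_core (subset_trans (restr_sub H W) HG) sT eT; rewrite c0 subset0 inE.
      by [].
    move=> h; apply: leq_ltn_trans (leq_mul (leqnn _) h) _; rewrite muln1 ltn_exp2l //.
    apply: leq_trans kA; apply: leq_trans (leq_mul qk (leqnn _)); by rewrite mulSn addSn ltnS leq_addl.
  rewrite F0 /=; have [hU UW cU] := evens_step fr F0 ct; set U := shortest_cycle _ _ in hU UW cU *.
  split=> //=.
  - by move: qE qk; clear; lia.
  - by apply: famok_add => // y yU; apply: f0; exact: (subsetP UW).
  - by move=> y /setDP[yW yU]; rewrite ffunE (negbTE yU) f0.
  - by apply: leq_trans ev _; rewrite mulSn addnC expnD -mulnA leq_mul2l cU orbT.
have [] := fold (enum G) (setT, [ffun=> 0], 0) 0.
  split=> //=; first by rewrite min0n.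
  - exact: famok0.
  - by move=> x _; rewrite ffunE.
  - by rewrite mul1n.
rewrite add0n -cardE -/(pack H k) => qE fo _ _; rewrite qE (minn_idPr kG) in fo *; by split.
Qed.
End Pack.

(** * Finding holes *)

Section FindHole.
Variable G : sgraph.
Hypothesis c4 : C4_free G.
Implicit Types (S U W : {set G}) (x y z : G).

Definition nb x : {set G} := [set y | (y == x) || edge x y].
Definition inner_part U b c d a e : {set G} := (U :\: (nb b :|: nb c :|: nb d)) :|: [set a; e].
(** Guess five consecutive vertices of the hole; what remains is reachability outside the
    neighbourhoods of the middle three, so the test is polynomial. *)
Definition short_hole t U := [exists a in U, [exists b in U, [exists c in U, [exists d in U, [exists e in U,
  [&& edge a b, edge b c, edge c d & edge d e] &&
  [&& ~~ edge a c, ~~ edge a d, ~~ edge a e & [&& ~~ edge b d, ~~ edge b e & ~~ edge c e]] &&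
  (e \in ball (inner_part U b c d a e) t a)]]]]].
Definition holedb U := short_hole #|G| U.
Definition minhole U := gmin (short_hole (first_true G (fun t => short_hole t U))) U.

(** The path from a to e need not be induced. [p5crit] gives a long hole among its at most t + 1
    vertices and b, c, d, which bounds the length by t + 4. *)
Lemma short_holeP t U : reflect (exists l f, [/\ 6 <= l, l <= t + 4, hol l f & img l f \subset U]) (short_hole t U).
Proof.
apply: (iffP idP) => [|[l [f [l6 lt fh fU]]]].
  case/existsP => a /andP[aU /existsP[b /andP[bU /existsP[c /andP[cU /existsP[d /andP[dU /existsP[e /andP[eU]]]]]]]]].
  case/andP => /andP[/and4P[ab bc cd de] /and4P[ac ad ae /and3P[bd be ce]]] /ballP[p [aW pp lp sp]].
  set W := inner_part _ _ _ _ _ _ in aW pp.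
  pose Y := [set x in a :: p] :|: [set b; c; d].
  have pW x : x \in a :: p -> x \in W.
    by rewrite inE => /predU1P[->//|]; case: (er_path aW pp) => _; apply.
  have YU : Y \subset U.
    apply/subsetP => x /setUP[|]; last by rewrite !inE => /orP[/orP[]|]/eqP->.
    by rewrite inE => /pW /setUP[/setDP[]//|/set2P[]->].
  have neq x y z : edge x z -> ~~ edge y z -> x != y by move=> h; apply: contraNneq => <-.
  have neq' x y z : edge x z -> ~~ edge y z -> y != x by move=> h h'; rewrite eq_sym (neq _ _ _ h h').
  have ba : edge b a by rewrite edgeC. have cb : edge c b by rewrite edgeC.
  have dc : edge d c by rewrite edgeC. have ed : edge e d by rewrite edgeC.
  have nca : ~~ edge c a by rewrite edgeC. have nda : ~~ edge d a by rewrite edgeC.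
  have nea : ~~ edge e a by rewrite edgeC. have ndb : ~~ edge d b by rewrite edgeC.
  have neb : ~~ edge e b by rewrite edgeC. have nec : ~~ edge e c by rewrite edgeC.
  have nW y : y \in W -> [/\ edge b y -> y = a, ~~ edge c y & edge d y -> y = e].
    case/setUP; last first.
      by case/set2P => ->; split=> //; [rewrite (negbTE nda)|rewrite (negbTE be)].
    by rewrite !inE !negb_or => /andP[/andP[/andP[/andP[_ /negbTE->] /andP[_ ->]] /andP[_ /negbTE->]] _].
  have eE : e \in a :: p by rewrite -lp mem_last.
  have [l [f [l6 fh fY]]] : holed Y.
    apply: (@p5crit _ c4 Y a b c d e) => //.
    - rewrite /= !inE !negb_or !andbT (edge_neq ab) (edge_neq bc) (edge_neq cd) (edge_neq de) /=.
      rewrite (neq' _ _ _ cd ad) (neq' _ _ _ de ae) (neq _ _ _ ab neb) (neq _ _ _ ba nda).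
      by rewrite (neq _ _ _ bc nec) (neq _ _ _ cb neb).
    - apply/and5P; split; apply/setUP; try (by right; rewrite !inE eqxx ?orbT); left; rewrite inE ?mem_head //.
    - move=> y /setUP[|]; last rewrite !inE; last by case/orP => [/orP[]|]/eqP->; rewrite ?edgexx ?eqxx ?orbT // (negbTE bd).
      by rewrite inE => /pW/nW[h _ _] /h->; rewrite !inE eqxx.
    - move=> y /setUP[|]; last rewrite !inE; last by case/orP => [/orP[]|]/eqP->; rewrite ?edgexx ?eqxx ?orbT.
      by rewrite inE => /pW/nW[_ /negbTE-> _].
    - move=> y /setUP[|]; last rewrite !inE; last by case/orP => [/orP[]|]/eqP->; rewrite ?edgexx ?eqxx ?orbT // (negbTE ndb).
      by rewrite inE => /pW/nW[_ _ h] /h->; rewrite !inE eqxx ?orbT.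
    rewrite conn_sym; apply/connectP; exists p => //.
    have pY x : x \in a :: p -> x \in Y :\: [set b; c; d].
      move=> xp; apply/setDP; split; first by apply/setUP; left; rewrite inE.
      have [h1 h2 h3] := nW _ (pW _ xp); rewrite !inE !negb_or; apply/andP; split; first (apply/andP; split).
      + by apply: contraNneq h2 => ->; rewrite edgeC.
      + apply/eqP => xc; rewrite xc in h1; move: cd; rewrite (h1 bc) (negbTE ad).
        by [].
      + by apply: contraNneq h2 => ->.
    apply: path_er (pY _ (mem_head _ _)) _ _; first by case: (er_path aW pp).
    by move=> x xp; apply: pY; rewrite inE xp orbT.
  exists l, f; split=> //; last exact: subset_trans fY YU.
  have := subset_leq_card fY; rewrite (card_img fh) => h; apply: leq_trans h _.
  apply: leq_trans (leq_card_setU _ _) _.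
  have : #|[set x in a :: p]| <= t.+1 by rewrite cardsE; apply: leq_trans (card_size _) _.
  have : #|[set b; c; d]| <= 3 by rewrite -setUA cardsU1 cards2; case: (b \notin _); case: (c != d).
  by clear; lia.
have e i : edge (f i) (f i.+1) by exact: (hol_edgeS _ fh).
have ne i j : i.+1 < j -> j.+1 < i + l -> ~~ edge (f i) (f j) by exact: hol_nedge.
have fin i : f i \in U by apply: (subsetP fU); exact: in_img.
have ex (P : pred G) (x : G) : x \in U -> P x -> [exists y in U, P y] by move=> xU Px; apply/existsP; exists x; rewrite xU.
apply: (ex _ (f 0)) => //; apply: (ex _ (f 1)) => //; apply: (ex _ (f 2)) => //; apply: (ex _ (f 3)) => //.
apply: (ex _ (f 4)) => //; rewrite !e !ne //=; try (by move: l6; clear; lia).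
have l4 : 4 + (l - 4) = l by rewrite subnKC //; move: l6; clear; lia.
have fl : f 0 = f l by rewrite -[l]add0n hol_per.
rewrite ballC fl -[in f l]l4; apply: (subsetP (ball_leq _ _ (_ : l - 4 <= t))); first by move: lt; clear; lia.
apply: (ball_run fh) => j; rewrite l4 => /andP[j4 jl].
case: (eqVneq j l) => [->|jl']; first by apply/setUP; right; rewrite !inE eqxx.
case: (eqVneq j 4) => [->|j4']; first by apply/setUP; right; rewrite !inE eqxx orbT.
apply/setUP; left; rewrite !inE fin andbT !negb_or !(eq_sym (f j)).
rewrite !(hol_neq fh) ?ne //; by move: j4 jl jl' j4'; clear; lia.
Qed.

Lemma holedbP U : reflect (holed U) (holedb U).
Proof.
apply: (iffP (short_holeP _ _)) => [[l [f [l6 _ fh fU]]]|[l [f [l6 fh fU]]]]; first by exists l, f.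
exists l, f; split=> //; apply: leq_trans (leq_addr 4 _); rewrite -(card_img fh); exact: max_card.
Qed.

(** With the least successful t, an inclusion-minimal set that passes the test contains a shortest
    long hole, which itself passes the test and is therefore the whole set. *)
Lemma minholeP U : holed U -> exists l f, [/\ 6 <= l, hol l f, img l f = minhole U, minhole U \subset U &
  forall l' f', 6 <= l' -> hol l' f' -> img l' f' \subset U -> l <= l'].
Proof.
case=> l0 [f0 [l06 fh0 fU0]]; pose P t := short_hole t U.
have mono i j : i <= j -> P i -> P j.
  move=> ij /short_holeP[l [f [l6 li fh fU]]]; apply/short_holeP; exists l, f; split=> //.
  by apply: leq_trans li _; rewrite leq_add2r.
have Pl l' f' : 6 <= l' -> hol l' f' -> img l' f' \subset U -> P (l' - 4).
  by move=> l6 fh fU; apply/short_holeP; exists l', f'; split=> //; rewrite subnK //; move: l6; clear; lia.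
have Pt : P (first_true G P).
  apply: (first_trueP mono (i := l0 - 4)); last exact: Pl fh0 fU0.
  have : l0 <= #|G| by rewrite -(card_img fh0) max_card.
  by move: l06; clear; lia.
have mU S S' : S \subset S' -> short_hole (first_true G P) S -> short_hole (first_true G P) S'.
  move=> SS' /short_holeP[l [f [l6 li fh fU]]]; apply/short_holeP; exists l, f; split=> //.
  exact: subset_trans SS'.
have [/short_holeP[l [f [l6 lt fh fM]]] g2 g3] := gminP mU Pt.
have fE : img l f = minhole U.
  by apply: (g3 _ fM); apply/short_holeP; exists l, f; split.
exists l, f; split; [exact: l6|exact: fh|exact: fE|exact: g2|].
move=> l' f' l6' fh' fU'; have := first_true_min G mono (Pl _ _ l6' fh' fU').
by move: lt l6'; clear; lia.
Qed.

Lemma card_hole_clique l f (D : {set G}) : 6 <= l -> hol l f -> clique D -> #|img l f :&: D| <= 2.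
Proof.
move=> l6 fh Dcl; case: (set_0Vmem (img l f :&: D)) => [->|[x]]; first by rewrite cards0.
case/setIP => /(in_imgP fh)[p pl xE] xD.
have l0 : 0 < l by apply: leq_trans l6.
have sub : img l f :&: D \subset [set x; f p.+1] \/ img l f :&: D \subset [set x; f (p + l.-1)].
  case: (boolP (f p.+1 \in D)) => h; [left|right]; apply/subsetP => y /setIP[yZ yD].
    rewrite !inE; case: (eqVneq y x) => //= yx; apply: contraT => ny.
    have := Dcl x y xD yD; rewrite eq_sym yx => /(_ isT) e; rewrite xE in e.
    case: (hol_nbr fh yZ e) => yE; first by rewrite yE eqxx in ny.
    have := Dcl _ _ h yD; rewrite eq_sym ny => /(_ isT); rewrite yE => e'.
    have := @hol_nedge G l f p.+1 (p + l.-1) fh; rewrite e'.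
    by have -> // : p.+2 < p + l.-1; [|have -> // : (p + l.-1).+1 < p.+1 + l]; move: l6 l0; clear; lia.
  rewrite !inE; case: (eqVneq y x) => //= yx.
  have := Dcl x y xD yD; rewrite eq_sym yx => /(_ isT) e; rewrite xE in e.
  by case: (hol_nbr fh yZ e) => yE; rewrite yE ?eqxx //; rewrite -yE yD in h.
have c2 (a b : G) : #|[set a; b]| <= 2 by rewrite cards2; case: (_ != _).
by case: sub => /subset_leq_card h; apply: leq_trans h (c2 _ _).
Qed.
End FindHole.

(** * Counting nested sets by their exits *)

Section SetSystem.
Variables (J G : finType) (al : J -> G) (A : J -> {set G}).

(* The exits [al i] behave like the attachment vertices of the branches of a tree. *)
Lemma branch_system (S : {set J}) (Y : {set G}) :
  (forall i, i \in S -> [/\ al i \in Y, al i \notin A i & A i :&: Y != set0]) ->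
  (forall i j, i \in S -> j \in S -> i != j -> al i \notin A j -> al j \notin A i -> A i :&: A j = set0) ->
  (forall i j, i \in S -> j \in S -> i != j -> al i \in A j -> al j \notin A i -> A i \subset A j) ->
  #|S| <= (#|Y|).*2.
Proof.
have [n] := ubnP #|Y|; elim: n S Y => // n IH S Y cY h1 h2 h3.
case: (set_0Vmem S) => [->|[i iS]]; first by rewrite cards0.
(* For a minimal trace [A o :&: Y], the indices with exit outside [A o] are counted by induction in
   [Y :\: A o]; the others have distinct exits in the trace. Together with o itself this is at most
   2|Y|, as the trace is nonempty. *)
case: (arg_minnP (fun i => #|A i :&: Y|) iS) => {i iS} o oS omin.
have {}oS : o \in S by [].
have [alo nalo nA0] := h1 _ oS.
pose S' := [set j in S | (j != o) && (al j \notin A o)].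
pose S2 := [set j in S | al j \in A o].
have Y0 : 0 < #|A o :&: Y| by rewrite card_gt0.
have cE := cardsID (A o) Y; rewrite setIC in cE.
have c1 : #|S'| <= (#|Y :\: A o|).*2.
  apply: IH => [|i|i j|i j]; try (by rewrite !inE => /and3P[i1 _ _] /and3P[j1 _ _]; auto).
    by move: cE Y0 cY; clear; lia.
  rewrite inE => /and3P[iS io ni]; have [a1 a2 a3] := h1 _ iS.
  split=> //; first by rewrite inE ni.
  case: (boolP (al o \in A i)) => oi.
    by apply/set0Pn; exists (al o); rewrite !inE oi nalo alo.
  case/set0Pn: a3 => y; rewrite inE => /andP[yi yY]; apply/set0Pn; exists y.
  rewrite !inE yi yY andbT /=; apply/negP => yo.
  by have := h2 _ _ iS oS io ni oi => /setP/(_ y); rewrite !inE yi yo.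
have c2 : #|S2| <= #|A o :&: Y|.
  rewrite -(card_in_imset (f := al) (D := mem S2)) => [|i j].
    apply/subset_leq_card/subsetP => y /imsetP[i]; rewrite !inE => /andP[iS io] ->.
    by rewrite io; case: (h1 _ iS).
  rewrite !inE => /andP[iS io] /andP[jS jo] E; apply/eqP; apply: contraT => ij.
  have [_ ni _] := h1 _ iS; have [_ nj _] := h1 _ jS.
  (* Since [A i] and [A j] are disjoint, one of them misses [al o]. That one lies in [A o], so by
     minimality it has the same trace on Y, but it misses its own exit. *)
  have dij : A i :&: A j = set0 by apply: h2 => //; rewrite ?E // -E.
  have key k : k \in S -> al k \in A o -> al k \notin A k -> al o \notin A k -> False.
    move=> kS ko nk ok; have ok' : o != k by apply/eqP => E'; move: nalo; rewrite {1}E' ko.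
    have sub := h3 _ _ kS oS; rewrite eq_sym ok' ko ok in sub; have {}sub := sub isT isT isT.
    have : A k :&: Y == A o :&: Y.
      by rewrite eqEcard setSI //=; exact: omin.
    move=> /eqP/setP/(_ (al k)); rewrite !inE (negbTE nk) ko /=.
    by have [-> _ _] := h1 _ kS.
  case: (boolP (al o \in A i)) => oi; last by case: (key i).
  case: (boolP (al o \in A j)) => oj; last by case: (key j).
  by move/setP: dij => /(_ (al o)); rewrite !inE oi oj.
have : #|S| <= #|o |: (S' :|: S2)|.
  apply/subset_leq_card/subsetP => j jS; rewrite !inE jS /=.
  by case: (j == o); case: (al j \in A o).
move=> h; apply: leq_trans h _; rewrite cardsU1.
have cU : #|S' :|: S2| <= #|S'| + #|S2| by rewrite leq_card_setU.
move: cU (leq_b1 (o \notin S' :|: S2)) c1 c2 Y0 cE.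
by clear; lia.
Qed.
End SetSystem.

(** * Packing balls that contain a long hole *)

Section LocalLoop.
Variable G : sgraph.
Hypothesis c4 : C4_free G.
Variables (V M D C X0 : {set G}) (m : nat) (f : nat -> G).
Hypothesis fh : hol m f.
Hypothesis CE : C = img m f.
Hypothesis m11 : 11 <= m.
Hypothesis CV : C \subset V.
Hypothesis Cmin : forall l h, 6 <= l -> hol l h -> img l h \subset V -> m <= l.
Hypothesis MV : M \subset V :\: spread V C.
Hypothesis DV : D \subset spread V C.

Definition local_set c X := ball M 7 c :|: (D :\: X).
(** If two balls of radius 7 meet, their centres are at distance at most 14 in M, hence at most 5(14
    + 2) = 80 on C. Deleting the ball of radius 80, and the at most two vertices of the packed hole
    in the clique D, keeps later holes disjoint. The cost is 161 + 2 = 163. *)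
Definition local_step (st : {set G} * {ffun G -> nat} * nat) c :=
  let L := local_set c st.1.1 in
  if [&& c \in C, c \notin st.1.1 & holedb L] then
    (st.1.1 :|: (ball C 80 c :|: (minhole L :&: D)), addf st.1.2 st.2 (minhole L), st.2.+1)
  else st.
Definition local_loop := foldl local_step (X0, [ffun=> 0], 0) (enum G).

Lemma ball_near r c c' : c \in C -> c' \in C -> c' \in ball M r c -> c' \in ball C (5 * r.+2) c.
Proof.
rewrite CE => cC c'C h; have m6 : 6 <= m by apply: leq_trans m11.
have CV' : img m f \subset V by rewrite -CE.
apply: (spread_near c4 fh CV' Cmin m6 cC c'C).
by rewrite -CE; exact: (subsetP (ballSS _ _ MV) _ h).
Qed.

Lemma ball_meet r s c c' y : y \in ball M r c -> y \in ball M s c' -> c' \in ball M (r + s) c.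
Proof. by move=> h1 h2; apply: ball_cat h1 _; rewrite ballC. Qed.

Lemma cardU_le (S T : {set G}) a b : #|S| <= a -> #|T| <= b -> #|S :|: T| <= a + b.
Proof. by move=> h1 h2; apply: leq_trans (leq_card_setU _ _) (leq_add h1 h2). Qed.

Lemma card_ballC r c : c \in C -> #|ball C r c| <= (r.*2).+1.
Proof. by rewrite CE; exact: card_ball. Qed.

Lemma MDdisj y : y \in M -> y \in D -> False.
Proof. by move=> /(subsetP MV)/setDP[_ /negP h] /(subsetP DV). Qed.

Lemma Dclique : clique D.
Proof.
have CV' : img m f \subset V by rewrite -CE.
have h := spread_clique c4 fh CV' Cmin m11; rewrite -CE in h.
by move=> x y /(subsetP DV) xD /(subsetP DV) yD; exact: h.
Qed.

Lemma local_loopP : let: (X, fam, q) := local_loop in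
  [/\ X0 \subset X, X \subset X0 :|: C :|: D, #|X| <= #|X0| + 163 * q,
      famok fam q & forall c, c \in C -> c \notin X -> ~ holed (local_set c X)].
Proof.
pose inv (s : seq G) (st : {set G} * {ffun G -> nat} * nat) :=
  [/\ X0 \subset st.1.1, st.1.1 \subset X0 :|: C :|: D, #|st.1.1| <= #|X0| + 163 * st.2,
   famok st.1.2 st.2 & (forall c, c \in s -> c \in C -> c \notin st.1.1 -> ~ holed (local_set c st.1.1)) /\
   forall y, st.1.2 y != 0 -> (y \in D /\ y \in st.1.1) \/
     exists c, [/\ c \in C, y \in ball M 7 c & ball C 80 c \subset st.1.1]].
suff : inv (enum G) local_loop.
  case: local_loop => -[X fam] q [h1 h2 h3 h4 [h5 _]]; split=> // c; apply: h5.
  by rewrite mem_enum.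
rewrite /local_loop; elim/last_ind: (enum G) => [|s c]; last first.
  rewrite foldl_rcons; case: (foldl _ _ _) => -[X fam] q [/= h1 h2 h3 h4 [h5 h6]].
  rewrite /local_step /=; case: ifP => [/and3P[cC cX /(holedbP c4) hL]|nc]; last first.
    split=> //=; split=> // c'; rewrite mem_rcons inE => /predU1P[->|]; last exact: h5.
    by move=> cC cX /(holedbP c4) hL; rewrite cC cX hL in nc.
  have [l [h [l6 hh hE hsub _]]] := minholeP c4 hL.
  have mono c' (X1 X2 : {set G}) : X1 \subset X2 -> holed (local_set c' X2) -> holed (local_set c' X1).
    by move=> X12; apply: holedS; apply: setUS; apply: setDS.
  split=> /=.
  - by apply: subset_trans h1 (subsetUl _ _).
  - rewrite subUset h2 subUset /=; apply/andP; split; apply/subsetP => y.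
      by move=> /(subsetP (ball_sub _ _ _)) yC; rewrite !inE yC ?orbT.
    by case/setIP => _ yD; rewrite !inE yD ?orbT.
  - apply: leq_trans (leq_card_setU _ _) _.
    have h7 : #|ball C 80 c :|: minhole (local_set c X) :&: D| <= 161 + 2.
      apply: cardU_le; first exact: card_ballC.
      rewrite -hE; apply: (card_hole_clique l6 hh); exact: Dclique.
    by move: h3 h7; clear; lia.
  - apply: famok_add => //; first by rewrite -hE; exists l, h.
    move=> y /(subsetP hsub) yL; apply/eqP; apply: contraT => /h6[[yD yX]|[c' [c'C yc' c'X]]].
      case/setUP: yL => [/(subsetP (ball_sub _ _ _)) yM|/setDP[_]]; first by case: (MDdisj yM yD).
      by rewrite yX.
    case/setUP: yL => [yc|/setDP[yD _]]; last first.
      by case: (MDdisj _ yD); exact: (subsetP (ball_sub _ _ _) _ yc').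
    have := ball_near c'C cC (ball_meet yc' yc) => /(subsetP c'X) cX'.
    by rewrite cX' in cX.
  - split.
      move=> c'; rewrite mem_rcons inE => /predU1P[->|c's] c'C.
        rewrite !in_setU negb_or => /andP[_]; rewrite negb_or => /andP[/negP[]].
        apply: (subsetP (ball_leq _ _ (leq0n 80))); exact: ball0.
      rewrite in_setU negb_or => /andP[c'X _]; move=> /(mono _ _ _ (subsetUl _ _)).
      exact: h5.
    move=> y; rewrite ffunE; case: ifP => [yZ _|_ /h6[[yD yX]|[c' [c'C yc' c'X]]]].
    + case/setUP: (subsetP hsub _ yZ) => [yc|/setDP[yD _]].
        right; exists c; split=> //; apply: subset_trans (subsetUr _ _); exact: subsetUl.
      by left; rewrite !in_setU in_setI yZ yD !orbT.
    + by left; split=> //; apply/setUP; left.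
    + by right; exists c'; split=> //; apply: subset_trans c'X (subsetUl _ _).
split=> //=; first by rewrite -setUA subsetUl.
- by rewrite muln0 addn0.
- exact: famok0.
- by split=> // y; rewrite ffunE.
Qed.
End LocalLoop.

(** * Holes through the clique *)

Section Links.
Variable G : sgraph.
Hypothesis c4 : C4_free G.
Implicit Types (S T I R : {set G}) (c d x y z : G).
Variables (V M C : {set G}) (m : nat) (f : nat -> G).
Hypothesis fh : hol m f.
Hypothesis CE : C = img m f.
Hypothesis m11 : 11 <= m.
Hypothesis CV : C \subset V.
Hypothesis Cmin : forall l h, 6 <= l -> hol l h -> img l h \subset V -> m <= l.
Let D := spread V C.
Hypothesis MV : M \subset V :\: D.
Hypothesis nM : ~ holed M.

Lemma const_conn S (g : G -> bool) : (forall x y, x \in S -> y \in S -> edge x y -> g x = g y) ->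
  forall x y, conn S x y -> g x = g y.
Proof.
move=> h x y /connectP[p pp ->]; elim: p x pp => //= z p IH x /andP[/and3P[xS zS e] /IH <-].
exact: h.
Qed.

Lemma conn_split S T x y : x \in S -> conn S x y ->
  conn (S :\: T) x y \/ exists2 i, i \in T & i \in S /\ conn S x i.
Proof.
move=> xS /connectP[p pp lp]; case: (boolP (has (mem T) (x :: p))) => [/hasP[i ip iT]|nT].
  right; exists i => //; rewrite inE in ip.
  have xi : conn S x i by apply: path_connect pp _ _; rewrite inE.
  by split=> //; exact: conn_in xi.
left; apply/connectP; exists p => //; elim: p x xS pp nT {lp} => //= z p IH x xS.
move=> /andP[/and3P[_ zS e] pp]; rewrite !negb_or => /and3P[xT zT nT].
by rewrite !in_setD xS zS xT zT e /= IH //= negb_or zT.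
Qed.

(** * A component with a neighbour in the clique *)

Section OneLink.
Variables (c x d : G).
Let I := Iset M (C :&: M) c.
Let R := reach (ball M 7 c :\: I) x.
Let K := reach (M :\: I) x.
Hypothesis cC : c \in C :&: M.
Hypothesis dD : d \in D.
Hypothesis NL : ~ holed (ball M 7 c :|: [set d]).
Hypothesis cM : ball C 35 c \subset M.
Hypothesis nR : forall y, y \in R -> ~~ edge d y.
Variables (i0 r0 : G).
Hypotheses (i0I : i0 \in I) (r0R : r0 \in R) (ir : edge i0 r0).

Lemma dM : d \notin M.
Proof. by apply/negP => /(subsetP MV)/setDP[_ /negP]. Qed.

Lemma IsetP i : i \in I -> [/\ i \in C, i \in M, i \in ball M 3 c & i \in ball C 25 c].
Proof.
rewrite inE => /and3P[/setIP[iC iM] _ ib]; split=> //; have /setIP[cC' _] := cC.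
exact: (ball_near c4 fh CE m11 CV Cmin MV cC' iC ib).
Qed.

Lemma cI : c \in I.
Proof.
rewrite inE cC leqnn /=; apply: (subsetP (ball_leq _ _ (leq0n 3))); apply: ball0.
by case/setIP: cC.
Qed.

Lemma up7 r y : r <= 7 -> y \in ball M r c -> y \in ball M 7 c.
Proof. by move=> r7; apply: (subsetP (ball_leq _ _ r7)). Qed.

Lemma RK : R \subset K.
Proof.
apply/subsetP => y; rewrite !reachP => /andP[h1 h2].
have s : ball M 7 c :\: I \subset M :\: I by apply: setSD; exact: ball_sub.
by rewrite (subsetP s) //=; exact: connSub h2.
Qed.

Lemma KP y : y \in K -> [/\ y \in M, y \notin I & y != d].
Proof.
move=> yK; have /setDP[yM yI] := subsetP (reach_sub _ _) _ yK.
by split=> //; apply: contraTneq yM => ->; exact: dM.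
Qed.

Lemma dnI : d \notin I.
Proof. by apply/negP => /IsetP[_ h _ _]; case/negP: dM. Qed.

Lemma RnI y : y \in R -> y \notin I.
Proof. by move=> /(subsetP RK)/KP[]. Qed.

Lemma link_coc : coc (M :|: [set d]) (lam I R).
Proof.
have dcl : clique [set d] by move=> u v /set1P-> /set1P->; rewrite eqxx.
apply: (lam_ball_coc dcl (r := 3) (c := c)) => //.
- by apply/subsetP => i /IsetP[].
- apply/subsetP => y yR; have /setDP[h1 h2] := subsetP (reach_sub _ _) _ yR.
  by rewrite in_setD h2; apply/setUP; left.
move=> y z yR /setDP[/setUP[zb|/set1P->] zI] yz; last by have := nR yR; rewrite edgeC yz.
by apply: (reach_closed yR _ yz); rewrite in_setD zI.
Qed.

(** By [spread_hits] d has a neighbour among the three consecutive vertices of C centred at i; as a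
    neighbour of d it is not in R. *)
Lemma hit_near i : i \in I -> exists e, [/\ edge d e, e \in C, e \in ball M 4 c, e \in ball C 26 c & (e = i \/ edge i e) /\ lam I R i e = false].
Proof.
move=> iI; have [iC iM ib3 ib25] := IsetP iI.
have m0 : 0 < m by apply: leq_trans m11.
rewrite CE in iC; have [p pm iE] := in_imgP fh iC.
have CV' : img m f \subset V by rewrite -CE.
have dD' : d \in spread V (img m f) by rewrite -CE.
have m6 : 6 <= m by apply: leq_trans m11.
have [k k3 e] := spread_hits c4 fh CV' Cmin (p + m.-1) m6 fh erefl dD'.
set y := f (p + m.-1 + k) in e.
have yC : y \in C by rewrite CE in_img.
have yE : y = i \/ edge i y.
  rewrite /y iE; case: k k3 {e y yC} => [|[|[|//]]] _; [right|left|right].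
  - rewrite addn0 edgeC -[f p](hol_per _ fh).
    by rewrite (_ : p + m = (p + m.-1).+1); [exact: (hol_edgeS _ fh)|move: m0; clear; lia].
  - by rewrite -[RHS](hol_per _ fh); congr f; move: m0; clear; lia.
  - rewrite -[f (_ + _)](_ : f p.+1 = _); first exact: (hol_edgeS _ fh).
    by rewrite -(hol_per _ fh); congr f; move: m0; clear; lia.
have y26 : y \in ball C 26 c.
  case: yE => [->|e']; first exact: (subsetP (ball_leq _ _ (leqnSn 25))).
  exact: ballS ib25 yC e'.
have yM : y \in M by apply: (subsetP cM); apply: (subsetP (ball_leq _ _ (isT : 26 <= 35))).
exists y; split=> //.
  case: yE => [->|e']; first exact: (subsetP (ball_leq _ _ (leqnSn 3))).
  exact: ballS ib3 yM e'.
split=> //; have yR : y \notin R by apply: contraL e; exact: nR.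
by rewrite /lam (negbTE yR) andbF /=; apply/negbTE/negP => /andP[_] /RnI; rewrite iI.
Qed.

Lemma lamd y : lam I R d y = false.
Proof.
have dR : d \notin R by apply/negP => /(subsetP RK)/KP[_ _]; rewrite eqxx.
by rewrite /lam (negbTE dnI) (negbTE dR) andbF.
Qed.

(** No edge at d carries a label, so its neighbours in the ball have the potential of d; each i in I
    is joined to such a neighbour by an edge without label, or is one. *)
Lemma local_pot : exists g : G -> bool,
  [/\ forall y z, y \in ball M 7 c -> z \in ball M 7 c -> edge y z -> lam I R y z = g y (+) g z,
      forall i, i \in I -> g i = g d & forall y, y \in ball M 7 c -> edge d y -> g y = g d].
Proof.
have s : ball M 7 c :|: [set d] \subset M :|: [set d] by apply: setSU; exact: ball_sub.
have [g gE] := coc_potential c4 NL (cocS s link_coc); exists g.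
have bd y : y \in ball M 7 c -> y \in ball M 7 c :|: [set d] by move=> yb; rewrite in_setU yb.
have dd : d \in ball M 7 c :|: [set d] by rewrite !inE eqxx orbT.
have nbd y : y \in ball M 7 c -> edge d y -> g y = g d.
  by move=> yb e; have := gE d y dd (bd _ yb) e; rewrite lamd; case: (g d); case: (g y).
split=> // [y z yb zb|i iI]; first by apply: gE; exact: bd.
have [e [de eC e4 _ [ie l0]]] := hit_near iI; have [iC iM i3 _] := IsetP iI.
have eb := up7 (isT : 4 <= 7) e4; rewrite -(nbd _ eb de).
case: ie => [->//|ie]; have := gE i e (bd _ (up7 (isT : 3 <= 7) i3)) (bd _ eb) ie.
by rewrite l0; case: (g i); case: (g e).
Qed.

(** On the connected ball g differs from the local potential by a constant, so g is constant on I.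
    It is constant on K, which avoids I, and the edge [i0 r0] of label 1 separates the two
    values. *)
Lemma pot_K (g : G -> bool) : (forall y z, y \in M -> z \in M -> edge y z -> lam I R y z = g y (+) g z) ->
  forall i y, i \in I -> y \in K -> g i (+) g y.
Proof.
move=> gE i y iI yK; have [g1 [g1E g1I _]] := local_pot.
have [_ iM i3 _] := IsetP iI; have [_ i0M i03 _] := IsetP i0I.
have bM y' : y' \in ball M 7 c -> y' \in M by exact: (subsetP (ball_sub _ _ _)).
have same u v : u \in ball M 7 c -> v \in ball M 7 c -> g u (+) g1 u = g v (+) g1 v.
  move=> ub vb; apply: (@const_conn (ball M 7 c) (fun w => g w (+) g1 w)); last first.
    by apply: (connect_trans _ (ball_conn vb)); rewrite -/(conn _ _ _) conn_sym; exact: ball_conn.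
  move=> a b aB bB e; have := g1E _ _ aB bB e; rewrite (gE a b (bM _ aB) (bM _ bB) e).
  by case: (g a); case: (g b); case: (g1 a); case: (g1 b).
have := same i i0 (up7 (isT : 3 <= 7) i3) (up7 (isT : 3 <= 7) i03).
rewrite !g1I // => /addIb ->.
have [r0M r0I _] := KP (subsetP RK _ r0R).
have := gE i0 r0 i0M r0M ir; rewrite /lam i0I r0R /= => /esym; suff -> : g r0 = g y by [].
apply: (@const_conn (M :\: I) g) => [a b /setDP[aM aI] /setDP[bM' bI] e|].
  have := gE a b aM bM' e; rewrite /lam (negbTE aI) (negbTE bI) /=.
  by case: (g a); case: (g b).
have := subsetP RK _ r0R; have := yK; rewrite !reachP => /andP[_ h1] /andP[_ h2].
by apply: (connect_trans _ h1); rewrite -/(conn _ _ _) conn_sym.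
Qed.

Lemma M_pot : exists g : G -> bool,
  forall y z, y \in M -> z \in M -> edge y z -> lam I R y z = g y (+) g z.
Proof.
have [g gE] := coc_potential c4 nM (cocS (subsetUl _ _) link_coc).
by exists g.
Qed.

(** Such a y would have the potential of d locally, hence that of I, against [pot_K]. *)
Lemma far_K y : y \in K -> y \in ball M 7 c -> ~~ edge d y.
Proof.
move=> yK yb; apply/negP => e; have [g gE] := M_pot; have [g1 [g1E g1I g1n]] := local_pot.
have [_ _ i03 _] := IsetP i0I.
have bM y' : y' \in ball M 7 c -> y' \in M by exact: (subsetP (ball_sub _ _ _)).
have := pot_K gE i0I yK; suff -> : g i0 = g y by rewrite addbb.
have same u v : u \in ball M 7 c -> v \in ball M 7 c -> g u (+) g1 u = g v (+) g1 v.
  move=> ub vb; apply: (@const_conn (ball M 7 c) (fun w => g w (+) g1 w)); last first.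
    by apply: (connect_trans _ (ball_conn vb)); rewrite -/(conn _ _ _) conn_sym; exact: ball_conn.
  move=> a b aB bB e'; have := g1E _ _ aB bB e'; rewrite (gE a b (bM _ aB) (bM _ bB) e').
  by case: (g a); case: (g b); case: (g1 a); case: (g1 b).
have := same i0 y (up7 (isT : 3 <= 7) i03) yb.
by rewrite g1I // g1n // => /addIb.
Qed.

(** Follow the arc of C from c to y. After the last vertex of I, at distance at most 25 = 5(3 + 2)
    from c, it runs in K; d sees one of the next three vertices, still inside the ball of radius 7,
    which [far_K] forbids unless y comes within five steps. *)
Lemma K_arc y : y \in K -> conn (C :&: M) c y -> y \in ball C 30 c.
Proof.
move=> yK cy; apply: contraT => ny.
have cC2 := cC; rewrite CE in cC2 cy; have [h [t [hh hi h0 ht [tm hM]]]] := arc_param fh cC2 cy.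
have hC i : h i \in C by rewrite CE -hi in_img.
have ex0 : exists j, (j <= t) && (h j \in I) by exists 0; rewrite h0 cI.
have bnd j : (j <= t) && (h j \in I) -> j <= t by case/andP.
case: (ex_maxnP ex0 bnd) => j /andP[jt jI] jmax.
have [_ _ j3 j25] := IsetP jI.
have nI i : j < i <= t -> h i \notin I.
  by case/andP=> ji it; apply/negP => iI; have := jmax i; rewrite it iI => /(_ isT); rewrite leqNgt ji.
have jt' : j + 5 < t.
  rewrite ltnNge; apply/negP => h5; case/negP: ny; rewrite -ht.
  have : h t \in ball C (25 + (t - j)) c.
    by apply: ball_cat j25 _; rewrite -[t in h t](subnKC jt); exact: (ball_run hh).
  by apply: (subsetP (ball_leq _ _ _)); move: h5; clear; lia.
have hK i : j < i <= t -> h i \in K.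
  move=> hi'; have := yK; rewrite !reachP => /andP[h1 h2]; rewrite h1 /=.
  apply: (connect_trans h2); rewrite -/(conn _ _ _) conn_sym -ht.
  have it : i <= t by case/andP: hi'.
  rewrite -(subnKC it); apply: (hol_run hh) => k; rewrite subnKC // => /andP[ik kt].
  have jk : j < k <= t by rewrite kt (leq_trans _ ik) //; case/andP: hi'.
  by rewrite in_setD nI // hM.
have CV' : img m f \subset V by rewrite -CE.
have dD' : d \in spread V (img m f) by rewrite -CE.
have m6 : 6 <= m by apply: leq_trans m11.
have [k k3 e] := spread_hits c4 fh CV' Cmin j.+1 m6 hh hi dD'.
have kK : h (j.+1 + k) \in K by apply: hK; move: k3 jt'; clear; lia.
have := far_K kK; rewrite e => /(_ _)/negP; case=> //; apply: (up7 (isT : 6 <= 7)).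
have : h (j + k.+1) \in ball M (3 + k.+1) c.
  apply: ball_cat j3 _; apply: (ball_run hh) => i /andP[_ ik]; apply: hM.
  by apply: leq_trans ik _; move: k3 jt'; clear; lia.
by rewrite -addSnnS; apply: (subsetP (ball_leq _ _ _)); move: k3; clear; lia.
Qed.

(** The closed walk from [i0] along C to a neighbour of d, through d to [y0], inside K to [r0] and
    back to [i0] crosses from I to R exactly once. *)
Lemma link_holed y0 : y0 \in K -> edge d y0 -> holed ([set d] :|: K :|: ball C 30 c).
Proof.
move=> y0K dy0; apply: Classical_Prop.NNPP => nS; set S := _ :|: _ in nS.
have b35 r y : r <= 30 -> y \in ball C r c -> y \in S.
  by move=> r30 yb; apply/setUP; right; exact: (subsetP (ball_leq _ _ r30)).
have KS y : y \in K -> y \in S by move=> yK; apply/setUP; left; apply/setUP; right.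
have dS : d \in S by rewrite !inE eqxx.
have sS : S \subset M :|: [set d].
  apply/subsetP => y /setUP[/setUP[yd|/KP[yM _ _]]|yb]; apply/setUP; [by right|by left|left].
  by apply: (subsetP cM); exact: (subsetP (ball_leq _ _ (isT : 30 <= 35))).
have [g gE] := coc_potential c4 nS (cocS sS link_coc).
have [_ _ _ i25] := IsetP i0I.
have [e [de eC _ e26 [ie l0]]] := hit_near i0I.
have iS := b35 25 i0 isT i25; have eS := b35 26 e isT e26.
have r0K := subsetP RK _ r0R.
have E1 : g i0 = g e.
  case: ie => [-> //|ie]; have := gE i0 e iS eS ie; rewrite l0.
  by case: (g i0); case: (g e).
have E2 : g d = g e by have := gE d e dS eS de; rewrite lamd; case: (g d); case: (g e).
have E3 : g d = g y0 by have := gE d y0 dS (KS _ y0K) dy0; rewrite lamd; case: (g d); case: (g y0).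
have E4 : g r0 = g y0.
  apply: (@const_conn K g) => [a b aK bK e'|].
    have [_ aI _] := KP aK; have [_ bI _] := KP bK.
    have := gE a b (KS _ aK) (KS _ bK) e'; rewrite /lam (negbTE aI) (negbTE bI) /=.
    by case: (g a); case: (g b).
  by apply: (connect_trans _ (ball_conn y0K)); rewrite -/(conn _ _ _) conn_sym; exact: ball_conn.
have := gE i0 r0 iS (KS _ r0K) ir; rewrite /lam i0I r0R /= E1 -E2 E4 -E3 addbb.
by [].
Qed.
End OneLink.

(** If no vertex of the hole in D saw K, then along the hole the label would be the coboundary of K,
    by [pot_K] on the edges between K and I; but its sum is odd. *)
Lemma hole_link l h : 6 <= l -> hol l h -> img l h \subset M :|: D -> ~ holed (V :\: C) ->
  (forall c, c \in C :&: M -> ~ holed (ball M 7 c :|: (img l h :&: D))) ->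
  exists c x, let I := Iset M (C :&: M) c in let R := reach (ball M 7 c :\: I) x in
    [/\ c \in C :&: M, exists2 i, i \in I & i \in img l h,
     exists i r, [/\ i \in I, r \in R & edge i r],
     forall d y, d \in img l h :&: D -> y \in R -> ~~ edge d y &
     ball C 35 c \subset M -> exists d y, [/\ d \in img l h :&: D, y \in reach (M :\: I) x & edge d y]].
Proof.
move=> l6 hh hMD nVC NL; set DZ := _ :&: D.
have CV' : img m f \subset V by rewrite -CE.
have Dcl : clique D by have := spread_clique c4 fh CV' Cmin m11; rewrite -CE.
have DZcl : clique DZ by move=> u v /setIP[_ uD] /setIP[_ vD]; exact: Dcl.
have MD : [disjoint M & DZ].
  apply/pred0P => y /=; apply/negP => /andP[/(subsetP MV)/setDP[_ /negP yD] /setIP[_]].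
  exact: yD.
have hMD' : img l h \subset M :|: DZ.
  by apply/subsetP => y yZ; have := subsetP hMD _ yZ; rewrite !in_setU in_setI yZ.
have nMC : ~ holed (M :\: (C :&: M) :|: DZ).
  move=> hM; apply: nVC; apply: holedS hM; apply/subsetP => y /setUP[/setDP[yM yC]|/setIP[_]].
    have /setDP[yV _] := subsetP MV _ yM.
    by rewrite in_setD yV andbT; apply: contra yC => yC; rewrite in_setI yC.
  by rewrite inE => /andP[].
have [c [x [cC o nR]]] := detect_comp c4 (subsetIr C M) DZcl l6 hh hMD' (subsetIl _ _) NL MD nMC.
exists c, x; set I := Iset _ _ _ in o nR *; set R := reach _ x in o nR *.
have [j [jI jR]] : exists j, lam I R (h j) (h j.+1) /\ True.
  apply: Classical_Prop.NNPP => nj; move: o; rewrite /zs big1 // => j _.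
  by apply/negP => lj; apply: nj; exists j.
have e := hol_edgeS j hh.
have [i [r [iI rR ie iZ]]] : exists i r, [/\ i \in I, r \in R, edge i r & i \in img l h].
  case/orP: jI => /andP[h1 h2]; [exists (h j), (h j.+1)|exists (h j.+1), (h j)]; split=> //; try exact: in_img.
  by rewrite edgeC.
split=> //; [by exists i|by exists i, r|].
move=> cM; apply: Classical_Prop.NNPP => nd; set K := reach (M :\: I) x.
have nd' d y : d \in DZ -> y \in K -> ~~ edge d y.
  by move=> dZ yK; apply/negP => dy; apply: nd; exists d, y.
have [d dZ] : exists d, d \in DZ.
  case: (set_0Vmem DZ) => [E|[d dZ]]; last by exists d.
  by case: nM; exists l, h; split=> //; move: hMD'; rewrite E setU0.
have dD : d \in D by case/setIP: dZ.
have NL1 : ~ holed (ball M 7 c :|: [set d]).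
  by move=> hb; apply: (NL c cC); apply: holedS hb; apply: setUS; rewrite sub1set.
have nR1 y : y \in R -> ~~ edge d y by exact: nR.
have [g gE] := M_pot cC nR1.
have gK := pot_K cC dD NL1 cM nR1 iI rR ie gE.
have RKs : R \subset K := RK c x.
have Inot u : u \in DZ -> [/\ u \notin I, u \notin R & u \notin K].
  move=> uZ; have uM : u \notin M.
    by apply/negP => uM; move/pred0P: MD => /(_ u) /=; rewrite uM uZ.
  split; apply: contra uM; first by case/(IsetP cC).
    by move/(subsetP RKs)/(subsetP (reach_sub _ _))/setDP => [].
  by move/(subsetP (reach_sub _ _))/setDP => [].
move: o; rewrite (@zs_eq _ _ _ _ (fun u v => (u \in K) (+) (v \in K))) ?(zs_cob _ hh) // => k.
have ek := hol_edgeS k hh; have uZ := in_img k hh; have vZ := in_img k.+1 hh.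
move: (h k) (h k.+1) ek uZ vZ => u v uv /(subsetP hMD') uZ /(subsetP hMD') vZ.
case/setUP: uZ => uM; last first.
  have [uI uR uK] := Inot _ uM; rewrite /lam (negbTE uI) (negbTE uR) (negbTE uK) andbF /=.
  by apply/esym/negbTE/negP => vK; have := nd' _ _ uM vK; rewrite uv.
case/setUP: vZ => vM; last first.
  have [vI vR vK] := Inot _ vM; rewrite /lam (negbTE vI) (negbTE vR) (negbTE vK) andbF /=.
  rewrite addbF; apply/esym/negbTE/negP => uK; have := nd' _ _ vM uK; by rewrite edgeC uv.
case: (boolP (u \in K)) => uK; case: (boolP (v \in K)) => vK /=.
- have [_ uI _] := KP dD uK; have [_ vI _] := KP dD vK.
  by rewrite /lam (negbTE uI) (negbTE vI).
- have vI : v \in I.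
    by apply: contraR vK => vI; apply: (reach_closed uK _ uv); rewrite in_setD vI.
  by rewrite gE // addbC; exact: gK.
- have uI : u \in I.
    by apply: contraR uK => uI; apply: (reach_closed vK); rewrite 1?edgeC // in_setD uI.
  by rewrite gE //; exact: gK.
have nRu w : w \notin K -> w \notin R by apply: contra; exact: (subsetP RKs).
by rewrite /lam (negbTE (nRu _ uK)) (negbTE (nRu _ vK)) !andbF.
Qed.
End Links.

Section LinkLoop.
Variable G : sgraph.
Hypothesis c4 : C4_free G.
Implicit Types (S T I R K X : {set G}) (c d x y z : G) (p : G * G).
Variables (V M C : {set G}).

Definition IS c := Iset M (C :&: M) c.
Definition RS p := reach (ball M 7 p.1 :\: IS p.1) p.2.
Definition KS p := reach (M :\: IS p.1) p.2.

Definition link_cond (D : {set G}) X (t : G * G * G) :=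
  [&& t.1.1 \in C :&: M, ~~ (IS t.1.1 \subset X), (t.2 \in D) && (t.2 \notin X),
   ~~ [exists y in RS t.1, edge t.2 y], [exists i in IS t.1.1, [exists r in RS t.1, edge i r]] &
   [exists y in KS t.1, edge t.2 y]].
(** If K stays near c on C, the hole of [link_holed] is packed. Otherwise only the surroundings of c
    are deleted, and the number of such steps is bounded by [card_wide]. *)
Definition link_step (D : {set G}) (st : {set G} * {ffun G -> nat} * nat) (t : G * G * G) :=
  if link_cond D st.1.1 t then
    if KS t.1 :&: C \subset ball C 30 t.1.1 then
      (st.1.1 :|: (ball C 120 t.1.1 :|: [set t.2]),
       addf st.1.2 st.2 ([set t.2] :|: KS t.1 :|: ball C 30 t.1.1), st.2.+1)
    else (st.1.1 :|: ball C 120 t.1.1, st.1.2, st.2)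
  else st.
Definition triples : seq (G * G * G) := [seq (p, d) | p <- vpairs G, d <- enum G].
Definition link_loop (D : {set G}) X := foldl (link_step D) (X, [ffun=> 0], 0) triples.

Variables (m : nat) (f : nat -> G).
Hypothesis fh : hol m f.
Hypothesis CE : C = img m f.
Hypothesis m11 : 11 <= m.
Hypothesis CV : C \subset V.
Hypothesis Cmin : forall l h, 6 <= l -> hol l h -> img l h \subset V -> m <= l.
Let D := spread V C.
Hypothesis MV : M \subset V :\: D.
Hypothesis nM : ~ holed M.

(** The properties of an accepted pair that do not depend on the growing set X. *)
Definition item p :=
  [/\ p.1 \in C :&: M, ball C 35 p.1 \subset M,
   exists d, [/\ d \in D, ~ holed (ball M 7 p.1 :|: [set d]) & forall y, y \in RS p -> ~~ edge d y] &
   exists i r, [/\ i \in IS p.1, r \in RS p & edge i r]].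

Lemma item_arc p y : item p -> y \in KS p -> conn (C :&: M) p.1 y -> y \in ball C 30 p.1.
Proof.
case=> cC cM [d [dD NL nR]] [i [r [iI rR ir]]] yK cy.
exact: (K_arc c4 fh CE m11 CV Cmin MV nM cC dD NL cM nR iI rR ir yK cy).
Qed.

Lemma item_I p i : item p -> i \in IS p.1 -> [/\ i \in C, i \in M & i \in ball C 25 p.1].
Proof. by case=> cC _ _ _ /(IsetP c4 fh CE m11 CV Cmin MV cC)[]. Qed.

Lemma item_conn p y : item p -> y \in ball C 35 p.1 -> conn (C :&: M) p.1 y.
Proof.
case=> _ cM _ _ yb; apply: connSub (ball_conn yb).
by rewrite subsetI ball_sub.
Qed.

Lemma ball_up r s c y : r <= s -> y \in ball C r c -> y \in ball C s c.
Proof. by move=> rs; apply: (subsetP (ball_leq _ _ rs)). Qed.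

Lemma item_connI p i : item p -> i \in IS p.1 -> conn (C :&: M) p.1 i.
Proof. by move=> ip iI; apply: item_conn => //; have [_ _] := item_I ip iI; exact: ball_up. Qed.

Lemma item_edge p : item p -> exists i r, [/\ i \in IS p.1, r \in KS p & edge i r].
Proof.
case=> _ _ _ [i [r [iI rR ir]]]; exists i, r; split=> //; exact: (subsetP (RK M C p.1 p.2)).
Qed.

Lemma KS_in p y : y \in KS p -> y \in M /\ y \notin IS p.1.
Proof. by move/(subsetP (reach_sub _ _))/setDP. Qed.

Lemma KS_conn p y z : y \in KS p -> conn (M :\: IS p.1) y z -> z \in KS p.
Proof. by rewrite /KS !reachP => /andP[-> h] h' /=; exact: connect_trans h h'. Qed.

Lemma KS_inner p y z : y \in KS p -> z \in KS p -> conn (KS p) y z.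
Proof.
move=> yK zK; apply: (connect_trans _ (ball_conn zK)).
by rewrite -/(conn _ _ _) conn_sym; exact: ball_conn.
Qed.

Lemma KS_avoid p p' y z : (forall w, w \in KS p -> w \notin IS p'.1) ->
  y \in KS p -> z \in KS p -> y \in KS p' -> z \in KS p'.
Proof.
move=> av yK zK yK'; apply: KS_conn yK' _; apply: connSub (KS_inner yK zK).
by apply/subsetP => w wK; have [wM _] := KS_in wK; rewrite in_setD av.
Qed.

Lemma KS_sub p p' : item p -> (forall w, w \in KS p -> w \notin IS p'.1) ->
  (forall i, i \in IS p.1 -> i \in KS p') -> KS p \subset KS p'.
Proof.
move=> ip av iK'; have [j [r [jI rK jr]]] := item_edge ip; apply/subsetP => y yK.
have [rM _] := KS_in rK; apply: (KS_avoid av rK yK).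
by apply: (reach_closed (iK' _ jI) _ jr); rewrite in_setD av.
Qed.

(** If the two components met, the first would lie in the second, and so would the vertex of I
    attached to the first. *)
Lemma KS_disjoint p p' y : item p -> (forall w, w \in KS p -> w \notin IS p'.1) ->
  (forall w, w \in KS p' -> w \notin IS p.1) -> (forall i, i \in IS p.1 -> i \notin IS p'.1) ->
  y \in KS p -> y \notin KS p'.
Proof.
move=> ip av av' dI yK; apply/negP => yK'.
have [j [r [jI rK jr]]] := item_edge ip.
have rK' := KS_avoid av yK rK yK'; have [_ jM _] := item_I ip jI.
have jK' : j \in KS p'.
  by apply: (reach_closed rK'); rewrite 1?edgeC // in_setD jM dI.
by have := av' _ jK'; rewrite jI.
Qed.

(** Here 95 + 25 = 120: a set [IS] not contained in the deleted balls of radius 120 has its centre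
    far from theirs. *)
Definition far p p' := p'.1 \notin ball C 95 p.1.

Lemma farC p p' : far p p' = far p' p.
Proof. by rewrite /far ballC. Qed.

Lemma far_ball p p' r s y : far p p' -> r + s <= 95 -> y \in ball C r p.1 -> y \in ball C s p'.1 -> False.
Proof.
move=> /negP fp rs yr ys; apply: fp; apply: ball_up rs _.
by apply: ball_cat yr _; rewrite ballC.
Qed.

Lemma far_I p p' i : item p -> item p' -> far p p' -> i \in IS p.1 -> i \notin IS p'.1.
Proof.
move=> ip ip' fp iI; apply/negP => iI'; have [_ _ h1] := item_I ip iI; have [_ _ h2] := item_I ip' iI'.
exact: far_ball fp _ h1 h2.
Qed.

(** Deleted vertices of C whose successor lies in K. They mark, by one end each, arcs of [C :&: M]
    that start in K. *)
Definition exits K := [set y in C :\: M | [exists q : 'I_m, (y == f q) && (f q.+1 \in K)]].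

Lemma exitsE K q : f q \notin M -> (f q \in exits K) = (f q.+1 \in K).
Proof.
move=> qM; have [m4 e _] := fh; have m0 : 0 < m by apply: leq_trans m4.
rewrite inE in_setD qM CE in_img //=; apply/existsP/idP => [[j /andP[/eqP E]]|h].
  suff -> : f j.+1 = f q.+1 by [].
  by apply/eqP; move/eqP: E; rewrite !e -[j.+1]addn1 -[q.+1]addn1 => /eqP E; rewrite -modnDml -E modnDml.
exists (Ordinal (ltn_pmod q m0)); rewrite /= (hol_mod _ fh) eqxx /=.
suff -> : f (q %% m).+1 = f q.+1 by [].
by apply/eqP; rewrite e -addn1 modnDml addn1.
Qed.

(** Walk back along C from y to the first vertex outside M: it precedes the arc of y. *)
Lemma exit_ex y : y \in C :&: M -> ~~ (C \subset M) ->
  exists q, [/\ f q \notin M, f q.+1 \in M & conn (C :&: M) y (f q.+1)].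
Proof.
case/setIP => yC yM /subsetPn[z zC zM]; have [m4 e _] := fh; have m0 : 0 < m by apply: leq_trans m4.
rewrite CE in yC zC; have [a am yE] := in_imgP fh yC; have [b bm zE] := in_imgP fh zC.
have exj : exists j, (0 < j <= m) && (f (a + m - j) \notin M).
  case: (ltngtP b a) => ab; last by move: zM; rewrite zE ab -yE yM.
    exists (a - b); have -> : a + m - (a - b) = b + m by move: ab; clear; lia.
    by rewrite hol_per // -zE zM andbT; move: ab am; clear; lia.
  exists (a + m - b); rewrite subKn; last by move: bm; clear; lia.
  by rewrite -zE zM andbT; move: ab bm; clear; lia.
case: (ex_minnP exj) => j /andP[/andP[j0 jm] jM] jmin; exists (a + m - j).
have inM i : a + m - j < i <= a + m -> f i \in M.
  move=> hi; apply: contraT => iM; have := jmin (a + m - i).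
  rewrite subKn; last by case/andP: hi.
  rewrite iM andbT; case: (eqVneq i (a + m)) => [E|n]; last by move: hi n j0 jm; clear; lia.
  by move: iM; rewrite E hol_per // -yE yM.
have q1 : (a + m - j).+1 <= a + m by move: j0 jm; clear; lia.
split=> //; first by apply: inM; rewrite leqnn.
rewrite conn_sym yE -[f a](hol_per _ fh) -[in X in conn _ _ (f X)](subnKC q1).
apply: (hol_run fh) => i; rewrite subnKC // => /andP[h1 h2].
by rewrite in_setI CE in_img // inM // h2 andbT.
Qed.

Definition wide p := ~~ (KS p :&: C \subset ball C 30 p.1).

Section Exits.
Variables (p p' : G * G) (q : nat).
Hypotheses (ip : item p) (ip' : item p') (fpp : far p p').
Hypotheses (qM : f q \notin M) (cq : conn (C :&: M) p.1 (f q.+1)).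

Lemma in_CM : p.1 \in C :&: M.
Proof. by case: ip. Qed.

Lemma CM_conn (S : {set G}) y z : conn (C :&: M :\: S) y z -> conn (M :\: S) y z.
Proof. by apply: connSub; apply: setSD; exact: subsetIr. Qed.

(** By [item_arc] the start of the arc would be within 30 of the centre, so the deleted vertex
    before it would be within 31, where everything is in M. *)
Lemma exit_not r : item r -> f q.+1 \in KS r -> conn (C :&: M) r.1 (f q.+1) -> False.
Proof.
move=> ir h1 h2; have h := item_arc ir h1 h2; case/negP: qM; have [_ cM _ _] := ir.
apply: (subsetP cM); apply: (ball_up (isT : 31 <= 35)); apply: ballS h _ _; first by rewrite CE in_img.
by rewrite edgeC; exact: (hol_edgeS _ fh).
Qed.

Lemma exit_self : f q \notin exits (KS p).
Proof. by rewrite exitsE //; apply/negP => h; exact: exit_not ip h cq. Qed.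

(** If [KS p'] met [IS p.1], follow the arc to its start: either it stays in [KS p'], making [f q]
    an exit, or it meets [IS p'.1]; then both items share an arc and [item_arc] puts y near both
    centres. *)
Lemma exit_avoid : f q \notin exits (KS p') -> forall y, y \in KS p' -> y \notin IS p.1.
Proof.
rewrite exitsE // => nq y yK; apply/negP => yI.
have [yC yM y25] := item_I ip yI; have yCM : y \in C :&: M by rewrite in_setI yC.
have cy := item_connI ip yI.
have cyq : conn (C :&: M) y (f q.+1).
  by apply: (connect_trans _ cq); rewrite -/(conn _ _ _) conn_sym.
case: (conn_split (IS p'.1) yCM cyq) => [/CM_conn h|[i iI [_ ci]]].
  by case/negP: nq; exact: KS_conn yK h.
have cp'y : conn (C :&: M) p'.1 y.
  by apply: (connect_trans (item_connI ip' iI)); rewrite -/(conn _ _ _) conn_sym.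
exact: far_ball fpp _ y25 (item_arc ip' yK cp'y).
Qed.

(** From the start of the arc, which lies in [KS p'], the arc leads to i. It cannot meet [IS p'.1],
    since then [exit_not] would apply to [p']. *)
Lemma exit_inside : f q \in exits (KS p') -> forall i, i \in IS p.1 -> i \in KS p'.
Proof.
rewrite exitsE // => qK i iI.
have qCM : f q.+1 \in C :&: M by apply: conn_in in_CM cq.
have ci : conn (C :&: M) (f q.+1) i.
  by apply: (connect_trans _ (item_connI ip iI)); rewrite -/(conn _ _ _) conn_sym.
case: (conn_split (IS p'.1) qCM ci) => [/CM_conn h|[j jI [_ cj]]]; first exact: KS_conn qK h.
case: (exit_not ip' qK); apply: (connect_trans (item_connI ip' jI)).
by rewrite -/(conn _ _ _) conn_sym.
Qed.
End Exits.

Lemma wide_exits p : item p -> wide p -> ~~ (C \subset M) -> exits (KS p) != set0.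
Proof.
move=> ip /subsetPn[y /setIP[yK yC] yb] nCM; have [yM yI] := KS_in yK.
have yCM : y \in C :&: M by rewrite in_setI yC.
have [q [qM q1M cq]] := exit_ex yCM nCM; apply/set0Pn; exists (f q); rewrite exitsE //.
case: (conn_split (IS p.1) yCM cq) => [/CM_conn h|[i iI [_ ci]]]; first exact: KS_conn yK h.
case/negP: yb; apply: (item_arc ip yK); apply: (connect_trans (item_connI ip iI)).
by rewrite -/(conn _ _ _) conn_sym.
Qed.

(** Apply [branch_system] to the sets [exits (KS p)], with [al p] the deleted vertex before the arc
    of p. Whether it is an exit of another component decides between nesting and disjointness. *)
Lemma card_wide (TM : {set G * G}) : (forall p, p \in TM -> item p /\ wide p) ->
  (forall p p', p \in TM -> p' \in TM -> p != p' -> far p p') -> #|TM| <= (#|C :\: M|).*2.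
Proof.
move=> h1 h2; case: (boolP (C \subset M)) => CM.
  case: (set_0Vmem TM) => [->|[p pT]]; first by rewrite cards0.
  have [ip /subsetPn[y /setIP[yK yC] yb]] := h1 _ pT; case/negP: yb.
  have CMC : C :&: M = C by apply/setIidPl.
  have [pC _ _ _] := ip; apply: item_arc ip yK _; rewrite CMC; rewrite CMC in pC.
  have c0 z : z \in C -> conn C (f 0) z.
    rewrite {1}CE => /(in_imgP fh)[k _ ->]; rewrite -[k]add0n.
    by apply: (hol_run fh) => i _; rewrite CE in_img.
  by apply: (connect_trans _ (c0 _ yC)); rewrite -/(conn _ _ _) conn_sym; exact: c0.
have ex p : exists q, (p \in TM) ==> (f q \notin M) && conn (C :&: M) p.1 (f q.+1).
  case: (boolP (p \in TM)) => [pT|_]; last by exists 0.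
  have [[pC _ _ _] _] := h1 _ pT; have [q [q1 q2 q3]] := exit_ex pC CM; exists q.
  by rewrite q1.
pose al p := f (xchoose (ex p)).
have alP p : p \in TM -> al p \notin M /\ conn (C :&: M) p.1 (f (xchoose (ex p)).+1).
  by move=> pT; have /implyP/(_ pT)/andP[] := xchooseP (ex p).
apply: (branch_system (al := al) (A := fun p => exits (KS p))).
- move=> p pT; have [ip wp] := h1 _ pT; have [aM ac] := alP _ pT; split.
  + by rewrite in_setD aM CE in_img.
  + exact: (exit_self ip aM ac).
  + suff -> : exits (KS p) :&: (C :\: M) = exits (KS p) by exact: wide_exits.
    by apply/setIidPl/subsetP => y; rewrite inE => /andP[].
- move=> p p' pT p'T pp' n1 n2; have [ip _] := h1 _ pT; have [ip' _] := h1 _ p'T.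
  have fp := h2 _ _ pT p'T pp'; have fp' : far p' p by rewrite farC.
  have [aM ac] := alP _ pT; have [aM' ac'] := alP _ p'T.
  have av := exit_avoid ip ip' fp aM ac n1; have av' := exit_avoid ip' ip fp' aM' ac' n2.
  apply/setP => y; rewrite !inE; apply/negbTE/negP.
  move=> /andP[/andP[yCM /existsP[q /andP[/eqP yE qK]]] /andP[_ /existsP[q' /andP[/eqP yE' qK']]]].
  have yM : y \notin M by case/andP: yCM.
  have := KS_disjoint ip av' av (fun i => far_I ip ip' fp) qK.
  rewrite -exitsE -?yE // yE' exitsE -?yE' // qK'; by [].
move=> p p' pT p'T pp' n1 n2; have [ip _] := h1 _ pT; have [ip' _] := h1 _ p'T.
have fp := h2 _ _ pT p'T pp'; have fp' : far p' p by rewrite farC.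
have [aM ac] := alP _ pT; have [aM' ac'] := alP _ p'T.
have av' := exit_avoid ip' ip fp' aM' ac' n2.
have sub := KS_sub ip av' (exit_inside ip ip' aM ac n1).
apply/subsetP => y; rewrite !inE => /andP[-> /existsP[q /andP[yE qK]]] /=.
by apply/existsP; exists q; rewrite yE (subsetP sub).
Qed.

Variable X0 : {set G}.
Hypothesis NL : forall c, c \in C :&: M -> ~ holed (ball M 7 c :|: (D :\: X0)).
Hypothesis margin : forall c, c \in C -> c \notin X0 -> ball C 60 c \subset M.

(** Some i in I survives. It is within 25 of c, so its margin 60 covers radius 35 around c, and the
    radius 120 of deleted balls keeps c at distance more than 95 from their centres. *)
Lemma link_cond_item X t : X0 \subset X -> link_cond D X t ->
  item t.1 /\ forall p, ball C 120 p.1 \subset X -> far p t.1.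
Proof.
case: t => -[c x] d X0X /and5P[/= cC /subsetPn[i iI iX] /andP[dD dX] nR /andP[ir _]].
have [iC iM _ i25] := IsetP c4 fh CE m11 CV Cmin MV cC iI.
split.
  split=> //=.
  - have iX0 : i \notin X0 by apply: contra iX; exact: (subsetP X0X).
    apply/subsetP => y yb; apply: (subsetP (margin iC iX0)).
    by apply: (@ball_cat _ _ 25 35 i c) yb; rewrite ballC.
  - exists d; split=> //.
      move=> h; apply: (NL cC); apply: holedS h; apply: setUS; rewrite sub1set in_setD dD andbT.
      by apply: contra dX; exact: (subsetP X0X).
    by move=> y yR; apply: contra nR => e; apply/existsP; exists y; apply/andP.
  case/existsP: ir => j /andP[jI /existsP[r /andP[rR jr]]]; by exists j, r.
move=> p pX; apply/negP => h; case/negP: iX; apply: (subsetP pX).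
exact: (@ball_cat _ _ 95 25 _ c).
Qed.

Lemma link_loopP : let: (X, fam, q) := link_loop D X0 in
  [/\ X0 \subset X, X \subset X0 :|: C :|: D, #|X| <= #|X0| + 242 * q + 482 * #|C :\: M|,
      famok fam q & forall t, ~~ link_cond D X t].
Proof.
(* [TM] collects the wide items and [TS] the packed ones. A wide step costs 241 and is counted at
   most twice per vertex of [C :\: M]; a packed step costs 242. *)
pose inv (s : seq (G * G * G)) (st : {set G} * {ffun G -> nat} * nat) := exists TM TS : {set G * G},
  [/\ [/\ X0 \subset st.1.1, st.1.1 \subset X0 :|: C :|: D & #|st.1.1| <= #|X0| + 242 * st.2 + 241 * #|TM|],
   famok st.1.2 st.2 /\ (forall t, t \in s -> ~~ link_cond D st.1.1 t),
   (forall p, p \in TM -> wide p) /\ (forall p, p \in TM :|: TS -> item p /\ ball C 120 p.1 \subset st.1.1),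
   forall p p', p \in TM :|: TS -> p' \in TM :|: TS -> p != p' -> far p p' &
   forall y, st.1.2 y != 0 -> (y \in D /\ y \in st.1.1) \/
     exists p, [/\ p \in TS, y \in KS p :|: ball C 30 p.1 & KS p :&: C \subset ball C 30 p.1]].
suff : inv triples (link_loop D X0).
  case: link_loop => -[X fam] q [TM [TS [[/= h1 h2 h3] [h4 h5] [h6 h7] h8 _]]]; split=> //.
    apply: leq_trans h3 _; rewrite leq_add2l.
    have : #|TM| <= (#|C :\: M|).*2.
      apply: card_wide => [p pT|p p' pT p'T].
        by split; [have [] := h7 p; rewrite // in_setU pT|exact: h6].
      by apply: h8; rewrite in_setU ?pT ?p'T.
    by move: #|TM| #|C :\: M| => a b; clear; lia.
  case=> p d; apply: h5; apply/allpairsP; exists (p, d); by rewrite mem_vpairs mem_enum.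
have anti (X X' : {set G}) t : X \subset X' -> link_cond D X' t -> link_cond D X t.
  move=> XX' /and5P[h1 h2 /andP[h3 h4] h5 /andP[h6 h7]].
  rewrite /link_cond h1 h3 h5 h6 h7 !andbT /=; apply/andP; split.
    by apply: contra h2 => h; exact: subset_trans XX'.
  by apply: contra h4; exact: (subsetP XX').
rewrite /link_loop; elim/last_ind: triples => [|s t].
  exists set0, set0; split=> //=; last by move=> y; rewrite ffunE.
  - split=> //=; [by rewrite -setUA subsetUl|by rewrite cards0 !muln0 !addn0].
  - by split=> //; exact: famok0.
  - by split=> p; rewrite !inE.
  - by move=> p p'; rewrite !inE.
rewrite foldl_rcons; case: (foldl _ _ _) => -[X fam] q [TM [TS [[/= h1 h2 h3] [h4 h5] [h6 h7] h8 h9]]].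
rewrite /link_step /=; case: ifP => [lc|/negbT nlc]; last first.
  exists TM, TS; split=> //=; split=> // t'; rewrite mem_rcons inE => /predU1P[->//|]; exact: h5.
have [ip fp] := link_cond_item h1 lc.
have tC : t.1.1 \in C by case: ip => /setIP[].
have newp p : p \in TM :|: TS -> far p t.1 by move=> /h7[_]; exact: fp.
have newT : t.1 \notin TM :|: TS.
  apply/negP => /newp; rewrite /far => /negP; apply.
  by apply: (ball_up (leq0n _)); exact: ball0.
have c120 : #|ball C 120 t.1.1| <= 241.
  by have := @card_ball _ m f 120 t.1.1 fh; rewrite -CE => /(_ tC).
have IX (Y : {set G}) : ball C 120 t.1.1 \subset Y -> ~~ link_cond D Y t.
  move=> bY; apply/negP => /and5P[_ /negP h _ _ _]; apply: h.
  apply: subset_trans bY; apply/subsetP => i /(item_I ip)[_ _]; exact: ball_up.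
have h8' (S S' : {set G * G}) p p' : t.1 |: (TM :|: TS) = S :|: S' ->
    p \in S :|: S' -> p' \in S :|: S' -> p != p' -> far p p'.
  move=> <- /setU1P[->|pT] /setU1P[->|p'T]; rewrite ?eqxx // => ne; last exact: h8.
    by rewrite farC; exact: newp.
  exact: newp.
case: ifP => [small|/negbT big].
  exists TM, (t.1 |: TS).
  have E : t.1 |: (TM :|: TS) = TM :|: (t.1 |: TS) by rewrite setUCA.
  case/and5P: (lc) => _ _ /andP[dD dX] nR /andP[_ /existsP[y0 /andP[y0K dy0]]].
  split.
  - split=> /=; first by apply: subset_trans h1 (subsetUl _ _).
      rewrite !subUset h2 sub1set /=; apply/andP; split; last by apply/setUP; right.
      by apply/subsetP => y /(subsetP (ball_sub _ _ _)) yC; rewrite !in_setU yC orbT.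
    apply: leq_trans (leq_card_setU _ _) _.
    have : #|ball C 120 t.1.1 :|: [set t.2]| <= 241 + 1 by apply: cardU_le; rewrite ?cards1.
    by move: h3; clear; lia.
  - split=> /=.
      apply: famok_add => //.
        have [cC cM _ [i [r [iI rR ir]]]] := ip.
        apply: (link_holed c4 fh CE m11 CV Cmin MV cC dD cM _ iI rR ir y0K dy0).
        by move=> y yR; apply: contra nR => e; apply/existsP; exists y; apply/andP.
      move=> y yU; apply/eqP; apply: contraT => /h9 old.
      have yKb : y \in KS t.1 :|: ball C 30 t.1.1 -> y \in M.
        case/setUP => [/KS_in[] //|yb]; case: ip => _ cM _ _; apply: (subsetP cM).
        exact: ball_up yb.
      have yDM : y \in M -> y \notin D by move/(subsetP MV)/setDP => [].
      case: old => [[yD yX]|[p [pT yp sp]]].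
        case/setUP: yU => [/setUP[/set1P yE|yK]|yb].
        + by move: dX; rewrite -yE yX.
        + by have := yDM (yKb _); rewrite yD in_setU yK => /(_ isT).
        + by have := yDM (yKb _); rewrite yD in_setU yb orbT => /(_ isT).
      have pTT : p \in TM :|: TS by rewrite in_setU pT orbT.
      have [ipp _] := h7 _ pTT; have fpp := newp _ pTT.
      have ypM : y \in M.
        case/setUP: yp => [/KS_in[] //|yb]; case: ipp => _ cM _ _; apply: (subsetP cM).
        exact: ball_up yb.
      have b30 r z : KS r :&: C \subset ball C 30 r.1 -> z \in KS r -> z \in C -> z \in ball C 30 r.1.
        by move=> s1 zK zC; apply: (subsetP s1); rewrite in_setI zK.
      have avoid r r' : item r -> item r' -> far r r' -> KS r :&: C \subset ball C 30 r.1 ->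
          forall w, w \in KS r -> w \notin IS r'.1.
        move=> ir ir' frr sr w wK; apply/negP => wI; have [wC _ w25] := item_I ir' wI.
        exact: far_ball frr _ (b30 _ _ sr wK wC) w25.
      have ftp : far t.1 p by rewrite farC.
      case/setUP: yU => [/setUP[/set1P yE|yK]|yb].
      + by move: dD; rewrite -yE; have := yDM ypM; move/negbTE->.
      + case/setUP: yp => [yK'|yb'].
          have := KS_disjoint ip (avoid _ _ ip ipp ftp small) (avoid _ _ ipp ip fpp sp) (fun i => far_I ip ipp ftp) yK.
          by rewrite yK'.
        have yC := subsetP (ball_sub _ _ _) _ yb'.
        by case: (far_ball ftp (isT : 30 + 30 <= 95) (b30 _ _ small yK yC) yb').
      + have yC := subsetP (ball_sub _ _ _) _ yb.
        have yb' : y \in ball C 30 p.1 by case/setUP: yp => // yK'; exact: b30 sp yK' yC.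
        by case: (far_ball ftp (isT : 30 + 30 <= 95) yb yb').
    move=> t'; rewrite mem_rcons inE => /predU1P[->|/h5 h].
      by apply: IX; apply: subset_trans (subsetUr _ _); exact: subsetUl.
    by apply: contra h; apply: anti; exact: subsetUl.
  - split=> // p; rewrite -E => /setU1P[->|/h7[h10 h11]]; split=> //=.
      by apply: subset_trans (subsetUr _ _); exact: subsetUl.
    by apply: subset_trans h11 (subsetUl _ _).
  - by move=> p p'; apply: h8'.
  - move=> y /=; rewrite ffunE; case: ifP => [/setUP yU _|_ /h9[[yD yX]|[p [pT yp sp]]]].
    + case: yU => [/setUP[/set1P->|yK]|yb].
      * by left; split; [exact: dD|apply/setUP; right; apply/setUP; right; exact: set11].
      * by right; exists t.1; rewrite setU11 in_setU yK.
      * by right; exists t.1; rewrite setU11 in_setU yb orbT.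
    + by left; rewrite in_setU yX.
    + by right; exists p; split=> //; exact: setU1r.
exists (t.1 |: TM), TS.
have E : t.1 |: (TM :|: TS) = (t.1 |: TM) :|: TS by rewrite setUA.
split.
- split=> /=; first by apply: subset_trans h1 (subsetUl _ _).
    rewrite subUset h2 /=.
    by apply/subsetP => y /(subsetP (ball_sub _ _ _)) yC; rewrite !in_setU yC orbT.
  apply: leq_trans (leq_card_setU _ _) _; rewrite cardsU1.
  have -> : t.1 \notin TM by apply: contra newT => h; rewrite in_setU h.
  move: h3 c120; rewrite add1n; move: #|X| #|ball C 120 t.1.1| #|X0| #|TM| => a b a' b'.
  by clear; lia.
- split=> //= t'; rewrite mem_rcons inE => /predU1P[->|/h5 h]; first by apply: IX; exact: subsetUr.
  by apply: contra h; apply: anti; exact: subsetUl.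
- split=> p; first by move/setU1P => [->//|]; exact: h6.
  rewrite -E => /setU1P[->|/h7[h10 h11]]; split=> //=; first exact: subsetUr.
  by apply: subset_trans h11 (subsetUl _ _).
- by move=> p p'; apply: h8'.
move=> y /= /h9[[yD yX]|]; [left|by right].
by rewrite in_setU yX.
Qed.
End LinkLoop.

(** * The frame loop *)

Lemma foldl_enum (T : finType) (S : Type) (f : S -> T -> S) s0 (P : nat -> S -> Prop) :
  P 0 s0 -> (forall v s, P (enum_rank v) s -> P (enum_rank v).+1 (f s v)) ->
  P #|T| (foldl f s0 (enum T)).
Proof.
move=> P0 Pf.
suff h n : n <= #|T| -> P n (foldl f s0 (take n (enum T))).
  by have := h #|T| (leqnn _); rewrite take_oversize // cardE.
elim: n => [|n IH] nT; first by rewrite take0.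
rewrite (take_nth (enum_val (Ordinal nT))) -?cardE // foldl_rcons.
set v := nth _ _ _; have vE : enum_rank v = n :> nat.
  have -> : v = enum_val (Ordinal nT) by rewrite /enum_val; apply: set_nth_default; rewrite -cardE.
  by rewrite enum_valK.
by rewrite -vE; apply: Pf; rewrite vE; apply: IH; exact: ltnW.
Qed.

Section FrameLoop.
Variable G : sgraph.
Hypothesis c4 : C4_free G.
Implicit Types (S T U Z X : {set G}) (c d x y z : G).
Variables (Gam C : {set G}).

Definition comp_of c x := reach (ball Gam 7 c :\: Iset Gam C c) x.
Definition odd_pair Z c x :=
  odd #|[set e in restr (oedges G) Z | lam (Iset Gam C c) (comp_of c x) e.1 e.2]|.
Definition fstate := ({set G} * {set G * G} * ({set G * G} * {set G * G}))%type.
Definition frame_hit (st : fstate) := branch st.2.2 :|: [set x | [exists j, (j, x) \in st.1.2]].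
Definition first_c Z := least [set c in C | [exists x, odd_pair Z c x]].
Definition first_x Z := least [set x | [exists c in first_c Z, odd_pair Z c x]].
Definition new_I Z := [set y | [exists c in first_c Z, y \in Iset Gam C c]].
Definition new_R Z := [set y | [exists c in first_c Z, [exists x in first_x Z, y \in comp_of c x]]].
(** The loop vertex j serves as the name of the new slot, so names are fresh and there are enough of
    them. *)
Definition frame_next (st : fstate) j : fstate :=
  if holedb (Gam :\: frame_hit st) then
    let Z := minhole (Gam :\: frame_hit st) in
    let I := addrow st.1.2 j (new_I Z) in
    let R := addrow st.2.1 j (new_R Z) in
    (j |: st.1.1, I, (R, core (basis I R (st.2.2 :|: restr (oedges G) Z))))
  else st.
Definition frame_loop := foldl frame_next ((set0, set0), (set0, set0)) (enum G).

Hypothesis CG : C \subset Gam.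
Hypothesis nGC : ~ holed (Gam :\: C).
Hypothesis NL : forall c, c \in C -> ~ holed (ball Gam 7 c).
Hypothesis Ismall : forall c, c \in C -> #|Iset Gam C c| <= 51.

Lemma comp_coc c x : coc Gam (lam (Iset Gam C c) (comp_of c x)).
Proof.
have cl0 : clique (set0 : {set G}) by move=> y z; rewrite inE.
have h := @lam_ball_coc G Gam set0 cl0 3 c (Iset Gam C c) (comp_of c x).
rewrite /Uball !setU0 in h; apply: h => //.
- by apply/subsetP => y; rewrite inE => /and3P[].
- exact: reach_sub.
- exact: reach_closed.
Qed.

Lemma first_odd l f : 6 <= l -> hol l f -> img l f \subset Gam -> exists c x,
  [/\ c \in C, new_I (img l f) = Iset Gam C c, new_R (img l f) = comp_of c x &
      zs l f (lam (Iset Gam C c) (comp_of c x))].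
Proof.
move=> l6 fh fG.
have oE c x : odd_pair (img l f) c x = zs l f (lam (Iset Gam C c) (comp_of c x)).
  by rewrite -(hole_xs fh) ?xs_odd //; exact: lam_sym.
have cl0 : clique (set0 : {set G}) by move=> y z; rewrite inE.
have [|||||c [x [cC o _]]] := detect_comp c4 CG cl0 l6 fh.
- by rewrite setU0.
- exact: sub0set.
- by move=> c cC; rewrite /Uball setU0; exact: NL.
- by apply/pred0P => y /=; rewrite inE andbF.
- by rewrite setU0.
have n1 : [set c in C | [exists x, odd_pair (img l f) c x]] != set0.
  by apply/set0Pn; exists c; rewrite inE cC; apply/existsP; exists x; rewrite oE.
have [c1] := least_ex n1; rewrite inE => /andP[c1C /existsP[x1 o1]] E1.
have ex1 (P : pred G) : [exists y in first_c (img l f), P y] = P c1.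
  rewrite /first_c E1; apply/existsP/idP => [[y /andP[/set1P-> //]]|Px]; by exists c1; rewrite set11.
have n2 : [set x | [exists c in first_c (img l f), odd_pair (img l f) c x]] != set0.
  by apply/set0Pn; exists x1; rewrite inE ex1.
have [x2] := least_ex n2; rewrite inE ex1 => o2 E2.
have ex2 (P : pred G) : [exists y in first_x (img l f), P y] = P x2.
  rewrite /first_x E2; apply/existsP/idP => [[y /andP[/set1P-> //]]|Px]; by exists x2; rewrite set11.
exists c1, x2; split=> //; last by rewrite -oE.
  by apply/setP => y; rewrite inE ex1.
by apply/setP => y; rewrite inE ex1 ex2.
Qed.

Lemma card_bigcup_le (J : finType) (A : {set J}) (F : J -> {set G}) b :
  (forall j, j \in A -> #|F j| <= b) -> #|\bigcup_(j in A) F j| <= b * #|A|.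
Proof.
move=> h; rewrite mulnC -sum_nat_const; elim/big_rec2: _ => [|j n S jA IH]; first by rewrite cards0.
by apply: leq_trans (leq_card_setU _ _) _; rewrite leq_add // h.
Qed.

(** Each slot accounts for two branch vertices, by [card_branch], and at most 51 vertices of I. A
    long hole that survives to the end was available in every round, so every round added a slot. *)
Lemma frame_loopP : let st := frame_loop in
  [/\ frame Gam st.1.1 st.1.2 st.2.1 st.2.2, #|frame_hit st| <= 53 * #|st.1.1|,
      frame_hit st \subset Gam & holed (Gam :\: frame_hit st) -> #|G| <= #|st.1.1|].
Proof.
pose inv n (st : fstate) := [/\ frame Gam st.1.1 st.1.2 st.2.1 st.2.2,
  forall j, #|[set x | (j, x) \in st.1.2]| <= 51, forall j x, (j, x) \in st.1.2 -> x \in C,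
  (forall j, j \in st.1.1 -> enum_rank j < n) &
  holed (Gam :\: frame_hit st) -> n <= #|st.1.1|].
have : inv #|G| frame_loop.
  rewrite /frame_loop; apply: (foldl_enum (P := inv)).
    split=> //=; [exact: frame0|by move=> j; rewrite (_ : [set _ | _] = set0) ?cards0 //; apply/setP => x; rewrite !inE|..].
    + by move=> j x; rewrite inE.
    + by move=> j; rewrite inE.
  move=> v [[A I] [R H]] [/= fr rs rC Ar full]; rewrite /frame_next /=.
  case: (holedbP c4 (Gam :\: frame_hit ((A, I), (R, H)))) => [hZ|nh]; last first.
    by split=> //=; move=> j /Ar; exact: leqW.
  have [l [f [l6 fh fE fsub _]]] := minholeP c4 hZ; rewrite -fE in fsub *.
  have fG : img l f \subset Gam by apply: subset_trans fsub (subsetDl _ _).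
  have [c [x [cC -> -> o]]] := first_odd l6 fh fG.
  have vA : v \notin A by apply/negP => /Ar; rewrite ltnn.
  have nhit y : y \in img l f -> y \notin frame_hit ((A, I), (R, H)).
    by move=> /(subsetP fsub)/setDP[].
  have fr' : frame Gam (v |: A) (addrow I v (Iset Gam C c)) (addrow R v (comp_of c x))
      (core (basis (addrow I v (Iset Gam C c)) (addrow R v (comp_of c x)) (H :|: restr (oedges G) (img l f)))).
    apply: (frame_step fr vA fh fG _ _ (comp_coc c x) o).
      apply/pred0P => y /=; apply/negP => /andP[/nhit]; rewrite in_setU negb_or => /andP[/negP h _] /h.
      by [].
    move=> i y /nhit; rewrite in_setU negb_or => /andP[_]; rewrite inE => h; apply: contra h => iy.
    by apply/existsP; exists i.
  have [_ _ _ _ _ act _] := fr.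
  split=> //=.
  - move=> j; case: (eqVneq j v) => [->|jv].
      apply: leq_trans (Ismall cC); apply/subset_leq_card/subsetP => y; rewrite !inE eqxx /=.
      by case/orP => // vy; have /andP[/negP h _] := act v y vA.
    apply: leq_trans (rs j); apply/subset_leq_card/subsetP => y; rewrite !inE (negbTE jv) /= orbF.
    by [].
  - move=> j y; rewrite !inE /= => /orP[/rC //|/andP[_ /andP[]]]; by [].
  - by move=> j; rewrite !inE => /predU1P[->|/Ar /leqW].
  - move=> _; rewrite cardsU1 vA add1n ltnS; apply: full; exact: hZ.
case: frame_loop => -[A I] [R H] [/= fr rs rC Ar full] /=; split=> //.
  apply: leq_trans (leq_card_setU _ _) _; rewrite -[53]/(2 + 51) mulnDl leq_add //.
    have [sH ind _ _ d1 act _] := fr; rewrite mul2n.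
    apply: (card_branch (I := I) (R := R) _ d1 _ ind).
      exact: subset_trans sH (restr_sub _ _).
    by move=> j x jA; case/andP: (act j x jA).
  have [_ _ _ _ _ act _] := fr.
  apply: leq_trans (_ : #|\bigcup_(j in A) [set x | (j, x) \in I]| <= _); last exact: card_bigcup_le.
  apply/subset_leq_card/subsetP => x; rewrite inE => /existsP[j jx]; apply/bigcupP; exists j; last by rewrite inE.
  by apply: contraTT jx => jA; case/andP: (act j x jA).
have [sH _ _ _ _ _ _] := fr; apply/subsetP => x /setUP[|]; last first.
  by rewrite inE => /existsP[j /rC /(subsetP CG)].
rewrite inE => d3; have : 0 < deg H x by apply: leq_trans d3.
case/card_gt0P => e; rewrite inE => /andP[/(subsetP sH)]; rewrite inE => /and3P[_ e1 e2].
by case/orP => /eqP->.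
Qed.
End FrameLoop.

(** The hypothesis is the failure of [packP] with t = log(b + 1) + 1, where 4(2t + 1) + 1 = 8t + 5.
    It suffices that log(b + 1) is at most 2 log k + 20, as 8 times this plus 13 is the bound. *)
Lemma log_bound b k : 0 < k -> b < k * (8 * trunc_log 2 b.+1 + 13) -> b <= k * (16 * trunc_log 2 k + 173).
Proof.
move=> k0 hb; set y := trunc_log 2 b.+1 in hb; set L := trunc_log 2 k.
suff yL : y <= 2 * L + 20.
  apply: leq_trans (ltnW hb) _; rewrite leq_mul2l; apply/orP; right; move: yL; clear; lia.
rewrite leqNgt; apply/negP => yL.
have h1 : 2 ^ y <= b.+1 by apply: trunc_logP.
have h2 : k < 2 ^ L.+1 by exact: trunc_log_ltn.
(* If y is larger, then 8y + 13 is at most 2^z, and b + 1 would be below 2^(L + 1) 2^z = 2^y. *)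
pose z := y - L.+1.
have yE : y = L.+1 + z by rewrite /z; move: yL; clear; lia.
have h3 : 8 * y + 13 <= 2 ^ z.
  have z8 : L + 20 <= z by rewrite /z; move: yL; clear; lia.
  have : 16 * z + 64 <= 2 ^ z.
    have : 8 <= z by move: z8; clear; lia.
    clear; elim: z => // z IH; rewrite leq_eqVlt => /predU1P[<-|]; first by [].
    by rewrite ltnS => /IH; rewrite expnS; lia.
  by move: z8 yE; clear; lia.
have : 2 ^ y <= 2 ^ L.+1 * 2 ^ z - 2 ^ z.
  apply: leq_trans h1 _; apply: leq_trans hb _; rewrite -{2}[2 ^ z]mul1n -mulnBl.
  by apply: leq_mul => //; move: h2; clear; lia.
rewrite -expnD -yE; have : 0 < 2 ^ z by rewrite expn_gt0.
have : 2 ^ z <= 2 ^ y by rewrite leq_exp2l // yE leq_addl.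
by clear; lia.
Qed.

(** * The algorithm *)

Definition frame_bound k := k * (16 * trunc_log 2 k + 173).
(** Two local loops cost 163k each and the frame 53 times its size. Widening multiplies by 1 + 121,
    the wide links add 482 per deleted vertex of C, and 122 + 482 = 604; packed links cost 242k, and
    holes of length at most 20 are deleted entirely. *)
Definition core_bound k := 20 + (604 * (326 * k + 53 * frame_bound k) + 242 * k).

Section Core.
Variable G : sgraph.
Implicit Types (S T U V C X : {set G}) (fam : {ffun G -> nat}) (c d x y z : G).

(** Vertices stand in for the indices below k, which is faithful when k is at most #|G|. *)
Definition valid_fam k fam := [forall v : G, (enum_rank v < k) ==> holedb (cls fam (enum_rank v))].
Definition first_loop V C := local_loop (V :\: spread V C) set0 C set0.
Definition base_set V C := (V :\: spread V C) :\: (first_loop V C).1.1.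
Definition core_frame V C := frame_loop (base_set V C) (C :&: base_set V C).
(** If a long hole survives the frame loop, the frame has #|G| slots, and deleting the whole base
    set is within its bound. *)
Definition frame_set V C := (first_loop V C).1.1 :|:
  (if holedb (base_set V C :\: frame_hit (core_frame V C)) then base_set V C
   else frame_hit (core_frame V C)).
Definition second_loop V C :=
  local_loop ((V :\: spread V C) :\: frame_set V C) (spread V C) C (frame_set V C).
(** Vertices of C outside the widened set keep a margin of 60 = 25 + 35 on C: an i in I within 25 of
    c then secures radius 35 around c. *)
Definition widen_set V C := let X := (second_loop V C).1.1 in
  X :|: [set y in C | [exists x in X :&: C, y \in ball C 60 x]].
Definition third_loop V C :=
  link_loop ((V :\: spread V C) :\: (second_loop V C).1.1) C (spread V C) (widen_set V C).
Definition core_fam V C k :=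
  let f1 := (first_loop V C).1.2 in if valid_fam k f1 then f1 else
  let f2 := (pack (core_frame V C).2.2 k).1.2 in if valid_fam k f2 then f2 else
  let f3 := (second_loop V C).1.2 in if valid_fam k f3 then f3 else (third_loop V C).1.2.
Definition core_set V C := if #|C| <= 20 then C else (third_loop V C).1.1.

Hypothesis c4 : C4_free G.

Lemma valid_famP k fam : k <= #|G| -> reflect (forall i, i < k -> holed (cls fam i)) (valid_fam k fam).
Proof.
move=> kG; apply: (iffP forallP) => [h i ik|h v].
  have := h (enum_val (Ordinal (leq_trans ik kG))); rewrite enum_valK /= ik /=.
  by move/(holedbP c4).
by apply/implyP => vk; apply/(holedbP c4)/h.
Qed.

Lemma famok_valid k fam q : k <= #|G| -> famok fam q -> ~~ valid_fam k fam -> q < k.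
Proof.
move=> kG [h _]; apply: contraR; rewrite -leqNgt => kq; apply/(valid_famP _ kG) => i ik.
by apply: h; exact: leq_trans kq.
Qed.

Variables (V C : {set G}) (m : nat) (f : nat -> G) (k : nat).
Hypothesis fh : hol m f.
Hypothesis CE : C = img m f.
Hypothesis CV : C \subset V.
Hypothesis Cmin : forall l h, 6 <= l -> hol l h -> img l h \subset V -> m <= l.
Hypothesis nVC : ~ holed (V :\: C).
Hypothesis kG : k <= #|G|.
Hypothesis k0 : 0 < k.

Lemma spread_sub : spread V C \subset V :\: C.
Proof. by apply/subsetP => y; rewrite inE => /andP[]. Qed.

Lemma CM0 : C \subset V :\: spread V C.
Proof.
apply/subsetP => c cC; rewrite in_setD (subsetP CV) // andbT.
by apply/negP => /(subsetP spread_sub)/setDP[_]; rewrite cC.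
Qed.

Lemma core_small : #|C| <= 20 ->
  [/\ core_set V C \subset V, #|core_set V C| <= core_bound k & ~ holed (V :\: core_set V C)].
Proof.
move=> c20; rewrite /core_set c20; split=> //.
by apply: leq_trans c20 _; rewrite /core_bound leq_addr.
Qed.

Hypothesis m11 : 11 <= m.

Lemma first_facts : [/\ (first_loop V C).1.1 \subset C,
  #|(first_loop V C).1.1| <= 163 * (first_loop V C).2, famok (first_loop V C).1.2 (first_loop V C).2 &
  forall c, c \in C -> c \notin (first_loop V C).1.1 -> ~ holed (ball (V :\: spread V C) 7 c)].
Proof.
have := local_loopP c4 set0 fh CE m11 CV Cmin (subxx _) (sub0set _).
rewrite -/(first_loop V C); case: (first_loop V C) => -[X fam] q [_ h2 h3 h4 h5]; split=> //.
- by move: h2; rewrite set0U setU0.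
- by move: h3; rewrite cards0.
- move=> c cC cX hb; apply: (h5 c cC cX); apply: holedS hb; exact: subsetUl.
Qed.

Lemma base_sub : base_set V C \subset V :\: spread V C.
Proof. exact: subsetDl. Qed.

Lemma frame_facts : let st := core_frame V C in
  [/\ frame (base_set V C) st.1.1 st.1.2 st.2.1 st.2.2, #|frame_hit st| <= 53 * #|st.1.1|,
      frame_hit st \subset base_set V C & holed (base_set V C :\: frame_hit st) -> #|G| <= #|st.1.1|].
Proof.
have [XC _ _ NL] := first_facts; apply: (frame_loopP c4).
- exact: subsetIr.
- move=> h; apply: nVC; apply: holedS h; apply/subsetP => y /setDP[yB yC].
  have /setDP[yV yD] := subsetP base_sub _ yB.
  by rewrite in_setD yV andbT; apply: contra yC => yC; rewrite in_setI yC.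
- move=> c /setIP[cC]; rewrite in_setD => /andP[cX _] hb; apply: (NL c cC cX).
  by apply: holedS hb; apply: ballSS; exact: base_sub.
move=> c /setIP[cC cB]; have h : #|ball C 25 c| <= 51.
  by have := @card_ball _ m f 25 c fh; rewrite -CE => /(_ cC).
apply: leq_trans h; apply/subset_leq_card/subsetP => i; rewrite inE => /and3P[/setIP[iC _] _ ib].
exact: (ball_near c4 fh CE m11 CV Cmin base_sub cC iC ib).
Qed.

Lemma frame_small : ~~ valid_fam k (pack (core_frame V C).2.2 k).1.2 -> #|(core_frame V C).1.1| <= frame_bound k.
Proof.
move=> nv; have [fr _ _ _] := frame_facts; set b := #|_|.
apply: log_bound => //; rewrite ltnNge; apply/negP => hb; case/negP: nv.
have hl : b.+1 < 2 ^ (trunc_log 2 b.+1).+1 by exact: trunc_log_ltn.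
have [||_ fo] := packP c4 (t := (trunc_log 2 b.+1).+1) fr _ kG.
- by rewrite -/b expnS; move: hl; clear; lia.
- by rewrite -/b; apply: leq_trans hb; rewrite leq_mul2l; apply/orP; right; clear; lia.
by apply/(valid_famP _ kG) => i ik; case: fo => h _; exact: h.
Qed.

Lemma frame_set_facts : ~~ valid_fam k (first_loop V C).1.2 -> ~~ valid_fam k (pack (core_frame V C).2.2 k).1.2 ->
  [/\ frame_set V C \subset V :\: spread V C, #|frame_set V C| <= 163 * k + 53 * frame_bound k &
      ~ holed ((V :\: spread V C) :\: frame_set V C)].
Proof.
move=> nv1 nv2; have [XC cX fo _] := first_facts; have [fr ch hB full] := frame_facts.
have q1 := famok_valid kG fo nv1; have b2 := frame_small nv2.
rewrite /frame_set; case: (holedbP c4 (base_set V C :\: frame_hit (core_frame V C))) => hd.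
  split.
  - rewrite subUset base_sub andbT; apply: subset_trans XC CM0.
  - have h1 := full hd; have h2 : #|base_set V C| <= #|G| by exact: max_card.
    apply: leq_trans (leq_card_setU _ _) _; move: cX q1 b2 h1 h2.
    move: #|_| #|_| #|_| #|_| (frame_bound k) => a b c d e; clear; lia.
  - move=> [l [h [l6 hh /subsetP hs]]]; have := hs _ (in_img 0 hh).
    rewrite in_setD in_setU negb_or => /andP[/andP[h1 h2] h3].
    by case/negP: h2; rewrite in_setD h1.
split.
- rewrite subUset; apply/andP; split; first exact: subset_trans XC CM0.
  exact: subset_trans hB base_sub.
- apply: leq_trans (leq_card_setU _ _) _; move: cX q1 b2 ch.
  move: #|_| #|_| #|_| (frame_bound k) => a b c e; clear; lia.
move=> h; apply: hd; apply: holedS h; apply/subsetP => y.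
by rewrite !in_setD in_setU negb_or => /andP[/andP[-> ->]].
Qed.

Lemma second_facts : ~~ valid_fam k (second_loop V C).1.2 ->
  frame_set V C \subset V :\: spread V C ->
  [/\ frame_set V C \subset (second_loop V C).1.1, (second_loop V C).1.1 \subset V,
      #|(second_loop V C).1.1| <= #|frame_set V C| + 163 * k &
   forall c, c \in C -> c \notin (second_loop V C).1.1 ->
    ~ holed (ball ((V :\: spread V C) :\: frame_set V C) 7 c :|: (spread V C :\: (second_loop V C).1.1))].
Proof.
move=> nv fs; have := local_loopP c4 (frame_set V C) fh CE m11 CV Cmin (subsetDl _ (frame_set V C)) (subxx _).
rewrite -/(second_loop V C); case: (second_loop V C) nv => -[X fam] q /= nv [h1 h2 h3 h4 h5].
split=> //.
- apply: subset_trans h2 _; rewrite subUset; apply/andP; split; last first.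
    exact: subset_trans spread_sub (subsetDl _ _).
  by rewrite subUset; apply/andP; split=> //; exact: subset_trans fs (subsetDl _ _).
- have := famok_valid kG h4 nv; move: h3; move: #|_| #|_| => a b; clear; lia.
Qed.

(** As no stage packs k long holes, every stage stays within its bound. A surviving long hole gives
    by [hole_link] a triple that satisfies [link_cond], although the link loop has left none. *)
Lemma core_big : 20 < #|C| -> ~~ valid_fam k (core_fam V C k) ->
  [/\ core_set V C \subset V, #|core_set V C| <= core_bound k & ~ holed (V :\: core_set V C)].
Proof.
move=> c20; rewrite /core_fam.
case: ifP => [->//|/negbT nv1]; case: ifP => [->//|/negbT nv2]; case: ifP => [->//|/negbT nv3] nv4.
rewrite /core_set leqNgt c20 /=.
have [F1 F2 F3] := frame_set_facts nv1 nv2; have [S1 S2 S3 S4] := second_facts nv3 F1.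
pose X3 := (second_loop V C).1.1; pose X4 := widen_set V C; pose D := spread V C.
pose M := (V :\: D) :\: X3.
have X34 : X3 \subset X4 by exact: subsetUl.
have MV : M \subset V :\: D by exact: subsetDl.
have nM : ~ holed M by move=> h; apply: F3; apply: holedS h; exact: setDS.
have Cout c : c \in C -> c \notin X3 -> c \in M.
  by move=> cC cX; rewrite in_setD cX (subsetP CM0).
have NL c : c \in C :&: M -> ~ holed (ball M 7 c :|: (D :\: X4)).
  move=> /setIP[cC]; rewrite in_setD => /andP[cX _] h; apply: (S4 c cC cX); apply: holedS h.
  apply: setUSS; last exact: setDS.
  by apply: ballSS; exact: setDS.
have margin c : c \in C -> c \notin X4 -> ball C 60 c \subset M.
  move=> cC cX; apply/subsetP => y yb; have yC := subsetP (ball_sub _ _ _) _ yb; apply: Cout => //.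
  apply: contra cX => yX; rewrite in_setU; apply/orP; right; rewrite inE cC; apply/existsP; exists y.
  by rewrite in_setI yX yC ballC.
have := link_loopP c4 fh CE m11 CV Cmin MV nM NL margin.
have nv4' : ~~ valid_fam k (third_loop V C).1.2 by [].
have E : third_loop V C = link_loop M C D X4 by [].
rewrite -/D -E; case: (third_loop V C) nv4' => -[X5 f5] q5 /= nv5 [L1 L2 L3 L4 L5].
have q5k := famok_valid kG L4 nv5.
have X4V : X4 \subset V.
  rewrite subUset S2; apply/subsetP => y; rewrite inE => /andP[yC _]; exact: (subsetP CV).
split.
- apply: subset_trans L2 _; rewrite subUset; apply/andP; split; last first.
    exact: subset_trans spread_sub (subsetDl _ _).
  by rewrite subUset; apply/andP; split.
- have c3 : #|C :\: M| <= #|X3|.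
    apply/subset_leq_card/subsetP => c /setDP[cC cM]; apply: contraR cM; exact: Cout.
  have c4' : #|X4| <= #|X3| + 121 * #|X3|.
    apply: leq_trans (leq_card_setU _ _) _; rewrite leq_add2l.
    apply: leq_trans (_ : #|\bigcup_(x in X3 :&: C) ball C 60 x| <= _).
      apply/subset_leq_card/subsetP => y; rewrite inE => /andP[yC /existsP[x /andP[xX yx]]].
      by apply/bigcupP; exists x.
    have hb x : x \in X3 :&: C -> #|ball C 60 x| <= 121.
      by move=> /setIP[_ xC]; have := @card_ball _ m f 60 x fh; rewrite -CE => /(_ xC).
    apply: leq_trans (card_bigcup_le hb) _.
    by rewrite ?[121 * _]mulnC leq_mul2r; apply/orP; right; apply/subset_leq_card; exact: subsetIl.
  move: L3 c3 c4' S3 F2 q5k; rewrite /core_bound -/X3.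
  move: #|X5| #|X4| #|C :\: M| #|X3| #|frame_set V C| (frame_bound k) => a b c d e g; clear; lia.
case=> l [h [l6 hh hs]].
have hMD : img l h \subset M :|: D.
  apply/subsetP => y yZ; have /setDP[yV yX] := subsetP hs _ yZ; rewrite in_setU.
  case: (boolP (y \in D)) => yD; first by rewrite orbT.
  rewrite orbF in_setD [y \in V :\: D]in_setD yD yV /= andbT; apply/negP => yX3; case/negP: yX.
  by apply: (subsetP L1); apply: (subsetP X34).
have nX y : y \in img l h -> y \notin X5 by move=> /(subsetP hs)/setDP[].
have NL' c : c \in C :&: M -> ~ holed (ball M 7 c :|: (img l h :&: D)).
  move=> cCM hb; apply: (NL c cCM); apply: holedS hb; apply: setUS; apply/subsetP => y /setIP[yZ yD].
  by rewrite in_setD yD andbT; apply: contra (nX _ yZ); exact: (subsetP L1).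
have [c [x [cC [i iI iZ] [j [r [jI rR jr]]] nR hd]]] := hole_link c4 fh CE m11 CV Cmin MV nM l6 hh hMD nVC NL'.
have [iC iM _ i25] := IsetP c4 fh CE m11 CV Cmin MV cC iI.
have cM : ball C 35 c \subset M.
  have iX4 : i \notin X4 by apply: contra (nX _ iZ); exact: (subsetP L1).
  apply/subsetP => y yb; apply: (subsetP (margin i iC iX4)).
  by apply: (@ball_cat _ _ 25 35 i c) yb; rewrite ballC.
have [d [y [/setIP[dZ dD] yK dy]]] := hd cM.
case/negP: (L5 (c, x, d)); rewrite /link_cond /= cC dD (nX _ dZ) /=; apply/and4P; split.
- by apply/subsetPn; exists i => //; exact: nX.
- apply/negP => /existsP[z /andP[zR dz]]; have := nR d z; rewrite in_setI dZ dD dz => /(_ isT zR).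
  by [].
- by apply/existsP; exists j; rewrite jI; apply/existsP; exists r; rewrite rR.
- by apply/existsP; exists y; rewrite yK.
Qed.
End Core.

(** * Rounds of shortest long holes *)

Section Main.
Variable G : sgraph.
Implicit Types (S T U V C X : {set G}) (fam : {ffun G -> nat}) (c d x y z : G).

Definition rounds : {ffun G -> nat} * nat :=
  foldl (fun (st : {ffun G -> nat} * nat) (_ : G) =>
    let U := [set x | st.1 x == 0] in
    if holedb U then (addf st.1 st.2 (minhole U), st.2.+1) else st) ([ffun=> 0], 0) (enum G).
(** The vertices still present when hole i was chosen, among which it is shortest. *)
Definition upper (lab : {ffun G -> nat}) i := [set x | (lab x == 0) || (i < lab x)].
Definition main_step k (lab : {ffun G -> nat}) q (st : bool * {ffun G -> nat} * {set G}) (v : G) :=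
  let i := q.-1 - enum_rank v in
  let V := upper lab i :\: st.2 in let C := cls lab i in
  if st.1.1 || (q <= enum_rank v) then st
  else if (20 < #|C|) && valid_fam k (core_fam V C k) then (true, core_fam V C k, st.2)
  else (false, st.1.2, st.2 :|: core_set V C).
Definition main_alg k : bool * {ffun G -> nat} * {set G} :=
  if #|G| < k then (false, [ffun=> 0], setT)
  else if valid_fam k rounds.1 then (true, rounds.1, set0)
  else foldl (main_step k rounds.1 rounds.2) (false, [ffun=> 0], set0) (enum G).
(** The classes found above only contain long holes; the output must consist of holes. *)
Definition trim (fam : {ffun G -> nat}) : {ffun G -> nat} :=
  [ffun x => if (fam x != 0) && (x \in minhole (cls fam (fam x).-1)) then fam x else 0].

Hypothesis c4 : C4_free G.

Lemma roundsP : let: (lab, q) := rounds in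
  [/\ q <= #|G|, forall x, lab x <= q, ~ holed [set x | lab x == 0] &
   forall i, i < q -> exists m f, [/\ 6 <= m, hol m f, img m f = cls lab i &
    forall l h, 6 <= l -> hol l h -> img l h \subset upper lab i -> m <= l]].
Proof.
pose inv n (st : {ffun G -> nat} * nat) := [/\ st.2 <= n, forall x, st.1 x <= st.2,
  holed [set x | st.1 x == 0] -> n <= #|[set x | st.1 x != 0]| &
  forall i, i < st.2 -> exists m f, [/\ 6 <= m, hol m f, img m f = cls st.1 i &
    forall l h, 6 <= l -> hol l h -> img l h \subset upper st.1 i -> m <= l]].
have : inv #|G| rounds.
  rewrite /rounds; apply: (foldl_enum (P := inv)); first by split=> // x; rewrite ffunE.
  move=> v [lab q] [/= qn lq full sh]; case: (holedbP c4 [set x | lab x == 0]) => hU; last first.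
    by split=> //=; exact: leqW.
  have [m [f [m6 fh fE fU fmin]]] := minholeP c4 hU; set Z := minhole _ in fE fU *.
  have Z0 x : x \in Z -> lab x = 0 by move/(subsetP fU); rewrite inE => /eqP.
  have up i : i < q -> upper (addf lab q Z) i = upper lab i.
    move=> iq; apply/setP => x; rewrite !inE ffunE; case: ifP => // /Z0->.
    by rewrite eqxx /=; move: iq; clear; lia.
  have cl i : i < q -> cls (addf lab q Z) i = cls lab i.
    move=> iq; apply/setP => x; rewrite !inE ffunE; case: ifP => // /Z0->.
    by rewrite eqSS; move: iq; clear; case: eqP; lia.
  split=> //=.
  - by move=> x; rewrite ffunE; case: ifP => // _; exact: leqW.
  - move=> _; apply: leq_ltn_trans (full hU) _; apply: proper_card; apply/properP; split.
      by apply/subsetP => x; rewrite !inE ffunE; case: ifP.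
    exists (f 0); rewrite !inE ?ffunE -?fE ?in_img //.
    by rewrite (Z0 (f 0)) // -fE in_img.
  move=> i; rewrite ltnS leq_eqVlt => /predU1P[->|iq]; last by rewrite cl // up //; exact: sh.
  exists m, f; split=> //.
    rewrite fE; apply/setP => x; rewrite !inE ffunE; case: ifP => //; first by rewrite eqxx.
    by move=> _; have := lq x; case: eqP => // ->; rewrite ltnn.
  move=> l h l6 hh hs; apply: (fmin l h) => //; apply: subset_trans hs _; apply/subsetP => x.
  rewrite !inE ffunE; case: ifP => [/Z0-> //|_] /orP[//|]; by have := lq x; move: (lab x); clear; lia.
case: rounds => lab q [/= qn lq full sh]; split=> // hU.
have := full hU; rewrite leqNgt => /negP; apply; rewrite -cardsT; apply: proper_card.
case: hU => l [f [l6 fh /subsetP fs]]; apply/properP; split; first exact: subsetT.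
exists (f 0); rewrite ?inE //; have := fs _ (in_img 0 fh); by rewrite inE => ->.
Qed.

Lemma trim_hole k fam i : k <= #|G| -> valid_fam k fam -> i < k -> long_hole (cls (trim fam) i).
Proof.
move=> kG /(valid_famP c4 _ kG) h ik; have [l [f [l6 fh fE _ _]]] := minholeP c4 (h i ik).
have -> : cls (trim fam) i = img l f; last exact: hol_long_hole.
rewrite fE; apply/setP => x; rewrite inE ffunE.
have sub : minhole (cls fam i) \subset cls fam i by case: (minholeP c4 (h i ik)) => ? [? []].
apply/eqP/idP => [|xm].
  case: ifP => // /andP[_ xm] E; by move: xm; rewrite E.
have E : fam x = i.+1 by move/(subsetP sub): xm; rewrite inE => /eqP.
by rewrite E xm.
Qed.

Lemma main_correct k : 0 < k -> let: (ok, fam, X) := main_alg k in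
  if ok then k <= #|G| /\ valid_fam k fam else #|X| <= k * core_bound k /\ ~ holed (~: X).
Proof.
move=> k0; rewrite /main_alg; case: ltnP => kG.
  split; last by rewrite setCT => -[l [f [_ fh /subsetP/(_ _ (in_img 0 fh))]]]; rewrite inE.
  rewrite cardsT; apply: leq_trans (ltnW kG) _; rewrite -{1}[k]muln1 leq_mul2l /core_bound.
  by rewrite (leq_trans _ (leq_addr _ _)) ?orbT.
case: ifP => [v|/negbT nv]; first by [].
have := roundsP; case: rounds nv => lab q /= nv [qG lq n0 sh].
have qk : q < k.
  rewrite ltnNge; apply: contra nv => kq; apply/(valid_famP c4 _ kG) => i ik.
  have [m [f [m6 fh fE _]]] := sh i (leq_trans ik kq); exists m, f; by rewrite fE.
(* After n rounds the last n holes are treated, and X destroys all long holes among the vertices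
   present when the earliest of them was chosen. The separate bound by q covers the idle rounds. *)
pose inv n (st : bool * {ffun G -> nat} * {set G}) :=
  if st.1.1 then is_true (valid_fam k st.1.2) else
  [/\ st.2 \subset upper lab (q - n), #|st.2| <= n * core_bound k, #|st.2| <= q * core_bound k & ~ holed (upper lab (q - n) :\: st.2)].
have upq : upper lab q = [set x | lab x == 0].
  by apply/setP => x; rewrite !inE ltnNge lq orbF.
have : inv #|G| (foldl (main_step k lab q) (false, [ffun=> 0], set0) (enum G)).
  apply: (foldl_enum (P := inv)).
    by rewrite /inv /= subn0 upq sub0set cards0 setD0.
  move=> v [[ok fam] X]; rewrite /inv /main_step /=; case: ok => //= -[XU cn cX nX].
  case: (leqP q (enum_rank v)) => qv /=.
    have -> : q - (enum_rank v).+1 = q - enum_rank v by move: qv; clear; lia.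
    by split=> //; apply: leq_trans cn _; rewrite leq_mul2r leqnSn orbT.
  set i := q.-1 - enum_rank v.
  have iE : q - (enum_rank v).+1 = i by rewrite /i; move: qv; clear; lia.
  have iE' : q - enum_rank v = i.+1 by rewrite /i; move: qv; clear; lia.
  rewrite iE; rewrite iE' in XU nX.
  have iq : i < q by rewrite /i; move: qv; clear; lia.
  have [m [f [m6 fh fE fmin]]] := sh i iq; set C := cls lab i in fE *; set V := upper lab i :\: X.
  have upi : upper lab i = upper lab i.+1 :|: C.
    by apply/setP => x; rewrite !inE -orbA; congr orb; rewrite leq_eqVlt eq_sym orbC.
  have CX x : x \in C -> x \notin X.
    by move=> xC; apply/negP => /(subsetP XU); move: xC; rewrite !inE => /eqP->; rewrite ltnn.
  have CV : C \subset V.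
    by apply/subsetP => x xC; rewrite in_setD upi in_setU xC orbT andbT CX.
  have nVC : ~ holed (V :\: C).
    move=> h; apply: nX; apply: holedS h; apply/subsetP => x; rewrite !in_setD upi in_setU.
    by case/and3P => /negbTE-> ->; rewrite orbF.
  have Cmin l h : 6 <= l -> hol l h -> img l h \subset V -> m <= l.
    by move=> l6 hh hs; apply: (fmin l h l6 hh); exact: (subset_trans hs (subsetDl _ _)).
  have key : [/\ core_set V C \subset V, #|core_set V C| <= core_bound k & ~ holed (V :\: core_set V C)] ->
      [/\ X :|: core_set V C \subset upper lab i, #|X :|: core_set V C| <= (enum_rank v).+1 * core_bound k,
         #|X :|: core_set V C| <= q * core_bound k & ~ holed (upper lab i :\: (X :|: core_set V C))].
    case=> h1 h2 h3.
    have c1 : #|X :|: core_set V C| <= (enum_rank v).+1 * core_bound k.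
      by apply: leq_trans (leq_card_setU _ _) _; rewrite mulSn addnC leq_add.
    split; [|exact: c1| |by rewrite -setDDl].
      rewrite subUset; apply/andP; split; last exact: (subset_trans h1 (subsetDl _ _)).
      by rewrite upi; apply: (subset_trans XU); exact: subsetUl.
    by apply: leq_trans c1 _; rewrite leq_mul2r qv orbT.
  case: (leqP #|C| 20) => c20 /=; first by apply: key; apply: core_small.
  case vc: (valid_fam k (core_fam V C k)); first by rewrite /= vc.
  have {vc} nvc := negbT vc; apply: key.
  have m11 : 11 <= m by rewrite -(card_img fh) fE; apply: leq_trans c20.
  exact: (core_big c4 fh (esym fE) CV Cmin nVC kG k0 m11 c20 nvc).
rewrite /inv; case: (foldl _ _ _) => -[[] fam] X //= [_ _ cX nX]; split.
  by apply: leq_trans cX _; rewrite leq_mul2r (ltnW qk) orbT.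
move=> h; apply: nX; apply: holedS h; apply/subsetP => x xX.
rewrite in_setD !inE; rewrite inE in xX; rewrite xX /=.
have -> : q - #|G| = 0 by apply/eqP; rewrite subn_eq0.
by case: (lab x).
Qed.
End Main.

(** * Programs *)

Local Notation ram := Defs.mem.

(** The effect of loop-free code as a function, so that it is checked by computation; loops go
    through [triple_while]. *)
Fixpoint run c s := match c with
  | Const x c => set_reg s x c
  | Add x y z => set_reg s x (reg s y + reg s z)
  | Defs.Sub x y z => set_reg s x (reg s y - reg s z)
  | Fetch x y => set_reg s x (ram s (reg s y))
  | Store x y => set_mem s (reg s x) (reg s y)
  | Seq a b => run b (run a s)
  | If x a b => if reg s x != 0 then run a s else run b s
  | While _ _ => s
  end.
Fixpoint straight c := match c with
  | Seq a b | If _ a b => straight a && straight b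
  | While _ _ => false
  | _ => true
  end.
Fixpoint csize c := match c with
  | Seq a b => csize a + csize b
  | If _ a b => (csize a + csize b).+1
  | _ => 1
  end.

Lemma run_exec c s : straight c -> exists2 t, exec c s (run c s) t & t <= csize c.
Proof.
elim: c s => //=; try by move=> *; exists 1 => //; constructor.
  move=> a IHa b IHb s /andP[sa sb]; have [t ea ta] := IHa s sa; have [u eb tb] := IHb (run a s) sb.
  by exists (t + u); [apply: exec_Seq ea eb | exact: leq_add].
move=> x a IHa b IHb s /andP[sa sb]; case: ifP => h.
  have [t ea ta] := IHa s sa; exists t.+1; first exact: exec_IfT.
  by rewrite ltnS (leq_trans ta) // leq_addr.
have [t eb tb] := IHb s sb; exists t.+1; first by apply: exec_IfF => //; move/negbFE: h.
by rewrite ltnS (leq_trans tb) // leq_addl.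
Qed.

(** The base is at least 2, so sums and constants are absorbed by raising the exponent, and only
    exponents are tracked. *)
Definition triple n d c s (Q : state -> Prop) :=
  exists s' t, [/\ exec c s s' t, t <= (n + 2) ^ d & Q s'].

Lemma leq_pow2 n d e : d <= e -> (n + 2) ^ d <= (n + 2) ^ e.
Proof. by move=> h; rewrite leq_pexp2l // addn2. Qed.

Lemma size_pow n d : d <= (n + 2) ^ d.
Proof. by apply: ltnW; apply: ltn_expl; rewrite addn2. Qed.

Lemma tripleW n d e c s (P Q : state -> Prop) :
  d <= e -> (forall s', P s' -> Q s') -> triple n d c s P -> triple n e c s Q.
Proof.
move=> de PQ [s' [t [h1 h2 h3]]]; exists s', t; split=> //; last exact: PQ.
exact: leq_trans h2 (leq_pow2 _ de).
Qed.

Lemma triple_run n c s (Q : state -> Prop) : straight c -> Q (run c s) -> triple n (csize c) c s Q.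
Proof.
by move=> sc Qs; have [t et tb] := run_exec s sc; exists (run c s), t; split=> //; exact: leq_trans tb (size_pow _ _).
Qed.

Lemma triple_seq n d e c1 c2 s (P Q : state -> Prop) :
  triple n d c1 s P -> (forall s1, P s1 -> triple n e c2 s1 Q) -> triple n (d + e).+1 (Seq c1 c2) s Q.
Proof.
move=> [s1 [t1 [e1 b1 P1]]] h; have [s2 [t2 [e2 b2 Q2]]] := h _ P1.
exists s2, (t1 + t2); split=> //; first exact: exec_Seq e1 e2.
rewrite expnS; apply: leq_trans (_ : 2 * (n + 2) ^ (d + e) <= _); last by rewrite leq_mul2r leq_addl orbT.
by rewrite mul2n -addnn; apply: leq_add; [apply: leq_trans b1 _ | apply: leq_trans b2 _]; apply: leq_pow2; rewrite ?leq_addr ?leq_addl.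
Qed.

Lemma triple_if n d e x c1 c2 s (Q : state -> Prop) :
  (reg s x != 0 -> triple n d c1 s Q) -> (reg s x == 0 -> triple n e c2 s Q) ->
  triple n (d + e).+1 (If x c1 c2) s Q.
Proof.
have bd f t : f <= d + e -> t <= (n + 2) ^ f -> t.+1 <= (n + 2) ^ (d + e).+1.
  move=> h1 h2; rewrite expnS addn2 !mulSn; move: (leq_trans h2 (leq_pow2 n h1)).
  have : 0 < (n + 2) ^ (d + e) by rewrite expn_gt0 addn2.
  rewrite addn2; move: (_ ^ _) => k; move: (n * k) => j; clear; lia.
move=> h1 h2; case: (eqVneq (reg s x) 0) => h.
  have [s' [t [e1 b Qs]]] := h2 (introT eqP h); exists s', t.+1; split=> //; first by apply: exec_IfF => //; exact/eqP.
  by apply: bd b; exact: leq_addl.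
have [s' [t [e1 b Qs]]] := h1 h; exists s', t.+1; split=> //; first exact: exec_IfT.
by apply: bd b; exact: leq_addr.
Qed.

(** Two of the five extra powers pay for the number of rounds, the other three for the tests. *)
Lemma triple_while n d x c N (Inv : nat -> state -> Prop) s : N <= n * n ->
  (forall j s, j <= N -> Inv j s -> (reg s x == 0) = (j == N)) ->
  (forall j s, j < N -> Inv j s -> triple n d c s (Inv j.+1)) ->
  Inv 0 s -> triple n (d + 5) (While x c) s (Inv N).
Proof.
move=> Nn hx hb i0.
rewrite /triple in hb.
have [s' [t [h1 h2 h3]]] : exists s' t, [/\ exec (While x c) s s' t, t <= (N * ((n + 2) ^ d).+1).+1 & Inv N s'].
  have : N + 0 = N by rewrite addn0.
  move: (_ ^ d) hb => K hb; move: {1 3}N 0 i0 => r j; elim: r j s => [|r IH] j s ij E.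
    rewrite add0n in E; subst j; exists s, 1; split=> //.
    by apply: exec_WhileF; rewrite (hx N) ?eqxx.
  have jN : j < N by rewrite -E addSn ltnS leq_addl.
  have [s1 [t1 [e1 b1 i1]]] := hb _ _ jN ij.
  have [|s2 [t2 [e2 b2 i2]]] := IH j.+1 s1 i1; first by rewrite addnS -addSn.
  exists s2, (t1 + t2).+1; split=> //.
    by apply: exec_WhileT e1 e2; rewrite (hx j) ?(ltnW jN) // neq_ltn jN.
  by rewrite mulSn; move: b1 b2; move: (r * _) => a; clear; lia.
exists s', t; split=> //.
apply: leq_trans h2 _; apply: leq_trans (_ : ((n + 2) ^ 2 * (2 * (n + 2) ^ d)).+1 <= _).
  rewrite ltnS; apply: leq_mul.
    by apply: leq_trans Nn _; rewrite expnS expn1; apply: leq_mul; exact: leq_addr.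
  by have : 0 < (n + 2) ^ d by [rewrite expn_gt0 addn2]; move: (_ ^ _) => k; clear; lia.
have -> : (n + 2) ^ (d + 5) = (n + 2) ^ 2 * ((n + 2) ^ 3 * (n + 2) ^ d).
  by rewrite -!expnD; congr (_ ^ _); lia.
have : 8 <= (n + 2) ^ 3 by rewrite -[8]/(2 ^ 3) leq_exp2r // leq_addl.
have : 0 < (n + 2) ^ 2 by rewrite expn_gt0 addn2.
have : 0 < (n + 2) ^ d by rewrite expn_gt0 addn2.
move: (_ ^ 2) (_ ^ 3) (_ ^ d) => a b c0; clear; nia.
Qed.

(* Memory is divided into slots of n^2 cells.  Slot 0 holds the adjacency
   matrix, slot 1 starts with the multiples of n, and slot 2 is zero. *)
Section Code.
Fixpoint base (r i : nat) : cmd := if i is j.+1 then Seq (base r j) (Add r r 1) else Const r 0.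
Definition fetch r i := Seq (base r i) (Fetch r r).

Lemma straight_base r i : straight (base r i). Proof. by elim: i => //= i ->. Qed.
Lemma mem_base r i s : ram (run (base r i) s) = ram s. Proof. by elim: i. Qed.
Lemma reg_base r i s q : r != 1 ->
  reg (run (base r i) s) q = if q == r then i * reg s 1 else reg s q.
Proof.
move=> r1; elim: i q => [|i IH] q /=; first by case: eqP.
by rewrite !IH eqxx [1 == r]eq_sym (negbTE r1) mulSn addnC; case: eqP.
Qed.
End Code.

Opaque base.

Definition copy_slot i d : cmd :=
  Seq (Seq (base 4 i) (Seq (base 5 d) (Seq (Const 6 1) (Seq (Const 7 0) (Add 3 1 7)))))
  (While 3 (Seq (Fetch 7 4) (Seq (Store 5 7) (Seq (Add 4 4 6) (Seq (Add 5 5 6) (Defs.Sub 3 3 6)))))).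

Lemma copy_slotP i d : exists e, forall n s, reg s 1 = n * n -> i != d ->
  triple n e (copy_slot i d) s (fun s' => [/\ reg s' 0 = reg s 0, reg s' 1 = reg s 1 &
    forall a, ram s' a = if (d * (n * n) <= a) && (a < d.+1 * (n * n)) then ram s (i * (n * n) + (a - d * (n * n)))
      else ram s a]).
Proof.
eexists => n s r1 id; set q := n * n.
pose Inv j s' := [/\ reg s' 0 = reg s 0, reg s' 1 = reg s 1 &
  [/\ reg s' 3 = q - j, reg s' 4 = i * q + j, reg s' 5 = d * q + j, reg s' 6 = 1 &
  forall a, ram s' a = if (d * q <= a) && (a < d * q + j) then ram s (i * q + (a - d * q)) else ram s a]].
have dj : forall j, j < q -> (d * q <= i * q + j) && (i * q + j < d * q + q) = false.
  move=> j jq; have := id; rewrite neq_ltn => /orP[] h.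
    have : i.+1 * q <= d * q by rewrite leq_mul2r h orbT.
    by rewrite mulSn; move: (i * q) (d * q) => a b; move: jq; clear; lia.
  have : d.+1 * q <= i * q by rewrite leq_mul2r h orbT.
  by rewrite mulSn; move: (i * q) (d * q) => a b; move: jq; clear; lia.
apply: (triple_seq (P := Inv 0)).
  apply: triple_run; first by rewrite /= !straight_base.
  split; rewrite /= ?reg_base //= ?reg_base //=; split; rewrite ?reg_base //= ?reg_base //= ?addn0 ?subn0 ?r1 //.
  by move=> a; rewrite !mem_base; case: ifP => //; move: (d * q); clear; lia.
move=> s1 I1; apply: (tripleW (leqnn _) _ (triple_while (N := q) (Inv := Inv) (leqnn _) _ _ I1)).
- by move=> s' [h0 h1 [h3 h4 h5 h6 hm]]; split=> // a; rewrite hm mulSn addnC.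
- by move=> j s' jq [_ _ [-> _ _ _ _]]; rewrite subn_eq0 eqn_leq jq.
move=> j s' jq [h0 h1 [h3 h4 h5 h6 hm]]; apply: triple_run => //.
split=> //=; split=> //=; rewrite ?h3 ?h4 ?h5 ?h6 //; try by move: jq; clear; lia.
move=> a; rewrite !hm; case: eqP => [->|ne].
  have -> : i * q + j = i * q + (d * q + j - d * q) by rewrite addKn.
  rewrite addKn; have := dj j jq; rewrite leq_addr /= ltn_add2l ltnS leqnn /=.
  case: ifP => // /andP[h8 h9]; rewrite h8 /=; move: h9 jq; move: (i * q) (d * q); clear; lia.
have -> : (a < d * q + j.+1) = (a < d * q + j) || (a == d * q + j) by rewrite addnS ltnS leq_eqVlt orbC.
by have /eqP/negbTE-> := ne; rewrite orbF.
Qed.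

(** * Types of values and their layout in memory *)

Inductive ty := TV | TN | TB | TS | TF | TR | TP of ty & ty.

Fixpoint den t (G : sgraph) : Type := match t with
  | TV => G | TN => nat | TB => bool | TS => {set G} | TF => {ffun G -> nat} | TR => {set G * G}
  | TP a b => (den a G * den b G)%type end.

(** A pair is located componentwise, possibly in distant slots, so pairing and projections move no
    data. *)
Fixpoint loc t : Type := match t with TP a b => (loc a * loc b)%type | _ => nat end.
Fixpoint width t := match t with TP a b => width a + width b | _ => 1 end.
Fixpoint alloc t L : loc t := match t return loc t with
  | TP a b => (alloc a L, alloc b (L + width a)) | _ => L end.
Fixpoint below t L : loc t -> bool := match t return loc t -> bool with
  | TP a b => fun l => below L l.1 && below L l.2 | _ => fun l => l < L end.
Fixpoint avoid t A B : loc t -> bool := match t return loc t -> bool with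
  | TP a b => fun l => avoid A B l.1 && avoid A B l.2 | _ => fun l => (l < A) || (B <= l) end.
Fixpoint copy t : loc t -> nat -> cmd := match t return loc t -> nat -> cmd with
  | TP a b => fun l L => Seq (copy l.1 L) (copy l.2 (L + width a)) | _ => copy_slot end.
Fixpoint same q (m m' : nat -> nat) t : loc t -> loc t -> Prop := match t return loc t -> loc t -> Prop with
  | TP a b => fun l l' => same q m m' l.1 l'.1 /\ same q m m' l.2 l'.2
  | _ => fun l l' => forall o, o < q -> m (l * q + o) = m' (l' * q + o) end.

Definition sq (G : sgraph) := #|G| * #|G|.

Fixpoint holds G (m : nat -> nat) t : loc t -> den t G -> Prop := match t return loc t -> den t G -> Prop with
  | TV => fun l x => m (l * sq G) = enum_rank x
  | TN => fun l x => m (l * sq G) = x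
  | TB => fun l x => m (l * sq G) = nat_of_bool x
  | TS => fun l x => forall v : G, m (l * sq G + enum_rank v) = (v \in x)
  | TF => fun l x => forall v : G, m (l * sq G + enum_rank v) = x v
  | TR => fun l x => forall u v : G, m (l * sq G + (enum_rank u * #|G| + enum_rank v)) = ((u, v) \in x)
  | TP a b => fun l x => holds m l.1 x.1 /\ holds m l.2 x.2 end.

Lemma alloc_below t L : below (L + width t) (alloc t L).
Proof.
have mono a A B (l : loc a) : A <= B -> below A l -> below B l.
  move=> AB; elim: a l => //=; try by move=> l h; exact: leq_trans AB.
  by move=> a IHa b IHb l /andP[/IHa-> /IHb->].
elim: t L => //=; try by move=> L; rewrite addn1.
move=> a IHa b IHb L; rewrite addnA IHb andbT; apply: mono (IHa L).
by rewrite leq_addr.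
Qed.

Lemma belowW t A B (l : loc t) : A <= B -> below A l -> below B l.
Proof.
move=> AB; elim: t l => //=; try by move=> l h; exact: leq_trans AB.
by move=> a IHa b IHb l /andP[/IHa-> /IHb->].
Qed.

Lemma below_avoid t A B C (l : loc t) : below A l -> A <= B -> avoid B C l.
Proof.
move=> h AB; elim: t l h => //=; try by move=> l h; rewrite (leq_trans h AB).
by move=> a IHa b IHb l /andP[/IHa-> /IHb->].
Qed.

Lemma alloc_avoid t A B L : (L + width t <= A) || (B <= L) -> avoid A B (alloc t L).
Proof.
elim: t L => //=; try by move=> L; rewrite addn1.
move=> a IHa b IHb L h; rewrite IHa ?IHb //; move: h; case/orP => h; apply/orP; move: h; clear; lia.
Qed.

Lemma avoidW t A B A' B' (l : loc t) : A <= A' -> B' <= B -> avoid A B l -> avoid A' B' l.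
Proof.
move=> h1 h2; elim: t l => //=; try by move=> l /orP[] h; apply/orP; [left; exact: leq_trans h1 | right; exact: leq_trans h].
by move=> a IHa b IHb l /andP[/IHa-> /IHb->].
Qed.

Definition frame_out q A B (m m' : nat -> nat) := forall o, (o < A * q) || (B * q <= o) -> m' o = m o.

Lemma slot_out q A B l o : 0 < q -> (l < A) || (B <= l) -> o < q -> (l * q + o < A * q) || (B * q <= l * q + o).
Proof.
move=> q0 /orP[] h oq; apply/orP; [left|right].
  by apply: leq_trans (_ : l.+1 * q <= _); [rewrite mulSn; move: oq; clear; lia | rewrite leq_mul2r h orbT].
by apply: leq_trans (leq_addr _ _); rewrite leq_mul2r h orbT.
Qed.

Lemma slot_lt q L l o : l < L -> o < q -> l * q + o < L * q.
Proof.
move=> h oq; apply: leq_trans (_ : l.+1 * q <= _); first by rewrite mulSn addnC ltn_add2r.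
by rewrite leq_mul2r h orbT.
Qed.

Lemma same_extl q A B m1 m m' t (l l' : loc t) : 0 < q -> avoid A B l -> frame_out q A B m m1 ->
  same q m1 m' l l' -> same q m m' l l'.
Proof.
move=> q0 av fr; elim: t l l' av => //=; try by move=> l l' av h o oq; rewrite -h // fr // slot_out.
by move=> a IHa b IHb l l' /andP[h1 h2] [h3 h4]; split; [exact: IHa | exact: IHb].
Qed.

Lemma same_extr q A B m1 m m' t (l l' : loc t) : 0 < q -> avoid A B l' -> frame_out q A B m' m1 ->
  same q m m' l l' -> same q m m1 l l'.
Proof.
move=> q0 av fr; elim: t l l' av => //=; try by move=> l l' av h o oq; rewrite h // fr // slot_out.
by move=> a IHa b IHb l l' /andP[h1 h2] [h3 h4]; split; [exact: IHa | exact: IHb].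
Qed.

Section Sq.
Variable G : sgraph.
Hypothesis G0 : 0 < #|G|.
Lemma sq_gt0 : 0 < sq G. Proof. by rewrite muln_gt0 G0. Qed.
Lemma rank_sq (v : G) : enum_rank v < sq G.
Proof. by apply: leq_trans (ltn_ord _) _; rewrite leq_pmulr. Qed.
Lemma pair_sq (u v : G) : enum_rank u * #|G| + enum_rank v < sq G.
Proof.
apply: leq_trans (_ : (enum_rank u).+1 * #|G| <= _); first by rewrite mulSn addnC ltn_add2r.
by rewrite leq_mul2r ltn_ord orbT.
Qed.
Lemma pair_inj (u v u' v' : G) :
  (enum_rank u * #|G| + enum_rank v == enum_rank u' * #|G| + enum_rank v') = (u == u') && (v == v').
Proof.
apply/eqP/andP => [h|[/eqP-> /eqP->]] //.
have h1 := congr1 (divn^~ #|G|) h; have h2 := congr1 (modn^~ #|G|) h.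
move: h1 h2; rewrite !divnMDl // !modnMDl !divn_small ?modn_small // !addn0.
by move=> h1 h2; split; apply/eqP/enum_rank_inj/val_inj.
Qed.
Lemma input_memE (u v : G) : input_mem G (enum_rank u * #|G| + enum_rank v) = edge u v.
Proof.
congr nat_of_bool; apply/existsP/idP => [[x /existsP[y /andP[xy]]]|uv].
  by rewrite pair_inj => /andP[/eqP-> /eqP->].
by exists u; apply/existsP; exists v; rewrite uv eqxx.
Qed.

Lemma holds_same m m' t (l l' : loc t) (x : den t G) : same (sq G) m m' l l' -> holds m l x -> holds m' l' x.
Proof.
have q0 := sq_gt0; elim: t l l' x => //=.
- by move=> l l' x h; have := h 0 q0; rewrite !addn0 => ->.
- by move=> l l' x h; have := h 0 q0; rewrite !addn0 => ->.
- by move=> l l' x h; have := h 0 q0; rewrite !addn0 => ->.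
- by move=> l l' x h h' v; rewrite -h ?rank_sq.
- by move=> l l' x h h' v; rewrite -h ?rank_sq.
- by move=> l l' x h h' u v; rewrite -h ?pair_sq.
by move=> a IHa b IHb l l' x [h1 h2] [h3 h4]; split; [exact: IHa h1 _|exact: IHb h2 _].
Qed.

Lemma holds_below L m m' t (l : loc t) (x : den t G) : below L l -> (forall o, o < L * sq G -> m' o = m o) ->
  holds m l x -> holds m' l x.
Proof.
move=> bl fr; rewrite /= => h; elim: t l x bl h => //=.
- by move=> l x lL <-; rewrite fr // ltn_mul2r sq_gt0.
- by move=> l x lL <-; rewrite fr // ltn_mul2r sq_gt0.
- by move=> l x lL <-; rewrite fr // ltn_mul2r sq_gt0.
- by move=> l x lL h v; rewrite fr // slot_lt ?rank_sq.
- by move=> l x lL h v; rewrite fr // slot_lt ?rank_sq.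
- by move=> l x lL h u v; rewrite fr // slot_lt ?pair_sq.
by move=> a IHa b IHb l x /andP[l1 l2] [h1 h2]; split; [exact: IHa|exact: IHb].
Qed.
End Sq.

Lemma copyP t (l : loc t) L : avoid L (L + width t) l -> exists e, forall n s, 0 < n -> reg s 1 = n * n ->
  triple n e (copy l L) s (fun s' => [/\ reg s' 0 = reg s 0, reg s' 1 = reg s 1,
    frame_out (n * n) L (L + width t) (ram s) (ram s') & same (n * n) (ram s) (ram s') l (alloc t L)]).
Proof.
have leaf (i : nat) (M : nat) : (i < M) || (M + 1 <= i) -> exists e, forall n s, 0 < n -> reg s 1 = n * n ->
  triple n e (copy_slot i M) s (fun s' => [/\ reg s' 0 = reg s 0, reg s' 1 = reg s 1,
    frame_out (n * n) M (M + 1) (ram s) (ram s') &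
    forall o, o < n * n -> ram s (i * (n * n) + o) = ram s' (M * (n * n) + o)]).
  move=> h; have [e he] := copy_slotP i M; exists e => n s n0 r1.
  have iM : i != M by apply/eqP => E; move: h; rewrite E; clear; lia.
  apply: tripleW (leqnn _) _ (he n s r1 iM) => s' [h0 h1 hm]; split=> // o ho.
    by move: ho; rewrite addn1 hm; case: ifP => // /andP[h2 h3]; rewrite [_ <= o]leqNgt h3 orbF ltnNge h2.
  by rewrite hm leq_addr addKn slot_lt.
elim: t l L => [||||||a IHa b IHb]; try exact: leaf.
move=> [l1 l2] L /= /andP[v1 v2].
have v1' : avoid L (L + width a) l1 by apply: avoidW v1; rewrite // addnA leq_addr.
have v2' : avoid (L + width a) (L + width a + width b) l2 by apply: avoidW v2; rewrite ?leq_addr // addnA.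
have [e1 h1] := IHa l1 L v1'; have [e2 h2] := IHb l2 (L + width a) v2'.
exists (e1 + e2).+1 => n s n0 r1; apply: (triple_seq (h1 n s n0 r1)) => s1 [a0 a1 fr1 sm1].
have r1' : reg s1 1 = n * n by rewrite a1.
apply: tripleW (leqnn _) _ (h2 n s1 n0 r1') => s2 [b0 b1 fr2 sm2].
have q0 : 0 < n * n by rewrite muln_gt0 n0.
split; rewrite ?b0 ?b1 //.
  move=> o ho; rewrite fr2 ?fr1 //; case/orP: ho => ho; apply/orP; try (by left).
  - right; apply: leq_trans ho; rewrite leq_mul2r addnA leq_addr orbT //.
  - left; apply: leq_trans ho _; rewrite leq_mul2r leq_addr orbT //.
  - right; by rewrite -addnA.
split.
  apply: (same_extr q0 _ fr2 sm1); apply: alloc_avoid; by rewrite leqnn.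
by apply: (same_extl q0 _ fr1 sm2); apply: avoidW v2; rewrite ?addnA ?leq_addr.
Qed.

Record ready (G : sgraph) (s : state) : Prop := Ready {
  ready0 : reg s 0 = #|G|;
  ready1 : reg s 1 = sq G;
  ready_adj : forall o, o < sq G -> ram s o = input_mem G o;
  ready_mul : forall o, o < #|G| -> ram s (sq G + o) = o * #|G|;
  ready_zero : forall o, o < sq G -> ram s (2 * sq G + o) = 0 }.

Definition post (G : sgraph) L s t (l : loc t) (x : den t G) s' :=
  [/\ reg s' 0 = reg s 0, reg s' 1 = reg s 1, forall o, o < L * sq G -> ram s' o = ram s o & holds (ram s') l x].

Definition code_for a b (phi : forall G, den a G -> den b G) l L c e l' :=
  forall G : sgraph, 0 < #|G| -> forall x s, ready G s -> holds (ram s) l x -> triple #|G| e c s (post L s l' (phi G x)).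

(** Program, exponent and location of the result are chosen before G, so one program serves all
    graphs. Everything below L is preserved, so earlier values stay available. *)
Record compu a b (phi : forall G, den a G -> den b G) : Prop := Compu {
  compuP : forall (l : loc a) L, below L l -> 2 < L ->
    exists c e (l' : loc b) L', [/\ L <= L', below L' l' & code_for phi l L c e l'] }.
Arguments compuP {a b phi} _ l L _ _.
Arguments compu a b phi%_function_scope : clear implicits.

Lemma ready_ext (G : sgraph) s s' L : 0 < #|G| -> 2 < L -> reg s' 0 = reg s 0 -> reg s' 1 = reg s 1 ->
  (forall o, o < L * sq G -> ram s' o = ram s o) -> ready G s -> ready G s'.
Proof.
move=> G0 L2 h0 h1 fr [r0 r1 ra rm rz]; have q0 := sq_gt0 G0.
have n1 : #|G| <= sq G by rewrite leq_pmulr.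
split; rewrite ?h0 ?h1 //.
- by move=> o ho; rewrite fr ?ra //; have := @slot_lt (sq G) L 0 o _ ho; apply; exact: leq_trans L2.
- move=> o ho; rewrite fr ?rm //; have := @slot_lt (sq G) L 1 o _ (leq_trans ho n1); rewrite mul1n; apply; exact: leq_trans L2.
- by move=> o ho; rewrite fr ?rz // slot_lt.
Qed.

Lemma post_ready (G : sgraph) s s' L t (l : loc t) (x : den t G) : 0 < #|G| -> 2 < L -> ready G s -> post L s l x s' -> ready G s'.
Proof. by move=> G0 L2 r [h0 h1 fr _]; exact: (ready_ext G0 L2 h0 h1 fr r). Qed.

Definition skip := Const 3 0.

(** For values that memory already represents: components of the argument, a vertex read as its
    rank, or the zeros of slot 2 read as an empty set. *)
Lemma c_move a b (phi : forall G, den a G -> den b G) :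
  (forall (l : loc a), exists l' : loc b, (forall L, below L l -> 2 < L -> below L l') /\
    forall G : sgraph, 0 < #|G| -> forall x s, ready G s -> holds (ram s) l x -> holds (ram s) l' (phi G x)) -> compu a b phi.
Proof.
move=> h; split=> l L lL L2; have [l' [h1 h2]] := h l; exists skip, 1, l', L; split; [by []|exact: h1|].
move=> G G0 x s r hx; apply: (@triple_run _ skip) => //; split=> //; exact: h2 G0 _ _ r hx.
Qed.

Lemma c_comp a b c f g : compu a b f -> compu b c g -> compu a c (fun G p => g G (f G p)).
Proof.
move=> hf hg; split=> l L lL L2; have [c1 [e1 [l1 [L1 [LL1 b1 k1]]]]] := compuP hf l L lL L2.
have [c2 [e2 [l2 [L2' [LL2 b2 k2]]]]] := compuP hg l1 L1 b1 (leq_trans L2 LL1).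
exists (Seq c1 c2), (e1 + e2).+1, l2, L2'; split; [exact: leq_trans LL2|by []|].
move=> G G0 x s r hx; apply: (triple_seq (k1 G G0 x s r hx)) => s1 p1.
have r1 := post_ready G0 L2 r p1; case: p1 => h0 h1 fr hy.
apply: tripleW (leqnn _) _ (k2 G G0 _ s1 r1 hy) => s2 [h0' h1' fr' hz]; split; rewrite ?h0' ?h1' //.
move=> o ho; rewrite fr' ?fr //; apply: leq_trans ho _; by rewrite leq_mul2r LL1 orbT.
Qed.

Lemma c_pair a b c f g : compu a b f -> compu a c g -> compu a (TP b c) (fun G p => (f G p, g G p)).
Proof.
move=> hf hg; split=> l L lL L2; have [c1 [e1 [l1 [L1 [LL1 b1 k1]]]]] := compuP hf l L lL L2.
have [c2 [e2 [l2 [L2' [LL2 b2 k2]]]]] := compuP hg l L1 (belowW LL1 lL) (leq_trans L2 LL1).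
exists (Seq c1 c2), (e1 + e2).+1, (l1, l2), L2'; split; [exact: leq_trans LL2|by rewrite /= b2 (belowW LL2)|].
move=> G G0 x s r hx; apply: (triple_seq (k1 G G0 x s r hx)) => s1 p1.
have r1 := post_ready G0 L2 r p1; case: p1 => h0 h1 fr hy.
have hx1 := holds_below G0 lL fr hx.
apply: tripleW (leqnn _) _ (k2 G G0 _ s1 r1 hx1) => s2 [h0' h1' fr' hz]; split; rewrite ?h0' ?h1' //.
  move=> o ho; rewrite fr' ?fr //; apply: leq_trans ho _; by rewrite leq_mul2r LL1 orbT.
by split=> //; exact: (holds_below G0 b1 fr' hy).
Qed.

Lemma c_id a : compu a a (fun _ p => p).
Proof. by apply: c_move => l; exists l. Qed.
Lemma c_fst0 a b : compu (TP a b) a (fun _ p => p.1).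
Proof. by apply: c_move => l; exists l.1; split=> [L /andP[]|G G0 x s r []]. Qed.
Lemma c_snd0 a b : compu (TP a b) b (fun _ p => p.2).
Proof. by apply: c_move => l; exists l.2; split=> [L /andP[]|G G0 x s r []]. Qed.
Lemma c_rank0 : compu TV TN (fun G v => enum_rank v).
Proof. by apply: c_move => l; exists l. Qed.
Lemma c_nat0 : compu TB TN (fun G b => nat_of_bool b).
Proof. by apply: c_move => l; exists l. Qed.
Lemma c_set0 a : compu a TS (fun G _ => set0).
Proof.
apply: c_move => l; exists 2; split=> // G G0 x s r _ v; by rewrite in_set0 (ready_zero r) // rank_sq.
Qed.
Lemma c_F0 a : compu a TF (fun G _ => [ffun=> 0]).
Proof.
apply: c_move => l; exists 2; split=> // G G0 x s r _ v; rewrite ffunE (ready_zero r) //; exact: rank_sq.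
Qed.
Lemma c_R0 a : compu a TR (fun G _ => set0).
Proof.
apply: c_move => l; exists 2; split=> // G G0 x s r _ u v; rewrite in_set0 (ready_zero r) //; exact: pair_sq.
Qed.

Definition sval t G : den t G -> nat := match t return den t G -> nat with
  | TV => fun x => enum_rank x | TN => fun x => x | TB => fun x => nat_of_bool x | _ => fun _ => 0 end.
Definition scalar t := match t with TV | TN | TB => true | _ => false end.

Lemma reg_fetch r i s q : r != 1 -> reg (run (fetch r i) s) q = if q == r then ram s (i * reg s 1) else reg s q.
Proof. by move=> r1; rewrite /= reg_base // eqxx mem_base; case: eqP => // /eqP/negbTE h; rewrite reg_base // h. Qed.
Lemma mem_fetch r i s : ram (run (fetch r i) s) = ram s.
Proof. by rewrite /= mem_base. Qed.
Lemma straight_fetch r i : straight (fetch r i).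
Proof. by rewrite /= straight_base. Qed.

Lemma c_scalar a b (phi : forall G, den a G -> den b G) : scalar b ->
  (forall l : loc a, exists2 c, straight c & forall G : sgraph, 0 < #|G| -> forall x s, ready G s -> holds (ram s) l x ->
    [/\ reg (run c s) 0 = reg s 0, reg (run c s) 1 = reg s 1, ram (run c s) = ram s & reg (run c s) 4 = sval (phi G x)]) ->
  compu a b phi.
Proof.
move=> sb h; split=> l L lL L2; have [c sc hc] := h l.
exists (Seq c (Seq (base 5 L) (Store 5 4))), (csize (Seq c (Seq (base 5 L) (Store 5 4)))), (alloc b L), (L + width b).
split; [exact: leq_addr|exact: alloc_below|] => G G0 x s r hx.
apply: triple_run; first by rewrite /= sc straight_base.
have [h0 h1 hm h4] := hc G G0 x s r hx.
have E : run (Seq c (Seq (base 5 L) (Store 5 4))) s = set_mem (run (base 5 L) (run c s)) (L * sq G) (sval (phi G x)).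
  by rewrite /= !reg_base //= h1 h4 (ready1 r).
rewrite E; split; rewrite /= ?reg_base //=.
- by move=> o ho; rewrite mem_base hm; case: eqP ho => // ->; rewrite ltnn.
- by move: (phi G x); move: sb; clear; case: b => //= _ y; rewrite eqxx.
Qed.
Opaque fetch.

Ltac crunch := do 12? (rewrite ?(mem_base, mem_fetch) ?(reg_base, reg_fetch) //=).

Lemma c_add0 : compu (TP TN TN) TN (fun G p => p.1 + p.2).
Proof.
apply: c_scalar => // -[l1 l2]; exists (Seq (fetch 4 l1) (Seq (fetch 5 l2) (Add 4 4 5))); first by rewrite /= !straight_fetch.
move=> G G0 [x y] s r [hx hy]; by rewrite /=; crunch; rewrite (ready1 r); move: hx hy => /= -> ->.
Qed.

Lemma c_sub0 : compu (TP TN TN) TN (fun G p => p.1 - p.2).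
Proof.
apply: c_scalar => // -[l1 l2]; exists (Seq (fetch 4 l1) (Seq (fetch 5 l2) (Defs.Sub 4 4 5))); first by rewrite /= !straight_fetch.
by move=> G G0 [x y] s r [hx hy]; rewrite /=; crunch; rewrite (ready1 r); move: hx hy => /= -> ->.
Qed.

Lemma c_iszero0 : compu TN TB (fun G x => x == 0).
Proof.
apply: c_scalar => // l; exists (Seq (fetch 4 l) (If 4 (Const 4 0) (Const 4 1))); first by rewrite /= !straight_fetch.
move=> G G0 x s r /= hx; rewrite !reg_fetch //= (ready1 r) hx.
by case: eqP => _ /=; rewrite ?mem_fetch ?reg_fetch //= (ready1 r).
Qed.

Lemma c_constN a k : compu a TN (fun _ _ => k).
Proof. by apply: c_scalar => // l; exists (Const 4 k). Qed.
Lemma c_constB a (b : bool) : compu a TB (fun _ _ => b).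
Proof. by apply: c_scalar => // l; exists (Const 4 b). Qed.

Lemma c_card a : compu a TN (fun G _ => #|G|).
Proof.
by apply: c_scalar => // l; exists (Seq (Const 4 0) (Add 4 0 4)) => // G G0 x s r h; rewrite /= (ready0 r) addn0.
Qed.

Definition row_read l1 l2 := Seq (fetch 4 l1) (Seq (base 5 l2) (Seq (Add 4 4 5) (Fetch 4 4))).
Lemma row_readP (G : sgraph) l1 l2 s (v : G) : reg s 1 = sq G -> ram s (l1 * sq G) = enum_rank v ->
  [/\ reg (run (row_read l1 l2) s) 0 = reg s 0, reg (run (row_read l1 l2) s) 1 = reg s 1,
      ram (run (row_read l1 l2) s) = ram s & reg (run (row_read l1 l2) s) 4 = ram s (l2 * sq G + enum_rank v)].
Proof.
by move=> r1 h; rewrite /=; crunch; rewrite r1 h addnC.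
Qed.
Lemma c_mem0 : compu (TP TV TS) TB (fun G p => p.1 \in p.2).
Proof.
apply: c_scalar => // -[l1 l2]; exists (row_read l1 l2); first by rewrite /= !straight_fetch straight_base.
by move=> G G0 [x y] s r [hx hy]; have [h0 h1 h2 h4] := row_readP l2 (ready1 r) hx; split=> //; rewrite h4; exact: hy.
Qed.
Lemma c_app0 : compu (TP TV TF) TN (fun G p => p.2 p.1).
Proof.
apply: c_scalar => // -[l1 l2]; exists (row_read l1 l2); first by rewrite /= !straight_fetch straight_base.
by move=> G G0 [x y] s r [hx hy]; have [h0 h1 h2 h4] := row_readP l2 (ready1 r) hx; split=> //; rewrite h4; exact: hy.
Qed.

(* Leaves the address of cell (u, v) of slot l3 in register 5; the product
   with n is looked up in slot 1. *)
Definition cell_addr l1 l2 l3 := Seq (fetch 4 l1) (Seq (base 5 1) (Seq (Add 5 5 4) (Seq (Fetch 5 5)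
  (Seq (fetch 6 l2) (Seq (Add 5 5 6) (Seq (base 6 l3) (Add 5 5 6))))))).
Lemma straight_cell l1 l2 l3 : straight (cell_addr l1 l2 l3).
Proof. by rewrite /= !straight_fetch !straight_base. Qed.
Lemma cell_addrP (G : sgraph) l1 l2 l3 s (u v : G) : ready G s -> ram s (l1 * sq G) = enum_rank u -> ram s (l2 * sq G) = enum_rank v ->
  [/\ reg (run (cell_addr l1 l2 l3) s) 0 = reg s 0, reg (run (cell_addr l1 l2 l3) s) 1 = reg s 1,
      ram (run (cell_addr l1 l2 l3) s) = ram s &
      reg (run (cell_addr l1 l2 l3) s) 5 = l3 * sq G + (enum_rank u * #|G| + enum_rank v)].
Proof.
move=> r hu hv; rewrite /=.
crunch; rewrite (ready1 r) ?hu ?hv.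
by rewrite mul1n (ready_mul r) // addnC.
Qed.
Opaque cell_addr.

Lemma c_memR0 : compu (TP (TP TV TV) TR) TB (fun G p => p.1 \in p.2).
Proof.
apply: c_scalar => // -[[l1 l2] l3]; exists (Seq (cell_addr l1 l2 l3) (Fetch 4 5)); first by rewrite /= straight_cell.
move=> G G0 [[x y] z] s r [[hx hy] hz]; have [h0 h1 h2 h4] := cell_addrP l3 r hx hy.
by rewrite /= h0 h1 h2 h4; split=> //; exact: hz.
Qed.
Lemma c_edge0 : compu (TP TV TV) TB (fun G p => edge p.1 p.2).
Proof.
apply: c_scalar => // -[l1 l2]; exists (Seq (cell_addr l1 l2 0) (Fetch 4 5)); first by rewrite /= straight_cell.
move=> G G0 [x y] s r [hx hy]; have [h0 h1 h2 h4] := cell_addrP 0 r hx hy.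
by rewrite /= h0 h1 h2 h4 mul0n add0n (ready_adj r) ?pair_sq // input_memE.
Qed.

Lemma c_if a b t f g : compu a TB t -> compu a b f -> compu a b g ->
  compu a b (fun G p => if t G p then f G p else g G p).
Proof.
move=> ht hf hg; split=> l L lL L2; have [c0 [e0 [l0 [L0 [LL0 b0 k0]]]]] := compuP ht l L lL L2.
have lL0 := belowW LL0 lL; have L02 := leq_trans L2 LL0.
have [c1 [e1 [l1 [L1 [LL1 b1 k1]]]]] := compuP hf l L0 lL0 L02.
have [c2 [e2 [l2 [L2' [LL2 b2 k2]]]]] := compuP hg l L0 lL0 L02.
(* The branches leave their results in different places; each copies its own to M, beyond both. *)
pose M := L1 + L2'.
have M1 : L1 <= M by exact: leq_addr.
have M2 : L2' <= M by exact: leq_addl.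
have [d1 q1] := copyP (below_avoid (M + width b) b1 M1).
have [d2 q2] := copyP (below_avoid (M + width b) b2 M2).
exists (Seq (Seq c0 (fetch 4 l0)) (If 4 (Seq c1 (copy l1 M)) (Seq c2 (copy l2 M)))).
eexists; exists (alloc b M), (M + width b).
have LM : L <= M by apply: leq_trans LL0 _; exact: leq_trans M1.
split; [exact: leq_trans (leq_addr _ _)|exact: alloc_below|] => G G0 x s r hx.
pose mid s' := [/\ ready G s', forall o, o < L * sq G -> ram s' o = ram s o & holds (ram s') l x].
have up A B o : A <= B -> o < A * sq G -> o < B * sq G.
  by move=> AB ho; apply: leq_trans ho _; rewrite leq_mul2r AB orbT.
apply: (triple_seq (P := fun s' => mid s' /\ reg s' 4 = t G x)).
  apply: (triple_seq (k0 G G0 x s r hx)) => s1 p1; apply: triple_run; first exact: straight_fetch.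
  have r1 := post_ready G0 L2 r p1; case: p1 => h0 h1 fr hy.
  have hy' : ram s1 (l0 * sq G) = t G x by exact: hy.
  rewrite reg_fetch //= (ready1 r1) hy'; split=> //; split; rewrite ?mem_fetch //; last exact: (holds_below G0 lL fr hx).
  by apply: (ready_ext G0 L2 _ _ _ r1); rewrite ?reg_fetch ?mem_fetch.
move=> s1 [[r1 fr1 hx1] h4].
have fin c0' d l0' K (y : den b G) s2 : L0 <= K -> K <= M ->
  (forall n s, 0 < n -> reg s 1 = n * n -> triple n d (copy l0' M) s (fun s' => [/\ reg s' 0 = reg s 0, reg s' 1 = reg s 1,
    frame_out (n * n) M (M + width b) (ram s) (ram s') & same (n * n) (ram s) (ram s') l0' (alloc b M)])) ->
  c0' = copy l0' M -> post L0 s1 l0' y s2 -> triple #|G| d c0' s2 (post L s (alloc b M) y).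
  move=> LK KM q -> p2; have r2 := post_ready G0 L02 r1 p2; case: p2 => h0 h1 fr2 hy.
  apply: tripleW (leqnn _) _ (q _ _ G0 (ready1 r2)) => s3 [h0' h1' fr3 sm].
  split; [by rewrite h0' (ready0 r2) (ready0 r)|by rewrite h1' (ready1 r2) (ready1 r)| |exact: (holds_same G0 sm)].
  by move=> o ho; rewrite fr3 ?(up L M) // fr2 ?(up L L0) // fr1.
apply: triple_if; rewrite h4; case E: (t G x) => // _.
  by apply: (triple_seq (k1 G G0 x s1 r1 hx1)) => s2 p2; exact: (fin _ d1 l1 L1 _ _ LL1 M1 q1 (erefl _) p2).
by apply: (triple_seq (k2 G G0 x s1 r1 hx1)) => s2 p2; exact: (fin _ d2 l2 L2' _ _ LL2 M2 q2 (erefl _) p2).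
Qed.

Definition row_write l1 lb L := Seq (fetch 4 l1) (Seq (base 5 L) (Seq (Add 4 4 5) (Seq (fetch 5 lb) (Store 4 5)))).
Definition cell_write l1 l2 lb L := Seq (cell_addr l1 l2 L) (Seq (fetch 6 lb) (Store 5 6)).

Lemma copy_writeP i L wr : 2 < L -> i < L -> straight wr -> exists e, forall G : sgraph, 0 < #|G| -> forall s k v, ready G s -> k < sq G ->
  (forall s1, ready G s1 -> (forall o, o < L * sq G -> ram s1 o = ram s o) ->
    [/\ reg (run wr s1) 0 = reg s1 0, reg (run wr s1) 1 = reg s1 1 &
     forall o, ram (run wr s1) o = if o == L * sq G + k then v else ram s1 o]) ->
  triple #|G| e (Seq (copy_slot i L) wr) s (fun s' => [/\ reg s' 0 = reg s 0, reg s' 1 = reg s 1,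
    forall o, o < L * sq G -> ram s' o = ram s o &
    forall o, o < sq G -> ram s' (L * sq G + o) = if o == k then v else ram s (i * sq G + o)]).
Proof.
move=> L2 iL st; have [e he] := copy_slotP i L; exists (e + csize wr).+1 => G G0 s k v r kq hw.
have neq : i != L by rewrite neq_ltn iL.
apply: (triple_seq (he _ s (ready1 r) neq)) => s1 [h0 h1 hm]; rewrite -/(sq G) in hm.
have fr o : o < L * sq G -> ram s1 o = ram s o by move=> ho; rewrite hm leqNgt ho.
have r1 := ready_ext G0 L2 h0 h1 fr r; have [g0 g1 gm] := hw s1 r1 fr.
apply: triple_run => //; split; rewrite ?g0 ?g1 //.
  move=> o ho; rewrite gm fr //; case: eqP ho => // ->; by rewrite ltnNge leq_addr.
by move=> o oq; rewrite gm eqn_add2l hm leq_addr addKn slot_lt.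
Qed.

Lemma row_writeP (G : sgraph) l1 lb L s (v : G) : 2 < L -> ready G s -> ram s (l1 * sq G) = enum_rank v ->
  [/\ reg (run (row_write l1 lb L) s) 0 = reg s 0, reg (run (row_write l1 lb L) s) 1 = reg s 1 &
   forall o, ram (run (row_write l1 lb L) s) o = if o == L * sq G + enum_rank v then ram s (lb * sq G) else ram s o].
Proof.
move=> L2 r hv; rewrite /=; crunch.
by rewrite (ready1 r) hv addnC; split.
Qed.

Lemma c_updS0 : compu (TP (TP TS TV) TB) TS (fun G p => [set u | if u == p.1.2 then p.2 else u \in p.1.1]).
Proof.
split=> -[[l1 l2] l3] L /= /andP[/andP[b1 b2] b3] L2; have st : straight (row_write l2 l3 L) by rewrite /= !straight_fetch straight_base.
have [e he] := copy_writeP L2 b1 st; exists (Seq (copy_slot l1 L) (row_write l2 l3 L)), e, L, L.+1; split=> // G G0 [[x y] z] s r [/= [hx hy] hz].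
apply: tripleW (leqnn _) _ (he G G0 s (enum_rank y) (nat_of_bool z) r (rank_sq G0 y) _) => [s' [h0 h1 h2 h3]|s1 r1 fr].
  split=> // v; rewrite /= h3 ?rank_sq // !inE.
  have -> : (enum_rank v == enum_rank y :> nat) = (v == y) by rewrite (inj_eq val_inj) (inj_eq enum_rank_inj).
  by rewrite hx; case: ifP.
rewrite -hz -fr ?ltn_mul2r ?sq_gt0 //; apply: row_writeP => //; by rewrite fr // ltn_mul2r sq_gt0.
Qed.

Lemma c_updF0 : compu (TP (TP TF TV) TN) TF (fun G p => [ffun u => if u == p.1.2 then p.2 else p.1.1 u]).
Proof.
split=> -[[l1 l2] l3] L /= /andP[/andP[b1 b2] b3] L2; have st : straight (row_write l2 l3 L) by rewrite /= !straight_fetch straight_base.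
have [e he] := copy_writeP L2 b1 st; exists (Seq (copy_slot l1 L) (row_write l2 l3 L)), e, L, L.+1; split=> // G G0 [[x y] z] s r [/= [hx hy] hz].
apply: tripleW (leqnn _) _ (he G G0 s (enum_rank y) z r (rank_sq G0 y) _) => [s' [h0 h1 h2 h3]|s1 r1 fr].
  split=> // v; rewrite /= h3 ?rank_sq // ffunE.
  have -> : (enum_rank v == enum_rank y :> nat) = (v == y) by rewrite (inj_eq val_inj) (inj_eq enum_rank_inj).
  by rewrite hx; case: ifP.
rewrite -hz -fr ?ltn_mul2r ?sq_gt0 //; apply: row_writeP => //; by rewrite fr // ltn_mul2r sq_gt0.
Qed.

Lemma c_updR0 : compu (TP (TP TR (TP TV TV)) TB) TR (fun G p => [set u | if u == p.1.2 then p.2 else u \in p.1.1]).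
Proof.
split=> -[[l1 [l2 l2']] l3] L /= /andP[/andP[b1 /andP[b2 b2']] b3] L2.
have st : straight (cell_write l2 l2' l3 L) by rewrite /= straight_cell straight_fetch.
have [e he] := copy_writeP L2 b1 st; exists (Seq (copy_slot l1 L) (cell_write l2 l2' l3 L)), e, L, L.+1.
split=> // G G0 [[x [y y']] z] s r [/= [hx [hy hy']] hz].
apply: tripleW (leqnn _) _ (he G G0 s (enum_rank y * #|G| + enum_rank y') (nat_of_bool z) r (pair_sq y y') _) => [s' [h0 h1 h2 h3]|s1 r1 fr].
  split=> // u v; rewrite /= h3 ?pair_sq // !inE /= (pair_inj G0) hx xpair_eqE.
  by case: ifP.
have lt l : l < L -> l * sq G < L * sq G by move=> h; rewrite ltn_mul2r sq_gt0.
rewrite -hz -fr ?lt // /cell_write /=.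
have [h0 h1 h2 h5] := cell_addrP L r1 (etrans (fr _ (lt _ b2)) hy) (etrans (fr _ (lt _ b2')) hy').
by rewrite mem_fetch !reg_fetch //= h0 h1 h2 h5 (ready1 r1); split.
Qed.

(** Slot M holds the loop counter, which at the same time represents the current vertex, because
    vertices are stored as ranks. *)
Lemma c_foldl a t f g : compu a t f -> compu (TP (TP a t) TV) t g ->
  compu a t (fun G p => foldl (fun st v => g G ((p, st), v)) (f G p) (enum G)).
Proof.
move=> hf hg; split=> l L lL L2; have [c0 [e0 [l0 [L0 [LL0 b0 k0]]]]] := compuP hf l L lL L2.
pose acc := alloc t L0; pose M := L0 + width t.
have LM : L0 <= M by exact: leq_addr.
have ba : below M acc by exact: alloc_below.
have lM : below M.+1 l by apply: belowW lL; apply: leq_trans LL0 _; exact: leqW.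
pose lin : loc (TP (TP a t) TV) := ((l, acc), M).
have bin : below M.+1 lin by rewrite /= lM (belowW (leqnSn M) ba) leqnn.
have M2 : 2 < M.+1 by apply: leq_trans L2 _; apply: leq_trans LL0 _; exact: leqW.
have [c1 [e1 [l1 [L1 [LL1 b1 k1]]]]] := compuP hg lin M.+1 bin M2.
have [d0 q0] := copyP (below_avoid (L0 + width t) b0 (leqnn L0)).
have [d1 q1] := copyP (below_avoid (L1 + width t) b1 (leqnn L1)).
have av2 : avoid L0 (L0 + width t) (alloc t L1).
  by apply: alloc_avoid; apply/orP; right; apply: leq_trans LL1; exact: leqnSn.
have [d2 q2] := copyP av2.
pose test := Seq (fetch 4 M) (Defs.Sub 3 0 4).
pose incr := Seq (fetch 4 M) (Seq (Const 6 1) (Seq (Add 4 4 6) (Seq (base 5 M) (Store 5 4)))).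
(* The result of a round may share slots with the accumulator, for instance with components swapped;
   it passes through fresh slots at [L1]. *)
pose body := Seq (Seq c1 (Seq (copy l1 L1) (copy (alloc t L1) L0))) (Seq incr test).
pose zero := Seq (Const 4 0) (Seq (base 5 M) (Store 5 4)).
exists (Seq (Seq c0 (Seq (copy l0 L0) (Seq zero test))) (While 3 body)).
eexists; exists acc, M; split; [exact: leq_trans LM|by []|] => G G0 x s r hx.
have up A B o : A <= B -> o < A * sq G -> o < B * sq G.
  by move=> AB ho; apply: leq_trans ho _; rewrite leq_mul2r AB orbT.
have LM' : L <= M by exact: leq_trans LM.
have q00 := sq_gt0 G0.
have MM : M * sq G < M.+1 * sq G by rewrite ltn_mul2r q00 leqnn.
pose part j := foldl (fun st v => g G ((x, st), v)) (f G x) (take j (enum G)).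
pose base_inv j s' := [/\ ready G s', forall o, o < L * sq G -> ram s' o = ram s o, holds (ram s') acc (part j) & ram s' (M * sq G) = j].
pose Inv j s' := base_inv j s' /\ reg s' 3 = #|G| - j.
have testP j s1 : base_inv j s1 -> triple #|G| (csize test) test s1 (Inv j).
  move=> [r1 fr1 h1 hM]; apply: triple_run; first by rewrite /= straight_fetch.
  split; last by rewrite /= !reg_fetch //= (ready1 r1) (ready0 r1) hM.
  split; rewrite /= ?mem_fetch //.
  by apply: (ready_ext G0 M2 _ _ _ r1); rewrite /= ?reg_fetch ?mem_fetch.
have setP k s1 m : ready G s1 -> (forall o, o < L * sq G -> ram s1 o = ram s o) -> holds (ram s1) acc (part k) ->
  (forall o, m o = if o == M * sq G then k else ram s1 o) -> forall s2, reg s2 0 = reg s1 0 -> reg s2 1 = reg s1 1 -> ram s2 = m -> base_inv k s2.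
  move=> r1 fr1 h1 hm s2 g0 g1 g2.
  have fr2 o : o < M * sq G -> ram s2 o = ram s1 o by move=> ho; rewrite g2 hm; case: eqP ho => // ->; rewrite ltnn.
  split; [|by move=> o ho; rewrite fr2 ?fr1 ?(up L M)| |by rewrite g2 hm eqxx].
    apply: (ready_ext G0 _ g0 g1 fr2 r1); apply: leq_trans L2 _; exact: LM'.
  exact: (holds_below G0 ba fr2 h1).
apply: (triple_seq (P := Inv 0)).
  apply: (triple_seq (k0 G G0 x s r hx)) => s1 p1; have r1 := post_ready G0 L2 r p1; case: p1 => _ _ fr1 hy.
  apply: (triple_seq (q0 _ _ G0 (ready1 r1))) => s2 [g0 g1 fr2 sm2].
  have fr2' o : o < L0 * sq G -> ram s2 o = ram s1 o by move=> ho; rewrite fr2 // ho.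
  have r2 := ready_ext G0 (leq_trans L2 LL0) g0 g1 fr2' r1.
  have h2 : holds (ram s2) acc (part 0) by rewrite /part take0; exact: (holds_same G0 sm2).
  apply: (triple_seq (P := base_inv 0)); last by move=> s3; exact: testP.
  apply: triple_run; first by rewrite /= straight_base.
  apply: (setP 0 s2 _ r2 _ h2 _ _ _ _ (erefl _)); rewrite /= ?reg_base //= ?mem_base.
  - by move=> o ho; rewrite fr2' ?fr1 ?(up L L0).
  - by move=> o; rewrite (ready1 r2).
move=> s1 I1; apply: (tripleW (leqnn _) _ (triple_while (N := #|G|) (Inv := Inv) _ _ _ I1)).
- move=> s' [[r' fr h _] _]; split; rewrite ?(ready0 r') ?(ready1 r') ?(ready0 r) ?(ready1 r) //.
  by move: h; rewrite /part take_oversize // -cardE.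
- by rewrite leq_pmulr.
- by move=> j s' jN [_ ->]; rewrite subn_eq0 eqn_leq jN.
move=> j s2 jN [[r2 fr2 h2 hM] _].
pose v := enum_val (Ordinal jN).
have hin : holds (ram s2) lin (x, part j, v).
  by split; [split=> //; exact: (holds_below G0 lL fr2 hx)|rewrite /= enum_valK].
apply: (triple_seq (P := fun s3 => [/\ ready G s3, forall o, o < L * sq G -> ram s3 o = ram s o,
    holds (ram s3) acc (part j.+1) & ram s3 (M * sq G) = j])).
  apply: (triple_seq (k1 G G0 _ s2 r2 hin)) => s3 p3; have r3 := post_ready G0 M2 r2 p3; case: p3 => _ _ fr3 h3.
  apply: (triple_seq (q1 _ _ G0 (ready1 r3))) => s4 [g0 g1 fr4 sm4].
  have fr4' o : o < L1 * sq G -> ram s4 o = ram s3 o by move=> ho; rewrite fr4 // ho.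
  have ML1 : M <= L1 by apply: leq_trans LL1; exact: leqnSn.
  have r4 := ready_ext G0 (leq_trans M2 LL1) g0 g1 fr4' r3.
  have h4 := holds_same G0 sm4 h3.
  apply: tripleW (leqnn _) _ (q2 _ _ G0 (ready1 r4)) => s5 [k0' k1' fr5 sm5].
  have fr5' o : o < L0 * sq G -> ram s5 o = ram s4 o by move=> ho; rewrite fr5 // ho.
  split.
  - exact: (ready_ext G0 (leq_trans L2 LL0) k0' k1' fr5' r4).
  - by move=> o ho; rewrite fr5' ?fr4' ?fr3 ?fr2 // ?(up L L0) ?(up L L1) ?(up L M.+1) // (leq_trans LM') // leqnSn.
  - have := holds_same G0 sm5 h4; rewrite /= /part (take_nth v) ?size_enum_ord -?cardE //.
    have -> : nth v (enum G) j = v by rewrite /v /enum_val; apply: set_nth_default; rewrite -cardE.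
    by rewrite -cats1 foldl_cat.
  - have out : M * sq G < M.+1 * sq G by [].
    rewrite fr5 ?fr4' ?fr3 // ?(up M.+1 L1) //.
    by rewrite -/M leqnn orbT.
move=> s3 [r3 fr3 h3 hM3]; apply: (triple_seq (P := base_inv j.+1)); last by move=> s4; exact: testP.
apply: triple_run; first by rewrite /= straight_base straight_fetch.
apply: (setP _ s3 _ r3 fr3 h3 _ _ _ _ (erefl _)); do 3! rewrite /= ?reg_base ?reg_fetch ?mem_base ?mem_fetch //.
by move=> o; do 3! rewrite /= ?reg_base ?reg_fetch ?mem_base ?mem_fetch //; rewrite (ready1 r3) hM3 addn1.
Qed.

(** * Closure properties of computable functions *)

Lemma c_ext a b phi psi : (forall G (p : den a G), phi G p = psi G p) -> compu a b psi -> compu a b phi.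
Proof.
move=> E h; split=> l L lL L2; have [c [e [l' [L' [h1 h2 h3]]]]] := compuP h l L lL L2.
by exists c, e, l', L'; split=> // G G0 x s r hx; rewrite E; exact: h3.
Qed.

Lemma c_ap1 c a b (F : forall G, den a G -> den b G) x :
  compu a b F -> compu c a x -> compu c b (fun G p => F G (x G p)).
Proof. by move=> hF hx; exact: c_comp hx hF. Qed.
Lemma c_ap2 c a1 a2 b (F : forall G, den a1 G -> den a2 G -> den b G) x y :
  compu (TP a1 a2) b (fun G q => F G q.1 q.2) -> compu c a1 x -> compu c a2 y ->
  compu c b (fun G p => F G (x G p) (y G p)).
Proof. by move=> hF hx hy; exact: c_comp (c_pair hx hy) hF. Qed.
Lemma c_ap3 c a1 a2 a3 b (F : forall G, den a1 G -> den a2 G -> den a3 G -> den b G) x y z :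
  compu (TP (TP a1 a2) a3) b (fun G q => F G q.1.1 q.1.2 q.2) -> compu c a1 x -> compu c a2 y -> compu c a3 z ->
  compu c b (fun G p => F G (x G p) (y G p) (z G p)).
Proof. by move=> hF hx hy hz; exact: c_comp (c_pair (c_pair hx hy) hz) hF. Qed.
Lemma c_ap4 c a1 a2 a3 a4 b (F : forall G, den a1 G -> den a2 G -> den a3 G -> den a4 G -> den b G) x y z t :
  compu (TP (TP (TP a1 a2) a3) a4) b (fun G q => F G q.1.1.1 q.1.1.2 q.1.2 q.2) ->
  compu c a1 x -> compu c a2 y -> compu c a3 z -> compu c a4 t ->
  compu c b (fun G p => F G (x G p) (y G p) (z G p) (t G p)).
Proof. by move=> hF hx hy hz ht; exact: c_comp (c_pair (c_pair (c_pair hx hy) hz) ht) hF. Qed.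

Section Ops.
Variable c : ty.
Implicit Types (G : sgraph).

Lemma c_fst a b f : compu c (TP a b) f -> compu c a (fun G p => (f G p).1).
Proof. by move=> h; exact: c_comp h (@c_fst0 a b). Qed.
Lemma c_snd b a f : compu c (TP a b) f -> compu c b (fun G p => (f G p).2).
Proof. by move=> h; exact: c_comp h (@c_snd0 a b). Qed.
Lemma c_add (f g : forall G : sgraph, den c G -> nat) :
  compu c TN f -> compu c TN g -> compu c TN (fun G p => f G p + g G p).
Proof. exact: (c_ap2 (a1 := TN) (a2 := TN) (b := TN) (F := fun _ => addn) c_add0). Qed.
Lemma c_sub (f g : forall G : sgraph, den c G -> nat) :
  compu c TN f -> compu c TN g -> compu c TN (fun G p => f G p - g G p).
Proof. exact: (c_ap2 (a1 := TN) (a2 := TN) (b := TN) (F := fun _ => subn) c_sub0). Qed.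
Lemma c_leq (f g : forall G : sgraph, den c G -> nat) :
  compu c TN f -> compu c TN g -> compu c TB (fun G p => f G p <= g G p).
Proof. by move=> hf hg; exact: (c_comp (c_sub hf hg) c_iszero0). Qed.
Lemma c_succ (f : forall G : sgraph, den c G -> nat) :
  compu c TN f -> compu c TN (fun G p => (f G p).+1).
Proof. by move=> hf; apply: (c_ext (a := c) (b := TN) (psi := fun G p => f G p + 1)) => [G p|]; [rewrite addn1|exact: c_add hf (c_constN _ 1)]. Qed.
Lemma c_pred (f : forall G : sgraph, den c G -> nat) :
  compu c TN f -> compu c TN (fun G p => (f G p).-1).
Proof. by move=> hf; apply: (c_ext (a := c) (b := TN) (psi := fun G p => f G p - 1)) => [G p|]; [rewrite subn1|exact: c_sub hf (c_constN _ 1)]. Qed.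
Lemma c_andb (f g : forall G : sgraph, den c G -> bool) :
  compu c TB f -> compu c TB g -> compu c TB (fun G p => f G p && g G p).
Proof. by move=> hf hg; exact: (@c_if c TB f g _ hf hg (c_constB _ false)). Qed.
Lemma c_orb (f g : forall G : sgraph, den c G -> bool) :
  compu c TB f -> compu c TB g -> compu c TB (fun G p => f G p || g G p).
Proof. by move=> hf hg; exact: (@c_if c TB f _ g hf (c_constB _ true) hg). Qed.
Lemma c_implb (f g : forall G : sgraph, den c G -> bool) :
  compu c TB f -> compu c TB g -> compu c TB (fun G p => f G p ==> g G p).
Proof. by move=> hf hg; exact: (@c_if c TB f g _ hf hg (c_constB _ true)). Qed.
Lemma c_negb (f : forall G : sgraph, den c G -> bool) :
  compu c TB f -> compu c TB (fun G p => ~~ f G p).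
Proof. by move=> hf; exact: (@c_if c TB f _ _ hf (c_constB _ false) (c_constB _ true)). Qed.
Lemma c_addb (f g : forall G : sgraph, den c G -> bool) :
  compu c TB f -> compu c TB g -> compu c TB (fun G p => f G p (+) g G p).
Proof.
move=> hf hg; apply: (c_ext (a := c) (b := TB) (psi := fun G p => if f G p then ~~ g G p else g G p)).
  by move=> G p; case: (f G p).
exact: c_if hf (c_negb hg) hg.
Qed.
Lemma c_eqn (f g : forall G : sgraph, den c G -> nat) :
  compu c TN f -> compu c TN g -> compu c TB (fun G p => f G p == g G p).
Proof.
move=> hf hg; apply: (c_ext (a := c) (b := TB) (psi := fun G p => (f G p <= g G p) && (g G p <= f G p))); first by move=> G p; rewrite eqn_leq.
by apply: c_andb; apply: c_leq.
Qed.
Lemma c_rank (f : forall G : sgraph, den c G -> G) :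
  compu c TV f -> compu c TN (fun G p => enum_rank (f G p)).
Proof. by move=> h; exact: c_comp h c_rank0. Qed.
Lemma c_nat (f : forall G : sgraph, den c G -> bool) :
  compu c TB f -> compu c TN (fun G p => nat_of_bool (f G p)).
Proof. by move=> h; exact: c_comp h c_nat0. Qed.
Lemma c_eqv (f g : forall G : sgraph, den c G -> G) :
  compu c TV f -> compu c TV g -> compu c TB (fun G p => f G p == g G p).
Proof.
move=> hf hg; apply: (c_ext (a := c) (b := TB) (psi := fun G p => enum_rank (f G p) == enum_rank (g G p) :> nat)).
  by move=> G p; rewrite (inj_eq val_inj) (inj_eq enum_rank_inj).
by apply: c_eqn; apply: c_rank.
Qed.
Lemma c_mem (f : forall G : sgraph, den c G -> G) (g : forall G : sgraph, den c G -> {set G}) :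
  compu c TV f -> compu c TS g -> compu c TB (fun G p => f G p \in g G p).
Proof. exact: (c_ap2 (a1 := TV) (a2 := TS) (b := TB) (F := fun G x (S : {set G}) => x \in S) c_mem0). Qed.
Lemma c_app (f : forall G : sgraph, den c G -> G) (g : forall G : sgraph, den c G -> {ffun G -> nat}) :
  compu c TV f -> compu c TF g -> compu c TN (fun G p => g G p (f G p)).
Proof. exact: (c_ap2 (a1 := TV) (a2 := TF) (b := TN) (F := fun G x (S : {ffun G -> nat}) => S x) c_app0). Qed.
Lemma c_edge (f g : forall G : sgraph, den c G -> G) :
  compu c TV f -> compu c TV g -> compu c TB (fun G p => edge (f G p) (g G p)).
Proof. exact: (c_ap2 (a1 := TV) (a2 := TV) (b := TB) (F := fun G x y => edge x y) c_edge0). Qed.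
Lemma c_memR (f : forall G : sgraph, den c G -> G * G) (g : forall G : sgraph, den c G -> {set G * G}) :
  compu c (TP TV TV) f -> compu c TR g -> compu c TB (fun G p => f G p \in g G p).
Proof. exact: (c_ap2 (a1 := TP TV TV) (a2 := TR) (b := TB) (F := fun G x (S : {set G * G}) => x \in S) c_memR0). Qed.

Lemma c_fold t (f : forall G : sgraph, den c G -> den t G) (g : forall G : sgraph, den c G -> den t G -> G -> den t G) :
  compu c t f -> compu (TP (TP c t) TV) t (fun G q => g G q.1.1 q.1.2 q.2) ->
  compu c t (fun G p => foldl (g G p) (f G p) (enum G)).
Proof. by move=> hf hg; exact: (c_foldl hf hg). Qed.
End Ops.

Definition pairs (G : sgraph) : seq (G * G) := [seq (u, v) | u <- enum G, v <- enum G].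
Lemma foldl_pairs (G : sgraph) T (f : T -> G * G -> T) x :
  foldl f x (pairs G) = foldl (fun y u => foldl (fun z v => f z (u, v)) y (enum G)) x (enum G).
Proof.
have gen (s' s : seq G) y : foldl f y [seq (u, v) | u <- s, v <- s'] = foldl (fun y u => foldl (fun z v => f z (u, v)) y s') y s.
  by elim: s y => //= u s IH y; rewrite foldl_cat IH; congr foldl; elim: (s') y => //= v t' IH' y.
exact: gen.
Qed.
Lemma mem_pairs (G : sgraph) (x : G * G) : x \in pairs G.
Proof. by case: x => u v; apply/allpairsP; exists (u, v); rewrite /= !mem_enum. Qed.

Ltac cvar c f := lazymatch f with
  | (fun (G : sgraph) p => p) => constr:(c_id c)
  | (fun G p => fst (@?g G p)) => let h := cvar c g in constr:(c_fst h)
  | (fun G p => snd (@?g G p)) => let h := cvar c g in constr:(c_snd h)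
  end.

Lemma c_foldp c t (f : forall G : sgraph, den c G -> den t G) (g : forall G : sgraph, den c G -> den t G -> G * G -> den t G) :
  compu c t f -> compu (TP (TP c t) (TP TV TV)) t (fun G q => g G q.1.1 q.1.2 q.2) ->
  compu c t (fun G p => foldl (g G p) (f G p) (pairs G)).
Proof.
move=> hf hg; apply: c_ext; first by move=> G p; exact: foldl_pairs.
apply: (c_fold (g := fun G p y u => foldl (fun z v => g G p z (u, v)) y (enum G)) hf).
have v1 := c_id (TP (TP (TP (TP c t) TV) t) TV).
apply: (@c_fold _ _ _ (fun G (q : den (TP (TP c t) TV) G) z v => g G q.1.1 z (q.2, v))); first exact: c_snd (c_fst (c_id _)).
have := @c_ap3 (TP (TP (TP (TP c t) TV) t) TV) c t (TP TV TV) t g (fun G q => q.1.1.1.1) (fun G q => q.1.2) (fun G q => (q.1.1.2, q.2)) hg.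
apply.
- exact: c_fst (c_fst (c_fst (c_fst v1))).
- exact: c_snd (c_fst v1).
- exact: c_pair (c_snd (c_fst (c_fst v1))) (c_snd v1).
Qed.

(** The type of the discarded component cannot be read off from the goal, so the types that occur
    are tried in turn. *)
Ltac cproj lem := first
  [ apply: (lem _ _ TN) | apply: (lem _ _ TF) | apply: (lem _ _ TS) | apply: (lem _ _ TR) | apply: (lem _ _ TB) | apply: (lem _ _ TV)
  | apply: (lem _ _ (TP TS TF)) | apply: (lem _ _ (TP TR TR)) | apply: (lem _ _ (TP TS TR))
  | apply: (lem _ _ (TP (TP TR TR) (TP TR TR))) | apply: (lem _ _ (TP TB TF)) | apply: (lem _ _ (TP TV TV))].
(* Dispatch on the head symbol; extended after each closure lemma below. *)
Ltac user := fail.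
Ltac quant := fail.
Ltac cstep := cbv beta zeta; lazymatch goal with
  | |- compu ?c _ (fun G p => p) => exact: c_id
  | |- compu ?c _ (fun G p => fst (@?f G p)) => first [let h := cvar c f in exact (c_fst h) | cproj c_fst]
  | |- compu ?c _ (fun G p => snd (@?f G p)) => first [let h := cvar c f in exact (c_snd h) | cproj c_snd]
  | |- compu _ (TP _ _) (fun G p => pair _ _) => apply: c_pair
  | |- compu _ _ (fun G p => if _ then _ else _) => apply: c_if
  | |- compu _ _ (fun G p => andb _ _) => apply: c_andb
  | |- compu _ _ (fun G p => orb _ _) => apply: c_orb
  | |- compu _ _ (fun G p => implb _ _) => apply: c_implb
  | |- compu _ _ (fun G p => addb _ _) => apply: c_addb
  | |- compu _ _ (fun G p => edge _ _) => apply: c_edge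
  | |- compu _ TB (fun G p => leq _ _) => apply: c_leq
  | |- compu _ _ (fun G p => addn _ _) => apply: c_add
  | |- compu _ _ (fun G p => subn _ _) => apply: c_sub
  | |- compu _ TN (fun G p => nat_of_ord _) => apply: c_rank
  | |- compu _ TN (fun G p => nat_of_bool _) => apply: c_nat
  | |- compu _ TN (fun G p => predn _) => apply: c_pred
  | |- compu _ TN (fun G p => S _) => first [exact: c_constN | apply: c_succ]
  | |- compu _ TN (fun _ _ => _) => first [exact: c_constN | exact: c_card | user | apply: c_app | quant]
  | |- compu _ TB (fun _ _ => _) => first [exact: c_constB | user | quant | apply: c_eqv | apply: c_eqn | apply: c_mem | apply: c_memR | apply: c_negb]
  | |- _ => first [user | quant]
  end.
Ltac cgo := repeat cstep.

Section Quantifiers.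
Variable c : ty.

Lemma foldl_or (T : finType) (P : pred T) s b : foldl (fun b v => b || P v) b s = b || has P s.
Proof. by elim: s b => [|x s IH] b /=; rewrite ?orbF // IH orbA. Qed.

Lemma c_exists (P : forall G : sgraph, den c G -> G -> bool) :
  compu (TP c TV) TB (fun G q => P G q.1 q.2) -> compu c TB (fun G p => [exists v, P G p v]).
Proof.
move=> h; apply: (c_ext (a := c) (b := TB) (psi := fun G p => foldl (fun b v => b || P G p v) false (enum G))).
  move=> G p; rewrite foldl_or; apply/existsP/hasP => [[v Pv]|[v _ Pv]]; exists v => //.
  by rewrite mem_enum.
apply: c_fold; first exact: c_constB.
apply: c_orb; first by cgo.
have v1 := c_id (TP (TP c TB) TV).
exact: (c_ap2 (a2 := TV) (b := TB) h (c_fst (c_fst v1)) (c_snd v1)).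
Qed.

Lemma c_forall (P : forall G : sgraph, den c G -> G -> bool) :
  compu (TP c TV) TB (fun G q => P G q.1 q.2) -> compu c TB (fun G p => [forall v, P G p v]).
Proof.
move=> h; apply: (c_ext (a := c) (b := TB) (psi := fun G p => ~~ [exists v, ~~ P G p v])); first by move=> G p; rewrite negb_exists; apply: eq_forallb => v; rewrite negbK.
by apply: c_negb; apply: c_exists; apply: c_negb.
Qed.

Lemma c_set (P : forall G : sgraph, den c G -> G -> bool) :
  compu (TP c TV) TB (fun G q => P G q.1 q.2) -> compu c TS (fun G p => [set v | P G p v]).
Proof.
move=> h; apply: (c_ext (a := c) (b := TS) (psi := fun (G : sgraph) p => foldl (fun (S : {set G}) (v : G) => [set u | if u == v then P G p v else u \in S]) set0 (enum G))).
  move=> G p; apply/setP => x; rewrite inE.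
  have key s S : x \in foldl (fun (S : {set G}) v => [set u | if u == v then P G p v else u \in S]) S s = if x \in s then P G p x else x \in S.
    elim: s S => //= v s IH S; rewrite IH inE in_cons; case: (eqVneq x v) => [->|] /=; by case: ifP.
  by rewrite key mem_enum.
apply: c_fold; first exact: c_set0; have v1 := c_id (TP (TP c TS) TV).
have := @c_comp (TP (TP c TS) TV) (TP (TP TS TV) TB) TS (fun G q => (q.1.2, q.2, P G q.1.1 q.2)) _ _ c_updS0; apply.
apply: c_pair; first exact: c_pair (c_snd (c_fst v1)) (c_snd v1).
exact: (c_ap2 (a2 := TV) (b := TB) h (c_fst (c_fst v1)) (c_snd v1)).
Qed.

Lemma c_ffun (P : forall G : sgraph, den c G -> G -> nat) :
  compu (TP c TV) TN (fun G q => P G q.1 q.2) -> compu c TF (fun G p => [ffun v => P G p v]).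
Proof.
move=> h; apply: (c_ext (a := c) (b := TF) (psi := fun (G : sgraph) p => foldl (fun (S : {ffun G -> nat}) v => [ffun u => if u == v then P G p v else S u]) [ffun=> 0] (enum G))).
  move=> G p; apply/ffunP => x; rewrite ffunE.
  have key s (S : {ffun G -> nat}) : (foldl (fun (S : {ffun G -> nat}) v => [ffun u => if u == v then P G p v else S u]) S s) x = if x \in s then P G p x else S x.
    elim: s S => //= v s IH S; rewrite IH ffunE in_cons; case: (eqVneq x v) => [->|] /=; by case: ifP.
  by rewrite key mem_enum.
apply: c_fold; first exact: c_F0; have v1 := c_id (TP (TP c TF) TV).
have := @c_comp (TP (TP c TF) TV) (TP (TP TF TV) TN) TF (fun G q => (q.1.2, q.2, P G q.1.1 q.2)) _ _ c_updF0; apply.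
apply: c_pair; first exact: c_pair (c_snd (c_fst v1)) (c_snd v1).
exact: (c_ap2 (a2 := TV) (b := TN) h (c_fst (c_fst v1)) (c_snd v1)).
Qed.

Lemma c_setR (P : forall G : sgraph, den c G -> G * G -> bool) :
  compu (TP c (TP TV TV)) TB (fun G q => P G q.1 q.2) -> compu c TR (fun G p => [set v : G * G | P G p v]).
Proof.
move=> h; apply: (c_ext (a := c) (b := TR) (psi := fun (G : sgraph) p => foldl (fun (S : {set G * G}) v => [set u | if u == v then P G p v else u \in S]) set0 (pairs G))).
  move=> G p; apply/setP => x; rewrite inE.
  have key s (S : {set G * G}) : x \in foldl (fun (S : {set G * G}) v => [set u | if u == v then P G p v else u \in S]) S s = if x \in s then P G p x else x \in S.
    elim: s S => //= v s IH S; rewrite IH inE in_cons; case: (eqVneq x v) => [->|] /=; by case: ifP.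
  by rewrite key mem_pairs.
apply: c_foldp; first exact: c_R0; have v1 := c_id (TP (TP c TR) (TP TV TV)).
have := @c_comp (TP (TP c TR) (TP TV TV)) (TP (TP TR (TP TV TV)) TB) TR (fun G q => (q.1.2, q.2, P G q.1.1 q.2)) _ _ c_updR0; apply.
apply: c_pair; first exact: c_pair (c_snd (c_fst v1)) (c_snd v1).
exact: (c_ap2 (a2 := TP TV TV) (b := TB) h (c_fst (c_fst v1)) (c_snd v1)).
Qed.

Lemma foldl_card (T : finType) (S : {set T}) s k : foldl (fun k v => k + (v \in S)) k s = k + count (mem S) s.
Proof. by elim: s k => [|x s IH] k /=; rewrite ?addn0 // IH addnA. Qed.

Lemma c_cardS (f : forall G : sgraph, den c G -> {set G}) :
  compu c TS f -> compu c TN (fun G p => #|f G p|).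
Proof.
move=> h; apply: (c_ext (a := c) (b := TN) (psi := fun G p => foldl (fun k v => k + (v \in f G p)) 0 (enum G))).
  by move=> G p; rewrite foldl_card add0n -size_filter -(card_uniqP (filter_uniq _ (enum_uniq _))); apply: eq_card => v; rewrite mem_filter mem_enum andbT.
apply: c_fold; first exact: c_constN; have v1 := c_id (TP (TP c TN) TV).
apply: c_add; [exact: c_snd (c_fst v1)|apply: c_nat; apply: c_mem; first exact: c_snd v1].
exact: (c_ap1 h (c_fst (c_fst v1))).
Qed.

Lemma c_cardR (f : forall G : sgraph, den c G -> {set G * G}) :
  compu c TR f -> compu c TN (fun G p => #|f G p|).
Proof.
move=> h; apply: (c_ext (a := c) (b := TN) (psi := fun G p => foldl (fun k v => k + (v \in f G p)) 0 (pairs G))).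
  move=> G p; rewrite foldl_card add0n -size_filter -(card_uniqP _).
    by apply: eq_card => v; rewrite mem_filter mem_pairs andbT.
  by apply: filter_uniq; apply: allpairs_uniq; rewrite ?enum_uniq // => -[a b] [a' b'].
apply: c_foldp; first exact: c_constN; have v1 := c_id (TP (TP c TN) (TP TV TV)).
apply: c_add; [exact: c_snd (c_fst v1)|apply: c_nat; apply: c_memR; first exact: c_snd v1].
exact: (c_ap1 h (c_fst (c_fst v1))).
Qed.

Lemma foldl_iter (G : sgraph) T (f : T -> T) x r :
  foldl (fun s (v : G) => if enum_rank v < r then f s else s) x (enum G) = iter (minn r #|G|) f x.
Proof.
apply: (foldl_enum (P := fun j st => st = iter (minn r j) f x)); first by rewrite minn0.
move=> v st ->; case: ltnP => h; last by rewrite !(minn_idPl _) // leqW.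
by rewrite (minn_idPr h).
Qed.

(** Iteration is a loop over vertices, hence the cap at #|G|; each use below justifies the cap
    separately. *)
Lemma c_iter t (f : forall G : sgraph, den c G -> den t G) (g : forall G : sgraph, den c G -> den t G -> den t G) (r : forall G : sgraph, den c G -> nat) : compu c t f -> compu c TN r -> compu (TP c t) t (fun G q => g G q.1 q.2) ->
  compu c t (fun G p => iter (minn (r G p) #|G|) (g G p) (f G p)).
Proof.
move=> hf hr hg; apply: c_ext; first by move=> G p; symmetry; exact: foldl_iter.
apply: (c_fold (g := fun G p s v => if enum_rank v < r G p then g G p s else s)) => //; have v1 := c_id (TP (TP c t) TV).
apply: c_if; [apply: c_leq; first by cgo|exact: (c_ap2 hg (c_fst (c_fst v1)) (c_snd (c_fst v1)))|exact: c_snd (c_fst v1)].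
exact: (c_ap1 hr (c_fst (c_fst v1))).
Qed.

Lemma c_iterG t (f : forall G : sgraph, den c G -> den t G) (g : forall G : sgraph, den c G -> den t G -> den t G) :
  compu c t f -> compu (TP c t) t (fun G q => g G q.1 q.2) ->
  compu c t (fun G p => iter #|G| (g G p) (f G p)).
Proof.
move=> hf hg; have := c_iter hf (c_card c) hg; by apply: c_ext => G p; rewrite minnn.
Qed.
End Quantifiers.

Lemma c_existsR c (P : forall G : sgraph, den c G -> G * G -> bool) : compu (TP c (TP TV TV)) TB (fun G q => P G q.1 q.2) -> compu c TB (fun G p => [exists v : G * G, P G p v]).
Proof.
move=> h; apply: (c_ext (a := c) (b := TB) (psi := fun G p => [exists u, [exists v, P G p (u, v)]])).
  move=> G p; apply/existsP/existsP => [[[u v] Pv]|[u /existsP[v Pv]]]; last by exists (u, v).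
  by exists u; apply/existsP; exists v.
apply: c_exists; apply: c_exists; have v1 := c_id (TP (TP c TV) TV).
exact: (c_ap2 (a2 := TP TV TV) (b := TB) h (c_fst (c_fst v1)) (c_pair (c_snd (c_fst v1)) (c_snd v1))).
Qed.

Ltac quant ::= lazymatch goal with
  | |- compu _ TS _ => apply: c_set
  | |- compu _ TR _ => apply: c_setR
  | |- compu _ TF _ => first [exact: c_F0 | apply: c_ffun]
  | |- compu _ TN _ => first [apply: c_cardS | apply: c_cardR]
  | |- compu _ TB _ => first [apply: c_exists | apply: c_existsR | apply: c_forall]
  end.
Lemma c_ap5 c a1 a2 a3 a4 a5 b (F : forall G, den a1 G -> den a2 G -> den a3 G -> den a4 G -> den a5 G -> den b G) x y z t u :
  compu (TP (TP (TP (TP a1 a2) a3) a4) a5) b (fun G q => F G q.1.1.1.1 q.1.1.1.2 q.1.1.2 q.1.2 q.2) ->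
  compu c a1 x -> compu c a2 y -> compu c a3 z -> compu c a4 t -> compu c a5 u ->
  compu c b (fun G p => F G (x G p) (y G p) (z G p) (t G p) (u G p)).
Proof. by move=> hF hx hy hz ht hu; exact: c_comp (c_pair (c_pair (c_pair (c_pair hx hy) hz) ht) hu) hF. Qed.

Notation MAT := (TP (TP TR TR) (TP TR TR)) (only parsing).
Notation FS := (TP (TP TS TR) (TP TR TR)) (only parsing).
Notation LL := (TP (TP TS TF) TN) (only parsing).

Lemma c_setU0 : compu (TP TS TS) TS
  (fun (G : sgraph) q => setU q.1 q.2).
Proof. apply: (c_ext (a := (TP TS TS)) (b := TS) (psi := fun (G : sgraph) q => [set v : G | (v \in q.1) || (v \in q.2)])); [by move=> G q; apply/setP => x; rewrite !inE | cgo]. Qed.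
Lemma c_setU c x0 x1 :
  compu c TS x0 -> compu c TS x1 -> compu c TS (fun G p => setU (x0 G p) (x1 G p)).
Proof. exact: (@c_ap2 c TS TS TS (fun G : sgraph => fun (y0 : {set G}) (y1 : {set G}) => setU y0 y1) _ _ c_setU0). Qed.

Lemma c_setI0 : compu (TP TS TS) TS
  (fun (G : sgraph) q => setI q.1 q.2).
Proof. apply: (c_ext (a := (TP TS TS)) (b := TS) (psi := fun (G : sgraph) q => [set v : G | (v \in q.1) && (v \in q.2)])); [by move=> G q; apply/setP => x; rewrite !inE | cgo]. Qed.
Lemma c_setI c x0 x1 :
  compu c TS x0 -> compu c TS x1 -> compu c TS (fun G p => setI (x0 G p) (x1 G p)).
Proof. exact: (@c_ap2 c TS TS TS (fun G : sgraph => fun (y0 : {set G}) (y1 : {set G}) => setI y0 y1) _ _ c_setI0). Qed.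

Lemma c_setD0 : compu (TP TS TS) TS
  (fun (G : sgraph) q => setD q.1 q.2).
Proof. apply: (c_ext (a := (TP TS TS)) (b := TS) (psi := fun (G : sgraph) q => [set v : G | ~~ (v \in q.2) && (v \in q.1)])); [by move=> G q; apply/setP => x; rewrite !inE | cgo]. Qed.
Lemma c_setD c x0 x1 :
  compu c TS x0 -> compu c TS x1 -> compu c TS (fun G p => setD (x0 G p) (x1 G p)).
Proof. exact: (@c_ap2 c TS TS TS (fun G : sgraph => fun (y0 : {set G}) (y1 : {set G}) => setD y0 y1) _ _ c_setD0). Qed.

Lemma c_setUR0 : compu (TP TR TR) TR
  (fun (G : sgraph) q => setU q.1 q.2).
Proof. apply: (c_ext (a := (TP TR TR)) (b := TR) (psi := fun (G : sgraph) q => [set v : G * G | (v \in q.1) || (v \in q.2)])); [by move=> G q; apply/setP => x; rewrite !inE | cgo]. Qed.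
Lemma c_setUR c x0 x1 :
  compu c TR x0 -> compu c TR x1 -> compu c TR (fun G p => setU (x0 G p) (x1 G p)).
Proof. exact: (@c_ap2 c TR TR TR (fun G : sgraph => fun (y0 : {set G * G}) (y1 : {set G * G}) => setU y0 y1) _ _ c_setUR0). Qed.

Lemma c_setDR0 : compu (TP TR TR) TR
  (fun (G : sgraph) q => setD q.1 q.2).
Proof. apply: (c_ext (a := (TP TR TR)) (b := TR) (psi := fun (G : sgraph) q => [set v : G * G | ~~ (v \in q.2) && (v \in q.1)])); [by move=> G q; apply/setP => x; rewrite !inE | cgo]. Qed.
Lemma c_setDR c x0 x1 :
  compu c TR x0 -> compu c TR x1 -> compu c TR (fun G p => setD (x0 G p) (x1 G p)).
Proof. exact: (@c_ap2 c TR TR TR (fun G : sgraph => fun (y0 : {set G * G}) (y1 : {set G * G}) => setD y0 y1) _ _ c_setDR0). Qed.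

Lemma c_set10 : compu TV TS
  (fun (G : sgraph) q => set1 q).
Proof. apply: (c_ext (a := TV) (b := TS) (psi := fun (G : sgraph) q => [set v : G | v == q])); [by move=> G q; apply/setP => x; rewrite !inE | cgo]. Qed.
Lemma c_set1 c x0 :
  compu c TV x0 -> compu c TS (fun G p => set1 (x0 G p)).
Proof. exact: (@c_ap1 c TV TS (fun G : sgraph => fun (y0 : G) => set1 y0) _  c_set10). Qed.

Lemma c_set1R0 : compu (TP TV TV) TR
  (fun (G : sgraph) q => set1 q).
Proof. apply: (c_ext (a := (TP TV TV)) (b := TR) (psi := fun (G : sgraph) q => [set v : G * G | (v.1 == q.1) && (v.2 == q.2)])); [by move=> G q; apply/setP => x; rewrite !inE; case: x q => a b [] | cgo]. Qed.
Lemma c_set1R c x0 :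
  compu c (TP TV TV) x0 -> compu c TR (fun G p => set1 (x0 G p)).
Proof. exact: (@c_ap1 c (TP TV TV) TR (fun (G : sgraph) (y : G * G) => set1 y) _  c_set1R0). Qed.

Lemma c_subset0 : compu (TP TS TS) TB
  (fun (G : sgraph) q => q.1 \subset q.2).
Proof. apply: (c_ext (a := (TP TS TS)) (b := TB) (psi := fun (G : sgraph) q => [forall v, (v \in q.1) ==> (v \in q.2)])); [by move=> G q; apply/subsetP/forallP => h v; have := h v; move/implyP | cgo]. Qed.
Lemma c_subset c x0 x1 :
  compu c TS x0 -> compu c TS x1 -> compu c TB (fun G p => (x0 G p) \subset (x1 G p)).
Proof. exact: (@c_ap2 c TS TS TB (fun (G : sgraph) (y z : {set G}) => y \subset z) _ _ c_subset0). Qed.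

Lemma c_eq00 : compu TS TB
  (fun (G : sgraph) q => q == set0).
Proof. apply: (c_ext (a := TS) (b := TB) (psi := fun (G : sgraph) q => ~~ [exists v, v \in q])); [by move=> G q; apply/eqP/existsPn => [-> v|h]; [rewrite inE | apply/setP => v; rewrite inE; apply/negbTE] | cgo]. Qed.
Lemma c_eq0 c x0 :
  compu c TS x0 -> compu c TB (fun G p => (x0 G p) == set0).
Proof. exact: (@c_ap1 c TS TB (fun (G : sgraph) (y : {set G}) => y == set0) _  c_eq00). Qed.

Lemma c_eq0R0 : compu TR TB
  (fun (G : sgraph) q => q == set0).
Proof. apply: (c_ext (a := TR) (b := TB) (psi := fun (G : sgraph) q => ~~ [exists v, v \in q])); [by move=> G q; apply/eqP/existsPn => [-> v|h]; [rewrite inE | apply/setP => v; rewrite inE; apply/negbTE] | cgo]. Qed.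
Lemma c_eq0R c x0 :
  compu c TR x0 -> compu c TB (fun G p => (x0 G p) == set0).
Proof. exact: (@c_ap1 c TR TB (fun (G : sgraph) (y : {set G * G}) => y == set0) _  c_eq0R0). Qed.

Lemma foldl_odd (T : finType) (S : {set T}) s b : foldl (fun b v => b (+) (v \in S)) b s = b (+) odd (count (mem S) s).
Proof. by elim: s b => [|x s IH] b /=; rewrite ?addbF // IH oddD -addbA oddb. Qed.

Lemma c_oddS0 : compu TS TB
  (fun (G : sgraph) q => odd #|q|).
Proof. apply: (c_ext (a := TS) (b := TB) (psi := fun (G : sgraph) q => foldl (fun b v => b (+) (v \in q)) false (enum G))); [by move=> G q; rewrite foldl_odd -size_filter -(card_uniqP (filter_uniq _ (enum_uniq _))); congr odd; apply: eq_card => v; rewrite mem_filter mem_enum andbT | apply: (c_fold (c := TS) (t := TB) (g := fun (G : sgraph) q b v => b (+) (v \in q))); cgo]. Qed.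
Lemma c_oddS c x0 :
  compu c TS x0 -> compu c TB (fun G p => odd #|(x0 G p)|).
Proof. exact: (@c_ap1 c TS TB (fun (G : sgraph) (y : {set G}) => odd #|y|) _  c_oddS0). Qed.

Lemma c_oddR0 : compu TR TB
  (fun (G : sgraph) q => odd #|q|).
Proof. apply: (c_ext (a := TR) (b := TB) (psi := fun (G : sgraph) q => foldl (fun b v => b (+) (v \in q)) false (pairs G))); [by move=> G q; rewrite foldl_odd -size_filter -(card_uniqP (filter_uniq _ (allpairs_uniq (enum_uniq G) (enum_uniq G) _))); [congr odd; apply: eq_card => v; rewrite mem_filter mem_pairs andbT | move=> [? ?] [? ?]] | apply: (c_foldp (c := TR) (t := TB) (g := fun (G : sgraph) q b v => b (+) (v \in q))); cgo]. Qed.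
Lemma c_oddR c x0 :
  compu c TR x0 -> compu c TB (fun G p => odd #|(x0 G p)|).
Proof. exact: (@c_ap1 c TR TB (fun (G : sgraph) (y : {set G * G}) => odd #|y|) _  c_oddR0). Qed.

Lemma c_setT c : compu c TS (fun G _ => [set: G]).
Proof. by apply: (c_ext (a := c) (b := TS) (psi := fun (G : sgraph) _ => [set v : G | true])); [move=> G q; apply/setP => x; rewrite !inE | cgo]. Qed.
Ltac u_base := lazymatch goal with
  | |- compu _ TS (fun _ _ => set0) => exact: c_set0
  | |- compu _ TR (fun _ _ => set0) => exact: c_R0
  | |- compu _ TS (fun _ _ => setTfor _) => exact: c_setT
  | |- compu _ TB (fun _ _ => eq_op _ set0) => first [apply: c_eq0 | apply: c_eq0R]
  | |- compu _ TB (fun _ _ => odd _) => first [apply: c_oddS | apply: c_oddR]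
  | |- compu _ TS (fun _ _ => setU _ _) => apply: c_setU
  | |- compu _ TS (fun _ _ => setI _ _) => apply: c_setI
  | |- compu _ TS (fun _ _ => setD _ _) => apply: c_setD
  | |- compu _ TS (fun _ _ => set1 _) => apply: c_set1
  | |- compu _ TR (fun _ _ => setU _ _) => apply: c_setUR
  | |- compu _ TR (fun _ _ => setD _ _) => apply: c_setDR
  | |- compu _ TR (fun _ _ => set1 _) => apply: c_set1R
  | |- compu _ TB (fun _ _ => subset _ _) => apply: c_subset
  end.
Ltac user ::= u_base.

(** * Computability of the algorithm *)

Lemma c_expand0 : compu (TP TS TS) TS
  (fun (G : sgraph) q => @expand G q.1 q.2).
Proof. rewrite /expand; cgo. Qed.
Lemma c_expand c x0 x1 :
  compu c TS x0 -> compu c TS x1 -> compu c TS (fun G p => @expand G (x0 G p) (x1 G p)).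
Proof. exact: (@c_ap2 c TS TS TS (fun G => @expand G) _ _ c_expand0). Qed.
Ltac u_expand := lazymatch goal with |- compu _ TS (fun G p => @expand _ _ _) =>
  apply: c_expand | _ => u_base end.
Ltac user ::= u_expand.

Lemma ball_minn (G : sgraph) (S : {set G}) r x : ball S r x = ball S (minn r #|G|) x.
Proof.
case: (leqP r #|G|) => h //; apply/eqP; rewrite eqEsubset [X in _ && X]ball_leq ?(ltnW h) // andbT.
apply/subsetP => y yb; have xS : x \in S by case/ballP: yb => p [].
rewrite -/(reach S x) reachP xS; apply: connect_sub (ball_conn yb) => u v /and3P[/(subsetP (ball_sub _ _ _)) uS /(subsetP (ball_sub _ _ _)) vS uv].
by apply: connect1; rewrite /= uS vS.
Qed.

Lemma c_ball0 : compu (TP (TP TS TN) TV) TS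
  (fun (G : sgraph) q => @ball G q.1.1 q.1.2 q.2).
Proof. apply: (c_ext (a := (TP (TP TS TN) TV)) (b := TS) (psi := fun (G : sgraph) q => iter (minn q.1.2 #|G|) (expand q.1.1) (set1 q.2 :&: q.1.1))); [by move=> G q; rewrite ball_minn ball.unlock | apply: c_iter; cgo]. Qed.
Lemma c_ball c x0 x1 x2 :
  compu c TS x0 -> compu c TN x1 -> compu c TV x2 -> compu c TS (fun G p => @ball G (x0 G p) (x1 G p) (x2 G p)).
Proof. exact: (@c_ap3 c TS TN TV TS (fun G => @ball G) _ _ _ c_ball0). Qed.
Ltac u_ball := lazymatch goal with |- compu _ TS (fun G p => ball.body _ _ _) =>
  apply: c_ball | _ => u_expand end.
Ltac user ::= u_ball.

Lemma c_reach0 : compu (TP TS TV) TS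
  (fun (G : sgraph) q => @reach G q.1 q.2).
Proof. rewrite /reach; cgo. Qed.
Lemma c_reach c x0 x1 :
  compu c TS x0 -> compu c TV x1 -> compu c TS (fun G p => @reach G (x0 G p) (x1 G p)).
Proof. exact: (@c_ap2 c TS TV TS (fun G => @reach G) _ _ c_reach0). Qed.
Ltac u_reach := lazymatch goal with |- compu _ TS (fun G p => @reach _ _ _) =>
  apply: c_reach | _ => u_ball end.
Ltac user ::= u_reach.

Lemma c_nb0 : compu TV TS
  (fun (G : sgraph) q => @nb G q).
Proof. rewrite /nb; cgo. Qed.
Lemma c_nb c x0 :
  compu c TV x0 -> compu c TS (fun G p => @nb G (x0 G p)).
Proof. exact: (@c_ap1 c TV TS (fun G => @nb G) _  c_nb0). Qed.
Ltac u_nb := lazymatch goal with |- compu _ TS (fun G p => @nb _ _) =>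
  apply: c_nb | _ => u_reach end.
Ltac user ::= u_nb.

Lemma c_short_hole0 : compu (TP TN TS) TB
  (fun (G : sgraph) q => @short_hole G q.1 q.2).
Proof. rewrite /short_hole /inner_part; cgo. Qed.
Lemma c_short_hole c x0 x1 :
  compu c TN x0 -> compu c TS x1 -> compu c TB (fun G p => @short_hole G (x0 G p) (x1 G p)).
Proof. exact: (@c_ap2 c TN TS TB (fun G => @short_hole G) _ _ c_short_hole0). Qed.
Ltac u_short_hole := lazymatch goal with |- compu _ TB (fun G p => @short_hole _ _ _) =>
  apply: c_short_hole | _ => u_nb end.
Ltac user ::= u_short_hole.

Lemma c_holedb0 : compu TS TB
  (fun (G : sgraph) q => @holedb G q).
Proof. rewrite /holedb; cgo. Qed.
Lemma c_holedb c x0 :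
  compu c TS x0 -> compu c TB (fun G p => @holedb G (x0 G p)).
Proof. exact: (@c_ap1 c TS TB (fun G => @holedb G) _  c_holedb0). Qed.
Ltac u_holedb := lazymatch goal with |- compu _ TB (fun G p => @holedb _ _) =>
  apply: c_holedb | _ => u_short_hole end.
Ltac user ::= u_holedb.

Lemma c_first_true c (P : forall G : sgraph, den c G -> nat -> bool) :
  compu (TP c TV) TB (fun (G : sgraph) q => P G q.1 (enum_rank q.2)) -> compu c TN (fun G p => first_true G (P G p)).
Proof. by move=> h; rewrite /first_true; apply: c_cardS; apply: c_set; apply: c_negb. Qed.

Lemma c_gmin c (P : forall G : sgraph, den c G -> {set G} -> bool) (U : forall G : sgraph, den c G -> {set G}) :
  compu (TP c TS) TB (fun (G : sgraph) q => P G q.1 q.2) -> compu c TS U -> compu c TS (fun G p => gmin (P G p) (U G p)).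
Proof.
move=> hP hU; rewrite /gmin; apply: (c_fold (c := c) (t := TS) (g := fun (G : sgraph) p V x => if P G p (V :\ x) then V :\ x else V) hU).
have hD : compu (TP (TP c TS) TV) TS (fun (G : sgraph) q => q.1.2 :\ q.2) by cgo.
apply: c_if => //; last by cgo.
by apply: (@c_ap2 (TP (TP c TS) TV) c TS TB P (fun G q => q.1.1) (fun G q => q.1.2 :\ q.2) hP) => //; cgo.
Qed.

Lemma c_minhole0 : compu TS TS
  (fun (G : sgraph) q => @minhole G q).
Proof. rewrite /minhole; apply: (@c_gmin TS (fun (G : sgraph) q => short_hole (first_true G (fun t => short_hole t q)))); [|by cgo]; apply: c_short_hole; [|by cgo]; apply: (@c_first_true (TP TS TS) (fun (G : sgraph) q t => short_hole t q.1)); cgo. Qed.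
Lemma c_minhole c x0 :
  compu c TS x0 -> compu c TS (fun G p => @minhole G (x0 G p)).
Proof. exact: (@c_ap1 c TS TS (fun G => @minhole G) _  c_minhole0). Qed.
Ltac u_minhole := lazymatch goal with |- compu _ TS (fun G p => @minhole _ _) =>
  apply: c_minhole | _ => u_holedb end.
Ltac user ::= u_minhole.

Lemma c_spread0 : compu (TP TS TS) TS
  (fun (G : sgraph) q => @spread G q.1 q.2).
Proof. rewrite /spread; cgo. Qed.
Lemma c_spread c x0 x1 :
  compu c TS x0 -> compu c TS x1 -> compu c TS (fun G p => @spread G (x0 G p) (x1 G p)).
Proof. exact: (@c_ap2 c TS TS TS (fun G => @spread G) _ _ c_spread0). Qed.
Ltac u_spread := lazymatch goal with |- compu _ TS (fun G p => @spread _ _ _) =>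
  apply: c_spread | _ => u_minhole end.
Ltac user ::= u_spread.

Lemma c_Iset0 : compu (TP (TP TS TS) TV) TS
  (fun (G : sgraph) q => @Iset G q.1.1 q.1.2 q.2).
Proof. rewrite /Iset; cgo. Qed.
Lemma c_Iset c x0 x1 x2 :
  compu c TS x0 -> compu c TS x1 -> compu c TV x2 -> compu c TS (fun G p => @Iset G (x0 G p) (x1 G p) (x2 G p)).
Proof. exact: (@c_ap3 c TS TS TV TS (fun G => @Iset G) _ _ _ c_Iset0). Qed.
Ltac u_Iset := lazymatch goal with |- compu _ TS (fun G p => @Iset _ _ _ _) =>
  apply: c_Iset | _ => u_spread end.
Ltac user ::= u_Iset.

Lemma c_addf0 : compu (TP (TP TF TN) TS) TF
  (fun (G : sgraph) q => @addf G q.1.1 q.1.2 q.2).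
Proof. rewrite /addf; cgo. Qed.
Lemma c_addf c x0 x1 x2 :
  compu c TF x0 -> compu c TN x1 -> compu c TS x2 -> compu c TF (fun G p => @addf G (x0 G p) (x1 G p) (x2 G p)).
Proof. exact: (@c_ap3 c TF TN TS TF (fun G => @addf G) _ _ _ c_addf0). Qed.
Ltac u_addf := lazymatch goal with |- compu _ TF (fun G p => @addf _ _ _ _) =>
  apply: c_addf | _ => u_Iset end.
Ltac user ::= u_addf.

Lemma c_cls0 : compu (TP TF TN) TS
  (fun (G : sgraph) q => @cls G q.1 q.2).
Proof. rewrite /cls; cgo. Qed.
Lemma c_cls c x0 x1 :
  compu c TF x0 -> compu c TN x1 -> compu c TS (fun G p => @cls G (x0 G p) (x1 G p)).
Proof. exact: (@c_ap2 c TF TN TS (fun G => @cls G) _ _ c_cls0). Qed.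
Ltac u_cls := lazymatch goal with |- compu _ TS (fun G p => @cls _ _ _) =>
  apply: c_cls | _ => u_addf end.
Ltac user ::= u_cls.

Lemma c_local_loop0 : compu (TP (TP (TP TS TS) TS) TS) LL
  (fun (G : sgraph) q => @local_loop G q.1.1.1 q.1.1.2 q.1.2 q.2).
Proof. rewrite /local_loop /local_step /local_set; apply: c_fold; cgo. Qed.
Lemma c_local_loop c x0 x1 x2 x3 :
  compu c TS x0 -> compu c TS x1 -> compu c TS x2 -> compu c TS x3 -> compu c LL (fun G p => @local_loop G (x0 G p) (x1 G p) (x2 G p) (x3 G p)).
Proof. exact: (@c_ap4 c TS TS TS TS LL (fun G => @local_loop G) _ _ _ _ c_local_loop0). Qed.
Ltac u_local_loop := lazymatch goal with |- compu _ LL (fun G p => @local_loop _ _ _ _ _) =>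
  apply: c_local_loop | _ => u_cls end.
Ltac user ::= u_local_loop.

Lemma c_least0 : compu TS TS
  (fun (G : sgraph) q => @least G q).
Proof. rewrite /least; cgo. Qed.
Lemma c_least c x0 :
  compu c TS x0 -> compu c TS (fun G p => @least G (x0 G p)).
Proof. exact: (@c_ap1 c TS TS (fun G => @least G) _  c_least0). Qed.
Ltac u_least := lazymatch goal with |- compu _ TS (fun G p => @least _ _) =>
  apply: c_least | _ => u_local_loop end.
Ltac user ::= u_least.

Lemma c_blk0 : compu (TP (TP MAT TB) TB) TR
  (fun (G : sgraph) q => @blk G q.1.1 q.1.2 q.2).
Proof. rewrite /blk; cgo. Qed.
Lemma c_blk c x0 x1 x2 :
  compu c MAT x0 -> compu c TB x1 -> compu c TB x2 -> compu c TR (fun G p => @blk G (x0 G p) (x1 G p) (x2 G p)).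
Proof. exact: (@c_ap3 c MAT TB TB TR (fun G => @blk G) _ _ _ c_blk0). Qed.
Ltac u_blk := lazymatch goal with |- compu _ TR (fun G p => @blk _ _ _ _) =>
  apply: c_blk | _ => u_least end.
Ltac user ::= u_blk.

Lemma c_col_image0 : compu (TP (TP (TP (TP TR TR) MAT) (TP TV TV)) TB) TS
  (fun (G : sgraph) q => @col_image G q.1.1.1.1 q.1.1.1.2 q.1.1.2 q.1.2 q.2).
Proof. rewrite /col_image /phi /lab; cgo. Qed.
Lemma c_col_image c x0 x1 x2 x3 x4 :
  compu c TR x0 -> compu c TR x1 -> compu c MAT x2 -> compu c (TP TV TV) x3 -> compu c TB x4 -> compu c TS (fun G p => @col_image G (x0 G p) (x1 G p) (x2 G p) (x3 G p) (x4 G p)).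
Proof. exact: (@c_ap5 c TR TR MAT (TP TV TV) TB TS (fun G => @col_image G) _ _ _ _ _ c_col_image0). Qed.
Ltac u_col_image := lazymatch goal with |- compu _ TS (fun G p => @col_image _ _ _ _ _ _) =>
  apply: c_col_image | _ => u_blk end.
Ltac user ::= u_col_image.

Lemma c_prow0 : compu (TP (TP (TP (TP MAT TS) TS) TB) TV) TB
  (fun (G : sgraph) q => @prow G q.1.1.1.1 q.1.1.1.2 q.1.1.2 q.1.2 q.2).
Proof. rewrite /prow; cgo. Qed.
Lemma c_prow c x0 x1 x2 x3 x4 :
  compu c MAT x0 -> compu c TS x1 -> compu c TS x2 -> compu c TB x3 -> compu c TV x4 -> compu c TB (fun G p => @prow G (x0 G p) (x1 G p) (x2 G p) (x3 G p) (x4 G p)).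
Proof. exact: (@c_ap5 c MAT TS TS TB TV TB (fun G => @prow G) _ _ _ _ _ c_prow0). Qed.
Ltac u_prow := lazymatch goal with |- compu _ TB (fun G p => @prow _ _ _ _ _ _) =>
  apply: c_prow | _ => u_col_image end.
Ltac user ::= u_prow.

Lemma c_upd0 : compu (TP (TP (TP (TP MAT TS) TS) TB) TB) TR
  (fun (G : sgraph) q => @upd G q.1.1.1.1 q.1.1.1.2 q.1.1.2 q.1.2 q.2).
Proof. rewrite /upd; cgo. Qed.
Lemma c_upd c x0 x1 x2 x3 x4 :
  compu c MAT x0 -> compu c TS x1 -> compu c TS x2 -> compu c TB x3 -> compu c TB x4 -> compu c TR (fun G p => @upd G (x0 G p) (x1 G p) (x2 G p) (x3 G p) (x4 G p)).
Proof. exact: (@c_ap5 c MAT TS TS TB TB TR (fun G => @upd G) _ _ _ _ _ c_upd0). Qed.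
Ltac u_upd := lazymatch goal with |- compu _ TR (fun G p => @upd _ _ _ _ _ _) =>
  apply: c_upd | _ => u_prow end.
Ltac user ::= u_upd.

Lemma c_foldv c t (f : forall G : sgraph, den c G -> den t G) (g : forall G : sgraph, den c G -> den t G -> G * G -> den t G) :
  compu c t f -> compu (TP (TP c t) (TP TV TV)) t (fun (G : sgraph) q => g G q.1.1 q.1.2 q.2) ->
  compu c t (fun G p => foldl (g G p) (f G p) (vpairs G)).
Proof. exact: c_foldp. Qed.

Lemma c_foldt c t (f : forall G : sgraph, den c G -> den t G) (g : forall G : sgraph, den c G -> den t G -> G * G * G -> den t G) :
  compu c t f -> compu (TP (TP c t) (TP (TP TV TV) TV)) t (fun (G : sgraph) q => g G q.1.1 q.1.2 q.2) ->
  compu c t (fun G p => foldl (g G p) (f G p) (triples G)).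
Proof.
move=> hf hg; apply: (c_ext (a := c) (b := t) (psi := fun G p => foldl (fun y e => foldl (fun z v => g G p z (e, v)) y (enum G)) (f G p) (vpairs G))).
  move=> G p; have gen (s : seq (G * G)) (s' : seq G) y : foldl (g G p) y [seq (e, v) | e <- s, v <- s'] =
      foldl (fun y e => foldl (fun z v => g G p z (e, v)) y s') y s.
    by elim: s y => //= e s IH y; rewrite foldl_cat IH; congr foldl; elim: (s') y => //= v t' IH' y.
  exact: gen.
apply: (c_foldv (g := fun G p y e => foldl (fun z v => g G p z (e, v)) y (enum G)) hf).
apply: (@c_fold (TP (TP c t) (TP TV TV)) t (fun G q => q.1.2) (fun G q z v => g G q.1.1 z (q.2, v))); first exact: c_snd (c_fst (c_id _)).
have v1 := c_id (TP (TP (TP (TP c t) (TP TV TV)) t) TV).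
have := @c_ap3 (TP (TP (TP (TP c t) (TP TV TV)) t) TV) c t (TP (TP TV TV) TV) t g (fun G q => q.1.1.1.1) (fun G q => q.1.2) (fun G q => (q.1.1.2, q.2)) hg; apply.
- exact: c_fst (c_fst (c_fst (c_fst v1))).
- exact: c_snd (c_fst v1).
- exact: c_pair (c_snd (c_fst (c_fst v1))) (c_snd v1).
Qed.

Lemma c_diag c : compu c TR (fun G _ => diag G).
Proof. by rewrite /diag; cgo. Qed.
Ltac u_diag := lazymatch goal with |- compu _ TR (fun G p => diag _) => exact: c_diag | _ => u_upd end.
Ltac user ::= u_diag.
Lemma c_basis0 : compu (TP (TP TR TR) TR) TR
  (fun (G : sgraph) q => @basis G q.1.1 q.1.2 q.2).
Proof. rewrite /basis /bstep; apply: (c_fst (b := MAT)); apply: c_foldv; cgo. Qed.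
Lemma c_basis c x0 x1 x2 :
  compu c TR x0 -> compu c TR x1 -> compu c TR x2 -> compu c TR (fun G p => @basis G (x0 G p) (x1 G p) (x2 G p)).
Proof. exact: (@c_ap3 c TR TR TR TR (fun G => @basis G) _ _ _ c_basis0). Qed.
Ltac u_basis := lazymatch goal with |- compu _ TR (fun G p => @basis _ _ _ _) =>
  apply: c_basis | _ => u_diag end.
Ltac user ::= u_basis.

Lemma c_oedges c : compu c TR (fun G _ => oedges G).
Proof. by rewrite /oedges; cgo. Qed.
Ltac u_oedges := lazymatch goal with |- compu _ TR (fun G p => oedges _) => exact: c_oedges | _ => u_basis end.
Ltac user ::= u_oedges.
Lemma c_deg0 : compu (TP TR TV) TN
  (fun (G : sgraph) q => @deg G q.1 q.2).
Proof. rewrite /deg /inc; cgo. Qed.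
Lemma c_deg c x0 x1 :
  compu c TR x0 -> compu c TV x1 -> compu c TN (fun G p => @deg G (x0 G p) (x1 G p)).
Proof. exact: (@c_ap2 c TR TV TN (fun G => @deg G) _ _ c_deg0). Qed.
Ltac u_deg := lazymatch goal with |- compu _ TN (fun G p => @deg _ _ _) =>
  apply: c_deg | _ => u_oedges end.
Ltac user ::= u_deg.

Lemma c_restr0 : compu (TP TR TS) TR
  (fun (G : sgraph) q => @restr G q.1 q.2).
Proof. rewrite /restr; cgo. Qed.
Lemma c_restr c x0 x1 :
  compu c TR x0 -> compu c TS x1 -> compu c TR (fun G p => @restr G (x0 G p) (x1 G p)).
Proof. exact: (@c_ap2 c TR TS TR (fun G => @restr G) _ _ c_restr0). Qed.
Ltac u_restr := lazymatch goal with |- compu _ TR (fun G p => @restr _ _ _) =>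
  apply: c_restr | _ => u_deg end.
Ltac user ::= u_restr.

Lemma c_prune0 : compu TR TR
  (fun (G : sgraph) q => @prune G q).
Proof. rewrite /prune; cgo. Qed.
Lemma c_prune c x0 :
  compu c TR x0 -> compu c TR (fun G p => @prune G (x0 G p)).
Proof. exact: (@c_ap1 c TR TR (fun G => @prune G) _  c_prune0). Qed.
Ltac u_prune := lazymatch goal with |- compu _ TR (fun G p => @prune _ _) =>
  apply: c_prune | _ => u_restr end.
Ltac user ::= u_prune.

Lemma c_core0 : compu TR TR
  (fun (G : sgraph) q => @core G q).
Proof. rewrite /core; apply: c_iterG; cgo. Qed.
Lemma c_core c x0 :
  compu c TR x0 -> compu c TR (fun G p => @core G (x0 G p)).
Proof. exact: (@c_ap1 c TR TR (fun G => @core G) _  c_core0). Qed.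
Ltac u_core := lazymatch goal with |- compu _ TR (fun G p => @core _ _) =>
  apply: c_core | _ => u_prune end.
Ltac user ::= u_core.

Lemma c_branch0 : compu TR TS
  (fun (G : sgraph) q => @branch G q).
Proof. rewrite /branch; cgo. Qed.
Lemma c_branch c x0 :
  compu c TR x0 -> compu c TS (fun G p => @branch G (x0 G p)).
Proof. exact: (@c_ap1 c TR TS (fun G => @branch G) _  c_branch0). Qed.
Ltac u_branch := lazymatch goal with |- compu _ TS (fun G p => @branch _ _) =>
  apply: c_branch | _ => u_core end.
Ltac user ::= u_branch.

Lemma c_nbhd0 : compu (TP TR TS) TS
  (fun (G : sgraph) q => @nbhd G q.1 q.2).
Proof. rewrite /nbhd /adj; cgo. Qed.
Lemma c_nbhd c x0 x1 :
  compu c TR x0 -> compu c TS x1 -> compu c TS (fun G p => @nbhd G (x0 G p) (x1 G p)).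
Proof. exact: (@c_ap2 c TR TS TS (fun G => @nbhd G) _ _ c_nbhd0). Qed.
Ltac u_nbhd := lazymatch goal with |- compu _ TS (fun G p => @nbhd _ _ _) =>
  apply: c_nbhd | _ => u_branch end.
Ltac user ::= u_nbhd.

Lemma c_spr0 : compu (TP TR TS) TS
  (fun (G : sgraph) q => @spr G q.1 q.2).
Proof. rewrite /spr; cgo. Qed.
Lemma c_spr c x0 x1 :
  compu c TR x0 -> compu c TS x1 -> compu c TS (fun G p => @spr G (x0 G p) (x1 G p)).
Proof. exact: (@c_ap2 c TR TS TS (fun G => @spr G) _ _ c_spr0). Qed.
Ltac u_spr := lazymatch goal with |- compu _ TS (fun G p => @spr _ _ _) =>
  apply: c_spr | _ => u_nbhd end.
Ltac user ::= u_spr.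

Lemma c_smooth0 : compu (TP (TP TR TS) TS) TS
  (fun (G : sgraph) q => @smooth G q.1.1 q.1.2 q.2).
Proof. rewrite /smooth; apply: c_iterG; cgo. Qed.
Lemma c_smooth c x0 x1 x2 :
  compu c TR x0 -> compu c TS x1 -> compu c TS x2 -> compu c TS (fun G p => @smooth G (x0 G p) (x1 G p) (x2 G p)).
Proof. exact: (@c_ap3 c TR TS TS TS (fun G => @smooth G) _ _ _ c_smooth0). Qed.
Ltac u_smooth := lazymatch goal with |- compu _ TS (fun G p => @smooth _ _ _ _) =>
  apply: c_smooth | _ => u_spr end.
Ltac user ::= u_smooth.

Lemma levE (G : sgraph) (F : {set G * G}) (Br : {set G}) t u :
  lev F Br t u = iter t (fun L => smooth F Br (spr F L)) (smooth F Br [set u]).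
Proof. by elim: t => //= t ->. Qed.
(** The capped version is the computable one; [shortest_cycle] only uses thresholds up to #|G|,
    where both agree. *)
Definition blev (G : sgraph) (F : {set G * G}) (Br : {set G}) t u := lev F Br (minn t #|G|) u.

Lemma c_blev0 : compu (TP (TP (TP TR TS) TN) TV) TS
  (fun (G : sgraph) q => @blev G q.1.1.1 q.1.1.2 q.1.2 q.2).
Proof. rewrite /blev; apply: (c_ext (a := (TP (TP (TP TR TS) TN) TV)) (b := TS) (psi := fun (G : sgraph) q => iter (minn q.1.2 #|G|) (fun L => smooth q.1.1.1 q.1.1.2 (spr q.1.1.1 L)) (smooth q.1.1.1 q.1.1.2 [set q.2]))); [by move=> G q; rewrite levE | apply: c_iter; cgo]. Qed.
Lemma c_blev c x0 x1 x2 x3 :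
  compu c TR x0 -> compu c TS x1 -> compu c TN x2 -> compu c TV x3 -> compu c TS (fun G p => @blev G (x0 G p) (x1 G p) (x2 G p) (x3 G p)).
Proof. exact: (@c_ap4 c TR TS TN TV TS (fun G => @blev G) _ _ _ _ c_blev0). Qed.
Ltac u_blev := lazymatch goal with |- compu _ TS (fun G p => @blev _ _ _ _ _) =>
  apply: c_blev | _ => u_smooth end.
Ltac user ::= u_blev.

Definition bcyc (G : sgraph) (F : {set G * G}) (Br : {set G}) t (U : {set G}) :=
  [exists e in restr F U, e.2 \in blev (restr F U :\ e) Br t e.1].
Lemma bcycE (G : sgraph) (F : {set G * G}) (Br : {set G}) t (U : {set G}) : t <= #|G| -> cyc F Br t U = bcyc F Br t U.
Proof. by move=> h; rewrite /bcyc /blev (minn_idPl h). Qed.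

Lemma c_bcyc0 : compu (TP (TP (TP TR TS) TN) TS) TB
  (fun (G : sgraph) q => @bcyc G q.1.1.1 q.1.1.2 q.1.2 q.2).
Proof. rewrite /bcyc; cgo. Qed.
Lemma c_bcyc c x0 x1 x2 x3 :
  compu c TR x0 -> compu c TS x1 -> compu c TN x2 -> compu c TS x3 -> compu c TB (fun G p => @bcyc G (x0 G p) (x1 G p) (x2 G p) (x3 G p)).
Proof. exact: (@c_ap4 c TR TS TN TS TB (fun G => @bcyc G) _ _ _ _ c_bcyc0). Qed.
Ltac u_bcyc := lazymatch goal with |- compu _ TB (fun G p => @bcyc _ _ _ _ _) =>
  apply: c_bcyc | _ => u_blev end.
Ltac user ::= u_bcyc.

Lemma shortest_cycleE (G : sgraph) (F : {set G * G}) (W : {set G}) :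
  shortest_cycle F W = gmin (bcyc F (branch F) (first_true G (fun t => bcyc F (branch F) t W))) W.
Proof.
have E : first_true G (fun t => cyc F (branch F) t W) = first_true G (fun t => bcyc F (branch F) t W).
  by apply: eq_card => v; rewrite !inE bcycE // ltnW.
rewrite /shortest_cycle E; have : first_true G (fun t => bcyc F (branch F) t W) <= #|G| by exact: max_card.
move: (first_true _ _) => t tG; rewrite /gmin; elim: (enum _) W {E} => //= x s IH V.
by rewrite IH bcycE.
Qed.

Lemma c_shortest_cycle0 : compu (TP TR TS) TS
  (fun (G : sgraph) q => @shortest_cycle G q.1 q.2).
Proof. apply: c_ext; [by move=> G q; exact: shortest_cycleE|]; apply: (@c_gmin (TP TR TS) (fun (G : sgraph) q => bcyc q.1 (branch q.1) (first_true G (fun t => bcyc q.1 (branch q.1) t q.2)))); [|by cgo]; apply: c_bcyc; [by cgo|by cgo| |by cgo]; apply: (@c_first_true (TP (TP TR TS) TS) (fun (G : sgraph) q t => bcyc q.1.1 (branch q.1.1) t q.1.2)); cgo. Qed.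
Lemma c_shortest_cycle c x0 x1 :
  compu c TR x0 -> compu c TS x1 -> compu c TS (fun G p => @shortest_cycle G (x0 G p) (x1 G p)).
Proof. exact: (@c_ap2 c TR TS TS (fun G => @shortest_cycle G) _ _ c_shortest_cycle0). Qed.
Ltac u_shortest_cycle := lazymatch goal with |- compu _ TS (fun G p => @shortest_cycle _ _ _) =>
  apply: c_shortest_cycle | _ => u_bcyc end.
Ltac user ::= u_shortest_cycle.

Lemma c_pack0 : compu (TP TR TN) LL
  (fun (G : sgraph) q => @pack G q.1 q.2).
Proof. rewrite /pack /pack_step; apply: c_fold; cgo. Qed.
Lemma c_pack c x0 x1 :
  compu c TR x0 -> compu c TN x1 -> compu c LL (fun G p => @pack G (x0 G p) (x1 G p)).
Proof. exact: (@c_ap2 c TR TN LL (fun G => @pack G) _ _ c_pack0). Qed.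
Ltac u_pack := lazymatch goal with |- compu _ LL (fun G p => @pack _ _ _) =>
  apply: c_pack | _ => u_shortest_cycle end.
Ltac user ::= u_pack.

Lemma c_comp_of0 : compu (TP (TP (TP TS TS) TV) TV) TS
  (fun (G : sgraph) q => @comp_of G q.1.1.1 q.1.1.2 q.1.2 q.2).
Proof. rewrite /comp_of; cgo. Qed.
Lemma c_comp_of c x0 x1 x2 x3 :
  compu c TS x0 -> compu c TS x1 -> compu c TV x2 -> compu c TV x3 -> compu c TS (fun G p => @comp_of G (x0 G p) (x1 G p) (x2 G p) (x3 G p)).
Proof. exact: (@c_ap4 c TS TS TV TV TS (fun G => @comp_of G) _ _ _ _ c_comp_of0). Qed.
Ltac u_comp_of := lazymatch goal with |- compu _ TS (fun G p => @comp_of _ _ _ _ _) =>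
  apply: c_comp_of | _ => u_pack end.
Ltac user ::= u_comp_of.

Lemma c_odd_pair0 : compu (TP (TP (TP (TP TS TS) TS) TV) TV) TB
  (fun (G : sgraph) q => @odd_pair G q.1.1.1.1 q.1.1.1.2 q.1.1.2 q.1.2 q.2).
Proof. rewrite /odd_pair /lam; cgo. Qed.
Lemma c_odd_pair c x0 x1 x2 x3 x4 :
  compu c TS x0 -> compu c TS x1 -> compu c TS x2 -> compu c TV x3 -> compu c TV x4 -> compu c TB (fun G p => @odd_pair G (x0 G p) (x1 G p) (x2 G p) (x3 G p) (x4 G p)).
Proof. exact: (@c_ap5 c TS TS TS TV TV TB (fun G => @odd_pair G) _ _ _ _ _ c_odd_pair0). Qed.
Ltac u_odd_pair := lazymatch goal with |- compu _ TB (fun G p => @odd_pair _ _ _ _ _ _) =>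
  apply: c_odd_pair | _ => u_comp_of end.
Ltac user ::= u_odd_pair.

Lemma c_first_c0 : compu (TP (TP TS TS) TS) TS
  (fun (G : sgraph) q => @first_c G q.1.1 q.1.2 q.2).
Proof. rewrite /first_c; cgo. Qed.
Lemma c_first_c c x0 x1 x2 :
  compu c TS x0 -> compu c TS x1 -> compu c TS x2 -> compu c TS (fun G p => @first_c G (x0 G p) (x1 G p) (x2 G p)).
Proof. exact: (@c_ap3 c TS TS TS TS (fun G => @first_c G) _ _ _ c_first_c0). Qed.
Ltac u_first_c := lazymatch goal with |- compu _ TS (fun G p => @first_c _ _ _ _) =>
  apply: c_first_c | _ => u_odd_pair end.
Ltac user ::= u_first_c.

Lemma c_first_x0 : compu (TP (TP TS TS) TS) TS
  (fun (G : sgraph) q => @first_x G q.1.1 q.1.2 q.2).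
Proof. rewrite /first_x; cgo. Qed.
Lemma c_first_x c x0 x1 x2 :
  compu c TS x0 -> compu c TS x1 -> compu c TS x2 -> compu c TS (fun G p => @first_x G (x0 G p) (x1 G p) (x2 G p)).
Proof. exact: (@c_ap3 c TS TS TS TS (fun G => @first_x G) _ _ _ c_first_x0). Qed.
Ltac u_first_x := lazymatch goal with |- compu _ TS (fun G p => @first_x _ _ _ _) =>
  apply: c_first_x | _ => u_first_c end.
Ltac user ::= u_first_x.

Lemma c_new_I0 : compu (TP (TP TS TS) TS) TS
  (fun (G : sgraph) q => @new_I G q.1.1 q.1.2 q.2).
Proof. rewrite /new_I; cgo. Qed.
Lemma c_new_I c x0 x1 x2 :
  compu c TS x0 -> compu c TS x1 -> compu c TS x2 -> compu c TS (fun G p => @new_I G (x0 G p) (x1 G p) (x2 G p)).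
Proof. exact: (@c_ap3 c TS TS TS TS (fun G => @new_I G) _ _ _ c_new_I0). Qed.
Ltac u_new_I := lazymatch goal with |- compu _ TS (fun G p => @new_I _ _ _ _) =>
  apply: c_new_I | _ => u_first_x end.
Ltac user ::= u_new_I.

Lemma c_new_R0 : compu (TP (TP TS TS) TS) TS
  (fun (G : sgraph) q => @new_R G q.1.1 q.1.2 q.2).
Proof. rewrite /new_R; cgo. Qed.
Lemma c_new_R c x0 x1 x2 :
  compu c TS x0 -> compu c TS x1 -> compu c TS x2 -> compu c TS (fun G p => @new_R G (x0 G p) (x1 G p) (x2 G p)).
Proof. exact: (@c_ap3 c TS TS TS TS (fun G => @new_R G) _ _ _ c_new_R0). Qed.
Ltac u_new_R := lazymatch goal with |- compu _ TS (fun G p => @new_R _ _ _ _) =>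
  apply: c_new_R | _ => u_new_I end.
Ltac user ::= u_new_R.

Lemma c_frame_hit0 : compu FS TS
  (fun (G : sgraph) q => @frame_hit G q).
Proof. rewrite /frame_hit; cgo. Qed.
Lemma c_frame_hit c x0 :
  compu c FS x0 -> compu c TS (fun G p => @frame_hit G (x0 G p)).
Proof. exact: (@c_ap1 c FS TS (fun G => @frame_hit G) _  c_frame_hit0). Qed.
Ltac u_frame_hit := lazymatch goal with |- compu _ TS (fun G p => @frame_hit _ _) =>
  apply: c_frame_hit | _ => u_new_R end.
Ltac user ::= u_frame_hit.

Lemma c_addrow0 : compu (TP (TP TR TV) TS) TR
  (fun (G : sgraph) q => @addrow G q.1.1 q.1.2 q.2).
Proof. rewrite /addrow; cgo. Qed.
Lemma c_addrow c x0 x1 x2 :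
  compu c TR x0 -> compu c TV x1 -> compu c TS x2 -> compu c TR (fun G p => @addrow G (x0 G p) (x1 G p) (x2 G p)).
Proof. exact: (@c_ap3 c TR TV TS TR (fun G => @addrow G) _ _ _ c_addrow0). Qed.
Ltac u_addrow := lazymatch goal with |- compu _ TR (fun G p => @addrow _ _ _ _) =>
  apply: c_addrow | _ => u_frame_hit end.
Ltac user ::= u_addrow.

Lemma c_frame_loop0 : compu (TP TS TS) FS
  (fun (G : sgraph) q => @frame_loop G q.1 q.2).
Proof. rewrite /frame_loop /frame_next; apply: c_fold; cgo. Qed.
Lemma c_frame_loop c x0 x1 :
  compu c TS x0 -> compu c TS x1 -> compu c FS (fun G p => @frame_loop G (x0 G p) (x1 G p)).
Proof. exact: (@c_ap2 c TS TS FS (fun G => @frame_loop G) _ _ c_frame_loop0). Qed.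
Ltac u_frame_loop := lazymatch goal with |- compu _ FS (fun G p => @frame_loop _ _ _) =>
  apply: c_frame_loop | _ => u_addrow end.
Ltac user ::= u_frame_loop.

Lemma c_valid_fam0 : compu (TP TN TF) TB
  (fun (G : sgraph) q => @valid_fam G q.1 q.2).
Proof. rewrite /valid_fam; cgo. Qed.
Lemma c_valid_fam c x0 x1 :
  compu c TN x0 -> compu c TF x1 -> compu c TB (fun G p => @valid_fam G (x0 G p) (x1 G p)).
Proof. exact: (@c_ap2 c TN TF TB (fun G => @valid_fam G) _ _ c_valid_fam0). Qed.
Ltac u_valid_fam := lazymatch goal with |- compu _ TB (fun G p => @valid_fam _ _ _) =>
  apply: c_valid_fam | _ => u_frame_loop end.
Ltac user ::= u_valid_fam.

Lemma c_IS0 : compu (TP (TP TS TS) TV) TS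
  (fun (G : sgraph) q => @IS G q.1.1 q.1.2 q.2).
Proof. rewrite /IS; cgo. Qed.
Lemma c_IS c x0 x1 x2 :
  compu c TS x0 -> compu c TS x1 -> compu c TV x2 -> compu c TS (fun G p => @IS G (x0 G p) (x1 G p) (x2 G p)).
Proof. exact: (@c_ap3 c TS TS TV TS (fun G => @IS G) _ _ _ c_IS0). Qed.
Ltac u_IS := lazymatch goal with |- compu _ TS (fun G p => @IS _ _ _ _) =>
  apply: c_IS | _ => u_valid_fam end.
Ltac user ::= u_IS.

Lemma c_RS0 : compu (TP (TP TS TS) (TP TV TV)) TS
  (fun (G : sgraph) q => @RS G q.1.1 q.1.2 q.2).
Proof. rewrite /RS; cgo. Qed.
Lemma c_RS c x0 x1 x2 :
  compu c TS x0 -> compu c TS x1 -> compu c (TP TV TV) x2 -> compu c TS (fun G p => @RS G (x0 G p) (x1 G p) (x2 G p)).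
Proof. exact: (@c_ap3 c TS TS (TP TV TV) TS (fun G => @RS G) _ _ _ c_RS0). Qed.
Ltac u_RS := lazymatch goal with |- compu _ TS (fun G p => @RS _ _ _ _) =>
  apply: c_RS | _ => u_IS end.
Ltac user ::= u_RS.

Lemma c_KS0 : compu (TP (TP TS TS) (TP TV TV)) TS
  (fun (G : sgraph) q => @KS G q.1.1 q.1.2 q.2).
Proof. rewrite /KS; cgo. Qed.
Lemma c_KS c x0 x1 x2 :
  compu c TS x0 -> compu c TS x1 -> compu c (TP TV TV) x2 -> compu c TS (fun G p => @KS G (x0 G p) (x1 G p) (x2 G p)).
Proof. exact: (@c_ap3 c TS TS (TP TV TV) TS (fun G => @KS G) _ _ _ c_KS0). Qed.
Ltac u_KS := lazymatch goal with |- compu _ TS (fun G p => @KS _ _ _ _) =>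
  apply: c_KS | _ => u_RS end.
Ltac user ::= u_KS.

Notation T3 := (TP (TP TV TV) TV) (only parsing).
Lemma c_link_cond0 : compu (TP (TP (TP (TP TS TS) TS) TS) T3) TB
  (fun (G : sgraph) q => @link_cond G q.1.1.1.1 q.1.1.1.2 q.1.1.2 q.1.2 q.2).
Proof. rewrite /link_cond; cgo. Qed.
Lemma c_link_cond c x0 x1 x2 x3 x4 :
  compu c TS x0 -> compu c TS x1 -> compu c TS x2 -> compu c TS x3 -> compu c T3 x4 -> compu c TB (fun G p => @link_cond G (x0 G p) (x1 G p) (x2 G p) (x3 G p) (x4 G p)).
Proof. exact: (@c_ap5 c TS TS TS TS T3 TB (fun G => @link_cond G) _ _ _ _ _ c_link_cond0). Qed.
Ltac u_link_cond := lazymatch goal with |- compu _ TB (fun G p => @link_cond _ _ _ _ _ _) =>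
  apply: c_link_cond | _ => u_KS end.
Ltac user ::= u_link_cond.

Lemma c_link_loop0 : compu (TP (TP (TP TS TS) TS) TS) LL
  (fun (G : sgraph) q => @link_loop G q.1.1.1 q.1.1.2 q.1.2 q.2).
Proof. rewrite /link_loop /link_step; apply: c_foldt; cgo. Qed.
Lemma c_link_loop c x0 x1 x2 x3 :
  compu c TS x0 -> compu c TS x1 -> compu c TS x2 -> compu c TS x3 -> compu c LL (fun G p => @link_loop G (x0 G p) (x1 G p) (x2 G p) (x3 G p)).
Proof. exact: (@c_ap4 c TS TS TS TS LL (fun G => @link_loop G) _ _ _ _ c_link_loop0). Qed.
Ltac u_link_loop := lazymatch goal with |- compu _ LL (fun G p => @link_loop _ _ _ _ _) =>
  apply: c_link_loop | _ => u_link_cond end.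
Ltac user ::= u_link_loop.

Lemma c_first_loop0 : compu (TP TS TS) LL
  (fun (G : sgraph) q => @first_loop G q.1 q.2).
Proof. rewrite /first_loop; cgo. Qed.
Lemma c_first_loop c x0 x1 :
  compu c TS x0 -> compu c TS x1 -> compu c LL (fun G p => @first_loop G (x0 G p) (x1 G p)).
Proof. exact: (@c_ap2 c TS TS LL (fun G => @first_loop G) _ _ c_first_loop0). Qed.
Ltac u_first_loop := lazymatch goal with |- compu _ LL (fun G p => @first_loop _ _ _) =>
  apply: c_first_loop | _ => u_link_loop end.
Ltac user ::= u_first_loop.

Lemma c_base_set0 : compu (TP TS TS) TS
  (fun (G : sgraph) q => @base_set G q.1 q.2).
Proof. rewrite /base_set; cgo. Qed.
Lemma c_base_set c x0 x1 :
  compu c TS x0 -> compu c TS x1 -> compu c TS (fun G p => @base_set G (x0 G p) (x1 G p)).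
Proof. exact: (@c_ap2 c TS TS TS (fun G => @base_set G) _ _ c_base_set0). Qed.
Ltac u_base_set := lazymatch goal with |- compu _ TS (fun G p => @base_set _ _ _) =>
  apply: c_base_set | _ => u_first_loop end.
Ltac user ::= u_base_set.

Lemma c_core_frame0 : compu (TP TS TS) FS
  (fun (G : sgraph) q => @core_frame G q.1 q.2).
Proof. rewrite /core_frame; cgo. Qed.
Lemma c_core_frame c x0 x1 :
  compu c TS x0 -> compu c TS x1 -> compu c FS (fun G p => @core_frame G (x0 G p) (x1 G p)).
Proof. exact: (@c_ap2 c TS TS FS (fun G => @core_frame G) _ _ c_core_frame0). Qed.
Ltac u_core_frame := lazymatch goal with |- compu _ FS (fun G p => @core_frame _ _ _) =>
  apply: c_core_frame | _ => u_base_set end.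
Ltac user ::= u_core_frame.

Lemma c_frame_set0 : compu (TP TS TS) TS
  (fun (G : sgraph) q => @frame_set G q.1 q.2).
Proof. rewrite /frame_set; cgo. Qed.
Lemma c_frame_set c x0 x1 :
  compu c TS x0 -> compu c TS x1 -> compu c TS (fun G p => @frame_set G (x0 G p) (x1 G p)).
Proof. exact: (@c_ap2 c TS TS TS (fun G => @frame_set G) _ _ c_frame_set0). Qed.
Ltac u_frame_set := lazymatch goal with |- compu _ TS (fun G p => @frame_set _ _ _) =>
  apply: c_frame_set | _ => u_core_frame end.
Ltac user ::= u_frame_set.

Lemma c_second_loop0 : compu (TP TS TS) LL
  (fun (G : sgraph) q => @second_loop G q.1 q.2).
Proof. rewrite /second_loop; cgo. Qed.
Lemma c_second_loop c x0 x1 :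
  compu c TS x0 -> compu c TS x1 -> compu c LL (fun G p => @second_loop G (x0 G p) (x1 G p)).
Proof. exact: (@c_ap2 c TS TS LL (fun G => @second_loop G) _ _ c_second_loop0). Qed.
Ltac u_second_loop := lazymatch goal with |- compu _ LL (fun G p => @second_loop _ _ _) =>
  apply: c_second_loop | _ => u_frame_set end.
Ltac user ::= u_second_loop.

Lemma c_widen_set0 : compu (TP TS TS) TS
  (fun (G : sgraph) q => @widen_set G q.1 q.2).
Proof. rewrite /widen_set; cgo. Qed.
Lemma c_widen_set c x0 x1 :
  compu c TS x0 -> compu c TS x1 -> compu c TS (fun G p => @widen_set G (x0 G p) (x1 G p)).
Proof. exact: (@c_ap2 c TS TS TS (fun G => @widen_set G) _ _ c_widen_set0). Qed.
Ltac u_widen_set := lazymatch goal with |- compu _ TS (fun G p => @widen_set _ _ _) =>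
  apply: c_widen_set | _ => u_second_loop end.
Ltac user ::= u_widen_set.

Lemma c_third_loop0 : compu (TP TS TS) LL
  (fun (G : sgraph) q => @third_loop G q.1 q.2).
Proof. rewrite /third_loop; cgo. Qed.
Lemma c_third_loop c x0 x1 :
  compu c TS x0 -> compu c TS x1 -> compu c LL (fun G p => @third_loop G (x0 G p) (x1 G p)).
Proof. exact: (@c_ap2 c TS TS LL (fun G => @third_loop G) _ _ c_third_loop0). Qed.
Ltac u_third_loop := lazymatch goal with |- compu _ LL (fun G p => @third_loop _ _ _) =>
  apply: c_third_loop | _ => u_widen_set end.
Ltac user ::= u_third_loop.

Lemma c_core_fam0 : compu (TP (TP TS TS) TN) TF
  (fun (G : sgraph) q => @core_fam G q.1.1 q.1.2 q.2).
Proof. rewrite /core_fam; cgo. Qed.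
Lemma c_core_fam c x0 x1 x2 :
  compu c TS x0 -> compu c TS x1 -> compu c TN x2 -> compu c TF (fun G p => @core_fam G (x0 G p) (x1 G p) (x2 G p)).
Proof. exact: (@c_ap3 c TS TS TN TF (fun G => @core_fam G) _ _ _ c_core_fam0). Qed.
Ltac u_core_fam := lazymatch goal with |- compu _ TF (fun G p => @core_fam _ _ _ _) =>
  apply: c_core_fam | _ => u_third_loop end.
Ltac user ::= u_core_fam.

Lemma c_core_set0 : compu (TP TS TS) TS
  (fun (G : sgraph) q => @core_set G q.1 q.2).
Proof. rewrite /core_set; cgo. Qed.
Lemma c_core_set c x0 x1 :
  compu c TS x0 -> compu c TS x1 -> compu c TS (fun G p => @core_set G (x0 G p) (x1 G p)).
Proof. exact: (@c_ap2 c TS TS TS (fun G => @core_set G) _ _ c_core_set0). Qed.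
Ltac u_core_set := lazymatch goal with |- compu _ TS (fun G p => @core_set _ _ _) =>
  apply: c_core_set | _ => u_core_fam end.
Ltac user ::= u_core_set.

Lemma c_rounds c : compu c (TP TF TN) (fun G _ => rounds G).
Proof. rewrite /rounds; apply: c_fold; cgo. Qed.
Ltac u_rounds := lazymatch goal with |- compu _ _ (fun G p => rounds _) => exact: c_rounds | _ => u_core_set end.
Ltac user ::= u_rounds.
Lemma c_upper0 : compu (TP TF TN) TS
  (fun (G : sgraph) q => @upper G q.1 q.2).
Proof. rewrite /upper; cgo. Qed.
Lemma c_upper c x0 x1 :
  compu c TF x0 -> compu c TN x1 -> compu c TS (fun G p => @upper G (x0 G p) (x1 G p)).
Proof. exact: (@c_ap2 c TF TN TS (fun G => @upper G) _ _ c_upper0). Qed.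
Ltac u_upper := lazymatch goal with |- compu _ TS (fun G p => @upper _ _ _) =>
  apply: c_upper | _ => u_rounds end.
Ltac user ::= u_upper.

Lemma c_trim0 : compu TF TF
  (fun (G : sgraph) q => @trim G q).
Proof. rewrite /trim; cgo. Qed.
Lemma c_trim c x0 :
  compu c TF x0 -> compu c TF (fun G p => @trim G (x0 G p)).
Proof. exact: (@c_ap1 c TF TF (fun G => @trim G) _  c_trim0). Qed.
Ltac u_trim := lazymatch goal with |- compu _ TF (fun G p => @trim _ _) =>
  apply: c_trim | _ => u_upper end.
Ltac user ::= u_trim.

Lemma c_main_alg0 : compu TN (TP (TP TB TF) TS) (fun (G : sgraph) q => main_alg G q).
Proof. rewrite /main_alg /main_step; cgo; apply: c_fold; cgo. Qed.

(** One number per vertex for both outcomes: the index of its hole, or membership in the hitting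
    set. *)
Definition answer (G : sgraph) k : bool * {ffun G -> nat} :=
  let r := main_alg G k in (r.1.1, if r.1.1 then trim r.1.2 else [ffun x => nat_of_bool (x \in r.2)]).

Lemma c_answer : compu TN (TP TB TF) (fun (G : sgraph) q => answer G q).
Proof.
have h c f : compu c TN f -> compu c (TP (TP TB TF) TS) (fun G p => main_alg G (f G p)).
  exact: (@c_ap1 c TN (TP (TP TB TF) TS) (fun G => main_alg G) f c_main_alg0).
rewrite /answer; cgo; try (apply: h; cgo).
Qed.

(** * The program *)

Opaque answer.

(** Without multiplication, the square of n is accumulated in register 1; k is first saved in
    register 8. *)
Definition square_code := Seq (Seq (Const 9 0) (Seq (Add 8 1 9) (Seq (Const 1 0) (Seq (Add 3 0 9) (Const 6 1)))))
  (While 3 (Seq (Add 1 1 0) (Defs.Sub 3 3 6))).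
Definition table_code := Seq (Seq (Const 9 0) (Seq (Add 4 1 9) (Seq (Const 5 0) (Seq (Add 3 0 9) (Const 6 1)))))
  (While 3 (Seq (Store 4 5) (Seq (Add 4 4 6) (Seq (Add 5 5 0) (Defs.Sub 3 3 6))))).
Definition setup_code := Seq square_code (Seq table_code (Seq (base 5 3) (Store 5 8))).

Lemma setupP : exists e, forall (G : sgraph) k, 0 < #|G| ->
  triple #|G| e setup_code (input G k) (fun s => ready G s /\ ram s (3 * sq G) = k).
Proof.
eexists=> G k G0; set n := #|G|; have nn : n <= n * n by rewrite leq_pmulr.
pose I1 j s := [/\ reg s 0 = n, reg s 8 = k, ram s = input_mem G, reg s 6 = 1 & reg s 3 = n - j /\ reg s 1 = j * n].
pose I2 j s := [/\ reg s 0 = n, reg s 8 = k, reg s 1 = n * n, reg s 6 = 1 & [/\ reg s 3 = n - j, reg s 4 = n * n + j,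
  reg s 5 = j * n & forall a, ram s a = if (n * n <= a) && (a < n * n + j) then (a - n * n) * n else input_mem G a]].
have far a : n * n <= a -> input_mem G a = 0.
  move=> h; rewrite /input_mem; case: existsP => // -[x /existsP[y /andP[_ /eqP E]]].
  by move: h; rewrite E leqNgt pair_sq.
apply: (triple_seq (P := I1 n)).
  apply: (triple_seq (P := I1 0)).
    by apply: triple_run => //; split; rewrite //= ?addn0 ?subn0.
  move=> s i1; apply: (triple_while (N := n) (Inv := I1)) i1 => //.
    by move=> j s' jn [_ _ _ _ [-> _]]; rewrite subn_eq0 eqn_leq jn.
  move=> j s' jn [h0 h8 hm h6 [h3 h1]]; apply: triple_run => //; split=> //=.
  by rewrite h3 h6 h1 h0 mulSn addnC; split=> //; move: jn; clear; lia.
move=> s [h0 h8 hm h6 [h3 h1]]; apply: (triple_seq (P := I2 n)).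
  apply: (triple_seq (P := I2 0)).
    apply: triple_run => //; split=> //=; split; rewrite /= ?h1 ?h0 ?addn0 ?subn0 //.
    by move=> a; rewrite hm; case: ifP => //; clear; lia.
  move=> s' i2; apply: (triple_while (N := n) (Inv := I2)) i2 => //.
    by move=> j s2 jn [_ _ _ _ [-> _ _ _]]; rewrite subn_eq0 eqn_leq jn.
  move=> j s2 jn [g0 g8 g1 g6 [g3 g4 g5 gm]]; apply: triple_run => //; split=> //=; split; rewrite /= ?g3 ?g4 ?g5 ?g6 ?g0.
  - by move: jn; clear; lia.
  - by rewrite addn1 addnS.
  - by rewrite mulSn addnC.
  move=> a; case: eqP => [->|ne]; first by rewrite leq_addr ltn_add2l leqnn /= addKn.
  have -> : (a < n * n + j.+1) = (a < n * n + j) by move/eqP: ne; clear; rewrite addnS ltnS leq_eqVlt => /negbTE->.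
  exact: gm.
move=> s' [g0 g8 g1 g6 [g3 g4 g5 gm]]; apply: triple_run; first by rewrite /= straight_base.
have q0 : 0 < n * n by rewrite muln_gt0 G0.
have hmem a : ram (run (Seq (base 5 3) (Store 5 8)) s') a = if a == 3 * (n * n) then k else ram s' a.
  by rewrite /= !reg_base //= g1 g8 mem_base.
split; last by rewrite hmem eqxx.
split; rewrite ?hmem.
- by rewrite /= reg_base.
- by rewrite /= reg_base.
- move=> o ho; rewrite hmem gm; case: eqP => [E|_]; last by rewrite [n * n <= o]leqNgt ho.
  by move: ho; rewrite E /sq -/n; move: (n * n) q0; clear; lia.
- move=> o ho; rewrite hmem gm /sq -/n leq_addr ltn_add2l ho addKn; case: eqP => // E.
  have aux a b : o < a -> a <= b -> 0 < b -> b + o <> 3 * b by clear; lia.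
  by case: (aux n (n * n) ho nn q0 E).
- move=> o; rewrite /sq -/n => ho; rewrite hmem gm far; last by move: (n * n); clear; lia.
  case: eqP => [E|_]; first by move: ho E; move: (n * n) q0; clear; lia.
  have aux a b : a <= b -> (2 * b + o < b + a) = false by clear; lia.
  by rewrite (aux n (n * n) nn) andbF.
Qed.

Lemma solve_code : exists c e, forall (G : sgraph) k, triple #|G| e c (input G k) (fun s =>
  if #|G| == 0 then reg s 0 = 1
  else reg s 0 = ~~ (answer G k).1 /\ forall v : G, ram s (enum_rank v) = (answer G k).2 v).
Proof.
have [e0 h0] := setupP; have [c [e1 [l [L [_ _ hc]]]]] := @compuP _ _ _ c_answer (3 : loc TN) 4 isT isT.
case: l hc => [l1 l2] hc.
have [c2 [e2 h2]] : exists c2 e2, forall (G : sgraph) s, 0 < #|G| -> reg s 1 = sq G ->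
    triple #|G| e2 c2 s (fun s' => reg s' 0 = reg s 0 /\ forall v : G, ram s' (enum_rank v) = ram s (l2 * sq G + enum_rank v)).
  case: (eqVneq l2 0) => [->|l20].
    by exists skip, 1 => G s G0 r1; apply: (@triple_run _ skip).
  have [e he] := copy_slotP l2 0; exists (copy_slot l2 0), e => G s G0 r1.
  apply: tripleW (leqnn _) _ (he _ s r1 l20) => s' [g0 g1 hm]; split=> // v.
  by rewrite hm mul0n mul1n subn0 rank_sq.
pose flag := Seq (fetch 4 l1) (Seq (Const 6 1) (Defs.Sub 0 6 4)).
(* The memory layout needs a nonempty graph; for the empty one the empty hitting set is announced at
   once. *)
exists (If 0 (Seq setup_code (Seq c (Seq flag c2))) (Const 0 1)); eexists => G k.
apply: triple_if => /=; last by move=> n0; apply: (@triple_run _ (Const 0 1)); rewrite // n0.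
rewrite -lt0n => G0; have n0 : (#|G| == 0) = false by rewrite eqn0Ngt G0.
rewrite n0; apply: (triple_seq (h0 G k G0)) => s [r hk].
apply: (triple_seq (hc G G0 k s r hk)) => s1 p1.
have r1 := post_ready G0 (isT : 2 < 4) r p1; case: p1 => _ _ _ [f1 f2].
pose Q s2 := [/\ reg s2 0 = ~~ (answer G k).1, reg s2 1 = sq G & forall v : G, ram s2 (l2 * sq G + enum_rank v) = (answer G k).2 v].
apply: (triple_seq (P := Q)).
  apply: triple_run; first by rewrite /= straight_fetch.
  have f1' : ram s1 (l1 * sq G) = (answer G k).1 by exact: f1.
  split; rewrite /=; do 3! rewrite ?reg_fetch ?mem_fetch //=; rewrite ?(ready1 r1) // f1'.
  by case: (answer G k).1.
move=> s2 [q0 q1 q2]; apply: tripleW (leqnn _) _ (h2 G s2 G0 q1) => s3 [g0 g1]; split; first by rewrite g0.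
by move=> v; rewrite g1.
Qed.

(** From k = 2 on the logarithm is at least 1, so linear and constant terms are absorbed; 189 = 16 +
    173. *)
Lemma core_bound_le k : 1 < k -> k * core_bound k <= (20 + 604 * (326 + 53 * 189) + 242) * (k ^ 2 * trunc_log 2 k).
Proof.
move=> k1; have t1 : 0 < trunc_log 2 k by rewrite trunc_log_gt0 //= k1.
have E : k ^ 2 * trunc_log 2 k = k * (k * trunc_log 2 k) by rewrite mulnA.
rewrite E mulnCA leq_mul2l; apply/orP; right; rewrite /core_bound /frame_bound.
have -> : k * (16 * trunc_log 2 k + 173) = 16 * (k * trunc_log 2 k) + 173 * k by rewrite mulnDr mulnCA [k * 173]mulnC.
have : k <= k * trunc_log 2 k by rewrite leq_pmulr.
by move: (k * _) k1 => m; clear; lia.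
Qed.

Lemma pow_input_size (G : sgraph) k e : (#|G| + 2) ^ e <= 3 ^ e * input_size G k ^ e.
Proof.
rewrite -expnMn; case: e => // e; rewrite leq_exp2r // /input_size.
have : #|G| <= #|G| ^ 2 by rewrite expnS expn1; case: #|G| => // n; rewrite leq_pmulr.
by move: #|G| (#|G| ^ 2) (trunc_log 2 k) => a b c; clear; lia.
Qed.

Section Answer.
Variables (G : sgraph) (k : nat).
Hypotheses (c4 : C4_free G) (k0 : 0 < k).

Transparent answer.
Lemma answer_correct :
  if (answer G k).1 then disjoint_long_holes (fun i : 'I_k => cls (answer G k).2 i)
  else let X := [set x | (answer G k).2 x != 0] in #|X| <= k * core_bound k /\ hits_long_holes X.
Proof.
have := main_correct c4 k0; rewrite /answer; case: (main_alg G k) => -[[] fam] X /= => [[kG v]|[cX nX]].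
  split=> [i|i j ij]; first exact: (trim_hole c4 kG v (ltn_ord i)).
  rewrite disjoint_subset; apply/subsetP => x; rewrite !inE => /eqP->; rewrite eqSS.
  by apply: contra ij => /eqP h; apply/eqP/val_inj.
have -> : [set x | [ffun x => nat_of_bool (x \in X)] x != 0] = X.
  by apply/setP => x; rewrite inE ffunE; case: (x \in X).
by split=> //; exact: hits_unholed.
Qed.

Opaque answer.

(** The dichotomy is the case distinction on the flag of the algorithm. *)
Lemma packing_or_hitting : (exists H : 'I_k -> {set G}, disjoint_long_holes H) \/
  (exists X : {set G}, #|X| <= k * core_bound k /\ hits_long_holes X).
Proof.
have := answer_correct; case: (answer G k).1 => h; first by left; exists (fun i : 'I_k => cls (answer G k).2 i).
by right; exists [set x | (answer G k).2 x != 0].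
Qed.

Lemma correct_outputP s (small : {set G} -> Prop) : (forall X : {set G}, #|X| <= k * core_bound k -> small X) ->
  (if #|G| == 0 then reg s 0 = 1
   else reg s 0 = ~~ (answer G k).1 /\ forall v : G, Defs.mem s (enum_rank v) = (answer G k).2 v) ->
  correct_output k small s.
Proof.
move=> sm; rewrite /correct_output; case: eqVneq => [n0 ->|_ [-> hm]] /=.
  have nov (x : G) : False by have := card0_eq n0 x; rewrite inE.
  split; last by apply: hits_unholed => -[l [f _]]; exact: (nov (f 0)).
  by apply: sm; rewrite (_ : output_set G s = set0) ?cards0 //; apply/setP => x; case: (nov x).
have := answer_correct; case: (answer G k).1 => /= h.
  case: h => h1 h2; have E i : output_family G s i = cls (answer G k).2 (i : 'I_k) by apply/setP => x; rewrite !inE hm.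
  by split=> [i|i j ij]; rewrite !E; [exact: h1|exact: h2].
have -> : output_set G s = [set x | (answer G k).2 x != 0] by apply/setP => x; rewrite !inE hm.
by case: h => h1 h2; split=> //; exact: sm.
Qed.
End Answer.

(* Growth of the bound and conclusion *)
From mathcomp Require Import all_boot all_order all_algebra.
From mathcomp Require Import all_classical all_reals all_analysis.
Import Order.TTheory GRing.Theory Num.Theory.
Import numFieldNormedType.Exports.
Local Open Scope classical_set_scope.
Local Open Scope ring_scope.

Lemma core_bound_bigO (R : realType) :
  (fun k : nat => (k * core_bound k)%:R : R) =O_\oo (fun k : nat => k%:R ^+ 2 * ln k%:R).
Proof.
apply/eqOP; near=> K; near=> k.
have k1 : (1 < k)%N by near: k; exact: nbhs_infty_gt.
have kR : 1 < k%:R :> R by rewrite ltr1n.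
have lnk : 0 < ln (k%:R : R) by exact: ln_gt0.
have ln2 : 0 < ln (2 : R) by apply: ln_gt0; rewrite ltr1n.
(* The truncated binary logarithm is at most ln k / ln 2, which puts the factor 1 / ln 2 into the
   constant. *)
have tl : (trunc_log 2 k)%:R * ln (2 : R) <= ln k%:R.
  rewrite mulr_natl -lnXn ?ltr0n // ler_ln ?posrE ?exprn_gt0 ?ltr0n ?(ltnW k1) //.
  by rewrite -natrX ler_nat trunc_logP // ltnW.
rewrite ger0_norm ?ler0n // ger0_norm; last by rewrite mulr_ge0 ?exprn_ge0 ?ler0n // ltW.
have h := core_bound_le k1.
apply: le_trans (_ : ((20 + 604 * (326 + 53 * 189) + 242) * (k ^ 2 * trunc_log 2 k))%N%:R <= _); first by rewrite ler_nat.
set A := (20 + _ + _)%N; rewrite natrM natrM natrX.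
apply: le_trans (_ : (A%:R / ln 2) * (k%:R ^+ 2 * ln k%:R) <= _).
  rewrite -mulrA ler_wpM2l ?ler0n // mulrCA ler_wpM2l ?exprn_ge0 ?ler0n //.
  by rewrite mulrC ler_pdivlMr.
apply: ler_wpM2r; first by rewrite mulr_ge0 ?exprn_ge0 ?ler0n // ltW.
by near: K; apply: nbhs_pinfty_ge; rewrite num_real.
Unshelve. all: by end_near. Qed.

Theorem theorem1p3 (R : realType) :
  (exists f : nat -> R,
    f =O_\oo (fun k : nat => k%:R ^+ 2 * ln k%:R) /\
    forall (G : sgraph) (k : nat), C4_free G -> (0 < k)%N ->
      (exists H : 'I_k -> {set G}, disjoint_long_holes H) \/
      (exists X : {set G}, #|X|%:R <= f k /\ hits_long_holes X)) /\
  (exists g : nat -> R,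
    g =O_\oo (fun k : nat => k%:R ^+ 2 * ln k%:R) /\
    exists c : cmd,
      polynomial_time c
        (fun G k => C4_free G /\ (0 < k)%N)
        (fun G k => correct_output k (fun X : {set G} => #|X|%:R <= g k))).
Proof.
split; exists (fun k : nat => (k * core_bound k)%:R); split; try exact: core_bound_bigO.
  move=> G k c4 k0; have [h|[X [cX hX]]] := packing_or_hitting c4 k0; first by left.
  by right; exists X; rewrite ler_nat.
have [c [e hc]] := solve_code; exists c, ((3 ^ e)%N *: 'X^e) => G k [c4 k0].
have [s [t [h1 h2 h3]]] := hc G k; exists s, t; split=> //.
  rewrite hornerZ hornerXn; apply: leq_trans h2 _.
  by have := pow_input_size G k e; rewrite -[(_ ^+ _)%R]/(_) .
by apply: correct_outputP h3 => // X cX; rewrite ler_nat.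
Qed.
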